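(* Let $X\subset(M,L)$ be a coregular submanifold of a Dirac manifold. (1) There exists an embedded invariant submanifold $(P,L_P)\subset(M,L)$ containing $X$ that lies inside the saturation $Sat(X)$. (2) Shrinking $P$ if necessary, there exists a neighborhood $U$ of $X$ in $M$ such that $(P,L_P)$ is the saturation of $X$ in $(U,L|_U)$.
   Context: For a Dirac structure $L\subset TM\oplus T^*M$, $\mathrm{pr}_T:L\to TM$ is the projection. An embedded submanifold $X\subset(M,L)$ is coregular if the map $\overline{\mathrm{pr}_T}:L|_X\to TM|_X/TX$, obtained by composing $\mathrm{pr}_T$ with the projection to the normal bundle, has constant rank. The saturation $Sat(X)$ of $X$ in $(M,L)$ is the union of all presymplectic leaves (leaves of the singular foliation integrating $\mathrm{pr}_T(L)$) that intersect $X$; the saturation of $X$ in $(U,L|_U)$ is defined in the same way using the leaves of $(U,L|_U)$. A submanifold $P\subset(M,L)$ is invariant if $\mathrm{pr}_T(L|_P)\subset TP$; it then carries the pullback Dirac structure $L_P=\{v+(\mathrm{d}\iota)^*\beta:\mathrm{d}\iota(v)+\beta\in L\}$, with $\iota:P\hookrightarrow M$ the inclusion. *)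

(* Defs.v *)
From HB Require Import structures.
From mathcomp Require Import all_boot all_order all_algebra.
From mathcomp Require Import all_classical all_reals all_analysis.

Set Implicit Arguments.
Unset Strict Implicit.
Unset Printing Implicit Defensive.

Import Order.TTheory GRing.Theory Num.Theory.
Import numFieldNormedType.Exports.

Local Open Scope classical_set_scope.
Local Open Scope ring_scope.

Section Smooth.
Context {R : realType} {n : nat} {V : normedModType R}.

(* Meant for open A: f is of class C^k on A when all its directional
   derivatives up to order k exist and are continuous at the points of A. *)
Fixpoint Ck (k : nat) (A : set 'rV[R]_n) (f : 'rV[R]_n -> V) : Prop :=
  (forall x, A x -> {for x, continuous f}) /\
  (if k is k'.+1 then
     forall v : 'rV[R]_n,
       (forall x, A x -> derivable f x v) /\ Ck k' A ('D_v f)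
   else True).

Definition smooth_on (A : set 'rV[R]_n) (f : 'rV[R]_n -> V) : Prop :=
  forall k, Ck k A f.

End Smooth.

(* The values of cmap outside cdom, and of cinv outside the image of cdom,
   are irrelevant. *)
Record chart (R : realType) (T : topologicalType) (n : nat) := Chart {
  cdom : set T;
  cmap : T -> 'rV[R]_n;
  cinv : 'rV[R]_n -> T;
  cdom_open : open cdom;
  cimg_open : open (cmap @` cdom);
  cmapK : forall p, cdom p -> cinv (cmap p) = p;
  cmap_continuous : forall p, cdom p -> {for p, continuous cmap};
  cinv_continuous :
    forall x, (cmap @` cdom) x -> {for x, continuous cinv}
}.

(* The atlas is indexed by the points: [chart_at p] is a preferred chart around
   p. Tangent vectors and covectors at p are represented by their row vectors of
   coordinates in [chart_at p]; a covector a takes the value a *m v^T on v. *)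
Record manifold (R : realType) := Manifold {
  carrier :> topologicalType;
  mdim : nat;
  chart_at : carrier -> chart R carrier mdim;
  chart_atP : forall p, cdom (chart_at p) p;
  chart_smooth : forall p q,
    smooth_on (cmap (chart_at p) @` (cdom (chart_at p) `&` cdom (chart_at q)))
              (cmap (chart_at q) \o cinv (chart_at p));
  manifold_hausdorff : hausdorff_space carrier;
  manifold_second_countable : @second_countable carrier
}.

Section Maps.
Context {R : realType} {M N : manifold R}.

Definition smooth_map (f : M -> N) : Prop :=
  continuous f /\
  forall (p : M) (q : N),
    smooth_on
      (cmap (chart_at p) @` (cdom (chart_at p) `&` f @^-1` cdom (chart_at q)))
      (cmap (chart_at q) \o f \o cinv (chart_at p)).

(* The differential of f at p, acting on row vectors on the right:
   df(v) = v *m tangent_map f p, so that (df)^* b = b *m (tangent_map f p)^T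
   and the row space of tangent_map f p is the image of df. *)
Definition tangent_map (f : M -> N) (p : M) : 'M[R]_(mdim M, mdim N) :=
  'J (cmap (chart_at (f p)) \o f \o cinv (chart_at p)) (cmap (chart_at p) p).

Definition injective_immersion (f : M -> N) : Prop :=
  [/\ smooth_map f, injective f & forall p, row_free (tangent_map f p)].

Definition embedding (f : M -> N) : Prop :=
  injective_immersion f /\
  forall A : set M, open A -> exists2 B : set N, open B & A = f @^-1` B.

End Maps.

Section GeneralizedTangent.
Context {R : realType} {M : manifold R}.
Local Notation n := (mdim M).

(* An element v + a of T_pM (+) T*_pM is encoded as row_mx v a, and a subspace
   of T_pM (+) T*_pM as the row space of a square matrix. *)

(* change of coordinates at r, from the chart at p to the chart at q *)
Definition transition (p q r : M) : 'M[R]_n :=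
  'J (cmap (chart_at q) \o cinv (chart_at p)) (cmap (chart_at p) r).

(* coordinate expression of a section of TM (+) T*M in the chart at q *)
Definition local_rep (q : M) (s : M -> 'rV[R]_(n + n)) (x : 'rV[R]_n) :
    'rV[R]_(n + n) :=
  let r := cinv (chart_at q) x in
  row_mx (lsubmx (s r) *m transition r q r)
         (rsubmx (s r) *m (transition q r r)^T).

Definition smooth_section (W : set M) (s : M -> 'rV[R]_(n + n)) : Prop :=
  forall q : M, smooth_on (cmap (chart_at q) @` (cdom (chart_at q) `&` W))
                          (local_rep q s).

(* <v + a, w + b> = a(w) + b(v) *)
Definition pairing (u w : 'rV[R]_(n + n)) : R :=
  (rsubmx u *m (lsubmx w)^T + rsubmx w *m (lsubmx u)^T) 0 0.

(* The Courant-Dorfman bracket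
     [[X + a, Y + b]] = [X, Y] + L_X b - i_Y da
   at p. As ('J Y x) i j = d_i Y^j, in coordinates
     [X, Y]  = X *m 'J Y x - Y *m 'J X x,
     L_X b   = X *m 'J b x + b *m ('J X x)^T,
     i_Y da  = Y *m ('J a x - ('J a x)^T). *)
Definition dorfman (s t : M -> 'rV[R]_(n + n)) (p : M) : 'rV[R]_(n + n) :=
  let x := cmap (chart_at p) p in
  let X y := lsubmx (local_rep p s y) in
  let a y := rsubmx (local_rep p s y) in
  let Y y := lsubmx (local_rep p t y) in
  let b y := rsubmx (local_rep p t y) in
  row_mx (X x *m 'J Y x - Y x *m 'J X x)
         (X x *m 'J b x + b x *m ('J X x)^T - Y x *m ('J a x - ('J a x)^T)).

End GeneralizedTangent.

Record dirac_structure (R : realType) (M : manifold R) := Dirac {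
  fiber :> M -> 'M[R]_(mdim M + mdim M);
  dirac_smooth : forall p, exists2 W : set M, open W /\ W p &
    exists F : 'I_(mdim M) -> M -> 'rV[R]_(mdim M + mdim M),
      (forall k, smooth_section W (F k)) /\
      (forall q, W q -> (fiber q :=: \matrix_k F k q)%MS);
  dirac_rank : forall p, \rank (fiber p) = mdim M;
  dirac_isotropic : forall p u w,
    (u <= fiber p)%MS -> (w <= fiber p)%MS -> pairing u w = 0;
  dirac_involutive : forall s t : M -> 'rV[R]_(mdim M + mdim M),
    smooth_section setT s -> smooth_section setT t ->
    (forall p, (s p <= fiber p)%MS) -> (forall p, (t p <= fiber p)%MS) ->
    forall p, (dorfman s t p <= fiber p)%MS
}.

Section DiracGeometry.
Context {R : realType} {M : manifold R} (L : dirac_structure M).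

Definition pr_T (p : M) : 'M[R]_(mdim M + mdim M, mdim M) := lsubmx (L p).

(* cokermx A represents the projection of row vectors modulo the row space
   of A. *)
Definition coregular {X : manifold R} (i : X -> M) : Prop :=
  exists r : nat, forall x : X,
    \rank (pr_T (i x) *m cokermx (tangent_map i x)) = r.

(* S is an integral submanifold of pr_T(L) contained in the open set U: the
   image of a connected manifold under an injective immersion whose tangent
   spaces are the spaces pr_T(L). *)
Definition integral_submanifold (U S : set M) : Prop :=
  exists (N : manifold R) (j : N -> M),
    [/\ connected [set: N], injective_immersion j, S = range j, S `<=` U &
        forall x : N, (tangent_map j x :=: pr_T (j x))%MS].

(* Leaves of (U, L|_U) for U open, where T_pU = T_pM; U = setT gives the
   leaves of (M, L). *)
Definition presymplectic_leaf (U S : set M) : Prop :=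
  integral_submanifold U S /\
  forall S' : set M, integral_submanifold U S' -> S `<=` S' -> S' `<=` S.

Definition saturation (U A : set M) : set M :=
  \bigcup_(S in [set S | presymplectic_leaf U S /\ S `&` A !=set0]) S.

Definition invariant {P : manifold R} (f : P -> M) : Prop :=
  forall p : P, (pr_T (f p) <= tangent_map f p)%MS.

Definition is_pullback {P : manifold R} (f : P -> M)
    (LP : dirac_structure P) : Prop :=
  forall (p : P) (u : 'rV[R]_(mdim P + mdim P)),
    (u <= LP p)%MS <->
    exists (v : 'rV[R]_(mdim P)) (b : 'rV[R]_(mdim M)),
      u = row_mx v (b *m (tangent_map f p)^T) /\
      (row_mx (v *m tangent_map f p) b <= L (f p))%MS.

Definition invariant_submanifold {P : manifold R} (f : P -> M)
    (LP : dirac_structure P) : Prop :=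
  [/\ embedding f, invariant f & is_pullback f LP].

End DiracGeometry.

(* Main.v *)
From HB Require Import structures.
Require Import Defs.
From mathcomp Require Import all_boot all_order all_algebra.
From mathcomp Require Import all_classical all_reals all_analysis.
From mathcomp Require Import ring lra zify.

(* Write n = dim M and let r be the constant rank of the normal projection of
   pr_T L along X. Since the sections of L are closed under the Dorfman bracket,
   pr_T L is locally spanned by vector fields Y_k whose brackets are combinations
   of the Y_k. The time-one flow of a constant combination of the Y_k then
   preserves the span of the Y_k: along a flow line both the transported fields
   and the defect of a variation solve linear differential equations, to which
   Gronwall's inequality applies. Flowing X along r combinations that are
   transverse to it gives charts (t, y1, y2) in which X is {t = 0, y2 = 0}, the
   t-lines are tangent to pr_T L, and pr_T L is tangent to the slice {y2 = 0}. For X a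
   point, the plaques of these charts glue to the leaves of pr_T L.

   For general X, a curve in a leaf that starts in a slice stays in that slice, again by
   Gronwall. Hence the slices of two charts agree near their common points of X:
   each of their points is joined by a t-line to X. On a sufficiently thin neighbourhood U
   of X they therefore glue to an embedded submanifold P, closed in U, every
   point of which is joined to X inside a leaf of U; conversely a leaf of U
   that meets P stays in P. So P is the saturation of X in U, and P' = P works in
   the second part. The pullback of L to P is spanned by the projections of a
   local frame of L, and its involutivity follows by extending its sections to
   sections of L. *)

Set Implicit Arguments.
Unset Strict Implicit.
Unset Printing Implicit Defensive.

Import Order.TTheory GRing.Theory Num.Theory.
Import numFieldNormedType.Exports.

Local Open Scope classical_set_scope.
Local Open Scope ring_scope.

(** * Maps of class C^k *)

(** The main obstacle is that the rank of pr_T L may jump away from X, so there is no Frobenius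
    theorem to start from and coefficients with respect to vector fields spanning pr_T L need not be
    smooth. The frame of L itself has constant rank: brackets of its members have smooth, hence
    locally bounded, coefficients, and these bounds survive the projection to TM. Gronwall's
    inequality needs nothing more. Involutivity is postulated for global sections only, so local
    frames have to be cut off and extended by zero before it applies. Leaves are maximal integral
    submanifolds with second countable domains. They are therefore built from countably many
    plaques, and this countability comes from the local constancy of the transverse coordinate. Two
    slices agree only near each common point of X, and this neighbourhood depends on the pair of
    charts. A countable cover that is locally finite along X leaves finitely many pairs to compare
    at each point, which yields one neighbourhood of X on which all slices are coherent. *)

Section CkTheory.
Context {R : realType}.

(** The derivatives in [Ck] are taken in the ambient space and only evaluated on [A], so nothing is
    lost by passing to single points, although these are not open. *)
Lemma CkP n (V : normedModType R) k (A : set 'rV[R]_n) (f : 'rV[R]_n -> V) :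
  Ck k A f <-> forall x, A x -> Ck k [set x] f.
Proof.
elim: k f => [|k IH] f /=.
  split=> [[cf _] x Ax|H]; first by split=> // y ->; exact: cf.
  by split=> // x Ax; have [+ _] := H x Ax; exact.
split=> [[cf df] x Ax|H].
  split=> [y ->|v]; first exact: cf.
  by have [d1 /IH d2] := df v; split=> [y ->|]; [exact: d1|exact: d2].
split=> [x Ax|v]; first by have [+ _] := H x Ax; exact.
split=> [x Ax|]; first by have [_ /(_ v)[+ _]] := H x Ax; exact.
by apply/IH => x Ax; have [_ /(_ v)[]] := H x Ax.
Qed.

Lemma Ck_sub n (V : normedModType R) k (A B : set 'rV[R]_n)
  (f : 'rV[R]_n -> V) : B `<=` A -> Ck k A f -> Ck k B f.
Proof. by move=> BA /CkP Af; apply/CkP => x Bx; apply: Af; exact: BA. Qed.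

Lemma near_continuous (T U : topologicalType) (f g : T -> U) (x : T) :
  {near x, f =1 g} -> {for x, continuous f} -> {for x, continuous g}.
Proof.
move=> fg; rewrite /prop_for /continuous_at (nbhs_singleton fg) => h.
by apply: cvg_trans h; apply: near_eq_cvg; exact: fg.
Qed.

Lemma Ck_near n (V : normedModType R) k (x : 'rV[R]_n)
  (f g : 'rV[R]_n -> V) : {near x, f =1 g} ->
  Ck k [set x] f -> Ck k [set x] g.
Proof.
elim: k f g => [|k IH] f g fg /=.
  by move=> [cf _]; split=> // y ->; apply: near_continuous fg _; exact: cf.
move=> [cf df]; split.
  by move=> y ->; apply: near_continuous fg _; exact: cf.
move=> v; have [d1 d2] := df v; split=> [y ->|].
  by apply: near_eq_derivable fg (d1 _ erefl).
apply: IH d2.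
(* Equality near x also holds near every point near x, hence the derivatives agree near x and not
   only at x. *)
by apply: filterS (near_join fg) => z; exact: near_eq_derive.
Qed.

Lemma Ck_ext n (V : normedModType R) k (A : set 'rV[R]_n)
  (f g : 'rV[R]_n -> V) : open A -> (forall x, A x -> f x = g x) ->
  Ck k A f -> Ck k A g.
Proof.
move=> oA fg /CkP Af; apply/CkP => x Ax; apply: Ck_near (Af _ Ax).
by apply: filterS (open_nbhs_nbhs (conj oA Ax)) => z; exact: fg.
Qed.

Lemma Ck_cont n (V : normedModType R) k (A : set 'rV[R]_n)
  (f : 'rV[R]_n -> V) x : Ck k A f -> A x -> {for x, continuous f}.
Proof. by case: k => [|k] [+ _]; exact. Qed.

Lemma CkW n (V : normedModType R) k (A : set 'rV[R]_n)
  (f : 'rV[R]_n -> V) : Ck k.+1 A f -> Ck k A f.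
Proof.
elim: k f => [|k IH] f [cf df]; split=> // v.
by have [d1 d2] := df v; split=> //; exact: IH.
Qed.

Lemma Ck_derive n (V : normedModType R) k (A : set 'rV[R]_n)
  (f : 'rV[R]_n -> V) v : Ck k.+1 A f -> Ck k A ('D_v f).
Proof. by move=> [_ /(_ v)[]]. Qed.

Lemma Ck_derivable n (V : normedModType R) k (A : set 'rV[R]_n)
  (f : 'rV[R]_n -> V) v x : Ck k.+1 A f -> A x -> derivable f x v.
Proof. by move=> [_ /(_ v)[+ _]]; exact. Qed.

Lemma Ck_cst n (V : normedModType R) k (A : set 'rV[R]_n) (a : V) :
  Ck k A (fun=> a).
Proof.
elim: k a => [|k IH] a; split=> //; try by move=> x Ax; exact: cst_continuous.
move=> v; split=> [x _|]; first exact: derivable_cst.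
by rewrite (_ : 'D_v _ = fun=> 0) // funeqE => x; exact: derive_cst.
Qed.

Lemma Ck_add n (V : normedModType R) k (A : set 'rV[R]_n)
  (f g : 'rV[R]_n -> V) : open A -> Ck k A f -> Ck k A g -> Ck k A (f + g).
Proof.
move=> oA; elim: k f g => [|k IH] f g [cf df] [cg dg].
  by split=> // x Ax; apply: continuousD; [exact: cf|exact: cg].
split=> [x Ax|v].
  by apply: continuousD; [exact: cf|exact: cg].
have [f1 f2] := df v; have [g1 g2] := dg v; split=> [x Ax|].
  by apply: derivableD; [exact: f1|exact: g1].
apply: Ck_ext (IH _ _ f2 g2) => // x Ax.
by rewrite deriveD //; [exact: f1|exact: g1].
Qed.

Lemma Ck_mul n k (A : set 'rV[R]_n)
  (f g : 'rV[R]_n -> R) : open A -> Ck k A f -> Ck k A g -> Ck k A (f * g).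
Proof.
move=> oA; elim: k f g => [|k IH] f g fk gk.
  case: fk gk => [cf df] [cg dg].
  by split=> // x Ax; apply: continuousM; [exact: cf|exact: cg].
move: (fk) (gk) => [cf df] [cg dg].
split=> [x Ax|v].
  by apply: continuousM; [exact: cf|exact: cg].
have [f1 f2] := df v; have [g1 g2] := dg v; split=> [x Ax|].
  by apply: derivableM; [exact: f1|exact: g1].
apply: (@Ck_ext _ _ _ _ (f * 'D_v g + g * 'D_v f)) => // [x Ax|].
  by rewrite deriveM //; [exact: f1|exact: g1].
by apply: Ck_add => //; apply: IH => //; exact: CkW.
Qed.

Lemma Ck_inv n k (A : set 'rV[R]_n)
  (f : 'rV[R]_n -> R) : open A -> (forall x, A x -> f x != 0) ->
  Ck k A f -> Ck k A (fun x => (f x)^-1).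
Proof.
move=> oA f0; elim: k f f0 => [|k IH] f f0 fk.
  case: fk => [cf df].
  by split=> // x Ax; apply: continuousV; [exact: f0|exact: cf].
move: (fk) => [cf df].
split=> [x Ax|v].
  by apply: continuousV; [exact: f0|exact: cf].
have [f1 f2] := df v; split=> [x Ax|].
  by apply: (derivableV (f0 _ Ax)); exact: f1.
apply: (@Ck_ext _ _ _ _ ((fun=> -1) * ((fun x => (f x)^-1) * (fun x => (f x)^-1))
   * 'D_v f)) => // [x Ax|].
  rewrite (deriveV (f0 _ Ax) (f1 _ Ax)).
  by rewrite !fctE/= mulN1r expr2 invfM.
do !apply: Ck_mul => //; first exact: Ck_cst.
- by apply: IH => //; exact: CkW.
- by apply: IH => //; exact: CkW.
Qed.

Lemma Ck_sum n (V : normedModType R) k (A : set 'rV[R]_n) (I : Type)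
    (r : seq I) (P : pred I) (F : I -> 'rV[R]_n -> V) :
  open A -> (forall i, P i -> Ck k A (F i)) ->
  Ck k A (fun x => \sum_(i <- r | P i) F i x).
Proof.
move=> oA H; elim: r => [|i r IH].
  rewrite (_ : (fun x => _) = fun=> 0); first exact: Ck_cst.
  by apply/funext => x; rewrite big_nil.
rewrite (_ : (fun x => _) = if P i then F i + (fun x => \sum_(j <- r | P j) F j x)
   else (fun x => \sum_(j <- r | P j) F j x)).
  by case: ifPn => // Pi; apply: (Ck_add oA _ IH); exact: H.
by apply/funext => x; rewrite big_cons; case: ifP.
Qed.

Lemma mx_norm_coord p q (M : 'M[R]_(p, q)) i j : `|M i j| <= `|M|.
Proof.
rewrite [leRHS]/Num.Def.normr/= mx_normrE.
exact: (le_bigmax _ (fun ij : 'I_p * 'I_q => `|M ij.1 ij.2|) (i, j)).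
Qed.

Lemma mx_norm_leP p q (M : 'M[R]_(p, q)) e : 0 <= e ->
  (forall i j, `|M i j| <= e) -> `|M| <= e.
Proof.
by move=> e0 H; rewrite [leLHS]/Num.Def.normr/= mx_normrE; apply: bigmax_le.
Qed.

Lemma mx_norm_ltP p q (M : 'M[R]_(p, q)) e : 0 < e ->
  (forall i j, `|M i j| < e) -> `|M| < e.
Proof.
by move=> e0 H; rewrite [ltLHS]/Num.Def.normr/= mx_normrE; apply/bigmax_ltP.
Qed.

Lemma cvg_mxP (T : Type) (F : set_system T) p q (f : T -> 'M[R]_(p, q))
  (l : 'M[R]_(p, q)) :
  Filter F -> (f @ F --> l) <-> forall i j, f x i j @[x --> F] --> l i j.
Proof.
move=> FF; split=> [fl i j|H].
  by apply: (@cvg_comp _ _ _ f (fun M : 'M[R]_(p, q) => M i j) F _ _ fl);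
    exact: coord_continuous.
apply/cvgrPdist_le => e e0; near=> x; apply: mx_norm_leP; first exact: ltW.
move=> i j; rewrite !mxE; move: i j; near: x.
apply: filter_forall => i; apply: filter_forall => j.
by have /cvgrPdist_le/(_ _ e0) := H i j.
Unshelve. all: by end_near. Qed.

Lemma continuous_mxP (T : topologicalType) p q (f : T -> 'M[R]_(p, q)) x :
  {for x, continuous f} <-> forall i j, {for x, continuous (fun y => f y i j)}.
Proof. exact: cvg_mxP. Qed.

Lemma Ck_mxP n k p q (A : set 'rV[R]_n) (f : 'rV[R]_n -> 'M[R]_(p, q)) :
  open A -> Ck k A f <-> forall i j, Ck k A (fun x => f x i j).
Proof.
move=> oA; elim: k f => [|k IH] f.
  split=> [[cf _] i j|H]; split=> // x Ax.
    by have /continuous_mxP := cf x Ax; exact.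
  by apply/continuous_mxP => i j; have [+ _] := H i j; exact.
split=> [[cf df] i j|H].
  split=> [x Ax|v]; first by have /continuous_mxP := cf x Ax; exact.
  have [d1 /IH d2] := df v; split=> [x Ax|].
    by move/derivable_mxP : (d1 x Ax); exact.
  apply: Ck_ext (d2 i j) => // x Ax.
  by rewrite derive_mx ?mxE//; exact: d1.
have d1 v x : A x -> derivable f x v.
  by move=> Ax; apply/derivable_mxP => i j; have [_ /(_ v)[+ _]] := H i j; exact.
split=> [x Ax|v].
  by apply/continuous_mxP => i j; have [+ _] := H i j; exact.
split=> [x Ax|]; first exact: d1.
apply/IH => i j; have [_ /(_ v)[_]] := H i j.
by apply: Ck_ext => // x Ax; rewrite derive_mx ?mxE//; exact: d1.
Qed.

Lemma derive_coord n (v x : 'rV[R]_n) i :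
  derivable (fun y : 'rV[R]_n => y 0 i) x v /\
  'D_v (fun y : 'rV[R]_n => y 0 i) x = v 0 i.
Proof.
have d := @derivable_id R _ x v; split.
  by move/derivable_mxP : d => /(_ 0 i).
by have /matrixP/(_ 0 i) := derive_mx d; rewrite derive_id mxE.
Qed.

Lemma Ck_coord n k (A : set 'rV[R]_n) i : Ck k A (fun x : 'rV[R]_n => x 0 i).
Proof.
case: k => [|k]; split=> //; try by move=> x Ax; exact: coord_continuous.
move=> v; split=> [x _|]; first by have [] := derive_coord v x i.
rewrite (_ : 'D_v _ = fun=> v 0 i); first exact: Ck_cst.
by rewrite funeqE => x; have [] := derive_coord v x i.
Qed.

End CkTheory.

Lemma near_open (T : topologicalType) (P : set T) (x : T) :
  nbhs x P -> exists B, [/\ open B, B x & B `<=` P].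
Proof. by rewrite nbhsE => -[B [oB Bx] BP]; exists B. Qed.

(** * Differentiability, the chain rule and smooth germs *)

Section Calculus.
Context {R : realType}.

Lemma derive_line (V W : normedModType R) (f : V -> W) x v (t0 : R) :
  derivable f (x + t0 *: v) v ->
  derivable (fun t : R => f (x + t *: v)) t0 1 /\
  'D_1 (fun t : R => f (x + t *: v)) t0 = 'D_v f (x + t0 *: v).
Proof.
rewrite /derivable /derive => d.
have E : (fun h : R => h^-1 *: (((fun t : R => f (x + t *: v)) \o shift t0) (h *: 1)
    - f (x + t0 *: v))) =
    (fun h : R => h^-1 *: ((f \o shift (x + t0 *: v)) (h *: v) - f (x + t0 *: v))).
  apply/funext => h /=; congr (_ *: (f _ - _)).
  by rewrite [h *: 1]mulr1 scalerDl addrCA.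
by rewrite E.
Qed.

Lemma mvt_line (V : normedModType R) (f : V -> R) x v (h : R) :
  (forall t : R, 0 <= t <= 1 -> derivable f (x + (t * h) *: v) v) ->
  exists2 t : R, 0 <= t <= 1 &
    f (x + h *: v) - f x = h * 'D_v f (x + (t * h) *: v).
Proof.
move=> H; pose psi (s : R) := f (x + s *: v).
pose phi (t : R) := psi (t * h).
have dm (t : R) : derivable (fun s : R => s * h) t 1 /\
    (fun s : R => s * h)^`()%classic t = h.
  have -> : (fun s : R => s * h) = (fun t : R => 0 + t *: (h : R^o)).
    by apply/funext => s; rewrite add0r.
  have [] := @derive_line R R (id : R -> R) 0 (h : R) t.
    exact: derivable_id.
  by move=> d1 d2; split=> //; rewrite derive1E d2 derive_id.
have dphi (t : R) : 0 <= t <= 1 ->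
    derivable phi t 1 /\ phi^`()%classic t = h * 'D_v f (x + (t * h) *: v).
  move=> t01; have [p1 p2] := derive_line (H t t01).
  have [m1 m2] := dm t; split.
    apply/derivable1_diffP; apply: differentiable_comp.
      exact/derivable1_diffP.
    exact/derivable1_diffP.
  by rewrite (derive1_comp m1 p1) m2 derive1E p2 mulrC.
have [||c c01] := @MVT_segment R phi (phi^`()%classic) 0 1 ler01.
- move=> t t01; rewrite derive1E; apply/derivableP; apply: (dphi t _).1.
  by move: t01; rewrite in_itv/= => /andP[/ltW-> /ltW->].
- apply: derivable_within_continuous => t t01; apply: (dphi t _).1.
  by move: t01; rewrite in_itv.
rewrite in_itv/= in c01.
rewrite subr0 mulr1 /phi /psi mul1r mul0r scale0r addr0 => ->.
by exists c => //; rewrite -(dphi c c01).2.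
Qed.

(** The estimate is uniform in the base point [y]: this allows it to be used at every vertex of a
    path near x, and for the second differences in Schwarz's theorem. *)
Lemma derive_incr (V : normedModType R) (f : V -> R) (x v : V) :
  (\forall y \near x, derivable f y v) -> {for x, continuous ('D_v f)} ->
  forall e : R, 0 < e -> exists2 d : R, 0 < d & forall y (h : R),
    `|y - x| < d -> `|h *: v| < d ->
    `|f (y + h *: v) - f y - h * 'D_v f x| <= e * `|h|.
Proof.
move=> df cf e e0.
have /cvgrPdist_le/(_ _ e0) ce := cf.
have /nbhs_normP[d /= d0 Hd] : \forall z \near x, derivable f z v /\
    `|'D_v f x - 'D_v f z| <= e.
  by near=> z; split; near: z; [exact: df|exact: ce].
have {}Hd z : `|z - x| < d -> derivable f z v /\ `|'D_v f x - 'D_v f z| <= e.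
  by move=> zx; apply: Hd; rewrite /ball_/= distrC.
exists (d / 2); first exact: divr_gt0.
move=> y h yx hv.
have {}Hd (t : R) : 0 <= t <= 1 -> derivable f (y + (t * h) *: v) v /\
    `|'D_v f x - 'D_v f (y + (t * h) *: v)| <= e.
  move=> /andP[t0 t1]; apply: Hd; rewrite addrAC.
  rewrite (le_lt_trans (ler_normD _ _))// (splitr d) ltrD//.
  rewrite -scalerA normrZ ger0_norm// (le_lt_trans _ hv)//.
  by rewrite ler_piMl.
have [|t t01 ->] := @mvt_line _ f y v h; first by move=> t /Hd[].
rewrite -mulrBr normrM mulrC distrC ler_wpM2r//.
by have [] := Hd t t01.
Unshelve. all: by end_near. Qed.

Lemma linear_rV_continuous (V : normedModType R) n (f : {linear 'rV[R]_n -> V}) :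
  continuous f.
Proof.
have -> : (f : 'rV[R]_n -> V) = (fun y => \sum_i y 0 i *: f (delta_mx 0 i)).
  apply/funext => y; rewrite {1}(row_sum_delta y) linear_sum.
  by apply: eq_bigr => i _; rewrite linearZ.
apply: (@continuous_big _ _ _ _ _ (@add_continuous V)) => i _ x.
by apply: (@continuousZr_tmp _ _ _ (fun y : 'rV[R]_n => y 0 i)); exact: coord_continuous.
Qed.

Lemma differentiableI (V W : normedModType R) (f : V -> W) (df : {linear V -> W}) x :
  continuous df ->
  (forall e : R, 0 < e -> \forall h \near 0, `|f (x + h) - f x - df h| <= e * `|h|) ->
  differentiable f x /\ 'd f x = df :> (V -> W).
Proof.
move=> cdf H.
have E : f \o shift x = cst (f x) + df +o_ 0 id.
  apply/eqaddoP => _/posnumP[e]; near=> h.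
  rewrite !fctE /= opprD addrA [h + x]addrC; near: h; exact: H.
have D := diff_unique cdf E; split=> //.
by apply/diff_locallyP; rewrite D.
Unshelve. all: by end_near. Qed.

(** The increment h is split along a path parallel to the axes, and each of its at most n steps
    contributes an error e / (n + 1) times |h|. Dividing by n + 1 instead of n covers n = 0. *)
Lemma C1_diff_R n (A : set 'rV[R]_n) (f : 'rV[R]_n -> R) x :
  open A -> Ck 1 A f -> A x -> differentiable f x.
Proof.
move=> oA fk Ax.
pose df (h : 'rV[R]_n) : R := \sum_i h 0 i * 'D_(delta_mx 0 i) f x.
have dfL : linear df.
  move=> a u v; rewrite /df scaler_sumr -big_split/=; apply: eq_bigr => i _.
  by rewrite !mxE mulrDl scalerAl.
pose dfM := GRing.isLinear.Build _ _ _ _ df dfL.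
pose L : {linear 'rV[R]_n -> R} := HB.pack df dfM.
apply: (proj1 (@differentiableI _ _ f L x (@linear_rV_continuous _ _ L) _)).
move=> e e0.
have nx : \forall y \near x, A y by exact: open_nbhs_nbhs.
have e1 : 0 < e / n.+1%:R by rewrite divr_gt0.
have H i : exists2 d : R, 0 < d & forall y (h : R),
    `|y - x| < d -> `|h *: (delta_mx 0 i : 'rV[R]_n)| < d ->
    `|f (y + h *: delta_mx 0 i) - f y - h * 'D_(delta_mx 0 i) f x| <= e / n.+1%:R * `|h|.
  apply: derive_incr e1.
    by apply: filterS nx => y Ay; exact: Ck_derivable fk Ay.
  exact: Ck_cont (Ck_derive _ fk) Ax.
have [d d0 Hd] : exists2 d : R, 0 < d & forall i y (h : R),
    `|y - x| < d -> `|h *: (delta_mx 0 i : 'rV[R]_n)| < d ->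
    `|f (y + h *: delta_mx 0 i) - f y - h * 'D_(delta_mx 0 i) f x| <= e / n.+1%:R * `|h|.
  pose g i := sval (cid2 (H i)).
  exists (\big[Order.min/1]_i g i).
    elim/big_ind: _ => // [a b a0 b0|i _]; first by rewrite lt_min a0.
    by rewrite /g; case: cid2.
  move=> i y h yx hd; rewrite /= in yx hd.
  have [g0 Hg] := svalP (cid2 (H i)).
  have gi : \big[Order.min/1]_i g i <= g i by exact: bigmin_le.
  by apply: Hg; apply: lt_le_trans gi.
have d1 : 0 < d / n.+1%:R by rewrite divr_gt0.
apply/nbhs_norm0P; exists (d / n.+1%:R) => //= h hd.
have hi i : `|h 0 i| <= `|h| by exact: mx_norm_coord.
have hei i : `|h 0 i *: (delta_mx 0 i : 'rV[R]_n)| <= `|h|.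
  apply: mx_norm_leP => // a b; rewrite !mxE.
  case: (_ && _); rewrite ?mulr1 ?mulr0 ?normr0//.
(* Induction along the path; the bound on the partial sums keeps its vertices within the radius [d]
   where the one-step estimates hold. *)
have K (s : seq 'I_n) : (size s <= n)%N ->
  `|f (x + \sum_(i <- s) h 0 i *: delta_mx 0 i) - f x
     - \sum_(i <- s) h 0 i * 'D_(delta_mx 0 i) f x| <= (size s)%:R * (e / n.+1%:R * `|h|)
  /\ `|\sum_(i <- s) h 0 i *: (delta_mx 0 i : 'rV[R]_n)| <= (size s)%:R * `|h|.
  elim: s => [|i s IH] sn; first by rewrite !big_nil addr0 subrr subr0 !normr0 !mul0r.
  have [IH1 IH2] := IH (ltnW sn).
  rewrite !big_cons /=; split; last first.
    rewrite (le_trans (ler_normD _ _))// -[(size s).+1]add1n natrD mulrDl mul1r.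
    by rewrite lerD.
  set S := \sum_(_ <- _) _ *: _ in IH1 IH2 *; set T := \sum_(_ <- _) _ * _ in IH1 IH2 *.
  have := Hd i (x + S) (h 0 i); rewrite [x + S - x]addrAC subrr add0r.
  have xS : `|S| < d.
    rewrite (le_lt_trans IH2)// (@le_lt_trans _ _ (n.+1%:R * `|h|))//.
      by rewrite ler_wpM2r// ler_nat; exact: leqW (ltnW sn).
    by rewrite mulrC -ltr_pdivlMr.
  have ih : `|h 0 i *: (delta_mx 0 i : 'rV[R]_n)| < d.
    rewrite (le_lt_trans (hei i))// (lt_le_trans hd)// ler_pdivrMr//.
    by rewrite ler_peMr ?ler1n// ltW.
  move=> /(_ xS ih) Hi.
  rewrite [_ *: _ + S]addrC addrA.
  rewrite [X in `|X|](_ : _ = (f (x + S + h 0 i *: delta_mx 0 i) - f (x + S) -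
    h 0 i * 'D_(delta_mx 0 i) f x) + (f (x + S) - f x - T)); last first.
    by ring.
  rewrite (le_trans (ler_normD _ _))// -[(size s).+1]add1n natrD mulrDl mul1r.
  rewrite lerD// (le_trans Hi)// ler_wpM2l// ltW//.
have sz : (size (index_enum 'I_n) <= n)%N.
  by rewrite [index_enum _]unlock -enumT size_enum_ord.
have [+ _] := K (index_enum 'I_n) sz.
rewrite -row_sum_delta => /le_trans; apply.
rewrite mulrA ler_wpM2r// mulrCA ger_pMr// ler_pdivrMr// mul1r ler_nat.
exact: leqW.
Qed.

Lemma C1_diff n p q (A : set 'rV[R]_n) (f : 'rV[R]_n -> 'M[R]_(p, q)) x :
  open A -> Ck 1 A f -> A x -> differentiable f x.
Proof.
move=> oA /(Ck_mxP _ _ oA) fk Ax.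
have -> : f = \sum_(i < p) \sum_(j < q) (fun x => f x i j *: (delta_mx i j : 'M[R]_(p, q))).
  apply/funext => y; rewrite [LHS]matrix_sum_delta fct_sumE; apply: eq_bigr => i _.
  by rewrite fct_sumE.
apply: differentiable_sum => i; apply: differentiable_sum => j.
apply: differentiableZl; exact: C1_diff_R (fk i j) Ax.
Qed.

Lemma derive_comp (U V W : normedModType R) (f : U -> V) (g : V -> W) x v :
  differentiable f x -> differentiable g (f x) ->
  'D_v (g \o f) x = 'D_('D_v f x) g (f x).
Proof.
move=> df dg; rewrite deriveE; last exact: differentiable_comp.
by rewrite diff_comp//= (deriveE v df) deriveE.
Qed.

Lemma derive_sumE (W : normedModType R) n (f : 'rV[R]_n -> W) x v :
  differentiable f x -> 'D_v f x = \sum_i v 0 i *: 'D_(delta_mx 0 i) f x.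
Proof.
move=> df; rewrite deriveE// {1}(row_sum_delta v) linear_sum.
by apply: eq_bigr => i _; rewrite linearZ/= -deriveE.
Qed.

(** The derivative of the composite is a sum of products of functions one order less smooth. Total
    differentiability, required by the chain rule and not part of [Ck], comes from [C1_diff] and
    [C1_diff_R]. *)
Lemma Ck_comp_R k n m (A : set 'rV[R]_n) (B : set 'rV[R]_m)
  (f : 'rV[R]_m -> R) (g : 'rV[R]_n -> 'rV[R]_m) :
  open A -> open B -> (forall x, A x -> B (g x)) ->
  Ck k B f -> Ck k A g -> Ck k A (f \o g).
Proof.
move=> oA oB AB; elim: k f => [|k IH] f fk gk.
  case: fk gk => [cf _] [cg _]; split=> // x Ax.
  by apply: continuous_comp; [exact: cg|apply: cf; exact: AB].
have fk1 : Ck 1 B f by elim: (k) fk => // j IHj /CkW.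
have gk1 : Ck 1 A g by elim: (k) gk => // j IHj /CkW.
have df y : B y -> differentiable f y by exact: C1_diff_R fk1.
have dg y : A y -> differentiable g y by exact: C1_diff gk1.
split=> [x Ax|v].
  apply: continuous_comp; first exact: Ck_cont gk Ax.
  by apply: (Ck_cont fk); exact: AB.
split=> [x Ax|].
  apply: diff_derivable; apply: differentiable_comp; first exact: dg.
  by apply: df; exact: AB.
apply: (@Ck_ext _ _ _ _ _ (fun x => \sum_i
   ((fun x => 'D_v g x 0 i) * ('D_(delta_mx 0 i) f \o g)) x)) => // [x Ax|].
  rewrite derive_comp; [|exact: dg|by apply: df; exact: AB].
  by rewrite derive_sumE //; apply: df; exact: AB.
apply: Ck_sum => // i _; apply: Ck_mul => //.
  by have /(Ck_mxP _ _ oA) := Ck_derive v gk; exact.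
by apply: IH; [exact: Ck_derive|exact: CkW].
Qed.

Lemma Ck_comp k n m p q (A : set 'rV[R]_n) (B : set 'rV[R]_m)
  (f : 'rV[R]_m -> 'M[R]_(p, q)) (g : 'rV[R]_n -> 'rV[R]_m) :
  open A -> open B -> (forall x, A x -> B (g x)) ->
  Ck k B f -> Ck k A g -> Ck k A (f \o g).
Proof.
move=> oA oB AB /(Ck_mxP _ _ oB) fk gk; apply/(Ck_mxP _ _ oA) => i j.
exact: (Ck_comp_R oA oB AB (fk i j)).
Qed.

(** One neighbourhood serves all orders k at once. This makes the condition open in x, so it can be
    differentiated and composed without leaving it. *)
Definition smooth_at n (V : normedModType R) (f : 'rV[R]_n -> V) x :=
  exists A : set 'rV[R]_n, [/\ open A, A x & smooth_on A f].

Section SmoothAt.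
Variable n : nat.
Implicit Types x v : 'rV[R]_n.

Lemma sa_near (V : normedModType R) (f g : 'rV[R]_n -> V) x :
  {near x, f =1 g} -> smooth_at f x -> smooth_at g x.
Proof.
move=> /near_open[B [oB Bx BE]] [A [oA Ax fA]].
exists (A `&` B); split; [exact: openI|by []|] => k.
apply: (@Ck_ext _ _ _ _ _ f); first exact: openI.
  by move=> z [_ /BE].
by apply: Ck_sub (fA k) => z [].
Qed.

Lemma sa_nbhs (V : normedModType R) (f : 'rV[R]_n -> V) x :
  smooth_at f x -> \forall y \near x, smooth_at f y.
Proof.
move=> [A [oA Ax fA]]; apply: filterS (open_nbhs_nbhs (conj oA Ax)) => y Ay.
by exists A.
Qed.

Lemma sa_onP (V : normedModType R) (f : 'rV[R]_n -> V) (A : set 'rV[R]_n) :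
  open A -> smooth_on A f <-> forall x, A x -> smooth_at f x.
Proof.
move=> oA; split=> [H x Ax|H k]; first by exists A.
apply/CkP => x /H[B [oB Bx fB]].
by apply: Ck_sub (fB k) => y ->.
Qed.

Lemma sa_on (V : normedModType R) (f : 'rV[R]_n -> V) (A : set 'rV[R]_n) :
  (forall x, A x -> smooth_at f x) -> smooth_on A f.
Proof.
move=> H k; apply/CkP => x /H[B [oB Bx fB]].
by apply: Ck_sub (fB k) => y ->.
Qed.

Lemma sa_at (V : normedModType R) (f : 'rV[R]_n -> V) x :
  (\forall y \near x, smooth_on [set y] f) -> smooth_at f x.
Proof.
move=> /near_open[B [oB Bx BE]]; exists B; split=> // k; apply/CkP => y /BE; exact.
Qed.

Lemma sa_cont (V : normedModType R) (f : 'rV[R]_n -> V) x :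
  smooth_at f x -> {for x, continuous f}.
Proof. by move=> [A [oA Ax fA]]; exact: Ck_cont (fA 0) Ax. Qed.

Lemma sa_derivable (V : normedModType R) (f : 'rV[R]_n -> V) x v :
  smooth_at f x -> derivable f x v.
Proof. by move=> [A [oA Ax fA]]; exact: Ck_derivable (fA 1) Ax. Qed.

Lemma sa_derive (V : normedModType R) (f : 'rV[R]_n -> V) x v :
  smooth_at f x -> smooth_at ('D_v f) x.
Proof. by move=> [A [oA Ax fA]]; exists A; split=> // k; exact: Ck_derive. Qed.

Lemma sa_diff p q (f : 'rV[R]_n -> 'M[R]_(p, q)) x :
  smooth_at f x -> differentiable f x.
Proof. by move=> [A [oA Ax fA]]; exact: C1_diff (fA 1) Ax. Qed.

Lemma sa_cst (V : normedModType R) (a : V) x : smooth_at (fun=> a) x.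
Proof. by exists setT; split=> //; [exact: openT|move=> k; exact: Ck_cst]. Qed.

Lemma sa_coord i x : smooth_at (fun x : 'rV[R]_n => x 0 i) x.
Proof. by exists setT; split=> //; [exact: openT|move=> k; exact: Ck_coord]. Qed.

Lemma sa_add (V : normedModType R) (f g : 'rV[R]_n -> V) x :
  smooth_at f x -> smooth_at g x -> smooth_at (fun x => f x + g x) x.
Proof.
move=> [A [oA Ax fA]] [B [oB Bx gB]]; exists (A `&` B).
have oAB : open (A `&` B) by exact: openI.
split=> // k; apply: Ck_add => //; [apply: Ck_sub (fA k)|apply: Ck_sub (gB k)];
  exact: subIsetl || exact: subIsetr.
Qed.

Lemma sa_mul (f g : 'rV[R]_n -> R) x :
  smooth_at f x -> smooth_at g x -> smooth_at (fun x => f x * g x) x.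
Proof.
move=> [A [oA Ax fA]] [B [oB Bx gB]]; exists (A `&` B).
have oAB : open (A `&` B) by exact: openI.
split=> // k; apply: Ck_mul => //; [apply: Ck_sub (fA k)|apply: Ck_sub (gB k)];
  exact: subIsetl || exact: subIsetr.
Qed.

Lemma sa_inv (f : 'rV[R]_n -> R) x :
  f x != 0 -> smooth_at f x -> smooth_at (fun x => (f x)^-1) x.
Proof.
move=> fx0 fs; have [A [oA Ax fA]] := fs.
have : \forall y \near x, f y != 0.
  exact: cvgr_neq0 (sa_cont fs) fx0.
move=> /near_open[B [oB Bx BE]]; exists (A `&` B).
have oAB : open (A `&` B) by exact: openI.
split=> // k; apply: Ck_inv => //; first by move=> y [_ /BE].
by apply: Ck_sub (fA k); exact: subIsetl.
Qed.

Lemma sa_sum (V : normedModType R) (I : Type) (r : seq I) (P : pred I)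
    (F : I -> 'rV[R]_n -> V) x :
  (forall i, P i -> smooth_at (F i) x) ->
  smooth_at (fun x => \sum_(i <- r | P i) F i x) x.
Proof.
move=> H; elim: r => [|i r IH].
  rewrite (_ : (fun x => _) = fun=> 0); first exact: sa_cst.
  by apply/funext => y; rewrite big_nil.
rewrite (_ : (fun x => _) = if P i then (fun x => F i x + \sum_(j <- r | P j) F j x)
   else (fun x => \sum_(j <- r | P j) F j x)).
  by case: ifPn => // Pi; apply: sa_add => //; exact: H.
by apply/funext => y; rewrite big_cons; case: ifP.
Qed.

Lemma sa_prod (I : Type) (r : seq I) (P : pred I) (F : I -> 'rV[R]_n -> R) x :
  (forall i, P i -> smooth_at (F i) x) ->
  smooth_at (fun x => \prod_(i <- r | P i) F i x) x.
Proof.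
move=> H; elim: r => [|i r IH].
  rewrite (_ : (fun x => _) = fun=> 1); first exact: sa_cst.
  by apply/funext => y; rewrite big_nil.
rewrite (_ : (fun x => _) = if P i then (fun x => F i x * \prod_(j <- r | P j) F j x)
   else (fun x => \prod_(j <- r | P j) F j x)).
  by case: ifPn => // Pi; apply: sa_mul => //; exact: H.
by apply/funext => y; rewrite big_cons; case: ifP.
Qed.

Lemma sa_mx p q (f : 'rV[R]_n -> 'M[R]_(p, q)) x :
  (forall i j, smooth_at (fun y => f y i j) x) -> smooth_at f x.
Proof.
move=> H; pose A i j := sval (cid (H i j)).
have AP i j : [/\ open (A i j), A i j x & smooth_on (A i j) (fun y => f y i j)].
  exact: (svalP (cid (H i j))).
have : \forall y \near x, forall i j, A i j y.
  near=> y; move=> i j; move: i j; near: y.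
  apply: filter_forall => i; apply: filter_forall => j.
  by have [oA Ax _] := AP i j; exact: open_nbhs_nbhs.
move=> /near_open[B [oB Bx BE]]; exists B; split=> // k.
apply/Ck_mxP => // i j; have [_ _ /(_ k)] := AP i j.
by apply: Ck_sub => y /BE; exact.
Unshelve. all: by end_near. Qed.

Lemma sa_entry p q (f : 'rV[R]_n -> 'M[R]_(p, q)) x i j :
  smooth_at f x -> smooth_at (fun y => f y i j) x.
Proof. by move=> [A [oA Ax fA]]; exists A; split=> // k; move: (fA k) => /Ck_mxP; exact. Qed.

Lemma sa_id x : smooth_at id x.
Proof. by apply: sa_mx => i j; rewrite ord1; exact: sa_coord. Qed.

Lemma sa_mulmx p q r (f : 'rV[R]_n -> 'M[R]_(p, q)) (g : 'rV[R]_n -> 'M[R]_(q, r)) x :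
  smooth_at f x -> smooth_at g x -> smooth_at (fun y => f y *m g y) x.
Proof.
move=> fs gs; apply: sa_mx => i j.
rewrite (_ : (fun y => _) = fun y => \sum_k f y i k * g y k j).
  by apply: sa_sum => k _; apply: sa_mul; exact: sa_entry.
by apply/funext => y; rewrite mxE.
Qed.

Lemma sa_scale p q (f : 'rV[R]_n -> R) (g : 'rV[R]_n -> 'M[R]_(p, q)) x :
  smooth_at f x -> smooth_at g x -> smooth_at (fun y => f y *: g y) x.
Proof.
move=> fs gs; apply: sa_mx => i j.
rewrite (_ : (fun y => _) = fun y => f y * g y i j).
  by apply: sa_mul => //; exact: sa_entry.
by apply/funext => y; rewrite mxE.
Qed.

Lemma sa_tr p q (f : 'rV[R]_n -> 'M[R]_(p, q)) x :
  smooth_at f x -> smooth_at (fun y => (f y)^T) x.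
Proof.
move=> fs; apply: sa_mx => i j.
rewrite (_ : (fun y => _) = fun y => f y j i); first exact: sa_entry.
by apply/funext => y; rewrite mxE.
Qed.

Lemma sa_det p (f : 'rV[R]_n -> 'M[R]_p) x :
  smooth_at f x -> smooth_at (fun y => \det (f y)) x.
Proof.
move=> fs; apply: sa_sum => s _; apply: sa_mul; first exact: sa_cst.
by apply: sa_prod => i _; exact: sa_entry.
Qed.

Lemma sa_invmx p (f : 'rV[R]_n -> 'M[R]_p) x :
  f x \in unitmx -> smooth_at f x -> smooth_at (fun y => invmx (f y)) x.
Proof.
rewrite unitmxE unitfE => fx fs; have ds := sa_det fs.
apply: (@sa_near _ (fun y => (\det (f y))^-1 *: \adj (f y))).
  have : \forall y \near x, \det (f y) != 0.
    exact: cvgr_neq0 (sa_cont ds) fx.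
  by apply: filterS => y fy; rewrite /invmx unitmxE unitfE fy.
apply: sa_scale; first exact: sa_inv.
apply: sa_mx => i j.
rewrite (_ : (fun y => _) = fun y => (-1) ^+ (j + i) * \det (row' j (col' i (f y)))).
  apply: sa_mul; first exact: sa_cst.
  apply: sa_det; apply: sa_mx => a b.
  rewrite (_ : (fun y => _) = fun y => f y (lift j a) (lift i b)); first exact: sa_entry.
  by apply/funext => y; rewrite !mxE.
by apply/funext => y; rewrite mxE.
Qed.

Lemma sa_jac m (f : 'rV[R]_n -> 'rV[R]_m) x : smooth_at f x ->
  smooth_at (fun y => 'J f y) x.
Proof.
move=> fs; apply: sa_mx => i j.
apply: (@sa_near _ (fun y => 'D_(delta_mx 0 i) f y 0 j)).
  apply: filterS (sa_nbhs fs) => y fy.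
  by rewrite deriveEjacobian; [rewrite -rowE mxE|exact: sa_diff].
by apply: sa_entry; exact: sa_derive.
Qed.

Lemma sa_row_mx p q1 q2 (f : 'rV[R]_n -> 'M[R]_(p, q1)) (g : 'rV[R]_n -> 'M[R]_(p, q2)) x :
  smooth_at f x -> smooth_at g x -> smooth_at (fun y => row_mx (f y) (g y)) x.
Proof.
move=> fs gs; apply: sa_mx => i j.
case: (split_ordP j) => k ->.
  rewrite (_ : (fun y => _) = fun y => f y i k); first exact: sa_entry.
  by apply/funext => y; rewrite row_mxEl.
rewrite (_ : (fun y => _) = fun y => g y i k); first exact: sa_entry.
by apply/funext => y; rewrite row_mxEr.
Qed.

Lemma sa_lsubmx p q1 q2 (f : 'rV[R]_n -> 'M[R]_(p, q1 + q2)) x :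
  smooth_at f x -> smooth_at (fun y => lsubmx (f y)) x.
Proof.
move=> fs; apply: sa_mx => i j.
rewrite (_ : (fun y => _) = fun y => f y i (lshift q2 j)); first exact: sa_entry.
by apply/funext => y; rewrite !mxE.
Qed.

Lemma sa_rsubmx p q1 q2 (f : 'rV[R]_n -> 'M[R]_(p, q1 + q2)) x :
  smooth_at f x -> smooth_at (fun y => rsubmx (f y)) x.
Proof.
move=> fs; apply: sa_mx => i j.
rewrite (_ : (fun y => _) = fun y => f y i (rshift q1 j)); first exact: sa_entry.
by apply/funext => y; rewrite !mxE.
Qed.

End SmoothAt.

Lemma sa_comp n m p q (f : 'rV[R]_m -> 'M[R]_(p, q)) (g : 'rV[R]_n -> 'rV[R]_m) x :
  smooth_at g x -> smooth_at f (g x) -> smooth_at (f \o g) x.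
Proof.
move=> gs; move: (gs) => [A [oA Ax gA]] [B [oB Bgx fB]].
have : \forall y \near x, B (g y).
  by apply: (sa_cont gs); exact: open_nbhs_nbhs.
move=> /near_open[C [oC Cx CE]]; exists (A `&` C).
have oAC : open (A `&` C) by exact: openI.
split=> // k; apply: (Ck_comp oAC oB _ (fB k)); first by move=> y [_ /CE].
by apply: Ck_sub (gA k); exact: subIsetl.
Qed.

Lemma jacE n m (f : 'rV[R]_n -> 'rV[R]_m) x v :
  smooth_at f x -> v *m 'J f x = 'D_v f x.
Proof. by move=> fs; rewrite deriveEjacobian//; exact: sa_diff. Qed.

Lemma jac_comp n m p (g : 'rV[R]_n -> 'rV[R]_m) (f : 'rV[R]_m -> 'rV[R]_p) x :
  smooth_at g x -> smooth_at f (g x) -> 'J (f \o g) x = 'J g x *m 'J f (g x).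
Proof.
move=> gs fs; apply/row_matrixP => i.
rewrite !rowE mulmxA (jacE _ (sa_comp gs fs)) (jacE _ gs) (jacE _ fs).
by rewrite derive_comp//; exact: sa_diff.
Qed.

Lemma jac_near n m (f g : 'rV[R]_n -> 'rV[R]_m) x : smooth_at f x ->
  {near x, f =1 g} -> 'J f x = 'J g x.
Proof.
move=> fs fg.
have gs : smooth_at g x by exact: (sa_near fg fs).
have E (h : 'rV[R]_n -> 'rV[R]_m) i : smooth_at h x -> row i ('J h x) = 'D_(delta_mx 0 i) h x.
  by move=> hs; rewrite rowE jacE.
apply/row_matrixP => i; apply: (etrans (E f i fs)).
apply: (etrans _ (esym (E g i gs))); exact: near_eq_derive.
Qed.

End Calculus.

(** * Symmetry of second derivatives, limits of derivatives, Gronwall's inequality *)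

Section Calculus2.
Context {R : realType}.

(** Both mixed derivatives are approximated by the second difference of [f] along h v and h w,
    divided by h^2, and this difference is symmetric in v and w. The estimate for one order of
    derivation is therefore enough. *)
Lemma schwarz_R n (f : 'rV[R]_n -> R) x v w :
  smooth_at f x -> 'D_v ('D_w f) x = 'D_w ('D_v f) x.
Proof.
wlog suff H : v w / smooth_at f x -> forall e : R, 0 < e -> exists2 d, 0 < d &
    forall h : R, `|h *: v| < d -> `|h *: w| < d ->
    `|f (x + h *: v + h *: w) - f (x + h *: v) - f (x + h *: w) + f x
      - h * (h * 'D_v ('D_w f) x)| <= e * `|h| * `|h|.
  move=> fs; apply/eqP; rewrite -subr_eq0 -normr_le0; apply/ler_addgt0Pl => e e0.
  have e2 : 0 < e / 2 by rewrite divr_gt0.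
  have [d d0 Hd] := H v w fs _ e2; have [d' d'0 Hd'] := H w v fs _ e2.
  have [h h0 [hv hw]] : exists2 h : R, 0 < h & `|h *: v| < Num.min d d' /\ `|h *: w| < Num.min d d'.
    have m0 : 0 < Num.min d d' by rewrite lt_min d0.
    have p0 : 0 < 1 + `|v| + `|w| by rewrite -addrA ltr_wpDr// addr_ge0.
    pose h := Num.min d d' / (1 + `|v| + `|w|).
    have h0 : 0 < h by exact: divr_gt0.
    have K (u : 'rV[R]_n) : `|u| <= `|v| + `|w| -> `|h *: u| < Num.min d d'.
      move=> hu; rewrite normrZ (gtr0_norm h0) /h mulrAC ltr_pdivrMr// ltr_pM2l//.
      by rewrite -addrA (le_lt_trans hu)// ltrDr.
    by exists h => //; split; apply: K; rewrite ?lerDl ?lerDr.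
  move: hv hw; rewrite !lt_min => /andP[hv hv'] /andP[hw hw'].
  have A1 := Hd h hv hw; have A2 := Hd' h hw' hv'.
  rewrite [x + h *: w + h *: v]addrAC in A2.
  set a := 'D_v _ x in A1 *; set b := 'D_w _ x in A2 *.
  have hh : 0 < h * h by rewrite mulr_gt0.
  rewrite -(ler_pM2r hh) addr0 (splitr e) mulrDl.
  rewrite -[X in `|_| * X]gtr0_norm// -normrM.
  rewrite (gtr0_norm h0) -mulrA in A1 A2.
  rewrite [X in `|X|](_ : _ = (f (x + h *: v + h *: w) - f (x + h *: w) -
     f (x + h *: v) + f x - h * (h * b)) - (f (x + h *: v + h *: w) - f (x + h *: v) -
      f (x + h *: w) + f x - h * (h * a))); last by ring.
  by apply: le_trans (ler_normB _ _) _; exact: lerD A2 A1.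
move=> fs e e0.
have sw := sa_derive w fs.
have [d d0 Hd] : exists2 d, 0 < d & forall y (h : R),
    `|y - x| < d -> `|h *: v| < d ->
    `|'D_w f (y + h *: v) - 'D_w f y - h * 'D_v ('D_w f) x| <= e * `|h|.
  apply: derive_incr e0; last exact: sa_cont (sa_derive v sw).
  by apply: filterS (sa_nbhs sw) => y; exact: sa_derivable.
have [d1 /= d10 Hd1] : exists2 d, 0 < d & forall y, `|y - x| < d -> smooth_at f y.
  have /nbhs_normP[d1 d10 H] := sa_nbhs fs; exists d1 => // y yx; apply: H.
  by rewrite /ball_/= distrC.
exists (Num.min d (d1 / 2)); first by rewrite lt_min d0 divr_gt0.
move=> h; rewrite !lt_min => /andP[hv hv1] /andP[hw hw1].
(* The second difference is the increment of [g] along w. The mean value theorem turns it into an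
   increment of ['D_w f] along v, to which [derive_incr] applies. *)
pose g y := f (y + h *: v) - f y.
have gs t : 0 <= t <= 1 -> smooth_at f (x + (t * h) *: w) /\
    smooth_at f (x + (t * h) *: w + h *: v).
  move=> /andP[t0 t1].
  have tw : `|(t * h) *: w| < d1 / 2.
    rewrite -scalerA normrZ ger0_norm// (le_lt_trans _ hw1)//.
    by rewrite ler_piMl.
  split; apply: Hd1.
    by rewrite addrAC subrr add0r (lt_trans tw)// gtr_pMr// invf_lt1// ltr1n.
  rewrite -[x + _ + _]addrA [x + _]addrC addrK (splitr d1).
  by rewrite (le_lt_trans (ler_normD _ _))// ltrD.
have dsh y : smooth_at f (y + h *: v) -> derivable (fun z => f (z + h *: v)) y w /\
    'D_w (fun z => f (z + h *: v)) y = 'D_w f (y + h *: v).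
  move=> sy; have : derivable f (y + h *: v) w by exact: sa_derivable.
  rewrite /derivable /derive.
  have -> // : (fun h0 : R => h0^-1 *: ((f \o shift (y + h *: v)) (h0 *: w) - f (y + h *: v)))
    = (fun h0 : R => h0^-1 *: (((fun z => f (z + h *: v)) \o shift y) (h0 *: w) - f (y + h *: v))).
  by apply/funext => k /=; rewrite addrA.
have [t t01|t t01] := @mvt_line R _ g x w h.
  have [s1 s2] := gs t t01; apply: derivableB; last exact: sa_derivable.
  by have [] := dsh _ s2.
have [s1 s2] := gs t t01.
have -> : 'D_w g (x + (t * h) *: w) = 'D_w f (x + (t * h) *: w + h *: v) - 'D_w f (x + (t * h) *: w).
  rewrite /g deriveB; [|by have [] := dsh _ s2|exact: sa_derivable].
  by have [_ ->] := dsh _ s2.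
move=> E.
have -> : f (x + h *: v + h *: w) - f (x + h *: v) - f (x + h *: w) + f x
   = g (x + h *: w) - g x.
  by rewrite /g [x + h *: w + _]addrAC; ring.
rewrite E -mulrBr normrM mulrC ler_wpM2r//.
apply: Hd => //; rewrite addrAC subrr add0r -scalerA normrZ.
move: t01 => /andP[t0 t1]; rewrite ger0_norm// (le_lt_trans _ hw)//.
by rewrite ler_piMl.
Qed.

Lemma derive_cvgE (V W : normedModType R) (f : V -> W) x v (l : W) :
  (fun h : R => h^-1 *: ((f \o shift x) (h *: v) - f x)) @ 0^' --> l -> 'D_v f x = l.
Proof. exact: cvg_lim. Qed.

Local Opaque derive jacobian.

Lemma derive_entry (V : normedModType R) p q (f : V -> 'M[R]_(p, q)) x v i j :
  derivable f x v -> 'D_v (fun y => f y i j) x = 'D_v f x i j.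
Proof. by move=> d; rewrite derive_mx// mxE. Qed.

Lemma schwarz n p q (f : 'rV[R]_n -> 'M[R]_(p, q)) x v w :
  smooth_at f x -> 'D_v ('D_w f) x = 'D_w ('D_v f) x.
Proof.
move=> fs; apply/matrixP => i j.
have E a b : 'D_a ('D_b f) x i j = 'D_a ('D_b (fun y => f y i j)) x.
  rewrite -derive_entry; last exact: sa_derivable (sa_derive b fs).
  apply: near_eq_derive; apply: filterS (sa_nbhs fs) => y fy.
  by rewrite derive_entry//; exact: sa_derivable.
apply: etrans (E v w) _; apply: etrans _ (esym (E w v)).
by apply: schwarz_R; exact: sa_entry.
Qed.

(** The norm is the maximum of the entries, so the mean value theorem may be used entry by entry
    although its intermediate point varies with the entry. *)
Lemma mvt_ineq (V : normedModType R) p q (f : V -> 'M[R]_(p, q)) x v K :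
  (forall t : R, 0 <= t <= 1 -> derivable f (x + t *: v) v /\ `|'D_v f (x + t *: v)| <= K) ->
  `|f (x + v) - f x| <= K.
Proof.
move=> H; have K0 : 0 <= K.
  by have [|_] := H 0; [rewrite lexx ler01|exact: le_trans].
apply: mx_norm_leP => // i j; rewrite !mxE.
have [t t01|t t01] := @mvt_line R _ (fun y => f y i j) x v 1.
  by move/derivable_mxP : (H t t01).1; rewrite mulr1; exact.
rewrite scale1r mul1r mulr1 => ->; have [d1 d2] := H t t01.
by rewrite derive_entry//; apply: le_trans d2; exact: mx_norm_coord.
Qed.

(** By the mean value theorem a difference quotient of [u k] at x is a value of ['D_v (u k)] near x,
    hence close to [w x] uniformly in large k. The bound passes to the limit in k for a fixed
    increment. *)
Lemma derive_limit_R (V : normedModType R) (u : nat -> V -> R) (ul w : V -> R)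
    (A : set V) v : open A ->
  (forall x, A x -> u ^~ x @ \oo --> ul x) ->
  (forall k x, A x -> derivable (u k) x v) ->
  (forall e : R, 0 < e -> exists K, forall k, (K <= k)%N -> forall x, A x ->
     `|'D_v (u k) x - w x| <= e) ->
  (forall x, A x -> {for x, continuous w}) ->
  forall x, A x -> derivable ul x v /\ 'D_v ul x = w x.
Proof.
move=> oA cu du uw cw x Ax.
suff H : (fun h : R => h^-1 *: ((ul \o shift x) (h *: v) - ul x)) @ 0^' --> w x.
  by split; [apply/cvg_ex; exists (w x)|exact: derive_cvgE].
apply/cvgrPdist_le => e e0.
have e2 : 0 < e / 2 by rewrite divr_gt0.
have [K HK] := uw _ e2.
have /cvgrPdist_le/(_ _ e2) cwx := cw x Ax.
have /nbhs_normP[d /= d0 Hd] : \forall z \near x, A z /\ `|w x - w z| <= e / 2.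
  by near=> z; split; near: z; [exact: open_nbhs_nbhs|exact: cwx].
have hd : \forall h \near (0 : R)^', `|h *: v| < d.
  have : (fun h : R => h *: v) @ (0 : R)^' --> (0 : V).
    rewrite -[X in _ --> X](scale0r v); apply: cvgZr_tmp; exact: nbhs_dnbhs.
  by move=> /cvgr0_norm_lt; apply.
near=> h.
have h0 : h != 0 by near: h; exact: nbhs_dnbhs_neq.
have hv : `|h *: v| < d by near: h; exact: hd.
have seg (t : R) : 0 <= t <= 1 -> A (x + (t * h) *: v) /\
   `|w x - w (x + (t * h) *: v)| <= e / 2.
  move=> /andP[t0 t1]; apply: Hd; rewrite /ball_/= opprD addrA subrr add0r normrN.
  by rewrite -scalerA normrZ ger0_norm// (le_lt_trans _ hv)// ler_piMl.
have Bk k : (K <= k)%N -> `|h^-1 *: (u k (h *: v + x) - u k x) - w x| <= e.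
  move=> kK; have [t /seg[At _]|t t01] := @mvt_line R _ (u k) x v h; first exact: du.
  rewrite [h *: v + x]addrC => ->; rewrite /GRing.scale/= mulKf//.
  have [At wt] := seg t t01.
  rewrite -(subrK (w (x + (t * h) *: v)) ('D_v _ _)) -addrA (le_trans (ler_normD _ _))//.
  by rewrite (splitr e) lerD//; [exact: HK|rewrite distrC].
have Ah : A (h *: v + x) by have [|+ _] := seg 1; [rewrite ler01 lexx|rewrite mul1r addrC].
rewrite distrC.
have C : (fun k => `|h^-1 *: (u k (h *: v + x) - u k x) - w x|) @ \oo -->
   `|h^-1 *: (ul (h *: v + x) - ul x) - w x|.
  apply: cvg_norm; apply: cvgB; last exact: cvg_cst.
  by apply: cvgZl_tmp; apply: cvgB; exact: cu.
rewrite -(cvg_lim _ C)//; apply: limr_le; first by apply/cvg_ex; eexists; exact: C.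
near=> k; apply: Bk; near: k; exact: nbhs_infty_ge.
Unshelve. all: by end_near. Qed.

Lemma derive_limit (V : normedModType R) p q (u : nat -> V -> 'M[R]_(p, q))
    (ul w : V -> 'M[R]_(p, q)) (A : set V) v : open A ->
  (forall x, A x -> u ^~ x @ \oo --> ul x) ->
  (forall k x, A x -> derivable (u k) x v) ->
  (forall e : R, 0 < e -> exists K, forall k, (K <= k)%N -> forall x, A x ->
     `|'D_v (u k) x - w x| <= e) ->
  (forall x, A x -> {for x, continuous w}) ->
  forall x, A x -> derivable ul x v /\ 'D_v ul x = w x.
Proof.
move=> oA cu du uw cw x Ax.
have H i j : derivable (fun y => ul y i j) x v /\
    'D_v (fun y => ul y i j) x = w x i j.
  apply: (@derive_limit_R _ (fun k y => u k y i j) (fun y => ul y i j)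
            (fun y => w y i j) A v) => //.
  - by move=> y /cu /cvg_mxP; exact.
  - by move=> k y /(du k)/derivable_mxP; exact.
  - move=> e /uw[K HK]; exists K => k Kk y Ay.
    rewrite derive_entry; last exact: du.
    have := HK k Kk y Ay; apply: le_trans.
    by have := @mx_norm_coord R _ _ ('D_v (u k) y - w y) i j; rewrite !mxE.
  - by move=> y /cw/continuous_mxP; exact.
have d : derivable ul x v by apply/derivable_mxP => i j; have [] := H i j.
by split=> //; apply/matrixP => i j; rewrite -derive_entry//; have [] := H i j.
Qed.

(** With [a k] the tail of the geometric series, [u + a] decreases and [u - a] increases: monotone
    convergence gives the limit together with the rate. *)
Lemma geometric_lim_R (u : nat -> R) C :
  (forall k, `|u k.+1 - u k| <= C * 2^-1 ^+ k) ->
  exists l, (u @ \oo --> l) /\ forall k, `|u k - l| <= 2 * C * 2^-1 ^+ k.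
Proof.
move=> H.
pose a k := 2 * C * 2^-1 ^+ k.
have aS k : a k.+1 = C * 2^-1 ^+ k.
  by rewrite /a exprS; field.
have aE k : a k = 2 * (C * 2^-1 ^+ k) by rewrite /a mulrA.
have a0 k : 0 <= a k by rewrite aE mulr_ge0//; exact: le_trans (H k).
have vd : nonincreasing_seq (fun k => u k + a k).
  apply/nonincreasing_seqP => k; rewrite aS aE.
  have := H k; rewrite ler_norml => /andP[_]; rewrite lerBlDl; lra.
have wi : nondecreasing_seq (fun k => u k - a k).
  apply/nondecreasing_seqP => k; rewrite aS aE.
  have := H k; rewrite ler_norml => /andP[+ _]; lra.
have vl k : u 0%N - a 0%N <= u k + a k.
  by apply: (le_trans (wi 0%N k (leq0n k))); have := a0 k; lra.
have wu k : u k - a k <= u 0%N + a 0%N.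
  by apply: (le_trans _ (vd 0%N k (leq0n k))); have := a0 k; lra.
have cv : cvgn (fun k => u k + a k).
  apply: nonincreasing_is_cvgn => //; exists (u 0%N - a 0%N) => _ [k _ <-]; exact: vl.
have ca : a @ \oo --> (0 : R).
  rewrite -[X in _ --> X](mulr0 (2 * C)); apply: cvgM; first exact: cvg_cst.
  by apply: cvg_expr; rewrite ger0_norm// invf_lt1// ltr1n.
pose l := limn (fun k => u k + a k).
have ul : u @ \oo --> l.
  have -> : u = (fun k => u k + a k - a k) by apply/funext => k; rewrite addrK.
  by rewrite -[X in _ --> X]subr0; apply: cvgB.
exists l; split=> // k.
have le1 : l <= u k + a k by apply: nonincreasing_cvgn_ge.
have le2 : u k - a k <= l.
  have cw : (fun k => u k - a k) @ \oo --> l.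
    by rewrite -[X in _ --> X]subr0; apply: cvgB.
  rewrite -(cvg_lim _ cw)//; apply: nondecreasing_cvgn_le => //.
  by apply/cvg_ex; exists l.
by rewrite -/(a k) ler_norml; apply/andP; split; lra.
Qed.

Lemma geometric_lim p q (u : nat -> 'M[R]_(p, q)) C :
  (forall k, `|u k.+1 - u k| <= C * 2^-1 ^+ k) ->
  exists l : 'M[R]_(p, q), (u @ \oo --> l) /\ forall k, `|u k - l| <= 2 * C * 2^-1 ^+ k.
Proof.
move=> H.
have HR i j : exists l, ((fun k => u k i j) @ \oo --> l) /\
    forall k, `|u k i j - l| <= 2 * C * 2^-1 ^+ k.
  apply: geometric_lim_R => k; apply: le_trans (H k).
  by have := @mx_norm_coord R _ _ (u k.+1 - u k) i j; rewrite !mxE.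
pose l := \matrix_(i, j) sval (cid (HR i j)).
exists l; split.
  by apply/cvg_mxP => i j; rewrite mxE; have [] := svalP (cid (HR i j)).
move=> k; apply: mx_norm_leP => [|i j]; last first.
  by rewrite !mxE; have [_] := svalP (cid (HR i j)); exact.
rewrite -mulrA mulr_ge0//; exact: le_trans (H k).
Qed.

(** The sum [g] of the squared entries replaces the norm, which is not differentiable. It satisfies
    g' <= c g, so g(s) exp(- c s) does not increase from its initial value 0. *)
Lemma gronwall p q (z : R -> 'M[R]_(p, q)) K :
  (forall s : R, 0 <= s <= 1 -> derivable z s 1 /\ `|'D_1 z s| <= K * `|z s|) ->
  z 0 = 0 -> forall s : R, 0 <= s <= 1 -> z s = 0.
Proof.
move=> H z0.
pose g s := \sum_i \sum_j z s i j ^+ 2.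
(* Each of the p q terms of g' is at most 2 |K| times |z|^2, and |z|^2 is at most g. *)
pose c := (p * q)%:R * (2 * `|K|).
have zg s : `|z s| ^+ 2 <= g s.
  have [z00|zn0] := eqVneq `|z s| 0.
    rewrite z00 expr2 mul0r; apply: sumr_ge0 => i _; apply: sumr_ge0 => j _; exact: sqr_ge0.
  have [ij E] := mx_norm_neq0 zn0.
  change (mx_norm (z s) ^+ 2 <= g s); rewrite E.
  rewrite real_normK ?num_real// /g (bigD1 ij.1)//= (bigD1 ij.2)//= -addrA lerDl addr_ge0//.
    by apply: sumr_ge0 => j _; exact: sqr_ge0.
  by apply: sumr_ge0 => i _; apply: sumr_ge0 => j _; exact: sqr_ge0.
have dg (s : R) : 0 <= s <= 1 -> is_derive s 1 g (\sum_i \sum_j 2 * (z s i j * 'D_1 z s i j)).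
  move=> s01; have [d1 d2] := H s s01.
  have -> : g = \sum_i \sum_j (fun s => z s i j ^+ 2).
    by apply/funext => t; rewrite /g fct_sumE; apply: eq_bigr => i _; rewrite fct_sumE.
  apply: is_derive_sum => i; apply: is_derive_sum => j.
  have dz : is_derive s 1 (fun s => z s i j) ('D_1 z s i j).
    rewrite -derive_entry//; apply: derivableP.
    by move/derivable_mxP : d1; exact.
  have -> : (fun s => z s i j ^+ 2) = (fun s => z s i j) * (fun s => z s i j).
    by apply/funext => t; rewrite expr2.
  apply: is_derive_eq; rewrite /GRing.scale/=; ring.
have dgle (s : R) : 0 <= s <= 1 -> \sum_i \sum_j 2 * (z s i j * 'D_1 z s i j) <= c * g s.
  move=> s01; have [d1 d2] := H s s01.
  have -> : c * g s = \sum_(i < p) \sum_(j < q) (2 * `|K| * g s).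
    rewrite sumr_const card_ord sumr_const card_ord -!mulrnA.
    by rewrite -[RHS]mulr_natl /c mulnC !mulrA.
  apply: ler_sum => i _; apply: ler_sum => j _.
  rewrite -mulrA ler_pM2l// (le_trans (ler_norm _))// normrM.
  apply: (@le_trans _ _ (`|z s| * (`|K| * `|z s|))).
    apply: ler_pM => //; first exact: mx_norm_coord.
    apply: le_trans (mx_norm_coord _ _ _) _; apply: le_trans d2 _.
    by rewrite ler_wpM2r// ler_norm.
  by rewrite mulrCA -expr2 ler_wpM2l.
pose k s := g s * expR (- c * s).
have dk (s : R) : 0 <= s <= 1 -> is_derive s 1 k ((\sum_i \sum_j 2 * (z s i j * 'D_1 z s i j) - c * g s) * expR (- c * s)).
  move=> s01; have dgs := dg s s01.
  have dl : is_derive s 1 (fun s => - c * s) (- c).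
    have -> : (fun s => - c * s) = ( - c \*: (id : R -> R)) by [].
    by apply: is_derive_eq; rewrite /GRing.scale/= mulr1.
  have de : is_derive s 1 (fun s => expR (- c * s)) (expR (- c * s) * (- c)).
    exact: (@is_derive1_comp R expR (fun s => - c * s)).
  have -> : k = g * (fun s => expR (- c * s)) by [].
  by apply: is_derive_eq; rewrite /GRing.scale/=; ring.
have k0 (s : R) : 0 <= s <= 1 -> k s <= 0.
  move=> /andP[s0 s1].
  have <- : k 0 = 0.
    by rewrite /k /g z0 big1 ?mul0r// => i _; rewrite big1// => j _; rewrite mxE expr2 mul0r.
  apply: (@ler0_derive1_nincr R k 0 1) => //.
  - move=> x; rewrite in_itv/= => /andP[/ltW x0 /ltW x1].
    by have [] := dk x _; rewrite ?x0 ?x1.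
  - move=> x; rewrite in_itv/= => /andP[/ltW x0 /ltW x1].
    have x01 : 0 <= x <= 1 by rewrite x0.
    have [_ dv] := dk x x01.
    by rewrite derive1E dv pmulr_lle0 ?expR_gt0// subr_le0; exact: dgle.
  - apply: derivable_within_continuous => x; rewrite in_itv/= => x01.
    by have [] := dk x x01.
move=> s s01; apply/eqP; rewrite -normr_eq0 -sqrf_eq0 eq_le sqr_ge0 andbT.
apply: le_trans (zg s) _; have := k0 s s01; rewrite /k.
by rewrite pmulr_lle0// expR_gt0.
Qed.

End Calculus2.

(** * The inverse function theorem *)

Section InverseFunction.
Context {R : realType}.
Local Opaque derive jacobian.

Lemma mulmx_norm p q r (A : 'M[R]_(p, q)) (B : 'M[R]_(q, r)) :
  `|A *m B| <= q%:R * `|A| * `|B|.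
Proof.
apply: mx_norm_leP => [|i j]; first by rewrite !mulr_ge0.
rewrite mxE (le_trans (ler_norm_sum _ _ _))//.
apply: (@le_trans _ _ (\sum_(k < q) `|A| * `|B|)).
  by apply: ler_sum => k _; rewrite normrM ler_pM// mx_norm_coord.
by rewrite sumr_const card_ord -[leLHS]mulr_natl mulrA.
Qed.

Lemma mulmx_continuous p q r (B : 'M[R]_(q, r)) :
  continuous (fun A : 'M[R]_(p, q) => A *m B).
Proof.
move=> A; apply/continuous_mxP => i j.
rewrite (_ : (fun y => _) = fun A : 'M[R]_(p, q) => \sum_k A i k * B k j); last first.
  by apply/funext => A'; rewrite mxE.
apply: (@continuous_big _ _ _ _ _ (@add_continuous R)) => k _ A'.
apply: (@continuousM R 'M[R]_(p, q) (fun A => A i k) (fun=> B k j) A').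
  exact: coord_continuous.
exact: cst_continuous.
Qed.

(** Newton's iteration with the derivative frozen at x: near x the map [phi] contracts by 1/2, and a
    fixed point of z |-> phi z + y T is a solution of f z = y. The same contraction gives
    injectivity, a Lipschitz inverse and the invertibility of the Jacobian near x. *)
Lemma inverse_function n (f : 'rV[R]_n -> 'rV[R]_n) x :
  smooth_at f x -> 'J f x \in unitmx ->
  exists (A B : set 'rV[R]_n) (g : 'rV[R]_n -> 'rV[R]_n),
    [/\ open A, A x & open B] /\
    [/\ forall z, A z -> [/\ B (f z), g (f z) = z, smooth_at f z & 'J f z \in unitmx] &
     forall y, B y -> [/\ A (g y), f (g y) = y & smooth_at g y]].
Proof.
move=> fs fu; pose T := invmx ('J f x).
pose phi z := z - f z *m T.
have phis z : smooth_at f z -> smooth_at phi z.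
  move=> fz; have -> : phi = fun z => z + f z *m (- T).
    by apply/funext => y; rewrite mulmxN.
  by apply: sa_add; [exact: sa_id|apply: sa_mulmx => //; exact: sa_cst].
have Dphi z v : smooth_at f z -> 'D_v phi z = v *m (1%:M - 'J f z *m T).
  move=> fz; have E : phi = id \- (mulmxr T \o f) by [].
  have dT y : differentiable (mulmxr T : 'rV[R]_n -> 'rV[R]_n) y.
    by apply: linear_differentiable; exact: mulmx_continuous.
  rewrite E deriveB; [|exact: derivable_id|]; last first.
    apply: diff_derivable; apply: differentiable_comp => //; exact: sa_diff.
  rewrite derive_id derive_comp//; last exact: sa_diff.
  rewrite deriveE// diff_lin/=; last exact: mulmx_continuous.
  by rewrite -jacE// mulmxBr mulmx1 mulmxA.
have [r r0 Hr] : exists2 r : R, 0 < r & forall z, `|z - x| < r ->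
    smooth_at f z /\ forall v, `|'D_v phi z| <= 2^-1 * `|v|.
  (* [mulmx_norm] costs a factor n, which this bound absorbs to leave the contraction factor 1/2. *)
  have e0 : 0 < (2 * (n%:R + 1))^-1 :> R by rewrite invr_gt0 mulr_gt0// ltr_wpDl.
  have cJ : {for x, continuous (fun z => 1%:M - 'J f z *m T)}.
    apply: (@continuousB R _ _ (fun=> 1%:M)); first exact: cst_continuous.
    apply: (@continuous_comp _ _ _ (fun z => 'J f z) (mulmx^~ T) x).
      exact: sa_cont (sa_jac fs).
    exact: mulmx_continuous.
  have E0 : 1%:M - 'J f x *m T = 0 by rewrite mulmxV// subrr.
  have cJ0 : (fun z => 1%:M - 'J f z *m T) @ x --> (0 : 'M[R]_n) :=
    eq_ind _ (fun l => (fun z => 1%:M - 'J f z *m T) @ x --> l) cJ _ E0.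
  have /cvgr0_norm_le/(_ _ e0) cJ' := cJ0.
  have /nbhs_normP[r r0 H] : \forall z \near x, smooth_at f z /\
      `|1%:M - 'J f z *m T| <= (2 * (n%:R + 1))^-1.
    by near=> z; split; near: z; [exact: sa_nbhs|exact: cJ'].
  exists r => // z zx; have [|s1 s2] := H z; first by rewrite /ball_/= distrC.
  split=> // v; rewrite Dphi// (le_trans (mulmx_norm _ _))//.
  rewrite (le_trans (ler_wpM2l _ s2)) ?mulr_ge0//.
  have n1 : 0 < n%:R + 1 :> R by rewrite ltr_wpDl.
  have -> : n%:R * `|v| * (2 * (n%:R + 1))^-1 = 2^-1 * `|v| * (n%:R / (n%:R + 1)).
    by field; rewrite gt_eqF.
  by rewrite ler_piMr ?mulr_ge0// ler_pdivrMr// mul1r lerDl.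
have lip z z' : `|z - x| < r -> `|z' - x| < r -> `|phi z - phi z'| <= 2^-1 * `|z - z'|.
  move=> zr z'r; rewrite -[X in phi X - _](subrK z' z) [z - z' + z']addrC.
  apply: mvt_ineq => t /andP[t0 t1].
  have : `|z' + t *: (z - z') - x| < r.
    have -> : z' + t *: (z - z') - x = t *: (z - x) + (1 - t) *: (z' - x).
      by apply/rowP => i; rewrite !mxE; ring.
    rewrite (le_lt_trans (ler_normD _ _))// !normrZ !ger0_norm ?subr_ge0//.
    have [->|tn0] := eqVneq t 0; first by rewrite mul0r add0r subr0 mul1r.
    have tp : 0 < t by rewrite lt_neqAle eq_sym tn0.
    have -> : r = t * r + (1 - t) * r by ring.
    by rewrite ltr_leD ?ltr_pM2l// ler_wpM2l ?subr_ge0// ltW.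
  move=> /Hr[s1 s2]; split; last exact: s2.
  by apply: sa_derivable; exact: phis.
have low z z' : `|z - x| < r -> `|z' - x| < r -> `|z - z'| <= 2 * `|(f z - f z') *m T|.
  move=> zr z'r; have := lip z z' zr z'r.
  have : `|z - z'| <= `|phi z - phi z'| + `|(f z - f z') *m T|.
    rewrite -[X in `|X| <= _](subrK ((f z - f z') *m T)) (le_trans (ler_normD _ _))//.
    have <- // : phi z - phi z' = z - z' - (f z - f z') *m T.
    rewrite mulmxBl /phi; move: (f z *m T) (f z' *m T) => a b.
    by apply/rowP => i; rewrite !mxE; ring.
  by move: `|z - z'| `|phi z - phi z'| `|_ *m T| => a b c; lra.
(* A vector v killed by the Jacobian would satisfy ['D_v phi z = v], against the factor 1/2. *)
have Ju z : `|z - x| < r -> 'J f z \in unitmx.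
  move=> /Hr[s1 s2]; rewrite -row_free_unit -kermx_eq0; apply/rowV0P => v /sub_kermxP vJ.
  have := s2 v; rewrite Dphi// mulmxBr mulmx1 mulmxA vJ mul0mx subr0.
  by move=> H; apply/eqP; rewrite -normr_le0; move: H; move: `|v| => a; lra.
(* The first step of the iteration has length c = |(y - f x) T| and the steps halve, so all iterates
   and their limit lie within 2 c of x; c < r / 4 keeps them in the ball of radius r. *)
have r4 : 0 < r / 4 by exact: divr_gt0.
have surj y : `|(y - f x) *m T| < r / 4 -> exists2 z, `|z - x| < r & f z = y.
  move=> yr; pose c := `|(y - f x) *m T|.
  pose u := fun k => iter k (fun z => phi z + y *m T) x.
  have uS k : u k.+1 = phi (u k) + y *m T by [].
  have u1 : `|u 1%N - u 0%N| = c.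
    rewrite uS /u/= /c /phi mulmxBl; congr `|_|.
    by move: (f x *m T) (y *m T) => a b; apply/rowP => i; rewrite !mxE; ring.
  have c0 : 0 <= c by exact: normr_ge0.
  have K k : `|u k - x| <= 2 * c - 2 * c * 2^-1 ^+ k /\ `|u k.+1 - u k| <= c * 2^-1 ^+ k.
    elim: k => [|k [IH1 IH2]].
      by rewrite /u/= subrr normr0 expr0 !mulr1 subrr; split=> //; rewrite -u1.
    have q0 : 0 <= 2^-1 ^+ k :> R by rewrite exprn_ge0.
    have p0 : 0 <= c * 2^-1 ^+ k by rewrite mulr_ge0.
    have h1 : `|u k.+1 - x| <= 2 * c - 2 * c * 2^-1 ^+ k.+1.
      rewrite -(subrK (u k) (u k.+1)) -addrA (le_trans (ler_normD _ _))//.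
      rewrite (le_trans (lerD IH2 IH1))// exprS.
      by move: p0; move: (2^-1 ^+ k) => q; lra.
    split=> //; rewrite !uS opprD addrACA subrr addr0.
    have b1 : `|u k.+1 - x| < r.
      rewrite (le_lt_trans h1)//; have : 0 <= 2 * c * 2^-1 ^+ k.+1.
        by rewrite mulr_ge0 ?exprn_ge0// mulr_ge0.
      by move: (_ ^+ _) => q; rewrite -/c in yr; lra.
    have b0 : `|u k - x| < r.
      rewrite (le_lt_trans IH1)//; by rewrite -/c in yr; lra.
    rewrite (le_trans (lip _ _ b1 b0))// exprS mulrCA ler_wpM2l//.
  have [z [uz uzk]] := @geometric_lim R _ _ u c (fun k => (K k).2).
  have zr : `|z - x| < r.
    have := uzk 0%N; rewrite expr0 mulr1 {1}/u/= distrC => H.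
    by rewrite (le_lt_trans H)//; rewrite -/c in yr; lra.
  exists z => //.
  have cz : {for z, continuous phi} by apply: sa_cont; apply: phis; have [] := Hr z zr.
  have uz1 : (fun k => u k.+1) @ \oo --> phi z + y *m T.
    apply: cvgD; last exact: cvg_cst.
    exact: (cvg_comp _ _ uz cz).
  have uz2 : (fun k => u k.+1) @ \oo --> z by rewrite cvg_shiftS.
  have E : phi z + y *m T = z by exact: (cvg_unique _ uz1 uz2).
  have : (y - f z) *m T = 0.
    by rewrite mulmxBl -[X in X - _](addKr (phi z)) E /phi opprB subrK subrr.
  move=> /(congr1 (mulmx^~ ('J f x))); rewrite -mulmxA mulVmx// mulmx1 mul0mx.
  by move=> /eqP; rewrite subr_eq0 => /eqP.
pose B := [set y | `|(y - f x) *m T| < r / 4].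
pose A := [set z | `|z - x| < r /\ B (f z)].
have gP y : exists z, B y -> `|z - x| < r /\ f z = y.
  have [By|nBy] := pselect (B y); last by exists x.
  by have [z] := surj y By; exists z.
pose g y := sval (cid (gP y)).
have gB y : B y -> `|g y - x| < r /\ f (g y) = y by exact: (svalP (cid (gP y))).
have inj z z' : `|z - x| < r -> `|z' - x| < r -> f z = f z' -> z = z'.
  move=> zr z'r E; apply/eqP; rewrite -subr_eq0 -normr_le0.
  by rewrite (le_trans (low _ _ zr z'r))// E subrr mul0mx normr0 mulr0.
have oball : open [set z | `|z - x| < r].
  have -> : [set z | `|z - x| < r] = ball x r.
    by rewrite -ball_normE; apply/seteqP; split=> z; rewrite /ball_/= distrC.
  exact: ball_open.
have oB : open B.
  have cB : continuous (fun y : 'rV[R]_n => `|(y - f x) *m T|).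
    have c1 (y : 'rV[R]_n) : {for y, continuous (fun y : 'rV[R]_n => (y - f x) *m T)}.
      apply: sa_cont; apply: sa_mulmx; last exact: sa_cst.
      by apply: (@sa_add _ _ _ id (fun=> - f x)); [exact: sa_id|exact: sa_cst].
    by move=> y; exact: (continuous_comp (c1 y) (@norm_continuous _ _ _)).
  exact: (open_comp (fun y _ => cB y) (@open_lt _ _)).
have oA : open A.
  rewrite openE => z [zr Bz]; rewrite /interior.
  have cf : {for z, continuous f} by apply: sa_cont; have [] := Hr z zr.
  by apply: filterI; [exact: open_nbhs_nbhs|apply: cf; exact: open_nbhs_nbhs].
have Ax : A x by split; rewrite ?subrr ?normr0// /B/= subrr mul0mx normr0.
exists A, B, g; split; first by split.
have gA y : B y -> A (g y) by move=> By; have [h1 h2] := gB y By; split=> //; rewrite h2.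
have glip y y' : B y -> B y' -> `|g y - g y'| <= 2 * `|(y - y') *m T|.
  move=> By By'; have [h1 h2] := gB y By; have [h1' h2'] := gB y' By'.
  by have := low _ _ h1 h1'; rewrite h2 h2'.
pose K := 2 * (n%:R * `|T|) + 1.
have K0 : 0 < K by rewrite ltr_wpDl// !mulr_ge0.
have glipK y y' : B y -> B y' -> `|g y - g y'| <= K * `|y - y'|.
  move=> By By'; rewrite (le_trans (glip _ _ By By'))//.
  rewrite (le_trans (ler_wpM2l _ (mulmx_norm _ _)))// /K.
  by have := normr_ge0 (y - y'); move: `|y - y'| `|T| n%:R => a b c; lra.
clearbody K g.
(* For k = g (y + h) - g y, the error k - h J^-1 equals - (h - k J) J^-1. Here h - k J is small
   compared with k by differentiability of [f], and k is at most [K] |h|. *)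
have gdiff y : B y -> differentiable g y /\
    'd g y = mulmxr (invmx ('J f (g y))) :> ('rV[R]_n -> 'rV[R]_n).
  move=> By; have [h1 h2] := gB y By; have [sgy _] := Hr _ h1.
  set J := 'J f (g y); have uJ : J \in unitmx by exact: Ju.
  apply: differentiableI; first exact: mulmx_continuous.
  move=> e e0.
  pose K' := K * (n%:R * `|invmx J|) + 1.
  have K'0 : 0 < K' by rewrite ltr_wpDl// mulr_ge0 ?mulr_ge0// ltW.
  have := diff_locallyx (sa_diff sgy) => dfy.
  have : \forall k \near (0 : 'rV[R]_n), `|f (k + g y) - f (g y) - 'd f (g y) k| <= e / K' * `|k|.
    have /eqaddoP := diff_locally (sa_diff sgy).
    move=> /(_ (e / K') (divr_gt0 e0 K'0)); apply: filterS => k.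
    by rewrite !fctE/= opprD addrA.
  move=> /nbhs_norm0P[d /= d0 Hd].
  have oBy : \forall h \near (0 : 'rV[R]_n), B (y + h).
    have /nbhs_normP[d1 /= d10 H1] : nbhs y B by exact: open_nbhs_nbhs.
    apply/nbhs_norm0P; exists d1 => //= h hd; apply: H1; rewrite /ball_/=.
    by rewrite opprD addrA subrr sub0r normrN.
  move: oBy => /nbhs_norm0P[d1 /= d10 H1].
  have dK : 0 < d / K := divr_gt0 d0 K0.
  have m0 : 0 < Num.min d1 (d / K) by rewrite lt_min d10 dK.
  apply/nbhs_norm0P; exists (Num.min d1 (d / K)); first exact: m0.
  move=> h; rewrite /mkset lt_min => /andP[hd1 hdK].
  have Byh := H1 h hd1.
  have [k kE] : exists k, k = g (y + h) - g y by exists (g (y + h) - g y).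
  rewrite -kE.
  have kle : `|k| <= K * `|h|.
    by have := glipK _ _ Byh By; rewrite kE [y + h - y]addrAC subrr add0r.
  have kd : `|k| < d by rewrite (le_lt_trans kle)// mulrC -ltr_pdivlMr.
  have := Hd k kd; rewrite {1}kE subrK (gB _ Byh).2 h2 [y + h - y]addrAC subrr add0r.
  rewrite -deriveE; last exact: sa_diff.
  rewrite -jacE// -/J => Hk.
  have -> : k - h *m invmx J = - ((h - k *m J) *m invmx J).
    by rewrite mulmxBl mulmxK// opprB.
  rewrite normrN (le_trans (mulmx_norm _ _))//.
  rewrite (le_trans (ler_wpM2r _ (ler_wpM2l _ Hk)))//.
  rewrite (le_trans (ler_wpM2r _ (ler_wpM2l _ (ler_wpM2l _ kle))))//.
    by rewrite divr_ge0// ltW.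
  rewrite [leLHS](_ : _ = e * `|h| * ((K' - 1) / K')); last first.
    by rewrite /K' addrK; ring.
  by rewrite ler_piMr ?mulr_ge0 ?(ltW e0)// ler_pdivrMr// mul1r gerBl.
(* Bootstrapping: ['D_v g] is the smooth map z |-> v J(z)^-1 composed with [g], so it is as smooth
   as [g] is already known to be. *)
have gC k : Ck k B g.
  elim: k => [|k IH].
    split=> // y By; apply: differentiable_continuous; by have [] := gdiff y By.
  split=> [y By|v].
    by apply: differentiable_continuous; have [] := gdiff y By.
  split=> [y By|]; first by apply: diff_derivable; have [] := gdiff y By.
  apply: (@Ck_ext _ _ _ _ _ ((fun z => v *m invmx ('J f z)) \o g)) => //.
    by move=> y By; have [d1 d2] := gdiff y By; rewrite deriveE// d2.
  apply: (@Ck_comp _ _ _ _ _ _ B A) => //.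
  have : smooth_on A (fun z => v *m invmx ('J f z)).
    apply: sa_on => z [zr Bz]; apply: sa_mulmx; first exact: sa_cst.
    apply: sa_invmx; first exact: Ju.
    by apply: sa_jac; have [] := Hr z zr.
  by apply.
split=> [z [zr Bz]|y By].
  split; [exact: Bz| |by have [] := Hr z zr|exact: Ju].
  by have [h1 h2] := gB _ Bz; exact: inj h1 zr h2.
split; [exact: gA|by have [] := gB y By|].
by exists B; split=> // k; exact: gC.
Unshelve. all: by end_near. Qed.

End InverseFunction.

(** * Bump functions *)

Section Bump.
Context {R : realType}.
Local Opaque derive jacobian.

(** The powers of 1/t are included because the family is then closed under differentiation: the
    derivative of [flat m] is [flat m.+2] minus m times [flat m.+1]. *)
Definition flat (m : nat) (t : R) : R :=
  if 0 < t then t^-1 ^+ m * expR (- t^-1) else 0.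

Lemma flat_ge0 m t : 0 <= flat m t.
Proof.
by rewrite /flat; case: ifP => // t0; rewrite mulr_ge0 ?expR_ge0// exprn_ge0// invr_ge0 ltW.
Qed.

Lemma flat_gt0 m t : 0 < t -> 0 < flat m t.
Proof. by move=> t0; rewrite /flat t0 mulr_gt0 ?expR_gt0// exprn_gt0// invr_gt0. Qed.

Lemma flat_eq0 m t : t <= 0 -> flat m t = 0.
Proof. by rewrite /flat leNgt => /negbTE ->. Qed.

(** From exp x >= (x / (m + 2))^(m + 2) at x = 1/t. Quadratic decay makes the difference quotients
    at 0 tend to 0. *)
Lemma flat_le m : exists C, forall t, `|flat m t| <= C * t ^+ 2.
Proof.
exists (m.+2%:R ^+ m.+2) => t; rewrite ger0_norm ?flat_ge0//.
have [t0|t0] := leP t 0; first by rewrite flat_eq0// mulr_ge0 ?sqr_ge0// exprn_ge0.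
rewrite /flat t0; set x := t^-1; have x0 : 0 < x by rewrite invr_gt0.
have k0 : 0 < m.+2%:R :> R by [].
have H : (x / m.+2%:R) ^+ m.+2 <= expR x.
  have -> : expR x = expR (x / m.+2%:R) ^+ m.+2.
    by rewrite -expRM_natl mulrC divfK ?gt_eqF.
  rewrite lerXn2r ?nnegrE ?divr_ge0 ?expR_ge0// ?ltW//.
  by have := expR_ge1Dx (x / m.+2%:R); move: (x / _) => y; lra.
rewrite expRN ler_pdivrMr ?expR_gt0//.
have -> : x ^+ m = m.+2%:R ^+ m.+2 * t ^+ 2 * (x / m.+2%:R) ^+ m.+2.
  have -> : (x / m.+2%:R) ^+ m.+2 = x ^+ m * x ^+ 2 / m.+2%:R ^+ m.+2.
    by rewrite expr_div_n -exprD addn2.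
  have K0 : m.+2%:R ^+ m.+2 != 0 :> R by rewrite expf_neq0// gt_eqF.
  by move: K0; rewrite /x; move: (_ ^+ m.+2) (_ ^+ m) => K a K0; field; rewrite K0 gt_eqF.
by rewrite ler_wpM2l// mulr_ge0 ?sqr_ge0// exprn_ge0.
Qed.

Lemma flat_derive m (t : R) :
  is_derive t 1 (flat m) (flat m.+2 t - m%:R * flat m.+1 t).
Proof.
have [t0|t0|->] := ltgtP t 0.
- rewrite !flat_eq0 ?ltW// mulr0 subr0.
  apply: (near_eq_is_derive _ (@is_derive_cst R R R 0 t 1)).
  near=> s; rewrite flat_eq0//.
  by apply/ltW; near: s; exact: lt_nbhsl.
- have tn0 : t != 0 by rewrite gt_eqF.
  have dV : is_derive t 1 (fun s : R => s^-1) (- t ^- 2).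
    have : is_derive t 1 (fun s : R => (id s)^-1) (- (id t) ^- 2 *: 1).
      exact: (@is_deriveV R id t 1 1 tn0 (is_derive_id t 1)).
    by rewrite /GRing.scale/= mulr1.
  have dX : is_derive t 1 (fun s : R => s^-1 ^+ m) (- m%:R * t^-1 ^+ m.+1).
    case: m => [|m]; first by rewrite oppr0 mul0r; exact: is_derive_cst.
    have := @is_deriveX R R (fun s : R => s^-1) m.+1 t 1 _ dV.
    have -> : (fun s : R => s^-1) ^+ m.+1 = (fun s : R => s^-1 ^+ m.+1).
      by apply/funext => s; rewrite exprfctE.
    move=> H; apply: is_derive_eq H _.
    rewrite /GRing.scale/= -exprVn -[in RHS]addn2 exprD; ring.
  have dE : is_derive t 1 (fun s : R => expR (- s^-1)) (expR (- t^-1) * t ^- 2).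
    apply: (@is_derive1_comp R expR (fun s => - s^-1)).
    by have := is_deriveN dV; rewrite opprK.
  have H := is_deriveM dX dE.
  have -> : flat m.+2 t - m%:R * flat m.+1 t = (t^-1 ^+ m *: (expR (- t^-1) * t ^- 2) +
      expR (- t^-1) *: (- m%:R * t^-1 ^+ m.+1)).
    by rewrite /flat t0 /GRing.scale/= -exprVn -addn2 exprD; ring.
  apply: (near_eq_is_derive _ H); near=> s; rewrite /flat ifT//.
  by near: s; exact: lt_nbhsr.
- rewrite !flat_eq0// mulr0 subr0.
  have [C HC] := flat_le m.
  have H : (fun h : R => h^-1 *: ((flat m \o shift 0) (h *: 1) - flat m 0)) @ 0^' --> (0 : R).
    apply/cvgrPdist_le => e e0; near=> h.
    have h0 : h != 0 by near: h; exact: nbhs_dnbhs_neq.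
    rewrite sub0r normrN /= (flat_eq0 m (lexx 0)) subr0 addr0 normrM normfV.
    rewrite [h *: 1]mulr1 ler_pdivrMl ?normr_gt0//.
    apply: le_trans (HC h) _.
    rewrite (le_trans (ler_wpM2r (sqr_ge0 h) (ler_norm C)))//.
    rewrite -real_normK ?num_real// expr2 mulrA mulrC ler_wpM2l//.
    have hd : `|h| <= e / (`|C| + 1).
      near: h; apply: dnbhs0_le; exact: divr_gt0 e0 (ltr_wpDl (normr_ge0 _) ltr01).
    rewrite (le_trans (ler_wpM2l (normr_ge0 _) hd))// mulrCA ler_piMr// ?ltW//.
    by rewrite ltr_pdivrMr ?mul1r ?ltrDl// ltr_wpDl.
  split; first by apply/cvg_ex; exists 0.
  exact: derive_cvgE H.
Unshelve. all: by end_near. Qed.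

Lemma flat_diff m (t : R) : differentiable (flat m) t.
Proof. by apply/derivable1_diffP; have [] := flat_derive m t. Qed.

Lemma sa_flat n m (g : 'rV[R]_n -> R) x :
  smooth_at g x -> smooth_at (fun y => flat m (g y)) x.
Proof.
move=> [A [oA Ax gA]]; exists A; split=> // k.
elim: k m => [|k IH] m.
  split=> // y Ay; apply: (@continuous_comp _ _ _ g (flat m)).
    exact: Ck_cont (gA 0) Ay.
  exact: differentiable_continuous (flat_diff _ _).
have dg y : A y -> differentiable g y by exact: C1_diff_R (gA 1).
split=> [y Ay|v].
  apply: (@continuous_comp _ _ _ g (flat m)).
    exact: Ck_cont (gA 0) Ay.
  exact: differentiable_continuous (flat_diff _ _).
split=> [y Ay|].
  apply: diff_derivable; apply: (@differentiable_comp _ _ _ _ g (flat m)).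
    exact: dg.
  exact: flat_diff.
apply: (@Ck_ext _ _ _ _ _ ('D_v g * ((fun y => flat m.+2 (g y)) +
   (fun=> - m%:R) * (fun y => flat m.+1 (g y))))) => //.
  move=> y Ay; rewrite (@derive_comp _ _ _ _ g (flat m))//; [|exact: dg|exact: flat_diff].
  rewrite [in RHS]deriveE; last exact: flat_diff.
  rewrite -[X in 'd _ _ X]mulr1 -[X in 'd _ _ X]/('D_v g y *: (1 : R)) linearZ/=.
  rewrite -deriveE; last exact: flat_diff.
  have [_ ->] := flat_derive m (g y).
  by rewrite !fctE mulNr.
apply: Ck_mul => //; first exact: Ck_derive (gA k.+1).
apply: Ck_add => //; apply: Ck_mul => //; exact: Ck_cst.
Qed.

Definition smooth_step (t : R) : R := flat 0 t / (flat 0 t + flat 0 (1 - t)).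

Lemma step_den t : 0 < flat 0 t + flat 0 (1 - t).
Proof.
have [t0|t0] := leP t 0; last by rewrite ltr_pwDl ?flat_gt0 ?flat_ge0.
by rewrite ltr_wpDl ?flat_ge0// flat_gt0// subr_gt0 (le_lt_trans t0).
Qed.

Lemma smooth_step0 t : t <= 0 -> smooth_step t = 0.
Proof. by move=> t0; rewrite /smooth_step (flat_eq0 _ t0) mul0r. Qed.

Lemma smooth_step1 t : 1 <= t -> smooth_step t = 1.
Proof.
move=> t1; have d := step_den t; rewrite /smooth_step.
rewrite (@flat_eq0 _ (1 - t)) ?subr_le0// addr0 divff// gt_eqF//.
by rewrite flat_gt0// (lt_le_trans _ t1).
Qed.

Lemma sa_step n (g : 'rV[R]_n -> R) x :
  smooth_at g x -> smooth_at (fun y => smooth_step (g y)) x.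
Proof.
move=> gs; apply: sa_mul; first exact: sa_flat.
apply: sa_inv; first by rewrite gt_eqF// step_den.
apply: sa_add; first exact: sa_flat.
apply: (@sa_flat n 0 (fun y => 1 - g y)).
have -> : (fun y => 1 - g y) = (fun y => 1 + (-1) * g y) by apply/funext => y; rewrite mulN1r.
by apply: sa_add; [exact: sa_cst|apply: sa_mul => //; exact: sa_cst].
Qed.

Lemma bump_exists n (c : 'rV[R]_n) (r : R) : 0 < r ->
  exists chi : 'rV[R]_n -> R, [/\ forall x, smooth_at chi x,
    forall x, `|x - c| <= r / 2 -> chi x = 1 &
    forall x, r <= `|x - c| -> chi x = 0].
Proof.
(* The i-th factor has argument 2 - (2 (x_i - c_i) / r)^2, at least 1 if |x_i - c_i| <= r / 2 and
   negative if |x_i - c_i| >= r. Balls are cubes for the maximum norm, so a product over the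
   coordinates suffices. *)
move=> r0; pose q (x : 'rV[R]_n) i := 2 - ((x 0 i - c 0 i) * (2 / r)) * ((x 0 i - c 0 i) * (2 / r)).
exists (fun x => \prod_i smooth_step (q x i)); split.
- move=> x; apply: sa_prod => i _; apply: sa_step.
  have -> : q ^~ i = fun x => 2 + (-1) * (((x 0 i + - c 0 i) * (2 / r)) * ((x 0 i + - c 0 i) * (2 / r))).
    by apply/funext => y; rewrite mulN1r.
  apply: sa_add; first exact: sa_cst.
  apply: sa_mul; first exact: sa_cst.
  by apply: sa_mul; (apply: sa_mul; last exact: sa_cst); (apply: sa_add; [exact: sa_coord|exact: sa_cst]).
- move=> x xc; apply: big1 => i _; apply: smooth_step1; rewrite /q.
  have : `|(x 0 i - c 0 i) * (2 / r)| <= 1.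
    rewrite normrM (gtr0_norm (divr_gt0 _ r0))// mulrA ler_pdivrMr// mul1r mulrC -ler_pdivlMl// mulrC.
    by apply: le_trans xc; have := @mx_norm_coord R _ _ (x - c) 0 i; rewrite !mxE.
  set a := _ * (2 / r) => a1; have : a * a <= 1.
    by rewrite -expr2 -real_normK ?num_real// expr_le1.
  lra.
- move=> x xc.
  have [i ic] : exists i, r <= `|x 0 i - c 0 i|.
    have xn0 : mx_norm (x - c) != 0 by rewrite gt_eqF// (lt_le_trans r0 xc).
    have [[i j] E] := mx_norm_neq0 xn0.
    exists j; move: xc; rewrite [`|x - c|]E /= !mxE.
    by rewrite ord1.
  rewrite (bigD1 i)//= smooth_step0 ?mul0r// /q.
  have : 2 <= `|(x 0 i - c 0 i) * (2 / r)|.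
    by rewrite normrM (gtr0_norm (divr_gt0 _ r0))// mulrA ler_pdivlMr// mulrC ler_wpM2r.
  set a := _ * (2 / r) => a1; have : 2 * 2 <= a * a.
    by rewrite -[a * a]expr2 -real_normK ?num_real// expr2 ler_pM.
  lra.
Qed.

Lemma sa_cutoff n p q (chi : 'rV[R]_n -> R) (f : 'rV[R]_n -> 'M[R]_(p, q)) c r :
  (forall x, smooth_at chi x) -> (forall x, r <= `|x - c| -> chi x = 0) ->
  (forall x, `|x - c| <= r -> smooth_at f x) ->
  forall x, smooth_at (fun x => chi x *: f x) x.
Proof.
move=> chis chi0 fs x; have [xr|xr] := leP `|x - c| r.
  by apply: sa_scale => //; exact: fs.
apply: (@sa_near _ _ _ (fun=> 0)); last exact: sa_cst.
apply/nbhs_normP; exists (`|x - c| - r); first by rewrite /= subr_gt0.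
move=> y /=; rewrite ltrBrDl -ltrBrDr => yr; rewrite chi0 ?scale0r//.
rewrite ltW// (lt_le_trans yr)// lerBlDr.
by rewrite -{1}(subrK y x) -addrA addrC (le_trans (ler_normD _ _)).
Qed.

End Bump.

(** * Flows as limits of Euler polygons *)

Section Euler.
Context {R : realType}.
Local Opaque derive jacobian.

Lemma ball_bound N p q (f : 'rV[R]_N -> 'M[R]_(p, q)) (rho : R) :
  (forall x, {for x, continuous f}) ->
  exists2 B : R, 0 <= B & forall z, `|z| <= rho -> `|f z| <= B.
Proof.
move=> cf; have [rho0|rho0] := ltP rho 0.
  by exists 0 => // z zr; have := le_lt_trans zr rho0; rewrite normr_lt0.
pose A := [set z : 'rV[R]_N | `|z| <= rho].
have cA : compact A.
  apply: bounded_closed_compact.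
    by exists rho; split; [exact: num_real|move=> x xr z Az; exact: le_trans Az (ltW xr)].
  have cn : continuous (fun z : 'rV[R]_N => `|z|) by exact: norm_continuous.
  exact: (closed_comp (fun z _ => cn z) (@closed_le _ _)).
have A0 : A !=set0 by exists 0; rewrite /A/= normr0.
have [|c Ac Hc] := @EVT_max_rV R N (fun z => `|f z|) A A0 cA.
  apply: continuous_subspaceT => z.
  exact: (continuous_comp (cf z) (@norm_continuous _ _ _)).
by exists `|f c| => // z zr; apply: Hc; rewrite inE.
Qed.

Lemma smooth_lip N p q (f : 'rV[R]_N -> 'M[R]_(p, q)) (rho : R) :
  (forall x, smooth_at f x) ->
  exists2 L : R, 0 <= L & forall z v, `|z| <= rho ->
    `|'D_v f z| <= L * `|v| /\ (`|z + v| <= rho -> `|f (z + v) - f z| <= L * `|v|).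
Proof.
move=> fs.
have H i : exists2 B : R, 0 <= B & forall z, `|z| <= rho -> `|'D_(delta_mx 0 i) f z| <= B.
  by apply: ball_bound => x; apply: sa_cont; exact: sa_derive.
pose b i := s2val (cid2 (H i)).
have bP i : 0 <= b i /\ forall z, `|z| <= rho -> `|'D_(delta_mx 0 i) f z| <= b i.
  by rewrite /b; case: cid2.
have D z v : `|z| <= rho -> `|'D_v f z| <= (\sum_i b i) * `|v|.
  move=> zr; rewrite derive_sumE; last exact: sa_diff.
  rewrite (le_trans (ler_norm_sum _ _ _))// mulr_suml; apply: ler_sum => i _.
  by rewrite normrZ mulrC ler_pM// ?mx_norm_coord//; have [_] := bP i; exact.
exists (\sum_i b i); first by apply: sumr_ge0 => i _; have [] := bP i.
move=> z v zr; split; first exact: D.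
move=> zvr; apply: mvt_ineq => t /andP[t0 t1]; split; first exact: sa_derivable.
apply: D; have -> : z + t *: v = (1 - t) *: z + t *: (z + v).
  by apply/rowP => i; rewrite !mxE; ring.
rewrite (le_trans (ler_normD _ _))// !normrZ !ger0_norm ?subr_ge0//.
have -> : rho = (1 - t) * rho + t * rho by ring.
by rewrite lerD// ler_wpM2l// subr_ge0.
Qed.

Lemma pow_le_expR (L : R) k j : 0 <= L -> (j <= 2 ^ k)%N ->
  (1 + 2^-1 ^+ k * L) ^+ j <= expR L.
Proof.
move=> L0 jk; set h := 2^-1 ^+ k; have h0 : 0 <= h by rewrite exprn_ge0.
have hk : (2 ^ k)%:R * h = 1.
  by rewrite /h natrX -exprMn mulfV ?pnatr_eq0// expr1n.
apply: (@le_trans _ _ (expR (h * L) ^+ (2 ^ k))).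
  apply: (@le_trans _ _ (expR (h * L) ^+ j)).
    by rewrite lerXn2r ?nnegrE ?expR_ge0 ?expR_ge1Dx// addr_ge0// mulr_ge0.
  apply: ler_weXn2l => //; rewrite -[X in X <= _]expR0 ler_expR; exact: mulr_ge0.
by rewrite -expRM_natl mulrA hk mul1r.
Qed.

(** A local error h^2 K at each of 2^k steps of size h = 2^-k accumulates to j h times h K (1 + h
    L)^j, where j h <= 1: the global error is of first order in h. *)
Lemma discrete_gronwall (d : nat -> R) (L K : R) k : 0 <= L -> 0 <= K ->
  d 0%N = 0 ->
  (forall j, (j < 2 ^ k)%N -> d j.+1 <= (1 + 2^-1 ^+ k * L) * d j + 2^-1 ^+ k * 2^-1 ^+ k * K) ->
  forall j, (j <= 2 ^ k)%N -> d j <= 2^-1 ^+ k * (K * expR L).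
Proof.
move=> L0 K0 d0 H.
set h := 2^-1 ^+ k in H *; have h0 : 0 <= h by rewrite exprn_ge0.
have hk : (2 ^ k)%:R * h = 1.
  by rewrite /h natrX -exprMn mulfV ?pnatr_eq0// expr1n.
have q1 : 1 <= 1 + h * L by rewrite lerDl mulr_ge0.
have q0 : 0 <= 1 + h * L by exact: le_trans q1.
have I j : (j <= 2 ^ k)%N -> d j <= j%:R * h * h * K * (1 + h * L) ^+ j.
  elim: j => [|j IH] jk; first by rewrite d0 !mul0r.
  apply: le_trans (H j jk) _.
  apply: le_trans (lerD (ler_wpM2l q0 (IH (ltnW jk))) (lexx _)) _.
  rewrite exprS -[j.+1]addn1 natrD.
  have e1 : 1 <= (1 + h * L) * (1 + h * L) ^+ j by rewrite -exprS exprn_ege1.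
  have p0 : 0 <= h * h * K by rewrite !mulr_ge0.
  have := ler_wpM2l p0 e1; rewrite mulr1.
  move: ((1 + h * L) ^+ j) => Q; lra.
move=> j jk; apply: le_trans (I j jk) _.
have jh : j%:R * h <= 1 by rewrite -[X in _ <= X]hk ler_wpM2r// ler_nat.
have eL : (1 + h * L) ^+ j <= expR L by exact: pow_le_expR.
rewrite -mulrA [j%:R * h]mulrC -mulrA [X in _ <= _ * X]mulrC -!mulrA ler_wpM2l//.
rewrite mulrA.
apply: (@le_trans _ _ (1 * (K * (1 + h * L) ^+ j))).
  by rewrite ler_wpM2r// mulr_ge0// exprn_ge0.
by rewrite mul1r [leRHS]mulrC ler_wpM2l.
Qed.

Definition euler_step N (Z : 'rV[R]_N -> 'rV[R]_N) (h : R) z := z + h *: Z z.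

Definition euler N (Z : 'rV[R]_N -> 'rV[R]_N) k j z :=
  iter j (euler_step Z (2^-1 ^+ k)) z.

(* The Euler polygons up to time 1 that start in a bounded set stay in a
   bounded set; unlike boundedness of [Z], this passes to the tangent
   prolongation of [Z]. *)
Definition euler_bounded N (Z : 'rV[R]_N -> 'rV[R]_N) :=
  forall rho : R, exists rho' : R, forall k j z, (j <= 2 ^ k)%N -> `|z| <= rho ->
    `|euler Z k j z| <= rho'.

(** One step of size h and two steps of size h / 2 differ by O(h^2), so halving the step moves the
    end point by O(h). With h = 2^-k these changes are summable. *)
Lemma euler_refine N (Z : 'rV[R]_N -> 'rV[R]_N) (rho : R) :
  (forall x, smooth_at Z x) -> euler_bounded Z ->
  exists C : R, forall k (z : 'rV[R]_N), `|z| <= rho ->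
   `|euler Z k.+1 (2 ^ k.+1) z - euler Z k (2 ^ k) z| <= C * 2^-1 ^+ k.
Proof.
move=> Zs Zb; have [rho' Hr] := Zb rho.
have [B B0 HB] : exists2 B : R, 0 <= B & forall z, `|z| <= rho' -> `|Z z| <= B.
  by apply: ball_bound => x; exact: sa_cont.
have [L L0 HL] := @smooth_lip _ _ _ Z rho' Zs.
have lip z w : `|z| <= rho' -> `|w| <= rho' -> `|Z z - Z w| <= L * `|z - w|.
  move=> zr wr; have [_] := HL w (z - w) wr.
  by rewrite [w + _]addrC subrK; exact.
exists (L * B * expR L) => k z zr.
set h := 2^-1 ^+ k; pose d j := `|euler Z k.+1 j.*2 z - euler Z k j z|.
have hh : h = 2 * 2^-1 ^+ k.+1 by rewrite exprS mulrA mulfV ?pnatr_eq0// mul1r.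
have h0 : 0 <= h by rewrite exprn_ge0.
have -> : (2 ^ k.+1)%N = (2 ^ k).*2 by rewrite expnS mul2n.
rewrite mulrC; apply: (@discrete_gronwall d L (L * B) k) => //.
- exact: mulr_ge0.
- by rewrite /d /euler/= subrr normr0.
move=> j jk; rewrite /d doubleS.
set a := euler Z k j z; set b := euler Z k.+1 j.*2 z.
have jk2 : (j.*2.+2 <= 2 ^ k.+1)%N by rewrite expnS mul2n -doubleS leq_double.
have ar : `|a| <= rho' by apply: Hr => //; exact: ltnW.
have br : `|b| <= rho' by apply: Hr => //; exact: leq_trans (leqnSn _) (leq_trans (leqnSn _) jk2).
have b'r : `|euler Z k.+1 j.*2.+1 z| <= rho' by apply: Hr => //; exact: leq_trans (leqnSn _) jk2.
have -> : euler Z k j.+1 z = a + h *: Z a by [].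
have -> : euler Z k.+1 j.*2.+2 z = euler Z k.+1 j.*2.+1 z + 2^-1 ^+ k.+1 *: Z (euler Z k.+1 j.*2.+1 z) by [].
have Eb : euler Z k.+1 j.*2.+1 z = b + 2^-1 ^+ k.+1 *: Z b by [].
move: (euler Z k.+1 j.*2.+1 z) b'r Eb => b' b'r Eb.
set h' := 2^-1 ^+ k.+1 in hh Eb *.
have h'0 : 0 <= h' by rewrite exprn_ge0.
have -> : b' + h' *: Z b' - (a + h *: Z a) = (b - a) + h' *: (Z b - Z a) + h' *: (Z b' - Z a).
  rewrite hh; move: (Z b') => u; rewrite Eb; move: (Z b) (Z a) => v w.
  by apply/rowP => i; rewrite !mxE; ring.
have n1 : `|Z b - Z a| <= L * `|b - a| by exact: lip.
have n2 : `|Z b' - Z a| <= L * (`|b - a| + h' * B).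
  apply: le_trans (lip _ _ b'r ar) _; rewrite ler_wpM2l// Eb addrAC.
  rewrite (le_trans (ler_normD _ _))// lerD2l normrZ ger0_norm// ler_wpM2l//.
  exact: HB.
rewrite (le_trans (ler_normD _ _))// (le_trans (lerD (ler_normD _ _) (lexx _)))//.
rewrite !normrZ !(ger0_norm h'0).
rewrite (le_trans (lerD (lerD (lexx _) (ler_wpM2l h'0 n1)) (ler_wpM2l h'0 n2)))//.
have pB : 0 <= h' * (h' * (L * B)) by rewrite !mulr_ge0.
by rewrite -/h hh; move: `|b - a| pB => D; nra.
Qed.

Lemma euler_smooth N (Z : 'rV[R]_N -> 'rV[R]_N) k j :
  (forall x, smooth_at Z x) -> forall x, smooth_at (euler Z k j) x.
Proof.
move=> Zs; elim: j => [|j IH] x; first exact: sa_id.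
have -> : euler Z k j.+1 = (fun z => euler_step Z (2^-1 ^+ k) z) \o euler Z k j by [].
apply: sa_comp => //; apply: sa_add; first exact: sa_id.
by apply: sa_scale => //; exact: sa_cst.
Qed.

(** Only the time-one map is taken; time t for the field a Y is recovered later as time one for (t
    a) Y. *)
Definition euler_flow N (Z : 'rV[R]_N -> 'rV[R]_N) (z : 'rV[R]_N) : 'rV[R]_N :=
  lim ((fun k => euler Z k (2 ^ k) z) @ \oo).

Lemma euler_flowP N (Z : 'rV[R]_N -> 'rV[R]_N) :
  (forall x, smooth_at Z x) -> euler_bounded Z ->
  forall rho : R, exists2 C : R, 0 <= C & forall k (z : 'rV[R]_N), `|z| <= rho ->
    `|euler Z k (2 ^ k) z - euler_flow Z z| <= C * 2^-1 ^+ k.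
Proof.
move=> Zs Zb rho; have [C HC] := @euler_refine _ Z rho Zs Zb.
exists `|2 * C| => // k z zr.
have [l [l1 l2]] := @geometric_lim R _ _ (fun k => euler Z k (2 ^ k) z) C (fun k => HC k z zr).
have -> : euler_flow Z z = l by apply: cvg_lim.
by apply: le_trans (l2 k) _; rewrite ler_wpM2r ?exprn_ge0// ler_norm.
Qed.

Lemma pow2_small (C e : R) : 0 < e -> exists K, forall k, (K <= k)%N -> C * 2^-1 ^+ k <= e.
Proof.
move=> e0.
have : (fun k => C * 2^-1 ^+ k) @ \oo --> (0 : R).
  rewrite -[X in _ --> X](mulr0 C); apply: cvgM; first exact: cvg_cst.
  by apply: cvg_expr; rewrite ger0_norm// invf_lt1// ltr1n.
move=> /cvgrPdist_le/(_ e e0)[K _ HK]; exists K => k /HK/=.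
by rewrite sub0r normrN; apply: le_trans; exact: ler_norm.
Qed.

Lemma euler_flow_cvg N (Z : 'rV[R]_N -> 'rV[R]_N) z :
  (forall x, smooth_at Z x) -> euler_bounded Z ->
  (fun k => euler Z k (2 ^ k) z) @ \oo --> euler_flow Z z.
Proof.
move=> Zs Zb; have [C C0 HC] := euler_flowP Zs Zb `|z|.
apply/cvgrPdist_le => e e0; have [K HK] := pow2_small C e0.
exists K => // k Kk; rewrite distrC /=; apply: le_trans (HC k z (lexx _)) _; exact: HK.
Qed.

Lemma euler_flow_continuous N (Z : 'rV[R]_N -> 'rV[R]_N) :
  (forall x, smooth_at Z x) -> euler_bounded Z ->
  forall z : 'rV[R]_N, {for z, continuous (euler_flow Z)}.
Proof.
move=> Zs Zb z; apply/(@cvgrPdist_le R _ _ (nbhs z) _ (euler_flow Z)) => e e0.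
have [C C0 HC] := euler_flowP Zs Zb (`|z| + 1).
have e3 : 0 < e / 3 by exact: divr_gt0.
have [K HK] := pow2_small C e3.
have := sa_cont (@euler_smooth N Z K (2 ^ K) Zs z).
move=> /cvgrPdist_le/(_ _ e3) cE.
have nz : \forall w \near z, `|w| <= `|z| + 1.
  apply/nbhs_normP; exists 1; rewrite //= => w /= zw.
  rewrite -(subrK z w) addrC (le_trans (ler_normD _ _))// lerD2l distrC.
  exact: ltW.
near=> w.
have wz : `|w| <= `|z| + 1 by near: w; exact: nz.
have zz : `|z| <= `|z| + 1 by rewrite lerDl.
have h1 := HC K z zz; have h2 := HC K w wz; have h3 := HK K (leqnn _).
have h4 : `|euler Z K (2 ^ K) z - euler Z K (2 ^ K) w| <= e / 3 by near: w; exact: cE.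
move: (euler Z K (2 ^ K) z) (euler Z K (2 ^ K) w) h1 h2 h4 => a b h1 h2 h4.
have -> : euler_flow Z z - euler_flow Z w = (a - b) - (a - euler_flow Z z) + (b - euler_flow Z w).
  by move: (euler_flow Z z) (euler_flow Z w) => u v; apply/rowP => i; rewrite !mxE; ring.
rewrite (le_trans (ler_normD _ _))// (le_trans (lerD (ler_normB _ _) (lexx _)))//.
have := le_trans h1 h3; have := le_trans h2 h3.
move: `|a - b| h4 `|a - _| `|b - _| => x Hx y u H1 H2; lra.
Unshelve. all: by end_near. Qed.

(** The complete lift of [Z] to the tangent bundle. Its Euler polygons consist of those of [Z] and
    of their derivatives. *)
Definition tangent_field N (Z : 'rV[R]_N -> 'rV[R]_N) (w : 'rV[R]_(N + N)) :=
  row_mx (Z (lsubmx w)) (rsubmx w *m 'J Z (lsubmx w)).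

Lemma tangent_field_smooth N (Z : 'rV[R]_N -> 'rV[R]_N) :
  (forall x, smooth_at Z x) -> forall x, smooth_at (tangent_field Z) x.
Proof.
move=> Zs w; have ls : smooth_at (fun w : 'rV[R]_(N + N) => lsubmx w) w.
  by apply: sa_lsubmx; exact: sa_id.
apply: sa_row_mx; first exact: (@sa_comp _ _ _ _ _ Z (fun w => lsubmx w) w ls (Zs _)).
apply: sa_mulmx; first by apply: sa_rsubmx; exact: sa_id.
exact: (@sa_comp _ _ _ _ _ (fun z => 'J Z z) (fun w => lsubmx w) w ls (sa_jac (Zs _))).
Qed.

Lemma euler_tangent N (Z : 'rV[R]_N -> 'rV[R]_N) k j z v :
  (forall x, smooth_at Z x) ->
  euler (tangent_field Z) k j (row_mx z v) =
  row_mx (euler Z k j z) ('D_v (euler Z k j) z).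
Proof.
move=> Zs; elim: j => [|j IH].
  congr row_mx; symmetry; exact: derive_id.
have -> : euler (tangent_field Z) k j.+1 (row_mx z v) =
   euler_step (tangent_field Z) (2^-1 ^+ k) (euler (tangent_field Z) k j (row_mx z v)) by [].
rewrite IH /euler_step /tangent_field row_mxKl row_mxKr scale_row_mx add_row_mx.
congr row_mx.
have sE := @euler_smooth N Z k j Zs z.
set h := 2^-1 ^+ k.
have -> : euler Z k j.+1 = (id + (h \*: Z)) \o euler Z k j by [].
have dhZ y : differentiable (h \*: Z) y.
  by apply: differentiableZ; exact: sa_diff.
have d1 : differentiable (euler Z k j) z by exact: sa_diff sE.
have d0 : differentiable (id : 'rV[R]_N -> 'rV[R]_N) (euler Z k j z) by exact: sa_diff (sa_id _).
have d2 : differentiable (id + (h \*: Z)) (euler Z k j z) by exact: differentiableD d0 (dhZ _).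
rewrite (derive_comp _ d1 d2).
rewrite deriveD; [|exact: derivable_id|exact: diff_derivable].
by rewrite derive_id deriveZ ?jacE//; exact: sa_derivable.
Qed.

Lemma row_mx_norm p q (a : 'rV[R]_p) (b : 'rV[R]_q) :
  [/\ `|a| <= `|row_mx a b|, `|b| <= `|row_mx a b| & `|row_mx a b| <= `|a| + `|b|].
Proof.
split; apply: mx_norm_leP => //; try exact: addr_ge0.
- by move=> i j; rewrite -(row_mxEl a b); exact: mx_norm_coord.
- by move=> i j; rewrite -(row_mxEr a b); exact: mx_norm_coord.
- move=> i j; case: (split_ordP j) => k ->.
    by rewrite row_mxEl (le_trans (mx_norm_coord _ _ _))// lerDl.
  by rewrite row_mxEr (le_trans (mx_norm_coord _ _ _))// lerDr.
Qed.

(** The polygons of [Z] stay in a bounded set where its derivative has norm at most L, so a tangent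
    vector grows by at most the factor 1 + h L per step, in total by exp L. *)
Lemma tangent_field_bounded N (Z : 'rV[R]_N -> 'rV[R]_N) :
  (forall x, smooth_at Z x) -> euler_bounded Z -> euler_bounded (tangent_field Z).
Proof.
move=> Zs Zb rho; have [rho' Hr] := Zb rho.
have [L L0 HL] := @smooth_lip _ _ _ Z rho' Zs.
exists (rho' + expR L * rho) => k j w jk wr.
have E : w = row_mx (lsubmx w) (rsubmx w) by rewrite hsubmxK.
have [] := row_mx_norm (lsubmx w) (rsubmx w); rewrite -E.
set z := lsubmx w in E *; set v := rsubmx w in E * => zw vw _.
have zr : `|z| <= rho := le_trans zw wr.
rewrite E euler_tangent//.
have [_ _] := row_mx_norm (euler Z k j z) ('D_v (euler Z k j) z); move/le_trans; apply.
rewrite lerD//; first exact: Hr.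
pose h : R := 2^-1 ^+ k; have h0 : 0 <= h by rewrite exprn_ge0.
have I i : (i <= 2 ^ k)%N -> `|'D_v (euler Z k i) z| <= (1 + h * L) ^+ i * `|v|.
  elim: i => [_|i IH ik].
    rewrite expr0 mul1r; have -> : 'D_v (euler Z k 0) z = v by exact: derive_id.
    by [].
  have := @euler_tangent N Z k i.+1 z v Zs.
  have -> : euler (tangent_field Z) k i.+1 (row_mx z v) =
     euler_step (tangent_field Z) h (euler (tangent_field Z) k i (row_mx z v)) by [].
  rewrite euler_tangent// /euler_step /tangent_field row_mxKl row_mxKr scale_row_mx add_row_mx.
  move=> /eq_row_mx[_ <-]; rewrite jacE//.
  rewrite (le_trans (ler_normD _ _))// normrZ ger0_norm// exprS -mulrA mulrDl mul1r.
  have ih := IH (ltnW ik).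
  rewrite lerD// -mulrA ler_wpM2l//.
  have [HLD _] := HL (euler Z k i z) ('D_v (euler Z k i) z) (Hr k i z (ltnW ik) zr).
  by apply: le_trans HLD _; rewrite ler_wpM2l.
apply: le_trans (I j jk) _; apply: ler_pM => //.
- by rewrite exprn_ge0// addr_ge0// mulr_ge0.
- exact: pow_le_expR.
- exact: le_trans vw wr.
Qed.

(** The derivatives of the polygons are polygons of the lift, hence converge locally uniformly, and
    limit and derivative may be interchanged. *)
Lemma euler_flow_derive N (Z : 'rV[R]_N -> 'rV[R]_N) :
  (forall x, smooth_at Z x) -> euler_bounded Z -> forall v z,
  derivable (euler_flow Z) z v /\
  'D_v (euler_flow Z) z = rsubmx (euler_flow (tangent_field Z) (row_mx z v)).
Proof.
move=> Zs Zb v z; have Ts := tangent_field_smooth Zs; have Tb := tangent_field_bounded Zs Zb.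
pose A := ball z (1 : R).
have AE y : A y -> `|y| <= `|z| + 1.
  rewrite /A -ball_normE /= => zy.
  by rewrite -(subrK z y) addrC (le_trans (ler_normD _ _))// lerD2l distrC ltW.
apply: (@derive_limit R _ _ _ (fun k => euler Z k (2 ^ k)) _
  (fun z => rsubmx (euler_flow (tangent_field Z) (row_mx z v))) A); first exact: ball_open.
- by move=> y _; exact: euler_flow_cvg.
- by move=> k y _; apply: sa_derivable; exact: euler_smooth.
- move=> e e0; have [C C0 HC] := euler_flowP Ts Tb (`|z| + 1 + `|v|).
  have [K HK] := pow2_small C e0; exists K => k Kk y /AE yz.
  have yv : `|row_mx y v| <= `|z| + 1 + `|v|.
    by have [_ _] := row_mx_norm y v; move/le_trans; apply; rewrite lerD2r.
  have := HC k _ yv; rewrite euler_tangent// => H.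
  apply: le_trans _ (HK k Kk); apply: le_trans _ H.
  set X := euler_flow _ _.
  have -> : 'D_v (euler Z k (2 ^ k)) y - rsubmx X =
    rsubmx (row_mx (euler Z k (2 ^ k) y) ('D_v (euler Z k (2 ^ k)) y) - X).
    by rewrite linearB/= row_mxKr.
  by have [_ + _] := row_mx_norm (lsubmx (row_mx (euler Z k (2 ^ k) y) ('D_v (euler Z k (2 ^ k)) y) - X))
     (rsubmx (row_mx (euler Z k (2 ^ k) y) ('D_v (euler Z k (2 ^ k)) y) - X)); rewrite hsubmxK.
- move=> y _; apply: (@continuous_comp _ _ _ (fun z => euler_flow (tangent_field Z) (row_mx z v)) rsubmx).
    apply: (@continuous_comp _ _ _ (fun z => row_mx z v) (euler_flow (tangent_field Z))).
      by apply: sa_cont; apply: sa_row_mx; [exact: sa_id|exact: sa_cst].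
    exact: euler_flow_continuous.
  by apply: sa_cont; apply: sa_rsubmx; exact: sa_id.
- exact: ballxx.
Qed.

(** Induction on the order for all fields in all dimensions at once: a derivative of the flow is a
    component of the flow of the lift, which satisfies the same hypotheses. *)
Lemma euler_flow_smooth N (Z : 'rV[R]_N -> 'rV[R]_N) :
  (forall x, smooth_at Z x) -> euler_bounded Z -> forall z, smooth_at (euler_flow Z) z.
Proof.
move=> Zs Zb z; exists setT; split=> //; first exact: openT.
move=> k; elim: k N Z Zs Zb {z} => [|k IH] N Z Zs Zb.
  by split=> // x _; exact: euler_flow_continuous.
split=> [x _|v]; first exact: euler_flow_continuous.
have H := euler_flow_derive Zs Zb.
split=> [x _|]; first by have [] := H v x.
have -> : 'D_v (euler_flow Z) =
    (fun z => rsubmx ((euler_flow (tangent_field Z) \o (fun z => row_mx z v)) z)).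
  by apply/funext => x; have [] := H v x.
apply/(Ck_mxP _ _ openT) => i j.
have : Ck k setT (euler_flow (tangent_field Z) \o (fun z => row_mx z v)).
  apply: (Ck_comp openT openT) => //.
    apply: IH; [exact: tangent_field_smooth|exact: tangent_field_bounded].
  have : smooth_on setT (fun z : 'rV[R]_N => row_mx z v).
    by apply: sa_on => x _; apply: sa_row_mx; [exact: sa_id|exact: sa_cst].
  by apply.
move=> /(Ck_mxP _ _ openT)/(_ i (rshift N j)).
by apply: Ck_ext => [|x _]; [exact: openT|rewrite mxE].
Qed.

End Euler.

(** * Flows of linear combinations of vector fields *)

Section ControlFlow.
Context {R : realType}.
Local Opaque derive jacobian.

Lemma derive_mulmx (V : normedModType R) p q r (f : V -> 'M[R]_(p, q)) (g : V -> 'M[R]_(q, r)) x v :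
  derivable f x v -> derivable g x v ->
  derivable (fun y => f y *m g y) x v /\
  'D_v (fun y => f y *m g y) x = 'D_v f x *m g x + f x *m 'D_v g x.
Proof.
move=> df dg.
have H i j : is_derive x v (fun y => (f y *m g y) i j) (('D_v f x *m g x + f x *m 'D_v g x) i j).
  have -> : (fun y => (f y *m g y) i j) = \sum_k ((fun y => f y i k) * (fun y => g y k j)).
    by apply/funext => y; rewrite mxE fct_sumE.
  rewrite !mxE -big_split/=.
  apply: is_derive_sum => k.
  have d1 : is_derive x v (fun y => f y i k) ('D_v f x i k).
    rewrite -(derive_entry _ _ df); apply: derivableP; by move/derivable_mxP : df; exact.
  have d2 : is_derive x v (fun y => g y k j) ('D_v g x k j).
    rewrite -(derive_entry _ _ dg); apply: derivableP; by move/derivable_mxP : dg; exact.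
  apply: is_derive_eq (is_deriveM d1 d2) _.
  by rewrite /GRing.scale/= addrC; congr (_ + _); rewrite mulrC.
have d : derivable (fun y => f y *m g y) x v.
  by apply/derivable_mxP => i j; have [] := H i j.
split=> //; apply/matrixP => i j; rewrite -(derive_entry _ _ d).
by have [_ ->] := H i j.
Qed.

Lemma derive_mulmxr (V : normedModType R) p q r (f : V -> 'M[R]_(p, q)) (A : 'M[R]_(q, r)) x v :
  derivable f x v ->
  derivable (fun y => f y *m A) x v /\ 'D_v (fun y => f y *m A) x = 'D_v f x *m A.
Proof.
move=> df; have [d1 d2] := derive_mulmx df (@derivable_cst R V _ A x v).
by split=> //; apply: (etrans d2); rewrite derive_cst mulmx0 addr0.
Qed.

Opaque derive.

Lemma taylor2 n m (f : 'rV[R]_n -> 'rV[R]_m) (rho : R) :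
  (forall x, smooth_at f x) ->
  exists2 Q : R, 0 <= Q & forall x u, `|x| <= rho -> `|x + u| <= rho ->
    `|f (x + u) - f x - u *m 'J f x| <= Q * `|u| ^+ 2.
Proof.
move=> fs.
have [L L0 HL] := @smooth_lip R _ _ _ (fun y => 'J f y) rho (fun y => sa_jac (fs y)).
exists (n%:R * L) => [|x u xr xur]; first exact: mulr_ge0.
have [J0 J0E] : exists J0, J0 = 'J f x by exists ('J f x).
rewrite -J0E.
pose g y := f y - y *m J0.
have -> : f (x + u) - f x - u *m J0 = g (x + u) - g x.
  rewrite /g mulmxDl; move: (x *m _) (u *m _) => a b.
  by apply/rowP => i; rewrite !mxE; ring.
have gs y : smooth_at g y.
  have -> : g = fun y => f y + y *m (- J0) by apply/funext => z; rewrite mulmxN.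
  by apply: sa_add => //; apply: sa_mulmx; [exact: sa_id|exact: sa_cst].
apply: mvt_ineq => t /andP[t0 t1]; split; first exact: sa_derivable.
have -> : 'D_u g (x + t *: u) = u *m ('J f (x + t *: u) - J0).
  have [d1 d2] := derive_mulmxr J0 (@derivable_id R _ (x + t *: u) u).
  have -> : g = f - (fun y => id y *m J0) by [].
  by rewrite deriveB; [rewrite d2 derive_id mulmxBr (jacE _ (fs _))|exact: sa_derivable|].
rewrite (le_trans (mulmx_norm _ _))// expr2 [leRHS]mulrACA !mulrA -mulrA -mulrA.
rewrite -[leRHS]mulrA ler_wpM2l// ler_wpM2l//.
have xt : `|x + t *: u| <= rho.
  have -> : x + t *: u = (1 - t) *: x + t *: (x + u).
    by apply/rowP => i; rewrite !mxE; ring.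
  rewrite (le_trans (ler_normD _ _))// !normrZ !ger0_norm ?subr_ge0//.
  have -> : rho = (1 - t) * rho + t * rho by ring.
  by rewrite lerD// ler_wpM2l// subr_ge0.
have [_ /(_ xt)] := HL x (t *: u) xr; rewrite -J0E => /le_trans; apply.
by rewrite ler_wpM2l// normrZ ger0_norm// ler_piMl.
Qed.

(** The coefficients are added to the state as constants of motion, so smoothness of one flow gives
    joint smoothness in the coefficients and the starting point. *)
Definition control_field m n (Y : 'rV[R]_n -> 'M[R]_(m, n)) (w : 'rV[R]_(m + n)) : 'rV[R]_(m + n) :=
  row_mx 0 (lsubmx w *m Y (rsubmx w)).

Section Control.
Variables (m n : nat) (Y : 'rV[R]_n -> 'M[R]_(m, n)) (B : R).
Hypothesis Ys : forall x, smooth_at Y x.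
Hypothesis YB : forall x, `|Y x| <= B.

Let Z := control_field Y.

Lemma control_smooth w : smooth_at Z w.
Proof.
apply: sa_row_mx; first exact: sa_cst.
apply: sa_mulmx; first by apply: sa_lsubmx; exact: sa_id.
have rs : smooth_at (fun w : 'rV[R]_(m + n) => rsubmx w) w.
  by apply: sa_rsubmx; exact: sa_id.
exact: (@sa_comp _ _ _ _ _ Y (fun w => rsubmx w) w rs (Ys _)).
Qed.

Lemma control_euler k j (a : 'rV[R]_m) (x : 'rV[R]_n) :
  euler Z k j (row_mx a x) = row_mx a (euler (fun x => a *m Y x) k j x).
Proof.
elim: j => [//|j IH].
have -> : euler Z k j.+1 (row_mx a x) = euler_step Z (2^-1 ^+ k) (euler Z k j (row_mx a x)) by [].
rewrite IH /euler_step /Z /control_field row_mxKl row_mxKr scale_row_mx add_row_mx.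
by rewrite scaler0 addr0.
Qed.

Lemma euler_affine_bound N (G : 'rV[R]_N -> 'rV[R]_N) (b : R) k j x :
  (forall x, `|G x| <= b) -> (j <= 2 ^ k)%N -> `|euler G k j x| <= `|x| + b.
Proof.
move=> Gb jk; have b0 : 0 <= b by exact: le_trans (Gb x).
pose h : R := 2^-1 ^+ k; have h0 : 0 <= h by rewrite exprn_ge0.
have hk : (2 ^ k)%:R * h = 1 by rewrite /h natrX -exprMn mulfV ?pnatr_eq0// expr1n.
apply: (@le_trans _ _ (`|x| + j%:R * h * b)); last first.
  by rewrite lerD2l ler_piMl// -[X in _ <= X]hk ler_wpM2r// ler_nat.
elim: j jk => [|j IH] jk; first by rewrite !mul0r addr0.
have -> : euler G k j.+1 x = euler G k j x + h *: G (euler G k j x) by [].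
rewrite (le_trans (ler_normD _ _))// -[j.+1]addn1 natrD !mulrDl mul1r addrA lerD//.
  exact: IH (ltnW jk).
by rewrite normrZ ger0_norm// ler_wpM2l.
Qed.

Lemma control_bound (a : 'rV[R]_m) (x : 'rV[R]_n) : `|a *m Y x| <= m%:R * `|a| * B.
Proof. by rewrite (le_trans (mulmx_norm _ _))// ler_wpM2l// mulr_ge0. Qed.

Lemma B_ge0 : 0 <= B. Proof. exact: le_trans (YB 0). Qed.

Lemma control_bounded : euler_bounded Z.
Proof.
move=> rho; exists (rho + (rho + m%:R * rho * B)) => k j w jk wr.
have E : w = row_mx (lsubmx w) (rsubmx w) by rewrite hsubmxK.
have [] := row_mx_norm (lsubmx w) (rsubmx w); rewrite -E => aw xw _.
rewrite E control_euler.
have [_ _] := row_mx_norm (lsubmx w) (euler (fun x => lsubmx w *m Y x) k j (rsubmx w)).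
move/le_trans; apply; apply: lerD; first exact: le_trans wr.
apply: le_trans (euler_affine_bound _ (control_bound (lsubmx w)) jk) _.
rewrite lerD ?(le_trans xw)// ler_wpM2r ?B_ge0// ler_wpM2l// (le_trans aw)//.
Qed.

Definition control_flow (w : 'rV[R]_(m + n)) : 'rV[R]_n := rsubmx (euler_flow Z w).

Lemma control_flow_smooth w : smooth_at control_flow w.
Proof.
apply: sa_rsubmx; apply: euler_flow_smooth; [exact: control_smooth|exact: control_bounded].
Qed.

Lemma control_flowP (rho : R) : exists2 C : R, 0 <= C & forall k (a : 'rV[R]_m) (x : 'rV[R]_n),
  `|a| <= rho -> `|x| <= rho ->
  `|euler (fun x => a *m Y x) k (2 ^ k) x - control_flow (row_mx a x)| <= C * 2^-1 ^+ k.
Proof.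
have [C C0 HC] := euler_flowP control_smooth control_bounded (rho + rho).
exists C => // k a x ar xr.
have wr : `|row_mx a x| <= rho + rho.
  by have [_ _] := row_mx_norm a x; move/le_trans; apply; exact: lerD.
apply: le_trans _ (HC k _ wr); rewrite control_euler /control_flow.
set X := euler _ _ _ _; set F := euler_flow _ _.
have -> : X - rsubmx F = rsubmx (row_mx a X - F) by rewrite linearB/= row_mxKr.
by have [_ + _] := row_mx_norm (lsubmx (row_mx a X - F)) (rsubmx (row_mx a X - F)); rewrite hsubmxK.
Qed.

Lemma control_flow0 (x : 'rV[R]_n) : control_flow (row_mx 0 x) = x.
Proof.
have [C C0 HC] := control_flowP (`|(0 : 'rV[R]_m)| + `|x|).
have E k : euler (fun x => (0 : 'rV[R]_m) *m Y x) k (2 ^ k) x = x.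
  elim: (2 ^ k)%N => [//|j IH].
  have -> : euler (fun x => (0 : 'rV[R]_m) *m Y x) k j.+1 x =
    euler_step (fun x => (0 : 'rV[R]_m) *m Y x) (2^-1 ^+ k) (euler (fun x => (0 : 'rV[R]_m) *m Y x) k j x) by [].
  by rewrite IH /euler_step mul0mx scaler0 addr0.
apply/eqP; rewrite eq_sym -subr_eq0 -normr_le0; apply/ler_addgt0Pl => e e0.
have [K HK] := pow2_small C e0; rewrite addr0; apply: le_trans (HK K (leqnn _)).
have := HC K 0 x; rewrite E; apply; rewrite ?lerDl ?lerDr//.
Qed.

(** The differential equation in t is obtained from the polygons by differentiating their end point
    in the scale t of the control. No semigroup property of the flow is used. *)
Lemma euler_time (a : 'rV[R]_m) (x : 'rV[R]_n) (T : R) :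
  let c k (t : R) := euler (fun x => (t *: a) *m Y x) k (2 ^ k) x in
  exists2 C : R, 0 <= C & forall k (t : R), `|t| <= T ->
   derivable (c k) t 1 /\ `|'D_1 (c k) t - a *m Y (c k t)| <= C * 2^-1 ^+ k.
Proof.
move=> c.
have [T0|T0] := ltP T 0.
  by exists 0 => // k t tT; have := le_lt_trans tT T0; rewrite normr_lt0.
pose G x := a *m Y x.
have Gs y : smooth_at G y by apply: sa_mulmx; [exact: sa_cst|exact: Ys].
pose b := m%:R * `|a| * B.
have Gb y : `|G y| <= b by exact: control_bound.
have b0 : 0 <= b by rewrite !mulr_ge0// B_ge0.
pose rho := `|x| + T * b.
have [L L0 HL] := @smooth_lip R _ _ _ G rho Gs.
have [Q Q0 HQ] := @taylor2 _ _ G rho Gs.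
have P1 : 0 <= T * L * b + Q * (T * b) ^+ 2.
  by apply: addr_ge0; apply: mulr_ge0 => //; [exact: mulr_ge0|exact: sqr_ge0].
exists ((T * L * b + Q * (T * b) ^+ 2) * expR (T * L)).
  by apply: mulr_ge0 => //; exact: expR_ge0.
move=> k t tT.
pose h : R := 2^-1 ^+ k; have h0 : 0 <= h by rewrite exprn_ge0.
have h1 : h <= 1 by rewrite exprn_ile1// invf_le1// ler1n.
have hk : (2 ^ k)%:R * h = 1 by rewrite /h natrX -exprMn mulfV ?pnatr_eq0// expr1n.
pose cj j (t : R) := euler (fun x => (t *: a) *m Y x) k j x.
have cS j (s : R) : cj j.+1 s = cj j s + (h * s) *: G (cj j s).
  by rewrite /cj /euler iterS /euler_step /G -scalemxAl scalerA.
have cr j : (j <= 2 ^ k)%N -> `|cj j t| <= rho.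
  move=> jk; apply: euler_affine_bound jk => y.
  rewrite -scalemxAl normrZ ler_pM//; exact: Gb.
have dM : derivable (fun s : R => (h * s)%:M : 'M[R]_1) t 1 /\
   'D_1 (fun s : R => (h * s)%:M : 'M[R]_1) t = h%:M.
  have -> : (fun s : R => (h * s)%:M : 'M[R]_1) = (fun s : R => 0 + s *: (h%:M : 'M[R]_1)).
    by apply/funext => s; rewrite add0r scale_scalar_mx mulrC.
  have := @derive_line R _ _ (id : 'M[R]_1 -> 'M[R]_1) 0 (h%:M) t.
  by rewrite derive_id; apply; exact: derivable_id.
have [dM1 dM2] := dM.
have cE j : cj j.+1 = cj j + (fun s => (h * s)%:M *m G (cj j s)).
  by apply/funext => s; rewrite cS !fctE mul_scalar_mx.
have dG j : derivable (cj j) t 1 -> derivable (fun s => G (cj j s)) t 1.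
  move=> dj; apply: diff_derivable; apply: (@differentiable_comp _ _ _ _ (cj j) G).
    exact/derivable1_diffP.
  exact: sa_diff.
have dcj0 j : derivable (cj j) t 1.
  elim: j => [|j IH]; first exact: derivable_cst.
  have [d1 _] := derive_mulmx dM1 (dG j IH).
  by rewrite cE; exact: derivableD IH d1.
have dcj j : 'D_1 (cj j.+1) t = 'D_1 (cj j) t + h *: G (cj j t) + (h * t) *: ('D_1 (cj j) t *m 'J G (cj j t)).
  have [p1 p2] := derive_mulmx dM1 (dG j (dcj0 j)).
  rewrite cE (deriveD (dcj0 j) p1) p2 dM2 !mul_scalar_mx addrA; congr (_ + _ + _ *: _).
  have dcj1 : differentiable (cj j) t by apply/derivable1_diffP; exact: dcj0.
  by rewrite (@derive_comp _ _ _ _ (cj j) G _ _ dcj1 (sa_diff (Gs _))) (jacE _ (Gs _)).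
split; first exact: dcj0.
(* After j steps the polygon approximates the solution at time j h t, whose derivative in t is j h
   times the field; [e j] is the deviation from this. *)
pose e j := 'D_1 (cj j) t - (j%:R * h) *: G (cj j t).
have -> : 'D_1 (c k) t - a *m Y (c k t) = e (2 ^ k)%N by rewrite /e hk scale1r.
rewrite mulrC; apply: (@discrete_gronwall R (fun j => `|e j|) (T * L) (T * L * b + Q * (T * b) ^+ 2) k) => //.
- exact: mulr_ge0.
- rewrite /e mul0r scale0r subr0; have -> : 'D_1 (cj 0%N) t = 0 by exact: derive_cst.
  exact: normr0.
move=> j jk.
have jr := cr j (ltnW jk); have jr1 := cr j.+1 jk.
have := HQ (cj j t) ((h * t) *: G (cj j t)) jr; rewrite -cS => /(_ jr1).
set r := G (cj j.+1 t) - _ - _ => rle.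
have eE : e j.+1 = e j + (h * t) *: (e j *m 'J G (cj j t))
   - (h * h * t) *: (G (cj j t) *m 'J G (cj j t)) - (j.+1%:R * h) *: r.
  rewrite /e (dcj j) /r -scalemxAl mulmxBl -scalemxAl.
  move: ('D_1 (cj j) t) ('J G (cj j t)) => D J; move: (D *m J) (G (cj j t) *m J) => u v.
  move: (G (cj j t)) (G (cj j.+1 t)) => w z.
  by apply/rowP => i; rewrite !mxE -[j.+1]addn1 natrD; ring.
have JL (u : 'rV[R]_n) : `|u *m 'J G (cj j t)| <= L * `|u|.
  by rewrite jacE//; have [] := HL (cj j t) u jr.
have jh1 : `|j.+1%:R * h| <= 1.
  by rewrite ger0_norm ?mulr_ge0// -[X in _ <= X]hk ler_wpM2r// ler_nat.
have n1 : `|(h * t) *: (e j *m 'J G (cj j t))| <= h * (T * L) * `|e j|.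
  rewrite normrZ normrM (ger0_norm h0) -!mulrA ler_wpM2l// ler_pM//; exact: JL.
have n2 : `|(h * h * t) *: (G (cj j t) *m 'J G (cj j t))| <= h * h * (T * L * b).
  rewrite normrZ normrM ger0_norm ?mulr_ge0// -!mulrA ler_wpM2l// ler_wpM2l// ler_pM//.
  by apply: le_trans (JL _) _; rewrite ler_wpM2l.
have n3 : `|(j.+1%:R * h) *: r| <= h * h * (Q * (T * b) ^+ 2).
  rewrite normrZ -[leRHS]mul1r ler_pM// (le_trans rle)//.
  have -> : h * h * (Q * (T * b) ^+ 2) = Q * (h * (T * b)) ^+ 2 by rewrite exprMn expr2; ring.
  have hTb : 0 <= h * (T * b) by apply: mulr_ge0 => //; exact: mulr_ge0.
  rewrite ler_wpM2l// lerXn2r ?nnegrE//.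
  rewrite normrZ normrM (ger0_norm h0) -mulrA ler_wpM2l// ler_pM//.
rewrite eE -/h (le_trans (ler_normB _ _))//.
rewrite (le_trans (lerD (ler_normB _ _) (lexx _)))// (le_trans (lerD (lerD (ler_normD _ _) (lexx _)) (lexx _)))//.
have := lerD (lerD n1 n2) n3.
move: `|e j| `|_ *: (e j *m _)| `|_ *: (G _ *m _)| `|_ *: r| (Q * _) => E1 E2 E3 E4 E5; lra.
Qed.

Lemma control_flow_ode (a : 'rV[R]_m) (x : 'rV[R]_n) (t : R) :
  let gam (t : R) := control_flow (row_mx (t *: a) x) in
  derivable gam t 1 /\ 'D_1 gam t = a *m Y (gam t).
Proof.
move=> gam.
pose T := `|t| + 1.
have [C C0 HC] := euler_time a x T.
have [C' C'0 HC'] := control_flowP (T * `|a| + `|x|).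
pose G x := a *m Y x.
have Gs y : smooth_at G y by apply: sa_mulmx; [exact: sa_cst|exact: Ys].
have T0 : 0 <= T by rewrite addr_ge0.
pose b := T * (m%:R * `|a| * B).
have [L L0 HL] := @smooth_lip R _ _ _ G (`|x| + b + C') Gs.
pose c k (t : R) := euler (fun x => (t *: a) *m Y x) k (2 ^ k) x.
have cg k (s : R) : `|s| <= T -> `|c k s - gam s| <= C' * 2^-1 ^+ k.
  move=> sT; apply: HC'; last by rewrite lerDr mulr_ge0.
  by rewrite normrZ ler_wpDr// ler_wpM2r.
have cb k (s : R) : `|s| <= T -> `|c k s| <= `|x| + b.
  move=> sT; apply: euler_affine_bound => // y.
  by rewrite -scalemxAl normrZ ler_pM// control_bound.
have sball (s : R) : ball t (1 : R) s -> `|s| <= T.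
  rewrite -ball_normE /= => ts.
  by rewrite -(subrK t s) addrC (le_trans (ler_normD _ _))// lerD2l distrC ltW.
have gs (s : R) : {for s, continuous gam}.
  apply: (@continuous_comp _ _ _ (fun s : R => row_mx (s *: a) x) control_flow s); last first.
    by apply: sa_cont; exact: control_flow_smooth.
  have [d _] := @derive_line R _ _ (id : 'rV[R]_(m + n) -> _) (row_mx 0 x) (row_mx a 0) s (@derivable_id R _ _ _).
  have E : (fun t0 : R => row_mx 0 x + t0 *: row_mx a 0) = (fun s0 : R => row_mx (s0 *: a) x).
    by apply/funext => u; rewrite scale_row_mx add_row_mx add0r scaler0 addr0.
  by rewrite -E; apply: differentiable_continuous; apply/derivable1_diffP.
apply: (@derive_limit R _ _ _ c gam (fun s => G (gam s)) (ball t 1) 1); first exact: ball_open.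
- move=> s /sball sT; apply/cvgrPdist_le => e e0; have [K HK] := pow2_small C' e0.
  exists K => // k Kk /=; rewrite distrC; apply: le_trans (cg k s sT) _; exact: HK.
- by move=> k s /sball sT; have [] := HC k s sT.
- move=> e e0; have [K HK] := pow2_small (C + L * C') e0; exists K => k Kk s /sball sT.
  apply: le_trans _ (HK k Kk); rewrite mulrDl.
  rewrite -(subrK (G (c k s)) ('D_1 (c k) s)) -addrA (le_trans (ler_normD _ _))//.
  rewrite lerD//; first by have [] := HC k s sT.
  have q1 : 2^-1 ^+ k <= 1 :> R by rewrite exprn_ile1// invf_le1// ler1n.
  have cr : `|c k s| <= `|x| + b + C' by rewrite (le_trans (cb k s sT))// lerDl.
  have gr : `|gam s| <= `|x| + b + C'.
    rewrite -(subrK (c k s) (gam s)) (le_trans (ler_normD _ _))// addrC lerD ?cb//.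
    by rewrite distrC (le_trans (cg k s sT))// ler_piMr.
  have [_] := HL (gam s) (c k s - gam s) gr.
  rewrite [gam s + _]addrC subrK => /(_ cr)/le_trans; apply.
  by rewrite -mulrA ler_wpM2l// cg.
- move=> s _; apply: (@continuous_comp _ _ _ gam G); first exact: gs.
  exact: sa_cont.
- exact: ballxx.
Qed.

End Control.
End ControlFlow.

(** * Involutive families of vector fields *)

Section FlowInvariance.
Context {R : realType}.
Local Opaque derive jacobian.

Lemma derive_affine (V W : normedModType R) (f : V -> W) x v w :
  (forall h : R, f (h *: v + x) = f x + h *: w) -> 'D_v f x = w.
Proof.
move=> H; apply: derive_cvgE; apply/cvgrPdist_le => e e0; near=> h.
have h0 : h != 0 by near: h; exact: nbhs_dnbhs_neq.
by rewrite /= H [f x + _]addrC addrK scalerA mulVf// scale1r subrr normr0 ltW.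
Unshelve. all: by end_near. Qed.

Lemma submx_coker p q n (A : 'M[R]_(p, n)) (B : 'M[R]_(q, n)) :
  B *m cokermx A = 0 -> (B <= A)%MS.
Proof. by move=> H; rewrite submxE H. Qed.

Lemma mulmx_coker0 p n (A : 'M[R]_(p, n)) : A *m cokermx A = 0.
Proof. by apply/eqP; rewrite -submxE. Qed.

Section Control.
Variables (m n : nat) (Y : 'rV[R]_n -> 'M[R]_(m, n)) (B : R).
Hypothesis Ys : forall x, smooth_at Y x.
Hypothesis YB : forall x, `|Y x| <= B.

Let Phi := control_flow Y.
Let Phis w : smooth_at Phi w. Proof. exact: control_flow_smooth Ys YB w. Qed.

Lemma flow_radial (a : 'rV[R]_m) (x : 'rV[R]_n) (s : R) :
  'D_(row_mx a 0) Phi (row_mx (s *: a) x) = a *m Y (Phi (row_mx (s *: a) x)).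
Proof.
have [_ <-] := control_flow_ode Ys YB a x s.
have L (t : R) : row_mx (t *: a) x = row_mx 0 x + t *: row_mx a 0.
  by rewrite scale_row_mx add_row_mx add0r scaler0 addr0.
have d : derivable Phi (row_mx 0 x + s *: row_mx a 0) (row_mx a 0).
  by apply: sa_derivable; exact: Phis.
have [_ H] := derive_line d.
rewrite L -H; congr ('D_1 _ s); apply/funext => t; by rewrite L.
Qed.

Section Variation.
Variables (a b : 'rV[R]_m) (x v : 'rV[R]_n).

(** The first coordinate is the time s, the second the parameter of a variation: at parameter 0 this
    is (s a, x), with derivative (s b, v) in the parameter. *)
Let kap (y : 'rV[R]_2) : 'rV[R]_(m + n) :=
  row_mx (y 0 0 *: (a + y 0 1 *: b)) (x + y 0 1 *: v).
Let K y := Phi (kap y).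
Let e0 : 'rV[R]_2 := delta_mx 0 0.
Let e1 : 'rV[R]_2 := delta_mx 0 1.

Let e0E (h : R) (y : 'rV[R]_2) : (h *: e0 + y) 0 0 = h + y 0 0 /\ (h *: e0 + y) 0 1 = y 0 1.
Proof. by rewrite !mxE/= mulr1 mulr0 add0r. Qed.

Let e1E (h : R) (y : 'rV[R]_2) : (h *: e1 + y) 0 0 = y 0 0 /\ (h *: e1 + y) 0 1 = h + y 0 1.
Proof. by rewrite !mxE/= mulr1 mulr0 add0r. Qed.

Let kap_smooth y : smooth_at kap y.
Proof.
apply: sa_row_mx.
  apply: sa_scale; first exact: sa_coord.
  apply: sa_add; first exact: sa_cst.
  by apply: sa_scale; [exact: sa_coord|exact: sa_cst].
apply: sa_add; first exact: sa_cst.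
by apply: sa_scale; [exact: sa_coord|exact: sa_cst].
Qed.

Let K_smooth y : smooth_at K y.
Proof. exact: (@sa_comp R _ _ _ _ Phi kap y (kap_smooth y) (Phis _)). Qed.

Let K0 y : 'D_e0 K y = (a + y 0 1 *: b) *m Y (K y).
Proof.
rewrite (@derive_comp R _ _ _ kap Phi y e0 (sa_diff (kap_smooth y)) (sa_diff (Phis _))).
have -> : 'D_e0 kap y = row_mx (a + y 0 1 *: b) 0.
  apply: derive_affine => h; rewrite /kap; have [-> ->] := e0E h y.
  by rewrite scale_row_mx add_row_mx scaler0 addr0 scalerDl addrC.
exact: flow_radial.
Qed.

Let W (s : R) := 'D_(row_mx (s *: b) v) Phi (row_mx (s *: a) x).

Let se0 (s : R) : (0 + s *: e0) 0 0 = s /\ (0 + s *: e0) 0 1 = 0.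
Proof. by have [] := e0E s 0; rewrite addr0 add0r => -> ->; rewrite !mxE addr0. Qed.

Let kap_se0 (s : R) : kap (0 + s *: e0) = row_mx (s *: a) x.
Proof. by rewrite /kap; have [-> ->] := se0 s; rewrite !scale0r !addr0. Qed.

Let WE (s : R) : W s = 'D_e1 K (0 + s *: e0).
Proof.
rewrite (@derive_comp R _ _ _ kap Phi _ e1 (sa_diff (kap_smooth _)) (sa_diff (Phis _))).
rewrite kap_se0 /W; congr ('D_ _ Phi _).
symmetry; apply: derive_affine => h; rewrite kap_se0 /kap.
have [-> ->] := e1E h (0 + s *: e0); have [-> ->] := se0 s.
by rewrite scale_row_mx add_row_mx addr0 scalerDr !scalerA [s * h]mulrC.
Qed.

(** The linearised equation along the flow line, by exchanging the derivatives in time and in the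
    parameter of [K]. *)
Lemma flow_variation (s : R) :
  let W (s : R) := 'D_(row_mx (s *: b) v) Phi (row_mx (s *: a) x) in
  let gam (s : R) := Phi (row_mx (s *: a) x) in
  derivable W s 1 /\
  'D_1 W s = b *m Y (gam s) + W s *m 'J (fun y => a *m Y y) (gam s).
Proof.
move=> W0 gam; rewrite -/W in W0 *.
have d := @sa_derivable R _ _ _ _ e0 (sa_derive e1 (K_smooth (0 + s *: e0))).
have [d1 d2] := derive_line d.
have -> : W0 = (fun t : R => 'D_e1 K (0 + t *: e0)) by apply/funext => t; exact: WE.
split; first exact: d1.
rewrite d2 (schwarz _ _ (K_smooth _)).
pose G (y : 'rV[R]_n) := a *m Y y.
have Gs y : smooth_at G y by apply: sa_mulmx; [exact: sa_cst|exact: Ys].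
have YK y : smooth_at (fun y => Y (K y)) y.
  exact: (@sa_comp R _ _ _ _ Y K y (K_smooth y) (Ys _)).
have GK y : smooth_at (fun y => G (K y)) y.
  exact: (@sa_comp R _ _ _ _ G K y (K_smooth y) (Gs _)).
have bs y : smooth_at (fun y : 'rV[R]_2 => y 0 1 *: b) y.
  by apply: sa_scale; [exact: sa_coord|exact: sa_cst].
have -> : 'D_e0 K = (fun y => G (K y)) + (fun y => (y 0 1 *: b) *m Y (K y)).
  by apply/funext => y; rewrite K0 mulmxDl.
set y0 := 0 + s *: e0.
have d3 := @sa_derivable R _ _ _ _ e1 (bs y0).
have d4 := @sa_derivable R _ _ _ _ e1 (YK y0).
have [d5 d6] := derive_mulmx d3 d4.
rewrite deriveD; [|exact: sa_derivable (GK y0)|exact: d5].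
rewrite d6 addrC (_ : y0 0 1 = 0); last exact: (se0 s).2.
rewrite scale0r mul0mx addr0.
have -> : 'D_e1 (fun y : 'rV[R]_2 => y 0 1 *: b) y0 = b.
  by apply: derive_affine => h; have [_ ->] := e1E h y0; rewrite scalerDl addrC.
have gE : K y0 = gam s by rewrite /K kap_se0.
rewrite gE; congr (_ + _).
rewrite (@derive_comp R _ _ _ K G y0 e1 (sa_diff (K_smooth _)) (sa_diff (Gs _))).
by rewrite gE (jacE _ (Gs _)).
Qed.

End Variation.

Section Invariance.
Variables (O : set 'rV[R]_n) (Kb : R) (a : 'rV[R]_m) (x : 'rV[R]_n).

Let gam (s : R) := Phi (row_mx (s *: a) x).
Let G (y : 'rV[R]_n) := a *m Y y.
Let Dm (s : R) : 'M[R]_n := dsubmx ('J Phi (row_mx (s *: a) x)).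

Hypothesis gamO : forall s : R, 0 <= s <= 1 -> O (gam s).
Hypothesis Dunit : forall s : R, 0 <= s <= 1 -> Dm s \in unitmx.
(* The span of the rows of [Y] is closed under brackets: row [k] of the left-hand
   side is the bracket of the fields [a *m Y] and [row k Y]. *)
Hypothesis brack : forall y, O y -> exists2 C : 'M[R]_m, `|C| <= Kb &
  'D_(a *m Y y) Y y - Y y *m 'J (fun y => a *m Y y) y = C *m Y y.

Let line (s : R) : row_mx (s *: a) x = row_mx 0 x + s *: row_mx a 0.
Proof. by rewrite scale_row_mx add_row_mx add0r scaler0 addr0. Qed.

Let vDm (v : 'rV[R]_n) s : v *m Dm s = 'D_(row_mx (s *: 0) v) Phi (row_mx (s *: a) x).
Proof.
rewrite scaler0 -(jacE _ (Phis _)) /Dm; move: ('J Phi _) => J.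
by rewrite -[in RHS](vsubmxK J) mul_row_col mul0mx add0r.
Qed.

Let dDm s : derivable Dm s 1 /\ 'D_1 Dm s = Dm s *m 'J G (gam s).
Proof.
have H i j : derivable (fun s => Dm s i j) s 1 /\
    'D_1 (fun s => Dm s i j) s = (Dm s *m 'J G (gam s)) i j.
  have [d1 d2] := flow_variation a 0 x (delta_mx 0 i) s.
  rewrite mul0mx add0r in d2.
  have -> : (fun s => Dm s i j) = (fun s => 'D_(row_mx (s *: 0) (delta_mx 0 i)) Phi (row_mx (s *: a) x) 0 j).
    by apply/funext => t; rewrite -vDm -rowE [RHS]mxE.
  split; first by move/derivable_mxP : d1; exact.
  by rewrite (derive_entry _ _ d1) d2 -vDm -mulmxA -rowE [LHS]mxE.
have d : derivable Dm s 1 by apply/derivable_mxP => i j; have [] := H i j.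
by split=> //; apply/matrixP => i j; rewrite -(derive_entry _ _ d); have [] := H i j.
Qed.

Let E (s : R) := invmx (Dm s).

Let Dms s : smooth_at (fun w => dsubmx ('J Phi w) : 'M[R]_n) (row_mx (s *: a) x).
Proof.
have := sa_jac (Phis (row_mx (s *: a) x)) => H.
apply: sa_mx => i j.
have -> : (fun y => (dsubmx ('J Phi y) : 'M[R]_n) i j) = (fun y => 'J Phi y (rshift m i) j).
  by apply/funext => y; rewrite mxE.
exact: sa_entry.
Qed.

Let dE s : 0 <= s <= 1 -> derivable E s 1 /\ 'D_1 E s = - ('J G (gam s) *m E s).
Proof.
move=> s01; have u := Dunit s01.
have Es : smooth_at (fun w => invmx (dsubmx ('J Phi w) : 'M[R]_n)) (row_mx (s *: a) x).
  by apply: sa_invmx; [exact: u|exact: Dms].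
have d : derivable E s 1.
  have d := @sa_derivable R _ _ _ _ (row_mx a 0) Es.
  rewrite line in d; have [d1 _] := derive_line d.
  have EE : E = (fun t : R => invmx (dsubmx ('J Phi (row_mx 0 x + t *: row_mx a 0)))).
    by apply/funext => t; rewrite /E /Dm line.
  by rewrite EE.
split=> //.
have [dD1 dD2] := dDm s.
have [d1 d2] := derive_mulmx dD1 d.
have nu : \forall t \near s, Dm t \in unitmx.
  have cD : {for s, continuous (fun t => \det (Dm t))}.
    have dv : derivable (fun w => \det (dsubmx ('J Phi w) : 'M[R]_n)) (row_mx (s *: a) x) (row_mx a 0).
      by apply: sa_derivable; exact: sa_det (Dms s).
    rewrite line in dv.
    have cE : (fun t => \det (Dm t)) = (fun t : R => \det (dsubmx ('J Phi (row_mx 0 x + t *: row_mx a 0)) : 'M[R]_n)).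
      by apply/funext => t; rewrite /Dm line.
    rewrite cE; apply: differentiable_continuous; apply/derivable1_diffP.
    exact: (derive_line dv).1.
  have nz : \det (Dm s) != 0 by rewrite -unitfE -unitmxE.
  have nz' : \forall t \near s, \det (Dm t) != 0 by exact: cvgr_neq0 cD nz.
  by apply: filterS nz' => t; rewrite -unitfE -unitmxE.
have z : 'D_1 (fun t => Dm t *m E t) s = 0.
  rewrite (@near_eq_derive _ _ _ _ (fun=> 1%:M)); first exact: derive_cst.
  by apply: filterS nu => t ut; rewrite /E mulmxV.
have : Dm s *m 'D_1 E s = - (Dm s *m ('J G (gam s) *m E s)).
  apply/eqP; rewrite -subr_eq0 opprK addrC mulmxA -dD2; apply/eqP.
  by rewrite -d2.
move=> /(congr1 (mulmx (invmx (Dm s)))).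
by rewrite mulmxN !mulKmx.
Qed.

(** The fields [Y] along the flow line, transported back to its starting point. The derivative of
    [z] is the transported bracket with a Y, which by [brack] is a combination of the rows of [z]
    again. *)
Let z (s : R) := Y (gam s) *m E s.

Let dgam s : derivable gam s 1 /\ 'D_1 gam s = a *m Y (gam s).
Proof. exact: control_flow_ode Ys YB a x s. Qed.

Let dz s : 0 <= s <= 1 -> derivable z s 1 /\
  exists2 C : 'M[R]_m, `|C| <= Kb & 'D_1 z s = C *m z s.
Proof.
move=> s01; have [dE1 dE2] := dE s01; have [dg1 dg2] := dgam s.
have dg : differentiable gam s by apply/derivable1_diffP.
have dY : derivable (fun s => Y (gam s)) s 1.
  apply: diff_derivable; apply: (@differentiable_comp _ _ _ _ gam Y) => //.
  exact: sa_diff.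
have [d1 d2] := derive_mulmx dY dE1.
split=> //; have [C CK CE] := brack (gamO s01); exists C => //.
have yD : 'D_1 (fun s => Y (gam s)) s = 'D_(a *m Y (gam s)) Y (gam s).
  by rewrite (@derive_comp _ _ _ _ gam Y _ _ dg (sa_diff (Ys _))) dg2.
apply: (etrans d2); rewrite /z mulmxA -CE yD dE2.
by rewrite mulmxBl mulmxN mulmxA.
Qed.

Let D0 : Dm 0 = 1%:M.
Proof.
apply/row_matrixP => i; rewrite rowE vDm rowE mulmx1.
rewrite !scale0r.
apply: derive_affine => h.
by rewrite scale_row_mx add_row_mx scaler0 add0r /Phi !(control_flow0 Ys YB) addrC.
Qed.

Let z0 : z 0 = Y x.
Proof. by rewrite /z /E D0 invmx1 mulmx1 /gam scale0r /Phi (control_flow0 Ys YB). Qed.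

Let norm_bound q (C : 'M[R]_m) (A : 'M[R]_(m, q)) : `|C| <= Kb ->
  `|C *m A| <= (m%:R * Kb) * `|A|.
Proof.
move=> CK; rewrite (le_trans (mulmx_norm _ _))// ler_wpM2r// ler_wpM2l//.
Qed.

Let zfwd q (w : 'M[R]_(n, q)) : Y x *m w = 0 -> forall s, 0 <= s <= 1 -> z s *m w = 0.
Proof.
move=> Yw s s01.
apply: (@gronwall R _ _ (fun s => z s *m w) (m%:R * Kb)) s01; last by rewrite z0.
move=> t t01; have [d1 [C CK dzE]] := dz t01.
have [e1 e2] := derive_mulmxr w d1; split=> //.
by rewrite e2 dzE -mulmxA; exact: norm_bound.
Qed.

(** Gronwall's inequality runs forwards from a zero at time 0, so the flow line is traversed
    backwards. *)
Let zbwd q (w : 'M[R]_(n, q)) : z 1 *m w = 0 -> Y x *m w = 0.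
Proof.
move=> zw; rewrite -z0.
pose g (t : R) := z (1 + t *: (-1)) *m w.
have s1 : (0 <= (1 : R)) && ((1 : R) <= 1) by rewrite ler01 lexx.
have : g 1 = 0.
  apply: (@gronwall R _ _ g (m%:R * Kb)) s1; last by rewrite /g scale0r addr0.
  move=> t /andP[t0 t1].
  have t01 : (0 <= (1 + t *: (-1 : R) : R)) && ((1 + t *: (-1 : R) : R) <= 1).
    by rewrite /GRing.scale/= mulrN1; apply/andP; split; lra.
  set u : R := 1 + t *: -1 in t01 *.
  have [d1 [C CK dzE]] := dz t01.
  have dd : differentiable z u by apply/derivable1_diffP.
  have dn : derivable z u (-1 : R) by exact: diff_derivable.
  have dnE : 'D_(-1 : R) z u = - (C *m z u).
    rewrite -dzE deriveE// -[X in 'd _ _ X]scaleN1r.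
    by rewrite linearZ/= scaleN1r -deriveE.
  have [l1 l2] := derive_line dn.
  have [e1 e2] := derive_mulmxr w l1; split; first exact: e1.
  by rewrite e2 l2 dnE mulNmx normrN -mulmxA; exact: norm_bound.
by rewrite /g /GRing.scale/= mul1r subrr.
Qed.

(** A linear equation z' = C z preserves the annihilator of the row space in both directions of
    time, hence the row space itself, even where its dimension is not known to be constant. *)
Lemma flow_span : (Y (gam 1) :=: Y x *m Dm 1)%MS.
Proof.
have s1 : (0 <= (1 : R)) && ((1 : R) <= 1) by rewrite ler01 lexx.
have -> : Y (gam 1) = z 1 *m Dm 1 by rewrite /z /E -mulmxA mulVmx ?Dunit// mulmx1.
apply: eqmxMr; apply/eqmxP/andP; split; apply: submx_coker.
  exact: (zfwd (mulmx_coker0 _) s1).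
by apply: zbwd; exact: mulmx_coker0.
Qed.

(** Variation of constants: transported back to the starting point, the variation [W] has derivative
    b z(s), which stays in the row space of [Y x]. *)
Lemma flow_control_span (b : 'rV[R]_m) :
  ('D_(row_mx b 0) Phi (row_mx a x) <= Y (gam 1))%MS.
Proof.
have s1 : (0 <= (1 : R)) && ((1 : R) <= 1) by rewrite ler01 lexx.
pose W (s : R) := 'D_(row_mx (s *: b) 0) Phi (row_mx (s *: a) x).
have -> : 'D_(row_mx b 0) Phi (row_mx a x) = (W 1 *m E 1) *m Dm 1.
  by rewrite -mulmxA mulVmx ?Dunit// mulmx1 /W !scale1r.
rewrite flow_span; apply: submxMr; apply: submx_coker.
set w := cokermx (Y x).
(* The constant is 0: modulo the row space of [Y x] the derivative vanishes identically. *)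
apply: (@gronwall R _ _ (fun s => W s *m E s *m w) 0) s1; last first.
  have -> : W 0 = 0 by rewrite /W !scale0r row_mx0; exact: derive0.
  by rewrite !mul0mx.
move=> s s01; have [dE1 dE2] := dE s01.
have [v1 v2] := flow_variation a b x 0 s.
have [d1 d2] := derive_mulmx v1 dE1.
have [e1 e2] := derive_mulmxr w d1; split=> //.
have eq : 'D_1 W s *m E s + W s *m 'D_1 E s = b *m Y (gam s) *m E s.
  by rewrite dE2 /W v2 mulmxDl mulmxN !mulmxA addrK.
rewrite mul0r (etrans e2 (congr1 (mulmxr w) (etrans d2 eq)))/=.
rewrite -[b *m _ *m _]mulmxA -mulmxA (zfwd (mulmx_coker0 _) s01) mulmx0 normr0//.
Qed.

End Invariance.
End Control.
End FlowInvariance.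

(** * Manifolds and pointwise smoothness *)

Section Euclidean.
Context {R : realType}.
Local Opaque derive jacobian.

Lemma rV_second_countable (k : nat) : @second_countable 'rV[R]_k.
Proof.
pose f (q : 'rV[rat]_k * rat) : set 'rV[R]_k :=
  [set x | `|x - map_mx ratr q.1| < ratr q.2].
exists (range f); first exact: sub_countable (card_image_le _ _) (countableP _).
split.
  move=> _ [q _ <-]; rewrite openE => x /= qx.
  apply/(@nbhs_normP R 'rV[R]_k); exists (ratr q.2 - `|x - map_mx ratr q.1|); first by rewrite /= subr_gt0.
  move=> y /= xy; rewrite /f /= (le_lt_trans (ler_distD x _ _))//.
  by rewrite distrC -ltrBrDr.
move=> x A /nbhs_normP[e /= e0 eA].
have [r /itvP r0e] : exists r : rat, ratr r \in `]0, e / 2[%R.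
  by apply: rat_in_itvoo; rewrite divr_gt0.
have r0 : 0 < ratr r :> R by rewrite r0e.
have [q Hq] : exists q : 'I_k -> rat, forall i, ratr (q i) \in `]x 0 i - ratr r, x 0 i + ratr r[%R.
  have H (i : 'I_k) : exists qi : rat, ratr qi \in `]x 0 i - ratr r, x 0 i + ratr r[%R.
    by apply: rat_in_itvoo; rewrite ltrD2l gtrN.
  by exists (fun i => sval (cid (H i))) => i; case: cid.
pose Q : 'rV[rat]_k := \row_i q i.
have qx : `|x - map_mx ratr Q| < ratr r.
  apply: mx_norm_ltP => // i j; rewrite !mxE ord1 ltr_norml.
  by have := Hq j; rewrite in_itv/= => /andP[h1 h2]; apply/andP; split; lra.
exists (f (Q, r)); first by split => //=; exists (Q, r).
move=> y /= yq; apply: eA => /=.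
rewrite (le_lt_trans (ler_distD (map_mx ratr Q) _ _))//.
rewrite [X in _ + X]distrC (lt_trans (ltrD qx yq))//.
by rewrite [ltRHS](splitr e) ltrD// r0e.
Qed.

Definition euc_chart (k : nat) : chart R 'rV[R]_k k.
Proof.
apply: (@Chart R 'rV[R]_k k setT id id openT) => //.
- by rewrite image_id; exact: openT.
- by move=> p _; exact: cvg_id.
- by move=> p _; exact: cvg_id.
Defined.

Definition euc (k : nat) : manifold R.
Proof.
apply: (@Manifold R 'rV[R]_k k (fun=> euc_chart k)) => //.
- by move=> p q; apply: sa_on => x _; exact: sa_id.
- exact: rV_second_countable.
Defined.

End Euclidean.

Section PointwiseSmooth.
Context {R : realType}.
Implicit Types M N Q : manifold R.
Local Opaque derive jacobian.

(** Continuity is a separate condition because the local expression also involves the arbitrary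
    values of [cmap] outside the domain of the chart. *)
Definition sm M N (f : M -> N) (p : M) :=
  {for p, continuous f} /\
  smooth_at (cmap (chart_at (f p)) \o f \o cinv (chart_at p)) (cmap (chart_at p) p).

Lemma chart_nbhs (T : topologicalType) n (c : chart R T n) p : cdom c p -> nbhs p (cdom c).
Proof. by move=> cp; apply: open_nbhs_nbhs; split => //; exact: cdom_open. Qed.

Lemma cimg_nbhs (T : topologicalType) n (c : chart R T n) p :
  cdom c p -> nbhs (cmap c p) (cmap c @` cdom c).
Proof. by move=> cp; apply: open_nbhs_nbhs; split; [exact: cimg_open|exists p]. Qed.

Lemma cinv_img (T : topologicalType) n (c : chart R T n) x :
  (cmap c @` cdom c) x -> cdom c (cinv c x) /\ cmap c (cinv c x) = x.
Proof. by move=> [p cp <-]; rewrite cmapK. Qed.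

Lemma cinv_near (T : topologicalType) n (c : chart R T n) p (A : set T) :
  cdom c p -> nbhs p A -> \forall x \near cmap c p, A (cinv c x).
Proof.
move=> cp pA; have : {for cmap c p, continuous (cinv c)}.
  by apply: cinv_continuous; exists p.
by move=> h; apply: h; rewrite cmapK.
Qed.

Lemma transition_smooth M (a b p : M) : cdom (chart_at a) p -> cdom (chart_at b) p ->
  smooth_at (cmap (chart_at b) \o cinv (chart_at a)) (cmap (chart_at a) p).
Proof.
move=> ap bp; apply: sa_at.
have : nbhs p (cdom (chart_at b)) by exact: chart_nbhs.
move=> /(cinv_near ap) nb; apply: filterS (filterI nb (cimg_nbhs ap)) => x [bx ax].
have [ac xE] := cinv_img ax.
move=> k; apply: Ck_sub (@chart_smooth R M a b k) => _ ->.
by exists (cinv (chart_at a) x).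
Qed.

Lemma smP M N (f : M -> N) (p : M) (a : M) (b : N) :
  cdom (chart_at a) p -> cdom (chart_at b) (f p) ->
  sm f p <-> {for p, continuous f} /\
    smooth_at (cmap (chart_at b) \o f \o cinv (chart_at a)) (cmap (chart_at a) p).
Proof.
move: a b; suff H : forall (a a' : M) (b b' : N), cdom (chart_at a) p -> cdom (chart_at a') p ->
    cdom (chart_at b) (f p) -> cdom (chart_at b') (f p) -> {for p, continuous f} ->
    smooth_at (cmap (chart_at b) \o f \o cinv (chart_at a)) (cmap (chart_at a) p) ->
    smooth_at (cmap (chart_at b') \o f \o cinv (chart_at a')) (cmap (chart_at a') p).
  move=> a b ap bp; split=> -[cf fs]; split => //.
  - exact: (H p a (f p) b (chart_atP p) ap (chart_atP (f p)) bp cf fs).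
  - exact: (H a p b (f p) ap (chart_atP p) bp (chart_atP (f p)) cf fs).
move=> a a' b b' ap a'p bp b'p cf fs.
have ts := transition_smooth a'p ap.
have us := transition_smooth bp b'p.
have E1 : cmap (chart_at a) p = (cmap (chart_at a) \o cinv (chart_at a')) (cmap (chart_at a') p).
  by rewrite /= cmapK.
rewrite E1 in fs; have gs := sa_comp ts fs.
have E2 : cmap (chart_at b) (f p) = ((cmap (chart_at b) \o f \o cinv (chart_at a)) \o
    (cmap (chart_at a) \o cinv (chart_at a'))) (cmap (chart_at a') p).
  by rewrite /= cmapK// cmapK.
rewrite E2 in us; have hs := sa_comp gs us.
apply: sa_near hs.
have n1 : nbhs p (cdom (chart_at a)) by exact: chart_nbhs.
have n2 : nbhs p (f @^-1` cdom (chart_at b)) by apply: cf; exact: chart_nbhs.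
apply: filterS (filterI (cinv_near a'p n1) (cinv_near a'p n2)) => x [/= h1 h2].
by rewrite cmapK// cmapK.
Qed.

Lemma sm_cont M N (f : M -> N) p : sm f p -> {for p, continuous f}.
Proof. by case. Qed.

(* [f] is continuous near [p] since [f q = cinv b (cmap b (f q))]. *)
Lemma sm_nbhs M N (f : M -> N) p : sm f p -> \forall q \near p, sm f q.
Proof.
move=> [cf fs]; pose a := chart_at p; pose b := chart_at (f p).
have n1 : nbhs p (cdom a) by exact: chart_nbhs (chart_atP p).
have n2 : nbhs p (f @^-1` cdom b) by apply: cf; exact: chart_nbhs (chart_atP _).
have n3 := @cmap_continuous _ _ _ a p (chart_atP p) _ (sa_nbhs fs).
apply: filterS (filterI n1 (filterI (nbhs_interior n2) n3)) => q [q1 [q2 q3]].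
have q4 : cdom b (f q) by exact: nbhs_singleton q2.
have c1 := @cmap_continuous _ _ _ a q q1.
have c2 := sa_cont q3.
have c3 : {for q, continuous (cinv b \o (cmap b \o f \o cinv a) \o cmap a)}.
  apply: continuous_comp; first exact: c1.
  apply: continuous_comp; first exact: c2.
  by apply: cinv_continuous; rewrite /= cmapK//; exists (f q).
have cq : {for q, continuous f}.
  apply: near_continuous c3; apply: filterS (filterI (chart_nbhs q1) q2) => z [z1 z2].
  by rewrite /= cmapK// cmapK.
by apply/(smP q1 q4).
Qed.

Lemma smooth_mapP M N (f : M -> N) : smooth_map f <-> forall p, sm f p.
Proof.
split=> [[cf fs] p|H].
  split; first exact: cf.
  have oA : open (cdom (chart_at p) `&` f @^-1` cdom (chart_at (f p))).
    apply: openI; first exact: cdom_open.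
    by apply: open_comp; [move=> x _; exact: cf|exact: cdom_open].
  apply: sa_at.
  have n2 : nbhs p (f @^-1` cdom (chart_at (f p))) by apply: cf; exact: chart_nbhs (chart_atP _).
  apply: filterS (filterI (cinv_near (chart_atP p) n2) (cimg_nbhs (chart_atP p))) => x [x2 x1].
  have [x3 x4] := cinv_img x1.
  move=> k; apply: Ck_sub (fs p (f p) k) => _ ->.
  by exists (cinv (chart_at p) x).
split=> [p|p q]; first by have [] := H p.
apply: sa_on => _ [r [pr qr] <-].
by have /(smP pr qr)[] := H r.
Qed.

Lemma sm_comp M N Q (f : M -> N) (g : N -> Q) p : sm f p -> sm g (f p) -> sm (g \o f) p.
Proof.
move=> [cf fs] [cg gs]; split; first exact: continuous_comp.
have E1 : cmap (chart_at (f p)) (f p) =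
    (cmap (chart_at (f p)) \o f \o cinv (chart_at p)) (cmap (chart_at p) p).
  by rewrite /= cmapK//; exact: chart_atP.
rewrite E1 in gs; have hs := sa_comp fs gs.
apply: sa_near hs.
have n2 : nbhs p (f @^-1` cdom (chart_at (f p))) by apply: cf; exact: chart_nbhs (chart_atP _).
by apply: filterS (cinv_near (chart_atP p) n2) => x /= h; rewrite cmapK.
Qed.

Lemma T_comp M N Q (f : M -> N) (g : N -> Q) p : sm f p -> sm g (f p) ->
  tangent_map (g \o f) p = tangent_map f p *m tangent_map g (f p).
Proof.
move=> [cf fs] [cg gs]; rewrite /tangent_map.
have E1 : cmap (chart_at (f p)) (f p) =
    (cmap (chart_at (f p)) \o f \o cinv (chart_at p)) (cmap (chart_at p) p).
  by rewrite /= cmapK//; exact: chart_atP.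
move: (gs); rewrite {1}E1 => gs'; rewrite [in RHS]E1.
rewrite -(jac_comp fs gs'); symmetry; apply: (jac_near (sa_comp fs gs')).
have n2 : nbhs p (f @^-1` cdom (chart_at (f p))) by apply: cf; exact: chart_nbhs (chart_atP _).
by apply: filterS (cinv_near (chart_atP p) n2) => x /= h; rewrite cmapK.
Qed.

Lemma sm_near M N (f g : M -> N) p : {near p, f =1 g} -> sm f p ->
  sm g p /\ tangent_map g p = tangent_map f p.
Proof.
move=> fg [cf fs]; have fgp := nbhs_singleton fg.
have fg' : {near cmap (chart_at p) p, cmap (chart_at (f p)) \o f \o cinv (chart_at p) =1
    cmap (chart_at (f p)) \o g \o cinv (chart_at p)}.
  by apply: filterS (cinv_near (chart_atP p) fg) => x /= ->.
split.
  split; first exact: near_continuous fg cf.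
  by rewrite -fgp; exact: sa_near fg' fs.
by rewrite /tangent_map -fgp; symmetry; exact: jac_near fs fg'.
Qed.

Lemma sm_id M (p : M) : sm (fun x : M => x) p /\ tangent_map (fun x : M => x) p = 1%:M.
Proof.
have n : {near cmap (chart_at p) p, id =1 cmap (chart_at p) \o (fun x : M => x) \o cinv (chart_at p)}.
  by apply: filterS (cimg_nbhs (chart_atP p)) => x /cinv_img[_ /= ->].
have s := @sa_id R _ (cmap (chart_at p) p).
split; first by split; [exact: cvg_id|exact: sa_near n s].
rewrite /tangent_map -(jac_near s n).
by apply/row_matrixP => i; rewrite !rowE (jacE _ s) derive_id mulmx1.
Qed.

Lemma sm_cst M N (q : N) (p : M) : sm (fun _ : M => q) p.
Proof. by split; [exact: cvg_cst|exact: sa_cst]. Qed.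

Lemma sm_euc (n m : nat) (f : 'rV[R]_n -> 'rV[R]_m) x : @sm (euc n) (euc m) f x <-> smooth_at f x.
Proof. by split=> [[]//|fs]; split => //; exact: sa_cont. Qed.

Lemma T_euc (n m : nat) (f : 'rV[R]_n -> 'rV[R]_m) x : @tangent_map R (euc n) (euc m) f x = 'J f x.
Proof. by []. Qed.

Lemma sm_cmap M (a p : M) : cdom (chart_at a) p ->
  @sm M (euc (mdim M)) (cmap (chart_at a)) p.
Proof.
move=> ap; split; first exact: cmap_continuous.
exact: transition_smooth (chart_atP p) ap.
Qed.

Lemma sm_cinv M (a : M) (x : euc (mdim M)) : (cmap (chart_at a) @` cdom (chart_at a)) x ->
  @sm (euc (mdim M)) M (cinv (chart_at a)) x.
Proof.
move=> ax; have [h1 h2] := cinv_img ax.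
split; first exact: cinv_continuous.
have := transition_smooth h1 (chart_atP (cinv (chart_at a) x)).
by rewrite h2.
Qed.

Lemma T_cmap M (a p : M) : @tangent_map R M (euc (mdim M)) (cmap (chart_at a)) p = transition p a p.
Proof. by []. Qed.

Lemma T_cinv M (a : M) (x : euc (mdim M)) : (cmap (chart_at a) @` cdom (chart_at a)) x ->
  @tangent_map R (euc (mdim M)) M (cinv (chart_at a)) x =
  transition a (cinv (chart_at a) x) (cinv (chart_at a) x).
Proof. by move=> /cinv_img[_ h2]; rewrite /transition h2. Qed.

Lemma T_cancel M N (f : M -> N) (g : N -> M) p : sm f p -> sm g (f p) ->
  (\forall x \near p, g (f x) = x) -> tangent_map f p *m tangent_map g (f p) = 1%:M.
Proof.
move=> fs gs gf; rewrite -T_comp//; have [s <-] := sm_id p.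
by apply: (sm_near _ s).2; apply: filterS gf => x /= ->.
Qed.

Lemma transition_id M (r : M) : transition r r r = 1%:M.
Proof. exact: (sm_id r).2. Qed.

End PointwiseSmooth.

(** * The Dorfman bracket and related sections *)

Section Dorfman.
Context {R : realType}.
Local Opaque derive jacobian.

(** The bracket as an operator on coordinate expressions: [dorfman] evaluates it at each point in
    the preferred chart there, while calculations near a point need a single fixed chart. *)
Definition dorfE n (s t : 'rV[R]_n -> 'rV[R]_(n + n)) (x : 'rV[R]_n) : 'rV[R]_(n + n) :=
  let X y := lsubmx (s y) in let a y := rsubmx (s y) in
  let Y y := lsubmx (t y) in let b y := rsubmx (t y) in
  row_mx (X x *m 'J Y x - Y x *m 'J X x)
         (X x *m 'J b x + b x *m ('J X x)^T - Y x *m ('J a x - ('J a x)^T)).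

Lemma dorfmanE (M : manifold R) (s t : M -> 'rV[R]_(mdim M + mdim M)) (p : M) :
  dorfman s t p = dorfE (local_rep p s) (local_rep p t) (cmap (chart_at p) p).
Proof. by []. Qed.

Lemma mulmx_rV_inj p q (A B : 'M[R]_(p, q)) :
  (forall v : 'rV[R]_p, v *m A = v *m B) -> A = B.
Proof. by move=> H; apply/row_matrixP => i; rewrite !rowE H. Qed.

Lemma tr11 (A : 'M[R]_1) : A^T = A.
Proof. by apply/matrixP => i j; rewrite mxE !ord1. Qed.

Lemma hess_sym k n (f : 'rV[R]_k -> 'rV[R]_n) x v w : smooth_at f x ->
  v *m 'D_w (fun y => 'J f y) x = w *m 'D_v (fun y => 'J f y) x.
Proof.
move=> fs; have Js := sa_jac fs.
suff H a b : a *m 'D_b (fun y => 'J f y) x = 'D_b ('D_a f) x.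
  by rewrite !H; exact: schwarz.
have [_ d] := derive_mulmx (@derivable_cst R _ _ a x b) (@sa_derivable R _ _ _ _ b Js).
rewrite derive_cst mul0mx add0r in d; rewrite -d.
apply: near_eq_derive.
by apply: filterS (sa_nbhs fs) => y ys; rewrite (jacE _ ys).
Qed.

(* With [J] the matrix of df, this says that u = v + (df)^* b and u' = df(v) + b. *)
Definition related_at k n (J : 'M[R]_(k, n)) (u : 'rV[R]_(k + k)) (u' : 'rV[R]_(n + n)) :=
  lsubmx u *m J = lsubmx u' /\ rsubmx u = rsubmx u' *m J^T.

(** The algebraic part of [dorf_related], with derivatives replaced by matrices: [HX] and [HY] are
    the second derivatives of f contracted with X and Y, and they cancel by symmetry. *)
Lemma related_bracket k n (J HX HY : 'M[R]_(k, n)) (X Y b : 'rV[R]_k) (X' Y' a' b' : 'rV[R]_n)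
    (JX JY Ja Jb : 'M[R]_k) (JX' JY' Ja' Jb' : 'M[R]_n) :
  X *m J = X' -> Y *m J = Y' -> b = b' *m J^T ->
  JX *m J = J *m JX' - HX -> JY *m J = J *m JY' - HY -> X *m HY = Y *m HX ->
  X *m Jb = X' *m Jb' *m J^T + b' *m HX^T ->
  Y *m Ja = Y' *m Ja' *m J^T + a' *m HY^T ->
  Y *m Ja^T = Y' *m Ja'^T *m J^T + a' *m HY^T ->
  related_at J (row_mx (X *m JY - Y *m JX) (X *m Jb + b *m JX^T - Y *m (Ja - Ja^T)))
    (row_mx (X' *m JY' - Y' *m JX') (X' *m Jb' + b' *m JX'^T - Y' *m (Ja' - Ja'^T))).
Proof.
move=> X0 Y0 b0 X1 Y1 XY b1 a1 a2; rewrite /related_at !row_mxKl !row_mxKr; split.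
  by rewrite mulmxBl -!mulmxA X1 Y1 !mulmxBr XY !mulmxA X0 Y0 opprB addrA subrK.
rewrite mulmxBr b1 a1 a2 b0 -[b' *m J^T *m _]mulmxA -trmx_mul X1 linearB/= mulmxBr trmx_mul.
by rewrite !mulmxBr !mulmxBl !mulmxDl !mulmxA; apply/rowP => i; rewrite !mxE; ring.
Qed.

Section Related.
Variables (k n : nat) (f : 'rV[R]_k -> 'rV[R]_n) (x : 'rV[R]_k).
Hypothesis fs : smooth_at f x.

Let J := 'J f x.
Let H (v : 'rV[R]_k) : 'M[R]_(k, n) := 'D_v (fun y => 'J f y) x.

(** Differentiation of the relation X J = X' o f in the direction v; the symmetry of the second
    derivative moves the extra term from X to v. *)
Lemma derive_vector (X : 'rV[R]_k -> 'rV[R]_k) (X' : 'rV[R]_n -> 'rV[R]_n) (v : 'rV[R]_k) :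
  smooth_at X x -> smooth_at X' (f x) ->
  (\forall y \near x, X y *m 'J f y = X' (f y)) ->
  v *m 'J X x *m J = v *m J *m 'J X' (f x) - v *m H (X x).
Proof.
move=> Xs X's E.
have [_ d] := derive_mulmx (@sa_derivable R _ _ _ _ v Xs) (@sa_derivable R _ _ _ _ v (sa_jac fs)).
rewrite (jacE _ Xs) (hess_sym _ _ fs) -/J; apply/eqP.
rewrite eq_sym subr_eq eq_sym -d; apply/eqP.
rewrite (@near_eq_derive _ _ _ _ (X' \o f) _ v E) (derive_comp _ (sa_diff fs) (sa_diff X's)).
by rewrite (jacE _ fs) (jacE _ X's).
Qed.

Lemma derive_covector (a : 'rV[R]_k -> 'rV[R]_k) (a' : 'rV[R]_n -> 'rV[R]_n) (v : 'rV[R]_k) :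
  smooth_at a x -> smooth_at a' (f x) ->
  (\forall y \near x, a y = a' (f y) *m ('J f y)^T) ->
  v *m 'J a x = v *m J *m 'J a' (f x) *m J^T + a' (f x) *m (H v)^T.
Proof.
move=> As A's E.
have c : smooth_at (fun y => a' (f y)) x by exact: (@sa_comp R _ _ _ _ a' f x fs A's).
have [_ d] := derive_mulmx (@sa_derivable R _ _ _ _ v c) (@sa_derivable R _ _ _ _ v (sa_tr (sa_jac fs))).
rewrite (jacE _ As) (@near_eq_derive _ _ _ _ (fun y => a' (f y) *m ('J f y)^T) _ v E) d.
congr (_ + _); congr (_ *m _).
  by rewrite (@derive_comp R _ _ _ f a' x v (sa_diff fs) (sa_diff A's)) (jacE _ fs) (jacE _ A's).
apply/matrixP => i j; have Jd := @sa_derivable R _ _ _ _ v (sa_jac fs).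
have Jtd := @sa_derivable R _ _ _ _ v (sa_tr (sa_jac fs)).
rewrite -(derive_entry _ _ Jtd) [RHS]mxE -(derive_entry _ _ Jd).
by congr ('D_v _ x); apply/funext => y; rewrite mxE.
Qed.

Variables (s t : 'rV[R]_k -> 'rV[R]_(k + k)) (s' t' : 'rV[R]_n -> 'rV[R]_(n + n)).
Hypotheses (ss : smooth_at s x) (ts : smooth_at t x).
Hypotheses (s's : smooth_at s' (f x)) (t's : smooth_at t' (f x)).
Hypothesis sE : \forall y \near x, related_at ('J f y) (s y) (s' (f y)).
Hypothesis tE : \forall y \near x, related_at ('J f y) (t y) (t' (f y)).

(** Naturality for related sections needs no inverse of [f], so it covers changes of charts as well
    as the inclusion of an invariant submanifold. *)
Lemma dorf_related : related_at J (dorfE s t x) (dorfE s' t' (f x)).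
Proof.
have X1 v := derive_vector v (sa_lsubmx ss) (sa_lsubmx s's) (filterS (fun y => @proj1 _ _) sE).
have Y1 v := derive_vector v (sa_lsubmx ts) (sa_lsubmx t's) (filterS (fun y => @proj1 _ _) tE).
have a1 v := derive_covector v (sa_rsubmx ss) (sa_rsubmx s's) (filterS (fun y => @proj2 _ _) sE).
have b1 v := derive_covector v (sa_rsubmx ts) (sa_rsubmx t's) (filterS (fun y => @proj2 _ _) tE).
have [X0 a0] := nbhs_singleton sE; have [Y0 b0] := nbhs_singleton tE.
have Hs v w : v *m H w = w *m H v by exact: hess_sym.
have X2 : 'J (fun y => lsubmx (s y)) x *m J = J *m 'J (fun y => lsubmx (s' y)) (f x) - H (lsubmx (s x)).
  by apply: mulmx_rV_inj => v; rewrite mulmxA X1 mulmxBr mulmxA.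
have a2 : 'J (fun y => rsubmx (s y)) x *m (lsubmx (t x))^T =
    J *m 'J (fun y => rsubmx (s' y)) (f x) *m (lsubmx (t' (f x)))^T +
    H (lsubmx (t x)) *m (rsubmx (s' (f x)))^T.
  apply: mulmx_rV_inj => v; rewrite mulmxA a1 mulmxDl mulmxDr -!mulmxA -[J^T *m _]trmx_mul Y0.
  by congr (_ + _); rewrite -trmx_mul Hs -[LHS]tr11 trmx_mul trmxK -mulmxA.
have a3 := congr1 trmx a2; rewrite linearD/= !trmx_mul !trmxK in a3.
have Y2 : 'J (fun y => lsubmx (t y)) x *m J = J *m 'J (fun y => lsubmx (t' y)) (f x) - H (lsubmx (t x)).
  by apply: mulmx_rV_inj => v; rewrite mulmxA Y1 mulmxBr mulmxA.
have b2 := b1 (nbhs_filter x) (lsubmx (s x)); rewrite X0 in b2.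
have a4 := a1 (nbhs_filter x) (lsubmx (t x)); rewrite Y0 in a4.
rewrite mulmxA in a3.
exact: (related_bracket X0 Y0 b0 X2 Y2 (Hs _ _) b2 a4 a3).
Qed.

End Related.
End Dorfman.

Section Sections.
Context {R : realType}.
Implicit Types M N : manifold R.
Local Opaque derive jacobian transition tangent_map.


Lemma transitionK M (a r : M) : cdom (chart_at a) r ->
  transition r a r *m transition a r r = 1%:M /\ transition a r r *m transition r a r = 1%:M.
Proof.
move=> ar; have s1 := sm_cmap ar.
have ai : (cmap (chart_at a) @` cdom (chart_at a)) (cmap (chart_at a) r) by exists r.
have s2 := sm_cinv ai.
have E2 := T_cinv ai; rewrite (cmapK ar) in E2.
rewrite -E2; split.
  apply: (@T_cancel _ M (euc (mdim M)) _ _ _ s1 s2).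
  by apply: filterS (chart_nbhs ar) => x ax; exact: cmapK.
have E : cinv (chart_at a) (cmap (chart_at a) r) = r by exact: cmapK.
have s3 : @sm _ M (euc (mdim M)) (cmap (chart_at a)) (cinv (chart_at a) (cmap (chart_at a) r)).
  by rewrite E.
have := @T_cancel _ (euc (mdim M)) M _ _ _ s2 s3 _.
rewrite E; apply.
by apply: filterS (cimg_nbhs ar) => x /cinv_img[].
Qed.

Lemma transition_unit M (a r : M) : cdom (chart_at a) r -> transition r a r \in unitmx.
Proof. by move=> /transitionK[/mulmx1_unit[u _] _]. Qed.

Lemma local_repE M (a r : M) s : cdom (chart_at a) r ->
  local_rep a s (cmap (chart_at a) r) =
  row_mx (lsubmx (s r) *m transition r a r) (rsubmx (s r) *m (transition a r r)^T).
Proof. by move=> ar; rewrite /local_rep cmapK. Qed.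

Section Map.
Variables (N M : manifold R) (f : N -> M).

Definition chart_expr (a : N) (b : M) : 'rV[R]_(mdim N) -> 'rV[R]_(mdim M) :=
  cmap (chart_at b) \o f \o cinv (chart_at a).

Lemma chart_exprE a b r : cdom (chart_at a) r ->
  chart_expr a b (cmap (chart_at a) r) = cmap (chart_at b) (f r).
Proof. by move=> ar; rewrite /chart_expr /= (cmapK ar). Qed.

Local Transparent transition tangent_map.
Lemma chart_exprJ a b r : cdom (chart_at a) r -> cdom (chart_at b) (f r) -> sm f r ->
  'J (chart_expr a b) (cmap (chart_at a) r) =
  transition a r r *m tangent_map f r *m transition (f r) b (f r).
Proof.
move=> ar br fs; have ai : (cmap (chart_at a) @` cdom (chart_at a)) (cmap (chart_at a) r) by exists r.
have s1 := sm_cinv ai; have E : cinv (chart_at a) (cmap (chart_at a) r) = r by exact: cmapK.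
have s2 : sm f (cinv (chart_at a) (cmap (chart_at a) r)) by rewrite E.
have s3 : @sm _ M (euc (mdim M)) (cmap (chart_at b)) (f (cinv (chart_at a) (cmap (chart_at a) r))).
  by rewrite E; exact: sm_cmap.
have s4 := sm_comp s1 s2.
have e1 : 'J (chart_expr a b) (cmap (chart_at a) r) =
    @tangent_map _ (euc (mdim N)) M (f \o cinv (chart_at a)) (cmap (chart_at a) r) *m
    transition (f (cinv (chart_at a) (cmap (chart_at a) r))) b (f (cinv (chart_at a) (cmap (chart_at a) r))).
  exact: (@T_comp _ (euc (mdim N)) M (euc (mdim M)) _ _ _ s4 s3).
apply: (etrans e1); rewrite (T_comp s1 s2) (T_cinv ai).
rewrite E; reflexivity.
Qed.

Local Opaque transition tangent_map.

Lemma chart_expr_smooth a b r : cdom (chart_at a) r -> cdom (chart_at b) (f r) -> sm f r ->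
  smooth_at (chart_expr a b) (cmap (chart_at a) r).
Proof. by move=> ar br /(smP ar br)[]. Qed.

Lemma related_local_rep a b r s s' : cdom (chart_at a) r -> cdom (chart_at b) (f r) -> sm f r ->
  related_at (tangent_map f r) (s r) (s' (f r)) ->
  related_at ('J (chart_expr a b) (cmap (chart_at a) r))
    (local_rep a s (cmap (chart_at a) r)) (local_rep b s' (cmap (chart_at b) (f r))).
Proof.
move=> ar br fs [h1 h2]; rewrite (chart_exprJ ar br fs) (local_repE _ ar) (local_repE _ br).
have [k1 k2] := transitionK ar; have [l1 l2] := transitionK br.
rewrite /related_at !row_mxKl !row_mxKr; split.
  by rewrite !mulmxA -[_ *m transition r a r *m _]mulmxA k1 mulmx1 h1.
by rewrite h2 -[RHS]mulmxA -trmx_mul -!mulmxA l1 mulmx1 trmx_mul mulmxA.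
Qed.

Lemma chart_expr_near a b r (P : N -> Prop) : cdom (chart_at a) r -> cdom (chart_at b) (f r) -> sm f r ->
  (\forall q \near r, P q) ->
  \forall y \near cmap (chart_at a) r, exists q, [/\ y = cmap (chart_at a) q, cdom (chart_at a) q,
     cdom (chart_at b) (f q), sm f q & P q].
Proof.
move=> ar br fs Pr; have n1 := cimg_nbhs ar.
have n2 : nbhs r (f @^-1` cdom (chart_at b)) by apply: (sm_cont fs); exact: chart_nbhs.
apply: filterS (filterI n1 (cinv_near ar (filterI n2 (filterI (sm_nbhs fs) Pr)))) => y [y1 [y2 [y3 y4]]].
by have [y5 y6] := cinv_img y1; exists (cinv (chart_at a) y).
Qed.

Lemma dorf_related_chart a b r s t s' t' :
  cdom (chart_at a) r -> cdom (chart_at b) (f r) -> sm f r ->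
  smooth_at (local_rep a s) (cmap (chart_at a) r) -> smooth_at (local_rep a t) (cmap (chart_at a) r) ->
  smooth_at (local_rep b s') (cmap (chart_at b) (f r)) ->
  smooth_at (local_rep b t') (cmap (chart_at b) (f r)) ->
  (\forall q \near r, related_at (tangent_map f q) (s q) (s' (f q))) ->
  (\forall q \near r, related_at (tangent_map f q) (t q) (t' (f q))) ->
  related_at ('J (chart_expr a b) (cmap (chart_at a) r))
    (dorfE (local_rep a s) (local_rep a t) (cmap (chart_at a) r))
    (dorfE (local_rep b s') (local_rep b t') (cmap (chart_at b) (f r))).
Proof.
move=> ar br fs ss ts s's t's sr tr.
have E := chart_exprE b ar.
rewrite -E in s's t's *.
apply: (dorf_related (chart_expr_smooth ar br fs) ss ts s's t's).
  apply: filterS (chart_expr_near ar br fs sr) => y [q [-> aq bq fq rq]].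
  rewrite (chart_exprE b aq); exact: related_local_rep.
apply: filterS (chart_expr_near ar br fs tr) => y [q [-> aq bq fq rq]].
rewrite (chart_exprE b aq); exact: related_local_rep.
Qed.

Lemma dorfman_related r s t s' t' : sm f r ->
  smooth_section setT s -> smooth_section setT t ->
  smooth_section setT s' -> smooth_section setT t' ->
  (\forall q \near r, related_at (tangent_map f q) (s q) (s' (f q))) ->
  (\forall q \near r, related_at (tangent_map f q) (t q) (t' (f q))) ->
  related_at (tangent_map f r) (dorfman s t r) (dorfman s' t' (f r)).
Proof.
move=> fs ss ts s's t's sr tr; rewrite !dorfmanE.
have H M' (u : M' -> 'rV[R]_(mdim M' + mdim M')) q : smooth_section setT u ->
    smooth_at (local_rep q u) (cmap (chart_at q) q).
  move=> us; have := us q; rewrite setIT => usq.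
  have /sa_onP := @cimg_open _ _ _ (chart_at q).
  by move=> /(_ _ (local_rep q u))[/(_ usq) + _]; apply; exists q => //; exact: chart_atP.
exact: (dorf_related_chart (chart_atP r) (chart_atP _) fs (H _ _ _ ss) (H _ _ _ ts) (H _ _ _ s's) (H _ _ _ t's) sr tr).
Qed.

End Map.

Section OneManifold.
Variable M : manifold R.
Implicit Types (a b r : M) (s t : M -> 'rV[R]_(mdim M + mdim M)).

Lemma related_id n (u : 'rV[R]_(n + n)) : related_at 1%:M u u.
Proof. by rewrite /related_at trmx1 !mulmx1. Qed.

Lemma local_rep_change a b r s : cdom (chart_at a) r -> cdom (chart_at b) r ->
  related_at ('J (chart_expr (fun x : M => x) a b) (cmap (chart_at a) r))
    (local_rep a s (cmap (chart_at a) r)) (local_rep b s (cmap (chart_at b) r)).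
Proof.
move=> ar br; have [ids idT] := sm_id r.
apply: (@related_local_rep M M (fun x => x) _ _ _ _ _ ar br ids).
by rewrite idT; exact: related_id.
Qed.

Lemma chart_exprJ_unit a b r : cdom (chart_at a) r -> cdom (chart_at b) r ->
  'J (chart_expr (fun x : M => x) a b) (cmap (chart_at a) r) \in unitmx.
Proof.
move=> ar br; have [ids idT] := sm_id r; rewrite (chart_exprJ ar br ids) idT mulmx1.
have [/mulmx1_unit[_ u] _] := transitionK ar.
rewrite unitmx_mul; apply/andP; split; [exact: u|exact: transition_unit].
Qed.

Lemma section_chart a b r s : cdom (chart_at a) r -> cdom (chart_at b) r ->
  smooth_at (local_rep b s) (cmap (chart_at b) r) ->
  smooth_at (local_rep a s) (cmap (chart_at a) r).
Proof.
move=> ar br sb; have [ids idT] := sm_id r.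
pose tau := chart_expr (fun x : M => x) a b.
have ts : smooth_at tau (cmap (chart_at a) r) by exact: (@chart_expr_smooth M M).
have E := @chart_exprE M M (fun x : M => x) a b r ar.
rewrite -E -/tau in sb.
have c : smooth_at (fun y => local_rep b s (tau y)) (cmap (chart_at a) r).
  exact: (@sa_comp _ _ _ _ _ (local_rep b s) tau).
have Js := sa_jac ts.
apply: (@sa_near _ _ _ (fun y => row_mx (lsubmx (local_rep b s (tau y)) *m invmx ('J tau y))
   (rsubmx (local_rep b s (tau y)) *m ('J tau y)^T))).
  have T : \forall q \near r, True by exact: nearT.
  apply: filterS (@chart_expr_near M M (fun x : M => x) a b r _ ar br ids T) => y [q [-> aq bq _ _]].
  have [h1 h2] := local_rep_change s aq bq.
  rewrite /tau (@chart_exprE M M (fun x : M => x) a b q aq).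
  by rewrite -h1 -h2 mulmxK ?hsubmxK//; exact: chart_exprJ_unit.
apply: sa_row_mx; apply: sa_mulmx; [exact: sa_lsubmx| |exact: sa_rsubmx|exact: sa_tr].
by apply: sa_invmx => //; exact: chart_exprJ_unit.
Qed.

Lemma smooth_sectionP s : smooth_section setT s <->
  forall r, exists2 a, cdom (chart_at a) r & smooth_at (local_rep a s) (cmap (chart_at a) r).
Proof.
split=> [H r|H q].
  exists r; first exact: chart_atP.
  have := H r; rewrite setIT => usq.
  have /sa_onP := @cimg_open _ _ _ (chart_at r).
  by move=> /(_ _ (local_rep r s))[/(_ usq) + _]; apply; exists r => //; exact: chart_atP.
apply: sa_on => _ [r [qr _] <-]; have [a ar sa] := H r.
exact: section_chart sa.
Qed.

Lemma smooth_section_at (W : set M) s a r : open W -> W r -> cdom (chart_at a) r ->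
  smooth_section W s -> smooth_at (local_rep a s) (cmap (chart_at a) r).
Proof.
move=> oW Wr ar H; apply: sa_at.
have nW : nbhs r W by apply: open_nbhs_nbhs.
apply: filterS (filterI (cimg_nbhs ar) (cinv_near ar nW)) => x [x1 x2] k.
have [x3 x4] := cinv_img x1.
by apply: Ck_sub (H a k) => _ ->; exists (cinv (chart_at a) x).
Qed.

(* [chart_block a r] expresses elements of T_rM (+) T*_rM in the chart at [a]. *)
Definition chart_block a r : 'M[R]_(mdim M + mdim M) :=
  block_mx (transition r a r) 0 0 (transition a r r)^T.

Lemma local_rep_block a r s : cdom (chart_at a) r ->
  local_rep a s (cmap (chart_at a) r) = s r *m chart_block a r.
Proof.
move=> ar; rewrite local_repE// -[in RHS](hsubmxK (s r)) /chart_block mul_row_block.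
by rewrite !mulmx0 addr0 add0r.
Qed.

Lemma chart_block_unit a r : cdom (chart_at a) r -> chart_block a r \in unitmx.
Proof.
move=> ar; have [k1 k2] := transitionK ar.
suff : chart_block a r *m block_mx (transition a r r) 0 0 (transition r a r)^T = 1%:M.
  by move=> /mulmx1_unit[u _].
rewrite /chart_block mulmx_block !mulmx0 !mul0mx !addr0 add0r -trmx_mul k1 trmx1.
exact/esym/scalar_mx_block.
Qed.

(** The coordinate formula does not depend on the chart: a section is related to itself along the
    identity map. *)
Lemma dorfman_chart a r s t : cdom (chart_at a) r ->
  smooth_section setT s -> smooth_section setT t ->
  dorfE (local_rep a s) (local_rep a t) (cmap (chart_at a) r) = dorfman s t r *m chart_block a r.
Proof.
move=> ar ss ts; have [ids idT] := sm_id r.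
have H b (br : cdom (chart_at b) r) (u : M -> 'rV[R]_(mdim M + mdim M)) :
    smooth_section setT u -> smooth_at (local_rep b u) (cmap (chart_at b) r).
  by move=> us; apply: smooth_section_at us => //; exact: openT.
have rel (u : M -> 'rV[R]_(mdim M + mdim M)) :
    \forall q \near r, related_at (tangent_map (fun x : M => x) q) (u q) (u q).
  by apply: nearW => q; rewrite (sm_id q).2; exact: related_id.
have : related_at ('J (chart_expr (fun x : M => x) r a) (cmap (chart_at r) r)) (dorfman s t r)
    (dorfE (local_rep a s) (local_rep a t) (cmap (chart_at a) r)).
  exact: (@dorf_related_chart M M (fun x => x) r a r s t s t (chart_atP r) ar ids
    (H r (chart_atP r) s ss) (H r (chart_atP r) t ts) (H a ar s ss) (H a ar t ts) (rel s) (rel t)).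
rewrite (chart_exprJ (chart_atP r) ar ids) idT mulmx1 transition_id mul1mx.
move: (dorfE _ _ _) (dorfman _ _ _) => u' u [h1 h2].
rewrite -[LHS]hsubmxK -h1.
rewrite -[in RHS](hsubmxK u) /chart_block mul_row_block !mulmx0 addr0 add0r h2.
rewrite -mulmxA -trmx_mul (transitionK ar).2 trmx1 mulmx1; reflexivity.
Qed.

End OneManifold.
End Sections.

(** * Local frames of a Dirac structure *)

Section Coefficients.
Context {R : realType}.
Local Opaque derive jacobian.

Lemma gram_unit p n (D : 'M[R]_(p, n)) : row_free D -> D *m D^T \in unitmx.
Proof.
move=> fD; rewrite -row_free_unit; apply: inj_row_free => v vD.
suff H : v *m D = 0 by apply: (row_free_inj fD); rewrite H mul0mx.
have : (v *m D) *m (v *m D)^T = 0 by rewrite trmx_mul mulmxA -[v *m D *m D^T]mulmxA vD mul0mx.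
move: (v *m D) => w /matrixP/(_ 0 0); rewrite !mxE => /eqP.
rewrite psumr_eq0 => [/allP w0|i _]; last by rewrite mxE -expr2 sqr_ge0.
apply/rowP => i; rewrite mxE; apply/eqP.
by have := w0 i (mem_index_enum i); rewrite mxE -expr2 sqrf_eq0.
Qed.

Lemma rank_rows m n (B : 'M[R]_(m, n)) r : \rank B = r ->
  exists S : 'M[R]_(r, m), row_free (S *m B).
Proof.
move=> <-; exists (row_base B *m pinvmx B).
by rewrite mulmxKpV ?eq_row_base// row_base_free.
Qed.

Lemma near_unit k p (f : 'rV[R]_k -> 'M[R]_p) x : smooth_at f x -> f x \in unitmx ->
  \forall w \near x, f w \in unitmx.
Proof.
move=> fs; rewrite unitmxE unitfE => u.
have c := sa_cont (sa_det fs).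
have h : \forall w \near x, \det (f w) != 0 by exact: cvgr_neq0 c u.
by apply: filterS h => w; rewrite -unitfE -unitmxE.
Qed.

Lemma near_row_free k m n (B : 'rV[R]_k -> 'M[R]_(m, n)) x : smooth_at B x -> row_free (B x) ->
  \forall w \near x, row_free (B w).
Proof.
move=> Bs /gram_unit u.
have gs : smooth_at (fun w => B w *m (B w)^T) x by apply: sa_mulmx => //; exact: sa_tr.
apply: filterS (near_unit gs u) => w uw; apply: inj_row_free => v vB.
have : v *m (B w *m (B w)^T) = 0 by rewrite mulmxA vB mul0mx.
by rewrite -row_free_unit in uw; rewrite -[RHS](mul0mx _ (B w *m (B w)^T)) => /(row_free_inj uw).
Qed.

(** Constant rank makes the coefficients smooth. A fixed choice [S] of independent combinations of
    the rows of [B] at x remains a basis of the row space nearby, and inverting its Gram matrix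
    solves for the coefficients. *)
Lemma smooth_coef k p m n (A : 'rV[R]_k -> 'M[R]_(p, n)) (B : 'rV[R]_k -> 'M[R]_(m, n)) x :
  smooth_at A x -> smooth_at B x ->
  (\forall w \near x, (A w <= B w)%MS /\ \rank (B w) = \rank (B x)) ->
  exists2 C : 'rV[R]_k -> 'M[R]_(p, m), smooth_at C x & \forall w \near x, A w = C w *m B w.
Proof.
move=> As Bs AB; have [S SB] := rank_rows (erefl (\rank (B x))).
pose D w := S *m B w.
have Ds : smooth_at D x by apply: sa_mulmx => //; exact: sa_cst.
have Gs : smooth_at (fun w => D w *m (D w)^T) x by apply: sa_mulmx => //; exact: sa_tr.
exists (fun w => A w *m (D w)^T *m invmx (D w *m (D w)^T) *m S).
  apply: sa_mulmx; last exact: sa_cst.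
  apply: sa_mulmx; first by apply: sa_mulmx => //; exact: sa_tr.
  by apply: sa_invmx => //; exact: gram_unit.
have fD := near_row_free Ds SB.
apply: filterS (filterI AB fD) => w [[ABw rB] fw].
have DB : (B w <= D w)%MS.
  have sDB : (D w <= B w)%MS by exact: submxMl.
  by have := mxrank_leqif_sup sDB; rewrite /leqif rB (eqnP fw) eqxx => -[_ <-].
have /submxP[c ->] := submx_trans ABw DB.
by rewrite -[_ *m S *m B w]mulmxA -/(D w) -[c *m D w *m _]mulmxA mulmxK// gram_unit.
Qed.

Lemma near_bounded k p q (C : 'rV[R]_k -> 'M[R]_(p, q)) x : {for x, continuous C} ->
  exists2 K : R, 0 <= K & \forall w \near x, `|C w| <= K.
Proof.
move=> cC; exists (`|C x| + 1) => //.
have c : {for x, continuous (fun w => `|C w|)} by exact: continuous_comp cC (@norm_continuous _ _ _).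
by apply: (@cvgr_le _ _ _ _ (fun w => `|C w|) _ c); rewrite ltrDl.
Qed.

Lemma dist_continuous n (c : 'rV[R]_n) : continuous (fun z : 'rV[R]_n => `|z - c|).
Proof.
move=> z; apply: (@continuous_comp _ _ _ (fun z : 'rV[R]_n => z - c) (fun z : 'rV[R]_n => `|z|) z).
  exact: sa_cont (sa_add (sa_id z) (sa_cst (- c) z)).
exact: norm_continuous.
Qed.

Lemma sa_ext n (V : normedModType R) (f g : 'rV[R]_n -> V) x :
  f =1 g -> smooth_at f x -> smooth_at g x.
Proof. by move=> /funext ->. Qed.

Lemma closed_ball_image n (T : topologicalType) (f : 'rV[R]_n -> T) (c : 'rV[R]_n) (r : R) :
  hausdorff_space T -> (forall x, `|x - c| <= r -> {for x, continuous f}) ->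
  closed (f @` [set x | `|x - c| <= r]).
Proof.
move=> hT cf; apply: compact_closed => //; apply: continuous_compact.
  by apply: continuous_in_subspaceT => x; rewrite inE; exact: cf.
apply: bounded_closed_compact.
  exists (`|c| + r); split; [exact: num_real|move=> x xr z /= zr].
  rewrite (le_trans _ (ltW xr))// -[z](subrK c) addrC (le_trans (ler_normD _ _))// lerD2l//.
have cn := @dist_continuous n c.
exact: (closed_comp (fun z _ => cn z) (@closed_le _ _)).
Qed.

Lemma near_ballP n (x : 'rV[R]_n) (P : set 'rV[R]_n) : nbhs x P ->
  exists2 e : R, 0 < e & forall y, `|y - x| < e -> P y.
Proof.
by move=> /nbhs_normP[e /= e0 eP]; exists e => // y yx; apply: eP; rewrite /= distrC.
Qed.

Lemma norm_ball_open n (x : 'rV[R]_n) (r : R) : open [set y : 'rV[R]_n | `|y - x| < r].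
Proof.
have cn := @dist_continuous n x.
exact: (open_comp (fun z _ => cn z) (@open_lt _ _)).
Qed.

Lemma near_norm_ball n (x y : 'rV[R]_n) (r : R) : `|y - x| < r -> \forall z \near y, `|z - x| < r.
Proof. by move=> yx; apply: open_nbhs_nbhs; split => //; exact: norm_ball_open. Qed.

End Coefficients.

Section Frames.
Context {R : realType} {M : manifold R} (L : dirac_structure M) (p0 : M).
Local Opaque derive jacobian transition tangent_map.
Local Notation n := (mdim M).
Local Notation a := (chart_at p0).
Local Notation x0 := (cmap (chart_at p0) p0).

Definition local_frame (F : 'rV[R]_n -> 'M[R]_(n, n + n)) (x : 'rV[R]_n) : Prop :=
  [/\ (cmap a @` cdom a) x, smooth_at F x &
      (F x :=: L (cinv a x) *m chart_block p0 (cinv a x))%MS].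

Lemma local_frame_exists : exists F, \forall x \near x0, local_frame F x.
Proof.
have [W [oW Wp] [F [Fs FE]]] := dirac_smooth L p0.
exists (fun x => \matrix_k local_rep p0 (F k) x).
have nW : nbhs p0 W by apply: open_nbhs_nbhs.
apply: filterS (filterI (cimg_nbhs (chart_atP p0)) (cinv_near (chart_atP p0) nW)) => x [x1 x2].
have [x3 x4] := cinv_img x1; split => //.
  apply: sa_mx => i j; apply: (@sa_ext _ _ _ (fun y => local_rep p0 (F i) y 0 j)).
    by move=> y; rewrite mxE.
  by apply: sa_entry; rewrite -x4; apply: smooth_section_at (Fs i).
have -> : \matrix_k local_rep p0 (F k) x = (\matrix_k F k (cinv a x)) *m chart_block p0 (cinv a x).
  apply/row_matrixP => i; rewrite rowK row_mul rowK -(local_rep_block _ x3) x4; reflexivity.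
by apply: eqmxMr; apply: eqmx_sym; exact: FE.
Qed.

Variable F : 'rV[R]_n -> 'M[R]_(n, n + n).
Hypothesis nF : \forall x \near x0, local_frame F x.

(** Involutivity of L speaks of global sections, so a combination of the local frame is cut off by a
    bump function and extended by zero, unchanged near the centre. *)
Lemma section_extend (c : 'rV[R]_n -> 'rV[R]_n) : smooth_at c x0 ->
  exists s, [/\ smooth_section setT s, forall r, (s r <= L r)%MS &
    \forall x \near x0, local_rep p0 s x = c x *m F x].
Proof.
move=> cs; have [e e0 He] := near_ballP (filterI nF (sa_nbhs cs)).
have r0 : 0 < e / 2 by rewrite divr_gt0.
have re : e / 2 < e by rewrite ltr_pdivrMr// ltr_pMr// ltr1n.
have [chi [chis chi1 chi0]] := bump_exists x0 r0.
pose g x := chi x *: (c x *m F x).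
have gs x : smooth_at g x.
  apply: (@sa_cutoff _ _ _ _ chi (fun x => c x *m F x) x0 (e / 2)) => // y yr.
  by have [[_ Fy _] cy] := He y (le_lt_trans yr re); exact: sa_mulmx.
pose s r := if pselect (cdom a r) then g (cmap a r) *m invmx (chart_block p0 r) else 0.
have sE r : cdom a r -> local_rep p0 s (cmap a r) = g (cmap a r).
  move=> ar; rewrite (local_rep_block _ ar) /s; case: pselect => // h.
  by apply: mulmxKV; exact: chart_block_unit.
have sg : {in cmap a @` cdom a, local_rep p0 s =1 g}.
  by move=> x; rewrite inE => -[r ar <-]; exact: sE.
have g0 x : e / 2 <= `|x - x0| -> g x = 0 by move=> xr; rewrite /g chi0// scale0r.
exists s; split.
- apply/smooth_sectionP => r; have [ar|nar] := pselect (cdom a r).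
    exists p0 => //; apply: sa_near (gs _).
    by apply: filterS (cimg_nbhs ar) => x ax; rewrite sg// inE.
  exists r; first exact: chart_atP.
  (* The extended section vanishes off [K], which is closed as a compact subset of a Hausdorff
     space. A point outside the chart thus has a neighbourhood on which the section is zero. *)
  pose K := cinv a @` [set x | `|x - x0| <= e / 2].
  have cK : closed K.
    apply: closed_ball_image; first exact: manifold_hausdorff.
    move=> x xr; apply: cinv_continuous.
    by have [[ax _ _] _] := He x (le_lt_trans xr re).
  have nK : nbhs r (~` K).
    apply: open_nbhs_nbhs; split; first exact: closed_openC.
    move=> [x xr xE]; apply: nar; rewrite -xE.
    by have [[/cinv_img[]]] := He x (le_lt_trans xr re).
  apply: (@sa_near _ _ _ (fun=> 0)); last exact: sa_cst.
  apply: filterS (filterI (cimg_nbhs (chart_atP r)) (cinv_near (chart_atP r) nK)) => x [x1 x2].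
  have [x3 x4] := cinv_img x1; rewrite -[in RHS]x4 (local_rep_block _ x3) /s.
  case: pselect => [ax|h]; last by rewrite mul0mx.
  rewrite g0 ?mul0mx// leNgt; apply/negP => /ltW h; apply: x2.
  by exists (cmap a (cinv (chart_at r) x)) => //; exact: cmapK.
- move=> r; rewrite /s; case: pselect => [ar|h0]; last exact: sub0mx.
  have [h|h] := leP (e / 2) `|cmap a r - x0|; first by rewrite g0// mul0mx sub0mx.
  have [[_ _ FE] _] := He _ (lt_trans h re); rewrite (cmapK ar) in FE.
  have u := chart_block_unit ar.
  rewrite -(mulmxK u (L r)); apply: submxMr; apply: scalemx_sub.
  by rewrite -FE; exact: submxMl.
- have [d d0 Hd] := near_ballP (cimg_nbhs (chart_atP p0)).
  apply/nbhs_normP; exists (Num.min (e / 2 / 2) d).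
    by rewrite /= lt_min !divr_gt0.
  move=> x; rewrite /= distrC lt_min => /andP[x1 x2].
  rewrite sg; last by rewrite inE; exact: Hd.
  by rewrite /g chi1 ?scale1r// ltW.
Qed.

Lemma dorfE_near k (s t s' t' : 'rV[R]_k -> 'rV[R]_(k + k)) x :
  smooth_at s x -> smooth_at t x ->
  {near x, s =1 s'} -> {near x, t =1 t'} -> dorfE s t x = dorfE s' t' x.
Proof.
move=> ss ts ss' tt'; rewrite /dorfE (nbhs_singleton ss') (nbhs_singleton tt').
rewrite (@jac_near _ _ _ _ (fun y => lsubmx (s' y)) _ (sa_lsubmx ss)); last by apply: filterS ss' => y ->.
rewrite (@jac_near _ _ _ _ (fun y => rsubmx (s' y)) _ (sa_rsubmx ss)); last by apply: filterS ss' => y ->.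
rewrite (@jac_near _ _ _ _ (fun y => lsubmx (t' y)) _ (sa_lsubmx ts)); last by apply: filterS tt' => y ->.
rewrite (@jac_near _ _ _ _ (fun y => rsubmx (t' y)) _ (sa_rsubmx ts)); last by apply: filterS tt' => y ->.
reflexivity.
Qed.

Lemma frame_involutive : \forall x \near x0, forall i j,
  (dorfE (fun y => row i (F y)) (fun y => row j (F y)) x <= F x)%MS.
Proof.
have rs i x : smooth_at F x -> smooth_at (fun y => row i (F y)) x.
  move=> Fx; apply: sa_mx => k l; apply: (@sa_ext _ _ _ (fun y => F y i l)); last exact: sa_entry.
  by move=> y; rewrite mxE.
apply: (filter_forall (nbhs_filter x0)) => i; apply: (filter_forall (nbhs_filter x0)) => j.
have ext k : exists s, [/\ smooth_section setT s, forall r, (s r <= L r)%MS &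
    \forall x \near x0, local_rep p0 s x = row k (F x)].
  have [s [s1 s2 s3]] := section_extend (sa_cst (delta_mx 0 k : 'rV[R]_n) x0).
  by exists s; split => //; apply: filterS s3 => x ->; rewrite rowE.
have [s [s1 s2 s3]] := ext i; have [t [t1 t2 t3]] := ext j.
apply: filterS (filterI nF (filterI (near_join s3) (near_join t3))) => x [[ax Fx FE] [sx tx]].
have [x3 x4] := cinv_img ax.
have sx' : {near x, (fun y => row i (F y)) =1 local_rep p0 s} by apply: filterS sx => y ->.
have tx' : {near x, (fun y => row j (F y)) =1 local_rep p0 t} by apply: filterS tx => y ->.
rewrite (dorfE_near (rs i x Fx) (rs j x Fx) sx' tx') -{1}x4 (dorfman_chart x3 s1 t1) FE.
by apply: submxMr; exact: dirac_involutive.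
Qed.

End Frames.

Section VectorFrame.
Context {R : realType} {M : manifold R} (L : dirac_structure M) (p0 : M).
Local Opaque derive jacobian transition tangent_map.
Local Notation n := (mdim M).
Local Notation a := (chart_at p0).
Local Notation x0 := (cmap (chart_at p0) p0).

Lemma sa_opp N p q (f : 'rV[R]_N -> 'M[R]_(p, q)) x :
  smooth_at f x -> smooth_at (fun y => - f y) x.
Proof.
move=> fs; apply: (@sa_ext _ _ _ (fun y => (-1 : R) *: f y)); first by move=> y; rewrite scaleN1r.
by apply: sa_scale => //; exact: sa_cst.
Qed.

Lemma sa_dorf k (s t : 'rV[R]_k -> 'rV[R]_(k + k)) x :
  smooth_at s x -> smooth_at t x -> smooth_at (dorfE s t) x.
Proof.
move=> ss ts.
have [s1 s2] := (sa_lsubmx ss, sa_rsubmx ss); have [t1 t2] := (sa_lsubmx ts, sa_rsubmx ts).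
have [j1 [j2 [j3 j4]]] := (sa_jac s1, (sa_jac s2, (sa_jac t1, sa_jac t2))).
have v := sa_add (sa_mulmx s1 j3) (sa_opp (sa_mulmx t1 j1)).
have w := sa_add (sa_add (sa_mulmx s1 j4) (sa_mulmx t2 (sa_tr j1)))
  (sa_opp (sa_mulmx t1 (sa_add j2 (sa_opp (sa_tr j2))))).
exact: sa_row_mx v w.
Qed.

Lemma sa_row N p q (f : 'rV[R]_N -> 'M[R]_(p, q)) i x :
  smooth_at f x -> smooth_at (fun y => row i (f y)) x.
Proof.
move=> fs; apply: (@sa_ext _ _ _ (fun y => delta_mx 0 i *m f y)); first by move=> y; rewrite rowE.
by apply: sa_mulmx => //; exact: sa_cst.
Qed.

Lemma lsubmx_mul p q1 q2 m (A : 'M[R]_(m, p)) (B : 'M[R]_(p, q1 + q2)) :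
  lsubmx (A *m B) = A *m lsubmx B.
Proof. by rewrite -{1}(hsubmxK B) mul_mx_row row_mxKl. Qed.

Lemma rsubmx_mul p q1 q2 m (A : 'M[R]_(m, p)) (B : 'M[R]_(p, q1 + q2)) :
  rsubmx (A *m B) = A *m rsubmx B.
Proof. by rewrite -{1}(hsubmxK B) mul_mx_row row_mxKr. Qed.

Lemma lsubmxE p q1 q2 (B : 'M[R]_(p, q1 + q2)) : lsubmx B = B *m col_mx 1%:M 0.
Proof. by rewrite -{2}(hsubmxK B) mul_row_col mulmx1 mulmx0 addr0. Qed.

Lemma lsubmx_block p (A : 'M[R]_(p, n + n)) r :
  lsubmx (A *m chart_block p0 r) = lsubmx A *m transition r p0 r.
Proof.
rewrite -{1}(hsubmxK A) /chart_block mul_row_block row_mxKl mulmx0 addr0; reflexivity.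
Qed.

Lemma frame_pr_T (F : 'rV[R]_n -> 'M[R]_(n, n + n)) x : local_frame L p0 F x ->
  (lsubmx (F x) :=: pr_T L (cinv a x) *m transition (cinv a x) p0 (cinv a x))%MS.
Proof.
move=> [_ _ FE]; rewrite /pr_T -lsubmx_block !lsubmxE; exact: eqmxMr.
Qed.

(** Brackets of members of a frame of L are combinations of the frame with smooth, hence locally
    bounded, coefficients because L has constant rank. The tangent components inherit the relation
    and the bound, although the rank of [Y] itself may jump. *)
Lemma vector_frame : exists (Y : 'rV[R]_n -> 'M[R]_n) (K : R), \forall x \near x0,
  [/\ (cmap a @` cdom a) x, smooth_at Y x,
      (Y x :=: pr_T L (cinv a x) *m transition (cinv a x) p0 (cinv a x))%MS &
      forall i, exists2 C : 'M[R]_n, `|C| <= K &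
        'D_(row i (Y x)) Y x - Y x *m 'J (fun y => row i (Y y)) x = C *m Y x].
Proof.
have [F nF] := local_frame_exists L p0.
pose Y x := lsubmx (F x).
pose A i x := \matrix_j dorfE (fun y => row i (F y)) (fun y => row j (F y)) x.
have nF0 := nbhs_singleton nF; have [_ F0 _] := nF0.
have As i : smooth_at (A i) x0.
  apply: sa_mx => j k.
  apply: (@sa_ext _ _ _ (fun x => dorfE (fun y => row i (F y)) (fun y => row j (F y)) x 0 k)).
    by move=> x; rewrite [RHS]mxE.
  by apply: sa_entry; apply: sa_dorf; exact: sa_row.
have rF x : local_frame L p0 F x -> \rank (F x) = n.
  move=> [/cinv_img[x1 x2] _ ->]; rewrite mxrankMfree ?row_free_unit ?chart_block_unit//.
  exact: dirac_rank.
have AF i : exists2 C : 'rV[R]_n -> 'M[R]_n, smooth_at C x0 & \forall x \near x0, A i x = C x *m F x.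
  apply: smooth_coef => //.
  apply: filterS (filterI nF (frame_involutive nF)) => x [Fx H]; split.
    by apply/row_subP => j; rewrite rowK; exact: H.
  by rewrite (rF _ Fx) (rF _ nF0).
pose C i := sval (cid2 (AF i)).
have Cs i : smooth_at (C i) x0 by rewrite /C; case: cid2.
have CE i : \forall x \near x0, A i x = C i x *m F x by rewrite /C; case: cid2.
have Cb i := near_bounded (sa_cont (Cs i)).
pose K i := sval (cid2 (Cb i)).
have K0 i : 0 <= K i by rewrite /K; case: cid2.
have CK i : \forall x \near x0, `|C i x| <= K i by rewrite /K; case: cid2.
exists Y, (\sum_i K i).
have CE' := filter_forall (nbhs_filter x0) CE.
have CK' := filter_forall (nbhs_filter x0) CK.
apply: filterS (filterI nF (filterI CE' CK')) => x [Fx [Cx Kx]].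
have [ax Fs _] := Fx; split => //.
- exact: sa_lsubmx.
- exact: frame_pr_T.
move=> i; exists (C i x).
  by rewrite (le_trans (Kx i))// (bigD1 i)//= lerDl sumr_ge0.
rewrite /Y -lsubmx_mul -Cx.
have Ys : smooth_at (fun y => lsubmx (F y)) x by exact: sa_lsubmx.
have E k : (fun y => lsubmx (row k (F y))) = (fun y => row k (lsubmx (F y))).
  by apply/funext => y; apply/rowP => l; rewrite !mxE.
have dj j v : 'D_v (fun y => row j (lsubmx (F y))) x = row j ('D_v (fun y => lsubmx (F y)) x).
  have e : (fun y => row j (lsubmx (F y))) = (fun y => delta_mx 0 j *m lsubmx (F y)).
    by apply/funext => y; rewrite rowE.
  have [_ d] := derive_mulmx (@derivable_cst R _ _ (delta_mx 0 j : 'rV[R]_n) x v) (@sa_derivable R _ _ _ _ v Ys).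
  rewrite e; apply: (etrans d); rewrite derive_cst mul0mx add0r rowE; reflexivity.
apply/row_matrixP => j.
have -> : row j (lsubmx (A i x)) = lsubmx (row j (A i x)) by apply/rowP => l; rewrite !mxE.
rewrite rowK /dorfE row_mxKl !E linearB/= row_mul -dj.
have -> : lsubmx (row i (F x)) = row i (lsubmx (F x)) by apply/rowP => l; rewrite !mxE.
have -> : lsubmx (row j (F x)) = row j (lsubmx (F x)) by apply/rowP => l; rewrite !mxE.
have e := jacE (row i (lsubmx (F x))) (sa_row j Ys).
exact: (esym (congr1 (fun z => z - _) e)).
Qed.

End VectorFrame.

(** * Counting dimensions of spans *)

Section LinearAlgebra.
Context {R : realType}.

Lemma rank_adds_coker m d n (A : 'M[R]_(m, n)) (J : 'M[R]_(d, n)) :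
  (\rank (A + J)%MS <= \rank (A *m cokermx J) + \rank J)%N.
Proof.
rewrite -(mxrank_mul_ker (A + J)%MS (cokermx J)); apply: leq_add.
  rewrite addsmxMr mulmx_coker0; apply: mxrankS.
  by rewrite addsmx_sub submx_refl sub0mx.
apply: mxrankS; apply/rV_subP => v; rewrite sub_capmx => /andP[_].
by rewrite sub_kermx => /eqP; exact: submx_coker.
Qed.

(** The first r + d rows of [Jp] are independent and lie in the transported sum of [Yx] and [Ji],
    which has dimension at most r + d by the rank condition. So they span it, and [Yp], being
    contained in it, has no component along the last e coordinates. *)
Lemma span_count (m r d e n : nat) (Jp : 'M[R]_(r + (d + e), n)) (T : 'M[R]_(n, r + (d + e)))
    (Ji : 'M[R]_(d, n)) (Yx Yp : 'M[R]_(m, n)) (D : 'M[R]_n) :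
  Jp *m T = 1%:M -> (usubmx Jp <= Yp)%MS -> usubmx (dsubmx Jp) = Ji *m D ->
  (Yp :=: Yx *m D)%MS -> \rank (Yx *m cokermx Ji) = r -> row_free Ji ->
  rsubmx (rsubmx (Yp *m T)) = 0.
Proof.
move=> JT VY UE YpE rY fJ.
pose V := usubmx Jp; pose U := usubmx (dsubmx Jp).
have fJp : row_free Jp by apply/row_freeP; exists T.
have rQ : \rank (V + U)%MS = (r + d)%N.
  apply/eqP; rewrite eqn_leq; apply/andP; split.
    by apply: leq_trans (mxrank_adds_leqif _ _) _; apply: leq_add; exact: rank_leq_row.
  have : (\rank Jp <= \rank (V + U)%MS + \rank (dsubmx (dsubmx Jp)))%N.
    rewrite -{1}[Jp]vsubmxK -{1}[dsubmx Jp]vsubmxK -addsmxE.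
    have h : ((V + (col_mx U (dsubmx (dsubmx Jp))))%MS <= (V + U) + dsubmx (dsubmx Jp))%MS.
      by rewrite -addsmxA addsmxS// -addsmxE.
    by apply: leq_trans (mxrankS h) _; exact: mxrank_adds_leqif.
  rewrite (eqnP fJp) addnA => h.
  have := leq_trans h (leq_add (leqnn _) (rank_leq_row (dsubmx (dsubmx Jp)))).
  by rewrite leq_add2r.
have QS : ((V + U)%MS <= (Yx + Ji)%MS *m D)%MS.
  rewrite addsmxMr addsmx_sub; apply/andP; split.
    by apply: submx_trans (addsmxSl _ _); rewrite -YpE.
  by rewrite /U UE; exact: addsmxSr.
have SQ : ((Yx + Ji)%MS *m D <= (V + U)%MS)%MS.
  have := mxrank_leqif_sup QS; rewrite /leqif => -[h1 <-].
  rewrite eqn_leq h1 rQ (leq_trans (mxrankM_maxl _ _))// (leq_trans (rank_adds_coker _ _))//.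
  by rewrite rY leq_add2l rank_leq_row.
have : (Yp <= V + U)%MS.
  apply: submx_trans SQ; rewrite YpE; apply: submxMr; exact: addsmxSl.
move=> /sub_addsmxP[[c1 c2] /= ->].
have h1 : V *m T = usubmx 1%:M.
  by rewrite -JT -[in RHS](vsubmxK Jp) mul_col_mx col_mxKu.
have h2 : U *m T = usubmx (dsubmx 1%:M).
  by rewrite -JT -[in RHS](vsubmxK Jp) mul_col_mx col_mxKd -[in RHS](vsubmxK (dsubmx Jp)) mul_col_mx col_mxKu.
rewrite mulmxDl -!mulmxA h1 h2 scalar_mx_block col_mxKu col_mxKd scalar_mx_block.
have -> : usubmx (row_mx (0 : 'M[R]_(d + e, r)) (block_mx 1%:M 0 0 1%:M)) = row_mx 0 (row_mx 1%:M 0).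
  by rewrite -col_mx0 /block_mx -block_mxEh /block_mx col_mxKu.
by rewrite !mul_mx_row add_row_mx !row_mxKr !mulmx0 add0r row_mxKr.
Qed.

End LinearAlgebra.

(** * Straightening along a submanifold *)

Section Straighten.
Context {R : realType}.
Local Opaque derive jacobian.

Lemma derive_linear p q k (f : 'rV[R]_k -> 'M[R]_(p, q)) x (m : nat) (a : 'rV[R]_m) (v : 'I_m -> 'rV[R]_k) :
  smooth_at f x -> 'D_(\sum_i a 0 i *: v i) f x = \sum_i a 0 i *: 'D_(v i) f x.
Proof.
move=> fs; have df := sa_diff fs; rewrite deriveE// linear_sum.
by apply: eq_bigr => i _; rewrite linearZ/= -deriveE.
Qed.

(** Bounded global fields have flows for all times. The bracket relation is kept only where the bump
    function is 1, and its bound for a Y is the combination of the bounds for the rows. *)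
Lemma cutoff_field m n (Y : 'rV[R]_n -> 'M[R]_(m, n)) (c : 'rV[R]_n) (K : R) :
  (\forall x \near c, smooth_at Y x /\ forall i, exists2 C : 'M[R]_m, `|C| <= K &
     'D_(row i (Y x)) Y x - Y x *m 'J (fun y => row i (Y y)) x = C *m Y x) ->
  exists (Yt : 'rV[R]_n -> 'M[R]_(m, n)) (B dl : R),
  [/\ forall x, smooth_at Yt x, forall x, `|Yt x| <= B, 0 < dl,
      forall x, `|x - c| < dl -> Yt x = Y x &
      forall a : 'rV[R]_m, exists Kb : R, forall x, `|x - c| < dl -> exists2 C : 'M[R]_m, `|C| <= Kb &
        'D_(a *m Yt x) Yt x - Yt x *m 'J (fun y => a *m Yt y) x = C *m Yt x].
Proof.
move=> H; have [e e0 He] := near_ballP H.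
have r0 : 0 < e / 2 by rewrite divr_gt0.
have re : e / 2 < e by rewrite ltr_pdivrMr// ltr_pMr// ltr1n.
have [chi [chis chi1 chi0]] := bump_exists c r0.
pose Yt x := chi x *: Y x.
have Ys x : smooth_at Yt x.
  apply: (@sa_cutoff _ _ _ _ chi Y c (e / 2)) => // y yr.
  by have [] := He y (le_lt_trans yr re).
have [B B0 HB] := @ball_bound R _ _ _ Yt (`|c| + e / 2) (fun x => sa_cont (Ys x)).
have YtE x : `|x - c| < e / 2 / 2 -> Yt x = Y x by move=> h; rewrite /Yt chi1 ?scale1r// ltW.
exists Yt, B, (e / 2 / 2); split => //.
- move=> x; have [h|h] := leP (e / 2) `|x - c|; first by rewrite /Yt chi0// scale0r normr0.
  apply: HB; rewrite -[x](subrK c) addrC (le_trans (ler_normD _ _))// lerD2l.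
  by rewrite ltW.
- by rewrite divr_gt0.
move=> a; exists (\sum_i `|a 0 i| * K) => x xd.
have xe : `|x - c| < e by rewrite (lt_trans xd)// (lt_trans _ re)// ltr_pdivrMr// ltr_pMr// ltr1n.
have [Yx /fin_all_exists2[C CK CE]] := He x xe.
have nE : \forall y \near x, Y y = Yt y.
  by apply: filterS (near_norm_ball xd) => y yd; rewrite YtE.
exists (\sum_i a 0 i *: C i).
  rewrite (le_trans (ler_norm_sum _ _ _))//; apply: ler_sum => i _.
  by rewrite normrZ ler_wpM2l.
have E1 : 'D_(a *m Yt x) Yt x = \sum_i a 0 i *: 'D_(row i (Y x)) Y x.
  rewrite -(@near_eq_derive _ _ _ _ _ _ _ nE) (YtE _ xd) mulmx_sum_row; exact: derive_linear.
have E2 : 'J (fun y => a *m Yt y) x = \sum_i a 0 i *: 'J (fun y => row i (Y y)) x.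
  apply: mulmx_rV_inj => v.
  have aY : smooth_at (fun y => a *m Yt y) x by apply: sa_mulmx => //; exact: sa_cst.
  have e1 := jacE v aY.
  have [_ d] := derive_mulmx (@derivable_cst R _ _ a x v) (@sa_derivable R _ _ _ _ v (Ys x)).
  rewrite derive_cst mul0mx add0r in d.
  apply: (etrans e1); apply: (etrans d); rewrite -(@near_eq_derive _ _ _ _ _ _ _ nE) mulmx_sumr mulmx_sum_row.
  apply: eq_bigr => i _; rewrite -scalemxAr; congr (_ *: _).
  have e2 := jacE v (sa_row i Yx); apply: esym; apply: (etrans e2).
  have [_ d2] := derive_mulmx (@derivable_cst R _ _ (delta_mx 0 i : 'rV[R]_m) x v) (@sa_derivable R _ _ _ _ v Yx).
  rewrite derive_cst mul0mx add0r in d2.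
  have -> : (fun y => row i (Y y)) = (fun y => delta_mx 0 i *m Y y) by apply/funext => y; rewrite rowE.
  apply: (etrans d2); rewrite rowE; reflexivity.
rewrite E1 E2 (YtE _ xd) mulmx_sumr mulmx_suml -sumrB; apply: eq_bigr => i _.
by rewrite -scalemxAr -scalerBr CE scalemxAl.
Qed.

(** In the application the source dimension is r + (d + e), only provably equal to n. *)
Lemma inverse_function_cast p n (f : 'rV[R]_p -> 'rV[R]_n) x : p = n ->
  smooth_at f x -> row_free ('J f x) ->
  exists (A : set 'rV[R]_p) (B : set 'rV[R]_n) (g : 'rV[R]_n -> 'rV[R]_p),
    [/\ open A, A x & open B] /\
    [/\ forall z, A z -> [/\ B (f z), g (f z) = z & smooth_at f z] &
        forall y, B y -> [/\ A (g y), f (g y) = y & smooth_at g y]].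
Proof.
move=> pn; move: pn f x => -> f x fs; rewrite row_free_unit => fu.
have [A [B [g [h1 [h2 h3]]]]] := inverse_function fs fu.
by exists A, B, g; split => //; split => // z /h2[].
Qed.

Lemma jac_cancel p q (f : 'rV[R]_p -> 'rV[R]_q) (g : 'rV[R]_q -> 'rV[R]_p) x :
  smooth_at f x -> smooth_at g (f x) -> (\forall y \near x, g (f y) = y) ->
  'J f x *m 'J g (f x) = 1%:M.
Proof.
move=> fs gs gf; have e1 := jac_comp fs gs; rewrite -e1.
have ids := sa_id x.
have e2 : {near x, id =1 g \o f} by apply: filterS gf => y /= ->.
have e3 := jac_near ids e2; rewrite -e3.
apply: mulmx_rV_inj => v; have e4 := jacE v ids; apply: (etrans e4).
by rewrite derive_id mulmx1.
Qed.

Lemma row_mx_norm_lt p q (u : 'rV[R]_p) (v : 'rV[R]_q) (e : R) : 0 < e ->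
  `|u| < e -> `|v| < e -> `|row_mx u v| < e.
Proof.
move=> e0 ue ve; apply: mx_norm_ltP => // i j; rewrite mxE.
by case: splitP => k _; [apply: le_lt_trans (mx_norm_coord u i k) ue|apply: le_lt_trans (mx_norm_coord v i k) ve].
Qed.

Lemma complete_basis p n (Q : 'M[R]_(p, n)) : row_free Q ->
  exists (e : nat) (N : 'M[R]_(e, n)), (p + e)%N = n /\ row_free (col_mx Q N).
Proof.
move=> fQ; exists (\rank (Q^C)%MS), (row_base (Q^C)%MS).
have E : (p + \rank (Q^C)%MS)%N = n by rewrite mxrank_compl (eqnP fQ) subnKC// -(eqnP fQ) rank_leq_col.
split => //; rewrite /row_free -addsmxE E.
have -> : \rank (Q + row_base Q^C)%MS = \rank (Q + Q^C)%MS.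
  apply/eqP; rewrite eqn_leq; apply/andP; split; apply: mxrankS; rewrite addsmx_sub addsmxSl/=;
    by apply: submx_trans (addsmxSr _ _); rewrite eq_row_base.
by have := addsmx_compl_full Q; rewrite /row_full.
Qed.

Section StraightenThm.
Variables (n m d r : nat) (Y : 'rV[R]_n -> 'M[R]_(m, n)) (iota : 'rV[R]_d -> 'rV[R]_n).
Variables (y0 : 'rV[R]_d) (K : R).
Hypothesis HY : \forall x \near iota y0, smooth_at Y x /\ forall i, exists2 C : 'M[R]_m, `|C| <= K &
   'D_(row i (Y x)) Y x - Y x *m 'J (fun y => row i (Y y)) x = C *m Y x.
Hypothesis Hi : \forall y \near y0, [/\ smooth_at iota y, row_free ('J iota y) &
   \rank (Y (iota y) *m cokermx ('J iota y)) = r].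

(* [Psi (t, y1, y2)] follows for unit time the flow of a combination [t *m S] of
   the rows of [Y], starting from [iota y1 + y2 *m N]. *)
Lemma straighten :
  exists (e : nat) (Psi : 'rV[R]_(r + (d + e)) -> 'rV[R]_n) (Th : 'rV[R]_n -> 'rV[R]_(r + (d + e))) (rho : R),
  let w0 : 'rV[R]_(r + (d + e)) := row_mx 0 (row_mx y0 0) in
  [/\ 0 < rho,
      forall w : 'rV[R]_(r + (d + e)), `|w - w0| < rho ->
        [/\ smooth_at Psi w, Th (Psi w) = w & smooth_at Th (Psi w)] /\
        [/\ (usubmx ('J Psi w) <= Y (Psi w))%MS,
            \rank (Y (Psi w)) = \rank (Y (Psi (row_mx 0 (rsubmx w)))) &
            rsubmx (rsubmx w) = 0 -> rsubmx (rsubmx (Y (Psi w) *m 'J Th (Psi w))) = 0],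
      forall A : set 'rV[R]_(r + (d + e)), open A -> (forall w : 'rV[R]_(r + (d + e)), A w -> `|w - w0| < rho) -> open (Psi @` A) &
      forall y : 'rV[R]_d, Psi (row_mx 0 (row_mx y 0)) = iota y].
Proof.
pose c := iota y0.
have [Yt [B [dl [Ys YB dl0 YE Ybr]]]] := cutoff_field HY.
pose Phi := control_flow Yt.
have Phis w : smooth_at Phi w by exact: control_flow_smooth Ys YB w.
have Phi0 x : Phi (row_mx 0 x) = x by exact: control_flow0 Ys YB x.
have JPhi0 x : 'J Phi (row_mx 0 x) = col_mx (Yt x) 1%:M.
  apply: mulmx_rV_inj => v; have e1 := jacE v (Phis (row_mx 0 x)); apply: (etrans e1).
  rewrite -[in LHS](hsubmxK v) -[in RHS](hsubmxK v) mul_row_col mulmx1.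
  move: (lsubmx v) (rsubmx v) => a b.
  have -> : row_mx a b = row_mx a 0 + row_mx 0 b by rewrite add_row_mx addr0 add0r.
  have dP := sa_diff (Phis (row_mx 0 x)).
  rewrite deriveE// linearD/= -!deriveE//; congr (_ + _).
    by have := flow_radial Ys YB a x 0; rewrite !scale0r -/Phi Phi0.
  by apply: derive_affine => h; rewrite scale_row_mx add_row_mx scaler0 add0r !Phi0 addrC.
(* Within [sg] the flow stays where the cut-off fields equal [Y], and its derivative in the starting
   point is invertible: the hypotheses of [flow_span]. *)
have [sg sg0 Hsg] : exists2 sg : R, 0 < sg & forall w : 'rV[R]_(m + n), `|w - row_mx 0 c| < sg ->
    [/\ `|Phi w - c| < dl, dsubmx ('J Phi w) \in unitmx & `|rsubmx w - c| < dl].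
  apply: near_ballP; near=> w; split; near: w.
  - have /cvgrPdist_lt/(_ _ dl0) := sa_cont (Phis (row_mx 0 c)).
    by apply: filterS => w; rewrite Phi0 distrC.
  - have Js : smooth_at (fun w => dsubmx ('J Phi w) : 'M[R]_n) (row_mx 0 c).
      have h := sa_tr (sa_rsubmx (sa_tr (sa_jac (Phis (row_mx 0 c))))).
      by apply: (sa_ext _ h) => w; rewrite trmx_rsub trmxK.
    by apply: (near_unit Js); rewrite JPhi0 col_mxKd unitmx1.
  - have nb : `|row_mx 0 c - row_mx 0 c : 'rV[R]_(m + n)| < dl by rewrite subrr normr0.
    apply: filterS (near_norm_ball nb) => w; apply: le_lt_trans.
    have [_ h _] := row_mx_norm (lsubmx w - 0) (rsubmx w - c).
    by apply: (le_trans h); rewrite -add_row_mx -opp_row_mx hsubmxK.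
have [_ ifree irank] := nbhs_singleton Hi.
(* The rows of [S *m Y c] are r combinations of the fields independent modulo the tangent space of
   X, so together with [J0] they are independent; [N] completes them to a basis. *)
have [S SY] := rank_rows irank.
pose J0 := 'J iota y0; pose Q0 := col_mx (S *m Y c) J0.
have fQ : row_free Q0.
  apply: inj_row_free => v; rewrite -[v]hsubmxK mul_row_col.
  move: (lsubmx v) (rsubmx v) => v1 v2 vQ.
  have v10 : v1 = 0.
    apply: (row_free_inj SY); rewrite mul0mx.
    have := congr1 (mulmxr (cokermx J0)) vQ; rewrite /= mulmxDl mul0mx -[v2 *m J0 *m _]mulmxA mulmx_coker0.
    by rewrite mulmx0 addr0 !mulmxA.
  move: vQ; rewrite v10 mul0mx add0r => vQ.
  have -> : v2 = 0 by apply: (row_free_inj ifree); rewrite mul0mx.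
  exact: row_mx0.
have [e [N [En fQN]]] := complete_basis fQ.
pose w0 : 'rV[R]_(r + (d + e)) := row_mx 0 (row_mx y0 0).
pose A1 : 'M[R]_(r + (d + e), m) := col_mx S 0.
pose A2 : 'M[R]_(r + (d + e), n) := col_mx 0 (col_mx 0 N).
pose P1 : 'M[R]_(r + (d + e), d) := col_mx 0 (col_mx 1%:M 0).
pose E2 : 'M[R]_(n, m + n) := row_mx 0 1%:M.
pose G (w : 'rV[R]_(r + (d + e))) : 'rV[R]_(m + n) := w *m row_mx A1 A2 + iota (w *m P1) *m E2.
have P1E w : w *m P1 = lsubmx (rsubmx w).
  by rewrite -{1}[w]hsubmxK -{1}[rsubmx w]hsubmxK !mul_row_col mulmx0 add0r mulmx1 mulmx0 addr0.
have GE w : G w = row_mx (lsubmx w *m S) (iota (lsubmx (rsubmx w)) + rsubmx (rsubmx w) *m N).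
  rewrite /G P1E mul_mx_row -{1 2}[w]hsubmxK -{1 2}[rsubmx w]hsubmxK /A1 /A2 !mul_row_col !mulmx0 !addr0 !add0r.
  by rewrite mul_mx_row mulmx0 mulmx1 add_row_mx addr0 addrC.
have Gw0 : G w0 = row_mx 0 c.
  by rewrite GE /w0 row_mxKl !row_mxKr row_mxKl mul0mx mul0mx addr0.
have Gs w : smooth_at iota (lsubmx (rsubmx w)) -> smooth_at G w.
  move=> is_; apply: sa_add; first by apply: sa_mulmx; [exact: sa_id|exact: sa_cst].
  apply: sa_mulmx; last exact: sa_cst.
  apply: (@sa_comp _ _ _ _ _ iota (fun w => w *m P1)); last by rewrite P1E.
  by apply: sa_mulmx; [exact: sa_id|exact: sa_cst].
have GJ w (z : 'rV[R]_(r + (d + e))) : smooth_at iota (lsubmx (rsubmx w)) -> z *m 'J G w =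
    row_mx (lsubmx z *m S) (lsubmx (rsubmx z) *m 'J iota (lsubmx (rsubmx w)) + rsubmx (rsubmx z) *m N).
  move=> is_; have e1 := jacE z (Gs w is_); apply: (etrans e1).
  have l1 : smooth_at (fun w : 'rV[R]_(r + (d + e)) => w *m row_mx A1 A2) w.
    by apply: sa_mulmx; [exact: sa_id|exact: sa_cst].
  have l2 : smooth_at (fun w : 'rV[R]_(r + (d + e)) => w *m P1) w.
    by apply: sa_mulmx; [exact: sa_id|exact: sa_cst].
  have is2 : smooth_at iota (w *m P1) by rewrite P1E.
  have l3 := @sa_comp _ _ _ _ _ iota (fun w => w *m P1) w l2 is2.
  have [d3 d4] := derive_mulmxr E2 (@sa_derivable R _ _ _ _ z l3).
  have e2 := @deriveD _ _ _ _ _ w z (@sa_derivable R _ _ _ _ z l1) d3.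
  apply: (etrans e2); rewrite d4 (@derive_comp _ _ _ _ (fun w => w *m P1) iota w z (sa_diff l2) (sa_diff is2)).
  have -> : 'D_z (fun w : 'rV[R]_(r + (d + e)) => w *m P1) w = z *m P1.
    by apply: derive_affine => h; rewrite mulmxDl scalemxAl addrC.
  have -> : 'D_z (fun w : 'rV[R]_(r + (d + e)) => w *m row_mx A1 A2) w = z *m row_mx A1 A2.
    by apply: derive_affine => h; rewrite mulmxDl scalemxAl addrC.
  have e3 := jacE (z *m P1) is2; rewrite -e3 !P1E.
  rewrite mul_mx_row -{1 2}[z]hsubmxK -{1 2}[rsubmx z]hsubmxK /A1 /A2 !mul_row_col !mulmx0 !addr0 !add0r.
  by rewrite mul_mx_row mulmx0 mulmx1 add_row_mx addr0 addrC.
pose Psi := Phi \o G.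
have [is0 _ _] := nbhs_singleton Hi.
have w0E : lsubmx (rsubmx w0) = y0 by rewrite /w0 row_mxKr row_mxKl.
have Psis w : smooth_at iota (lsubmx (rsubmx w)) -> smooth_at Psi w.
  by move=> is_; apply: sa_comp (Gs w is_) (Phis _).
have PsiJ w : smooth_at iota (lsubmx (rsubmx w)) -> 'J Psi w = 'J G w *m 'J Phi (G w).
  by move=> is_; exact: jac_comp (Gs w is_) (Phis _).
have isw0 : smooth_at iota (lsubmx (rsubmx w0)) by rewrite w0E.
have fJ : row_free ('J Psi w0).
  apply: inj_row_free => z; rewrite (PsiJ w0 isw0) mulmxA (GJ w0 z isw0) Gw0 JPhi0 mul_row_col mulmx1 w0E.
  have -> : Yt c = Y c by apply: YE; rewrite subrr normr0.
  rewrite addrA => h.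
  have : row_mx (row_mx (lsubmx z) (lsubmx (rsubmx z))) (rsubmx (rsubmx z)) *m col_mx Q0 N = 0.
    by rewrite mul_row_col /Q0 mul_row_col mulmxA.
  rewrite -[RHS](mul0mx _ (col_mx Q0 N)) => /(row_free_inj fQN) h2.
  rewrite -[z]hsubmxK -[rsubmx z]hsubmxK.
  rewrite -row_mx0 in h2; have [h3 ->] := eq_row_mx h2.
  by rewrite -row_mx0 in h3; have [-> ->] := eq_row_mx h3; rewrite !row_mx0.
have [A0 [B0 [Th [[oA0 A0w oB0] [hA hB]]]]] :=
  inverse_function_cast (etrans (addnA _ _ _) En) (Psis w0 isw0) fJ.
have nG : \forall w \near w0, `|G w - row_mx 0 c| < sg.
  have /cvgrPdist_lt/(_ _ sg0) := sa_cont (Gs w0 isw0).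
  by apply: filterS => w; rewrite Gw0 distrC.
have nI : \forall w \near w0, [/\ smooth_at iota (lsubmx (rsubmx w)), row_free ('J iota (lsubmx (rsubmx w))) &
    \rank (Y (iota (lsubmx (rsubmx w))) *m cokermx ('J iota (lsubmx (rsubmx w)))) = r].
  have := sa_cont (sa_lsubmx (sa_rsubmx (sa_id w0))).
  by rewrite /prop_for /continuous_at w0E => /(_ _ Hi).
have nA : nbhs w0 A0 by apply: open_nbhs_nbhs.
have [rho rho0 Hrho] := near_ballP (filterI nA (filterI nG nI)).
exists e, Psi, Th, rho; split => //; last first.
- by move=> y; rewrite /Psi /= GE row_mxKl !row_mxKr row_mxKl !mul0mx addr0 Phi0.
- move=> A oA Ab; rewrite openE => _ [w Aw <-].
  have [A0w' [_ _]] := Hrho w (Ab w Aw).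
  have [Bw Thw Pw] := hA w A0w'; have [_ _ Ths] := hB _ Bw.
  have nB : nbhs (Psi w) B0 by apply: open_nbhs_nbhs.
  have nT : \forall y \near Psi w, A (Th y).
    by apply: (sa_cont Ths); rewrite Thw; apply: open_nbhs_nbhs.
  apply: filterS (filterI nB nT) => y [By Ay]; exists (Th y) => //.
  by have [] := hB _ By.
move=> w ww.
have [A0w' [Gw [iw jw rw]]] := Hrho w ww.
have [Bw Thw Pw] := hA w A0w'; have [_ _ Ths] := hB _ Bw.
split; first by split.
pose a := lsubmx w *m S; pose x := iota (lsubmx (rsubmx w)) + rsubmx (rsubmx w) *m N.
have GwE : G w = row_mx a x by exact: GE.
(* Scaling the control by s in [0, 1] does not leave the ball for the maximum norm, so the whole
   flow line is controlled and not only its end. *)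
have ax (s : R) : (0 <= s) && (s <= 1) -> `|row_mx (s *: a) x - row_mx 0 c| < sg.
  move=> /andP[s0 s1]; rewrite opp_row_mx add_row_mx subr0.
  have E : G w - row_mx 0 c = row_mx a (x - c) by rewrite GwE opp_row_mx add_row_mx subr0.
  have [h1 h2 _] := row_mx_norm a (x - c); rewrite -E in h1 h2.
  apply: row_mx_norm_lt => //; last exact: le_lt_trans h2 Gw.
  apply: le_lt_trans (le_lt_trans h1 Gw); rewrite normrZ ger0_norm// -[leRHS]mul1r.
  exact: ler_wpM2r.
have gamO (s : R) : (0 <= s) && (s <= 1) -> `|Phi (row_mx (s *: a) x) - c| < dl.
  by move=> /ax/Hsg[].
have Du (s : R) : (0 <= s) && (s <= 1) -> dsubmx ('J Phi (row_mx (s *: a) x)) \in unitmx.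
  by move=> /ax/Hsg[].
have [Kb br] := Ybr a.
have sp := flow_span Ys YB gamO Du br.
have cs := flow_control_span Ys YB gamO Du br.
rewrite -/Phi !scale1r in sp.
have PsiE : Psi w = Phi (row_mx a x) by rewrite /Psi /= GwE.
have s1 : (0 <= (1 : R)) && ((1 : R) <= 1) by rewrite ler01 lexx.
have Ytw : Yt (Psi w) = Y (Psi w).
  by apply: YE; rewrite PsiE -{1}[a]scale1r; exact: gamO.
have Psi0 : Psi (row_mx 0 (rsubmx w)) = x.
  by rewrite /Psi /= GE row_mxKl row_mxKr mul0mx Phi0.
have xdl : `|x - c| < dl.
  by have [_ _] := Hsg _ Gw; rewrite GwE row_mxKr.
have Duw := Du 1 s1; rewrite scale1r -GwE in Duw.
have sp' : (Y (Psi w) :=: Yt x *m dsubmx ('J Phi (G w)))%MS.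
  by rewrite -Ytw PsiE GwE; exact: sp.
have cUE : usubmx (dsubmx ('J Psi w)) = 'J iota (lsubmx (rsubmx w)) *m dsubmx ('J Phi (G w)).
  apply: mulmx_rV_inj => v.
  have -> : v *m usubmx (dsubmx ('J Psi w)) = row_mx 0 (row_mx v 0) *m 'J Psi w.
    move: ('J Psi w) => J; rewrite -[in RHS](vsubmxK J) -[in RHS](vsubmxK (dsubmx J)) !mul_row_col.
    by rewrite !mul0mx add0r addr0.
  rewrite (PsiJ w iw) mulmxA (GJ w _ iw) row_mxKl !row_mxKr row_mxKl !mul0mx addr0.
  move: ('J iota _) ('J Phi _) => J1 J2; rewrite -[in LHS](vsubmxK J2) mul_row_col mul0mx add0r.
  by rewrite mulmxA.
have cV : (usubmx ('J Psi w) <= Y (Psi w))%MS.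
  apply/row_subP => i; rewrite rowE -Ytw.
  have -> : (delta_mx 0 i : 'rV[R]_r) *m usubmx ('J Psi w) = row_mx (delta_mx 0 i) 0 *m 'J Psi w.
    by move: ('J Psi w) => J; rewrite -[in RHS](vsubmxK J) mul_row_col mul0mx addr0.
  rewrite (PsiJ w iw) mulmxA (GJ w _ iw) row_mxKl row_mxKr linear0 linear0 !mul0mx addr0.
  have e1 := jacE (row_mx (delta_mx 0 i *m S) (0 : 'rV[R]_n)) (Phis (G w)).
  rewrite e1 GwE PsiE; have := cs (delta_mx 0 i *m S); rewrite -/Phi scale1r; apply.
split; first exact: cV.
- by rewrite sp' mxrankMfree ?row_free_unit// (YE _ xdl) Psi0.
move=> y20.
have xE : x = iota (lsubmx (rsubmx w)) by rewrite /x y20 mul0mx addr0.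
apply: (span_count _ cV cUE sp' _ jw).
  apply: (jac_cancel Pw Ths).
  have nAw : nbhs w A0 by apply: open_nbhs_nbhs.
  by apply: filterS nAw => z /hA[].
by rewrite (YE _ xdl) xE.
Unshelve. all: by end_near.
Qed.
End StraightenThm.

End Straighten.

(** * Slice charts *)

Section SliceCharts.
Context {R : realType} {M : manifold R} (L : dirac_structure M).
Local Opaque derive jacobian transition tangent_map.

Lemma rank_adds_cokerE m d n (A : 'M[R]_(m, n)) (B : 'M[R]_(d, n)) :
  \rank (A + B)%MS = (\rank (A *m cokermx B) + \rank B)%N.
Proof.
apply/eqP; rewrite eqn_leq rank_adds_coker/=.
rewrite -(mxrank_mul_ker (A + B)%MS (cokermx B)); apply: leq_add.
  by rewrite addsmxMr; apply: mxrankS; exact: addsmxSl.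
by apply: mxrankS; rewrite sub_capmx addsmxSr/= sub_kermx mulmx_coker0.
Qed.

(** The rank of the normal projection depends only on the two subspaces and is unchanged by an
    isomorphism, so coregularity can be read in any chart. *)
Lemma rank_coker_unit m d m' d' n (A : 'M[R]_(m, n)) (B : 'M[R]_(d, n)) (A' : 'M[R]_(m', n))
    (B' : 'M[R]_(d', n)) (D : 'M[R]_n) : D \in unitmx ->
  (A' :=: A *m D)%MS -> (B' :=: B *m D)%MS ->
  \rank (A' *m cokermx B') = \rank (A *m cokermx B).
Proof.
move=> uD AE BE; apply/eqP; rewrite -(eqn_add2r (\rank B')) -rank_adds_cokerE.
rewrite (adds_eqmx AE BE) -addsmxMr BE (mxrankMfree (A + B)%MS) ?(mxrankMfree B) ?row_free_unit//.
by rewrite -rank_adds_cokerE.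
Qed.

Section Def.
Variables (X : manifold R) (i : X -> M) (x0 : X) (r : nat).
Local Notation d := (mdim X).

Definition slice_center e : 'rV[R]_(r + (d + e)) := row_mx 0 (row_mx (cmap (chart_at x0) x0) 0).

(* Coordinates (t, y1, y2) around [i x0] such that [i X] is {t = 0, y2 = 0} near
   the centre (only one inclusion is recorded, in [sc_base]), the t-lines are
   tangent to [pr_T L], and [pr_T L] is tangent to {y2 = 0} along {y2 = 0}. *)
Record slice_chart := SliceChart {
  sc_codim : nat;
  sc_param : euc (r + (d + sc_codim)) -> M;
  sc_coord : M -> euc (r + (d + sc_codim));
  sc_rad : R;
  sc_rad0 : 0 < sc_rad;
  sc_param_sm : forall w : 'rV[R]_(r + (d + sc_codim)),
    `|w - slice_center sc_codim| < sc_rad -> sm sc_param w;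
  sc_coord_sm : forall w : 'rV[R]_(r + (d + sc_codim)),
    `|w - slice_center sc_codim| < sc_rad -> sm sc_coord (sc_param w);
  sc_paramK : forall w : 'rV[R]_(r + (d + sc_codim)),
    `|w - slice_center sc_codim| < sc_rad -> sc_coord (sc_param w) = w;
  sc_tangent : forall w : 'rV[R]_(r + (d + sc_codim)),
    `|w - slice_center sc_codim| < sc_rad ->
    (usubmx (tangent_map sc_param w : 'M[R]_(r + (d + sc_codim), mdim M)) <= pr_T L (sc_param w))%MS;
  sc_rank : forall w : 'rV[R]_(r + (d + sc_codim)),
    `|w - slice_center sc_codim| < sc_rad ->
    \rank (pr_T L (sc_param w)) = \rank (pr_T L (sc_param (row_mx 0 (rsubmx w))));
  sc_inv : forall w : 'rV[R]_(r + (d + sc_codim)),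
    `|w - slice_center sc_codim| < sc_rad -> rsubmx (rsubmx w) = 0 ->
    rsubmx (rsubmx (pr_T L (sc_param w) *m tangent_map sc_coord (sc_param w)
      : 'M[R]_(_, r + (d + sc_codim)))) = 0;
  sc_open : forall A : set 'rV[R]_(r + (d + sc_codim)), open A ->
    (forall w : 'rV[R]_(r + (d + sc_codim)), A w -> `|w - slice_center sc_codim| < sc_rad) ->
    open (sc_param @` A);
  sc_base : forall y : 'rV[R]_d, `|y - cmap (chart_at x0) x0| < sc_rad ->
    exists x, [/\ cdom (chart_at x0) x, cmap (chart_at x0) x = y &
      sc_param (row_mx 0 (row_mx y 0)) = i x]
}.

End Def.
Arguments sc_codim {X i x0 r} s.
Arguments sc_param {X i x0 r} s.
Arguments sc_coord {X i x0 r} s.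
Arguments sc_rad {X i x0 r} s.
Arguments sc_rad0 {X i x0 r} s.
Arguments sc_param_sm {X i x0 r} s [w] _.
Arguments sc_coord_sm {X i x0 r} s [w] _.
Arguments sc_paramK {X i x0 r} s [w] _.
Arguments sc_tangent {X i x0 r} s [w] _.
Arguments sc_rank {X i x0 r} s [w] _.
Arguments sc_inv {X i x0 r} s [w] _ _.
Arguments sc_open {X i x0 r} s [A] _ _.
Arguments sc_base {X i x0 r} s [y] _.

Lemma chart_image_open (p : M) (B : set 'rV[R]_(mdim M)) : open B ->
  B `<=` cmap (chart_at p) @` cdom (chart_at p) -> open (cinv (chart_at p) @` B).
Proof.
move=> oB Bi; rewrite openE => _ [x Bx <-].
have [x1 x2] := cinv_img (Bi x Bx).
have nB : nbhs (cmap (chart_at p) (cinv (chart_at p) x)) B by rewrite x2; apply: open_nbhs_nbhs.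
have := @cmap_continuous _ _ _ (chart_at p) _ x1 _ nB => n1.
have n2 : nbhs (cinv (chart_at p) x) [set q | B (cmap (chart_at p) q)] by exact: n1.
apply: filterS (filterI n2 (chart_nbhs x1)) => q [q1 q2].
by exists (cmap (chart_at p) q) => //; exact: cmapK.
Qed.

Lemma slice_chart_exists (X : manifold R) (i : X -> M) (x0 : X) (r : nat) (U : set M) :
  (\forall x \near x0, [/\ sm i x, row_free (tangent_map i x) &
     \rank (pr_T L (i x) *m cokermx (tangent_map i x)) = r]) ->
  open U -> U (i x0) ->
  exists s : slice_chart i x0 r, forall w : 'rV[R]_(r + (mdim X + sc_codim s)),
    `|w - slice_center x0 r (sc_codim s)| < sc_rad s -> U (sc_param s w).
Proof.
move=> Hi oU Ux0; pose p0 := i x0.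
have [ism _ _] := nbhs_singleton Hi.
have [Y [K HY]] := vector_frame L p0.
pose iota := chart_expr i x0 p0; pose y0 := cmap (chart_at x0) x0.
have ixE : iota y0 = cmap (chart_at p0) p0 by exact: (chart_exprE i p0 (chart_atP x0)).
have HY' : \forall x \near iota y0, smooth_at Y x /\ forall j, exists2 C : 'M[R]_(mdim M), `|C| <= K &
   'D_(row j (Y x)) Y x - Y x *m 'J (fun y => row j (Y y)) x = C *m Y x.
  by rewrite ixE; apply: filterS HY => x [].
have ios : smooth_at iota y0 by exact: (@chart_expr_smooth _ X M i x0 p0 x0 (chart_atP x0) (chart_atP p0) ism).
have nY : \forall y \near y0, (Y (iota y) :=: pr_T L (cinv (chart_at p0) (iota y)) *m
    transition (cinv (chart_at p0) (iota y)) p0 (cinv (chart_at p0) (iota y)))%MS.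
  have nY : \forall x \near cmap (chart_at p0) p0, (Y x :=: pr_T L (cinv (chart_at p0) x) *m
    transition (cinv (chart_at p0) x) p0 (cinv (chart_at p0) x))%MS by apply: filterS HY => x [].
  have := sa_cont ios; rewrite /prop_for /continuous_at ixE => c; exact: (c _ nY).
have Hi' : \forall y \near y0, [/\ smooth_at iota y, row_free ('J iota y) &
   \rank (Y (iota y) *m cokermx ('J iota y)) = r].
  have nx := @chart_expr_near _ X M i x0 p0 x0 _ (chart_atP x0) (chart_atP p0) ism Hi.
  apply: filterS (filterI nY nx) => y [Yy [x [yE ax bx sx [_ fx rx]]]].
  rewrite yE in Yy *.
  have iE : iota (cmap (chart_at x0) x) = cmap (chart_at p0) (i x) by exact: (chart_exprE i p0 ax).
  have [/mulmx1_unit[_ u] _] := transitionK ax; have u' := transition_unit bx.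
  have JE : ('J iota (cmap (chart_at x0) x) :=: tangent_map i x *m transition (i x) p0 (i x))%MS.
    rewrite (chart_exprJ ax bx sx) -mulmxA; apply: eqmxMfull; rewrite row_full_unit; exact: u.
  split.
  - exact: chart_expr_smooth.
  - rewrite /row_free JE mxrankMfree ?row_free_unit; [exact: fx|exact: u'].
  - rewrite -rx; apply: (rank_coker_unit u' _ JE).
    by rewrite iE (cmapK bx) in Yy; rewrite iE.
have [e [Psi [Th [rho1 [rho10 HPsi Hopen Hbase]]]]] := straighten HY' Hi'.
pose w0 : 'rV[R]_(r + (mdim X + e)) := row_mx 0 (row_mx y0 0).
have [Psis _ _] : [/\ smooth_at Psi w0, Th (Psi w0) = w0 & smooth_at Th (Psi w0)].
  by have [] := HPsi w0 _; rewrite ?subrr ?normr0.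
have Psi0 : Psi w0 = cmap (chart_at p0) p0 by rewrite Hbase.
have nU : nbhs p0 U by apply: open_nbhs_nbhs.
have n1 : \forall w \near w0, [/\ (cmap (chart_at p0) @` cdom (chart_at p0)) (Psi w),
     (Y (Psi w) :=: pr_T L (cinv (chart_at p0) (Psi w)) *m
    transition (cinv (chart_at p0) (Psi w)) p0 (cinv (chart_at p0) (Psi w)))%MS &
     U (cinv (chart_at p0) (Psi w))].
  have nn : \forall x \near cmap (chart_at p0) p0, [/\ (cmap (chart_at p0) @` cdom (chart_at p0)) x,
     (Y x :=: pr_T L (cinv (chart_at p0) x) *m
    transition (cinv (chart_at p0) x) p0 (cinv (chart_at p0) x))%MS & U (cinv (chart_at p0) x)].
    by apply: filterS (filterI HY (cinv_near (chart_atP p0) nU)) => x [[]].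
  have := sa_cont Psis; rewrite /prop_for /continuous_at Psi0 => c; exact: (c _ nn).
have [rho2 rho20 H2] := near_ballP n1.
have n3 := @chart_expr_near _ X M i x0 p0 x0 _ (chart_atP x0) (chart_atP p0) ism Hi.
have [rho3 rho30 H3] := near_ballP n3.
(* [rho1] is the radius of the straightening, [rho2] keeps the image in the chart at [p0], in [U]
   and where [Y] spans pr_T L, and [rho3] keeps the middle coordinates in the image of the chart at
   [x0]. *)
pose rho := Num.min rho1 (Num.min rho2 rho3).
have rho0 : 0 < rho by rewrite !lt_min rho10 rho20.
have rhoE (z : R) : z < rho -> [/\ z < rho1, z < rho2 & z < rho3] by rewrite !lt_min => /and3P[].
pose cPsi (w : euc (r + (mdim X + e))) : M := cinv (chart_at p0) (Psi w).
pose cTh (q : M) : euc (r + (mdim X + e)) := Th (cmap (chart_at p0) q).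
have cP w : `|w - w0| < rho -> [/\ cdom (chart_at p0) (cPsi w), cmap (chart_at p0) (cPsi w) = Psi w &
    (Y (Psi w) :=: pr_T L (cPsi w) *m transition (cPsi w) p0 (cPsi w))%MS].
  by move=> /rhoE[h1 h2 h3]; have [/cinv_img[k1 k2] k3 k4] := H2 w h2.
have cPsi_sm w : `|w - w0| < rho -> sm cPsi w /\
    tangent_map cPsi w = 'J Psi w *m transition p0 (cPsi w) (cPsi w).
  move=> ww; have [h1 h2 h3] := rhoE _ ww; have [[Ps _ _] _] := HPsi w h1.
  have [im _ _] := H2 w h2.
  have s1 := (sm_euc Psi w).2 Ps; have s2 := @sm_cinv _ M p0 (Psi w) im.
  split; first exact: (sm_comp s1 s2).
  have e1 := T_comp s1 s2; apply: (etrans e1); rewrite (T_cinv im) T_euc; reflexivity.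
have cTh_sm w : `|w - w0| < rho -> sm cTh (cPsi w) /\
    tangent_map cTh (cPsi w) = transition (cPsi w) p0 (cPsi w) *m 'J Th (Psi w).
  move=> ww; have [h1 h2 h3] := rhoE _ ww; have [[_ _ Ts] _] := HPsi w h1.
  have [k1 k2 k3] := cP w ww.
  have s1 := @sm_cmap _ M p0 (cPsi w) k1.
  have s2 : @sm _ (euc (mdim M)) (euc (r + (mdim X + e))) Th (cmap (chart_at p0) (cPsi w)).
    by rewrite k2; exact: ((sm_euc Th (Psi w)).2 Ts).
  split; first exact: (sm_comp s1 s2).
  have e1 := T_comp s1 s2; apply: (etrans e1); rewrite T_cmap T_euc k2; reflexivity.
have rk w : `|w - w0| < rho -> \rank (pr_T L (cPsi w)) = \rank (Y (Psi w)).
  move=> ww; have [k1 k2 k3] := cP w ww.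
  by rewrite k3 mxrankMfree ?row_free_unit ?transition_unit.
(* The centre has t = 0, so setting t = 0 does not increase the distance in the maximum norm. *)
have sub0 w : `|w - w0| < rho -> `|row_mx 0 (rsubmx w) - w0| < rho.
  apply: le_lt_trans; rewrite /w0 opp_row_mx add_row_mx subr0.
  rewrite -{2}[w]hsubmxK add_row_mx.
  apply: mx_norm_leP => // j l; rewrite mxE; case: splitP => l' _; first by rewrite mxE normr0.
  have [_ h _] := row_mx_norm (lsubmx w + - 0) (rsubmx w - row_mx y0 0).
  exact: le_trans (mx_norm_coord _ _ _) h.
have F1 w : `|w - w0| < rho -> sm cPsi w by move=> /cPsi_sm[].
have F2 w : `|w - w0| < rho -> sm cTh (cPsi w) by move=> /cTh_sm[].
have F3 w : `|w - w0| < rho -> cTh (cPsi w) = w.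
  move=> ww; have [h1 h2 h3] := rhoE _ ww; have [k1 k2 k3] := cP w ww.
  by have [[_ t _] _] := HPsi w h1; rewrite /cTh k2.
have F4 w : `|w - w0| < rho ->
    (usubmx (tangent_map cPsi w : 'M[R]_(r + (mdim X + e), mdim M)) <= pr_T L (cPsi w))%MS.
  move=> ww; have [h1 h2 h3] := rhoE _ ww; have [k1 k2 k3] := cP w ww.
  have [_ [t _ _]] := HPsi w h1; have [_ ->] := cPsi_sm w ww.
  have -> : usubmx ('J Psi w *m transition p0 (cPsi w) (cPsi w)) =
      usubmx ('J Psi w) *m transition p0 (cPsi w) (cPsi w).
    by move: ('J Psi w) (transition _ _ _) => J T; rewrite -{1}[J]vsubmxK mul_col_mx col_mxKu.
  have := submxMr (transition p0 (cPsi w) (cPsi w)) t; rewrite (eqmxMr _ k3) -mulmxA (transitionK k1).1 mulmx1.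
  exact.
have F5 w : `|w - w0| < rho -> \rank (pr_T L (cPsi w)) = \rank (pr_T L (cPsi (row_mx 0 (rsubmx w)))).
  move=> ww; have [h1 h2 h3] := rhoE _ ww.
  rewrite (rk _ ww) (rk _ (sub0 _ ww)).
  by have [_ []] := HPsi w h1.
have F6 w : `|w - w0| < rho -> rsubmx (rsubmx w) = 0 ->
    rsubmx (rsubmx (pr_T L (cPsi w) *m tangent_map cTh (cPsi w) : 'M[R]_(_, r + (mdim X + e)))) = 0.
  move=> ww y0E; have [h1 h2 h3] := rhoE _ ww; have [k1 k2 k3] := cP w ww.
  have [_ [_ _ /(_ y0E) t]] := HPsi w h1; have [_ ->] := cTh_sm w ww.
  have /submxP[c cE] : (pr_T L (cPsi w) *m transition (cPsi w) p0 (cPsi w) <= Y (Psi w))%MS by rewrite k3.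
  rewrite mulmxA cE -mulmxA rsubmx_mul rsubmx_mul t mulmx0; reflexivity.
have F7 (A : set 'rV[R]_(r + (mdim X + e))) : open A ->
    (forall w : 'rV[R]_(r + (mdim X + e)), A w -> `|w - w0| < rho) -> open (cPsi @` A).
  move=> oA Ab.
  have -> : cPsi @` A = cinv (chart_at p0) @` (Psi @` A) by rewrite image_comp.
  apply: chart_image_open.
    by apply: Hopen => // w /Ab/rhoE[].
  by move=> _ [w /Ab/rhoE[_ h _] <-]; have [] := H2 w h.
have F8 y : `|y - y0| < rho -> exists x, [/\ cdom (chart_at x0) x, cmap (chart_at x0) x = y &
    cPsi (row_mx 0 (row_mx y 0)) = i x].
  move=> /rhoE[_ _ /H3[x [x2 x1 x3 _ _]]]; exists x; split; [exact: x1|exact/esym|].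
  rewrite /cPsi Hbase x2 (_ : iota _ = cmap (chart_at p0) (i x)); first exact: cmapK.
  exact: (chart_exprE i p0 x1).
exists (@SliceChart X i x0 r e cPsi cTh rho rho0 F1 F2 F3 F4 F5 F6 F7 F8).
by move=> w /= /rhoE[_ h _]; have [] := H2 w h.
Qed.

End SliceCharts.

Arguments sc_codim {R M L X i x0 r} s.
Arguments sc_param {R M L X i x0 r} s.
Arguments sc_coord {R M L X i x0 r} s.
Arguments sc_rad {R M L X i x0 r} s.
Arguments sc_rad0 {R M L X i x0 r} s.
Arguments sc_param_sm {R M L X i x0 r} s [w] _.
Arguments sc_coord_sm {R M L X i x0 r} s [w] _.
Arguments sc_paramK {R M L X i x0 r} s [w] _.
Arguments sc_tangent {R M L X i x0 r} s [w] _.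
Arguments sc_rank {R M L X i x0 r} s [w] _.
Arguments sc_inv {R M L X i x0 r} s [w] _ _.
Arguments sc_open {R M L X i x0 r} s [A] _ _.
Arguments sc_base {R M L X i x0 r} s [y] _.

(** * Gluing parametrizations *)

Section GlueTopology.
Context {R : realType} (M : manifold R) (k : nat) (I : Type).
Variables (O : I -> set 'rV[R]_k) (g : I -> 'rV[R]_k -> M).

(** The points are those of [M], but the topology is not induced: a leaf may accumulate on
    itself. *)
Definition glue_type := {p : M | exists a y, O a y /\ g a y = p}.

HB.instance Definition _ := gen_eqMixin glue_type.
HB.instance Definition _ := gen_choiceMixin glue_type.

(* The finest topology that makes the parametrizations [g a] continuous. *)
Definition glue_open (A : set glue_type) : Prop :=
  forall a y (x : glue_type), O a y -> sval x = g a y -> A x ->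
  \forall z \near y, O a z -> forall x' : glue_type, sval x' = g a z -> A x'.

Lemma glue_openT : glue_open setT.
Proof. by move=> a y x _ _ _; apply: filterS filterT => z _ _ x' _. Qed.

Lemma glue_openI : setI_closed glue_open.
Proof.
move=> A B oA oB a y x Oy xy [Ax Bx].
have h1 := oA a y x Oy xy Ax; have h2 := oB a y x Oy xy Bx.
by apply: filterS (filterI h1 h2) => z [z1 z2] Oz x' x'z; split; [exact: z1|exact: z2].
Qed.

Lemma glue_openU (J : Type) (f : J -> set glue_type) :
  (forall j, glue_open (f j)) -> glue_open (\bigcup_j f j).
Proof.
move=> H a y x Oy xy [j _ fx]; have h := H j a y x Oy xy fx.
by apply: filterS h => z hz Oz x' x'z; exists j => //; exact: hz.
Qed.

HB.instance Definition _ := isOpenTopological.Build glue_type glue_openT glue_openI glue_openU.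

Lemma glue_nbhsP (x : glue_type) (A : set glue_type) :
  nbhs x A <-> exists B, [/\ glue_open B, B x & B `<=` A].
Proof. by []. Qed.

Lemma glue_openP (A : set glue_type) : open A <-> glue_open A.
Proof.
split=> [|oA]; last first.
  rewrite openE => x Ax; suff : nbhs x A by [].
  by apply/glue_nbhsP; exists A; split; [exact: oA|exact: Ax|exact: subset_refl].
rewrite openE => oA a y x Oy xy Ax; have /glue_nbhsP[B [oB Bx BA]] := oA x Ax.
by apply: filterS (oB a y x Oy xy Bx) => z hz Oz x' x'z; apply: BA; exact: hz.
Qed.

Lemma glue_inj (x y : glue_type) : sval x = sval y -> x = y.
Proof. by case: x y => [x hx] [y hy] /= xy; subst y; congr exist; exact: Prop_irrelevance. Qed.

End GlueTopology.

Section Glue.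
Context {R : realType} (M : manifold R) (k : nat) (I : Type).
Variables (O : I -> set 'rV[R]_k) (g : I -> @euc R k -> M) (rho : I -> M -> @euc R k).
Hypothesis oO : forall a, open (O a).
Hypothesis gs : forall a y, O a y -> sm (g a) y.
Hypothesis rs : forall a y, O a y -> sm (rho a) (g a y).
Hypothesis rg : forall a y, O a y -> rho a (g a y) = y.
(** The overlap of two pieces is open in each. This makes the domains of the charts open and
    excludes pieces that merely cross. *)
Hypothesis ov : forall a b y, O b y -> (exists2 z, O a z & g a z = g b y) ->
  \forall y' \near y, exists2 z, O a z & g a z = g b y'.
(** A sequence of pieces whose images cover the union of all, for second countability. *)
Variable D : nat -> I.
Hypothesis HD : forall a y, O a y -> exists m, exists2 z, O (D m) z & g (D m) z = g a y.
Local Opaque derive jacobian.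

Local Notation T := (glue_type O g).

Lemma sval_continuous : continuous (fun x : T => sval x).
Proof.
move=> x A /near_open[B [oB Bx BA]]; apply/glue_nbhsP.
exists [set x' : T | B (sval x')]; split => //; last by move=> x' /= /BA.
move=> a y x' Oy x'y /= Bx'; rewrite x'y in Bx'.
have n1 : \forall z \near y, B (g a z) by exact: sm_cont (gs Oy) _ (open_nbhs_nbhs (conj oB Bx')).
by apply: filterS n1 => z Bz Oz x2 ->.
Qed.

Section Chart.
Variables (p : T) (a : I).

Definition glue_dom : set T := [set x | exists2 z, O a z & g a z = sval x].
Definition glue_map (x : T) : 'rV[R]_k := rho a (sval x).
(** The point [p] is a default value outside [O a]. *)
Definition glue_inv (z : 'rV[R]_k) : T :=
  if pselect (O a z) is left h then exist _ (g a z) (ex_intro _ a (ex_intro _ z (conj h erefl))) else p.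

Lemma glue_invE z : O a z -> sval (glue_inv z) = g a z.
Proof. by rewrite /glue_inv; case: pselect. Qed.

Lemma glue_dom_open : open glue_dom.
Proof.
apply/glue_openP => b y x Oy xy [z Oz zx].
have h : exists2 z, O a z & g a z = g b y by exists z => //; rewrite zx.
by apply: filterS (ov Oy h) => y' hy' Oy' x' x'y; rewrite /glue_dom /= x'y.
Qed.

Lemma glue_imgE : glue_map @` glue_dom = O a.
Proof.
rewrite /glue_map; apply/seteqP; split => [_ [x [z Oz zx] <-]|z Oz].
  by rewrite -zx rg.
by exists (glue_inv z); [exists z => //|]; rewrite glue_invE// rg.
Qed.

Lemma glue_invK x : glue_dom x -> glue_inv (glue_map x) = x.
Proof. by move=> [z Oz zx]; apply: glue_inj; rewrite /glue_map -zx rg// glue_invE. Qed.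

Lemma glue_map_continuous x : glue_dom x -> {for x, continuous glue_map}.
Proof.
move=> [z Oz zx]; apply: (@continuous_comp _ _ _ (fun x : T => sval x) (rho a)).
  exact: sval_continuous.
by rewrite -zx; exact: sm_cont (rs Oz).
Qed.

Lemma glue_inv_continuous z : (glue_map @` glue_dom) z -> {for z, continuous glue_inv}.
Proof.
rewrite glue_imgE => Oz A /glue_nbhsP[B [oB Bz BA]].
have nO : nbhs z (O a) by apply: open_nbhs_nbhs.
apply: filterS (filterI nO (oB a z _ Oz (glue_invE Oz) Bz)) => z' [Oz' h].
by apply: BA; apply: h => //; exact: glue_invE.
Qed.

Definition glue_chart : chart R T k.
Proof.
apply: (@Chart R T k glue_dom glue_map glue_inv glue_dom_open _ glue_invK glue_map_continuous glue_inv_continuous).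
by rewrite glue_imgE; exact: oO.
Defined.

End Chart.

Definition glue_index (p : T) : I := sval (cid (svalP p)).

Definition glue_chart_at (p : T) := glue_chart p (glue_index p).

Lemma glue_indexP p : glue_dom (glue_index p) p.
Proof. by rewrite /glue_index; case: cid => /= a [y [Oy yE]]; exists y. Qed.

Lemma glue_chart_smooth p q :
  smooth_on (cmap (glue_chart_at p) @` (cdom (glue_chart_at p) `&` cdom (glue_chart_at q)))
            (cmap (glue_chart_at q) \o cinv (glue_chart_at p)).
Proof.
apply: sa_on => _ [x [[y Oy yx] [z Oz zx]] <-].
have -> : cmap (glue_chart_at p) x = y by rewrite /= /glue_map -yx rg.
have s1 := gs Oy; have s2 : sm (rho (glue_index q)) (g (glue_index p) y) by rewrite yx -zx; exact: rs.
have /sm_euc := sm_comp s1 s2; apply: sa_near.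
have nO : nbhs y (O (glue_index p)) by apply: open_nbhs_nbhs.
by apply: filterS nO => y' Oy' /=; rewrite /glue_map glue_invE.
Qed.

Lemma glue_hausdorff : hausdorff_space T.
Proof.
move=> p q pq; apply: glue_inj; apply: (@manifold_hausdorff R M) => A B pA qB.
have [x [Ax Bx]] := pq _ _ (sval_continuous pA) (sval_continuous qB).
by exists (sval x).
Qed.

Lemma glue_second_countable : @second_countable T.
Proof.
have [BB cB [oB bB]] := @rV_second_countable R k.
pose f (mU : nat * set 'rV[R]_k) : set T :=
  [set x | exists2 z, O (D mU.1) z /\ mU.2 z & g (D mU.1) z = sval x].
exists (f @` (setT `*` BB)).
  apply: sub_countable (card_image_le _ _) _.
  by apply: countableX => //; exact: countableP.
split.
  move=> _ [[m U] /= [_ BU] <-]; apply/glue_openP => b y x Oy xy [z [Oz Uz] zx] /=.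
  have h : exists2 z, O (D m) z & g (D m) z = g b y by exists z => //; rewrite zx.
  have s2 : sm (rho (D m)) (g b y) by rewrite -xy -zx; exact: rs.
  have c := sm_cont (sm_comp (gs Oy) s2).
  have nU : nbhs ((rho (D m) \o g b) y) U.
    by rewrite /= -xy -zx rg//; apply: open_nbhs_nbhs; split => //; exact: oB.
  apply: filterS (filterI (ov Oy h) (c _ nU)) => y' [[z' Oz' zy'] Uy'] Oy' x' x'y.
  exists z'; last by rewrite zy'.
  by split => //; rewrite /= -zy' rg// in Uy'.
move=> x A /glue_nbhsP[B [opB Bx BA]].
have [a [y [Oy yx]]] := svalP x.
have [m [z Oz zy]] := HD Oy.
have xz : sval x = g (D m) z by rewrite zy.
have nO : nbhs z (O (D m)) by apply: open_nbhs_nbhs.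
have [U [BU Uz] UB] := bB z _ (filterI nO (opB _ _ _ Oz xz Bx)).
exists (f (m, U)).
  by split; [exists (m, U)|exists z].
move=> x' [z' [Oz' Uz'] zx']; apply: BA.
by have [_ h] := UB z' Uz'; apply: h.
Qed.

Definition glue_manifold : manifold R :=
  @Manifold R T k glue_chart_at glue_indexP glue_chart_smooth glue_hausdorff glue_second_countable.

Definition glue_incl (x : glue_manifold) : M := sval x.

Lemma glue_incl_local (x : glue_manifold) : exists2 y, O (glue_index x) y &
  [/\ glue_incl x = g (glue_index x) y, sm glue_incl x & tangent_map glue_incl x = tangent_map (g (glue_index x)) y].
Proof.
have [y Oy yx] := glue_indexP x; exists y; first exact: Oy.
split; first exact/esym.
  split; first exact: sval_continuous.
  have -> : cmap (chart_at x) x = y by rewrite /= /glue_map -yx rg.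
  have [_ h] := gs Oy; rewrite yx in h; apply: sa_near h.
  have nO : nbhs y (O (glue_index x)) by apply: open_nbhs_nbhs.
  by apply: filterS nO => y' Oy' /=; rewrite /glue_incl glue_invE.
rewrite /tangent_map.
have -> : cmap (chart_at x) x = y by rewrite /= /glue_map -yx rg.
have [_ h] := gs Oy; rewrite yx in h.
have nO : nbhs y (O (glue_index x)) by apply: open_nbhs_nbhs.
have e : {near y, cmap (chart_at (glue_incl x)) \o g (glue_index x) \o cinv (chart_at (y : @euc R k)) =1
    cmap (chart_at (glue_incl x)) \o glue_incl \o cinv (chart_at x)}.
  by apply: filterS nO => y' Oy' /=; rewrite /glue_incl glue_invE.
have e2 := jac_near h e; rewrite -e2 yx; reflexivity.
Qed.

Lemma glue_tangent_sub a b y z : O a y -> O b z -> g a y = g b z ->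
  (tangent_map (g b) z <= tangent_map (g a) y)%MS.
Proof.
move=> Oy Oz yz; have h : exists2 y, O a y & g a y = g b z by exists y.
have s1 := gs Oz; have s2 : sm (rho a) (g b z) by rewrite -yz; exact: rs.
have s3 : sm (g a) (rho a (g b z)) by rewrite -yz rg//; exact: gs.
have s12 := sm_comp s1 s2.
have n : {near z, (g a \o (rho a \o g b)) =1 g b}.
  by apply: filterS (ov Oz h) => z' [y' Oy' yE] /=; rewrite -yE rg.
have [_ ->] := @sm_near R (@euc R k) M _ (g b) z n (sm_comp s12 s3).
have e := T_comp s12 s3; rewrite e /= -yz (rg Oy); exact: submxMl.
Qed.

(** The explicit description of the open sets allows connectedness of a leaf and embeddedness of P
    to be proved on the pieces. *)
Lemma glue_family : exists (N : manifold R) (j : N -> M),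
  [/\ mdim N = k, injective_immersion j,
      range j = [set p | exists a y, O a y /\ g a y = p],
      forall x a y, O a y -> j x = g a y -> (tangent_map j x :=: tangent_map (g a) y)%MS &
      forall A : set N, open A <-> forall a y x, O a y -> j x = g a y -> A x ->
        \forall z \near y, O a z -> forall x', j x' = g a z -> A x'].
Proof.
exists glue_manifold, glue_incl; split.
- by [].
- split.
  + by apply/smooth_mapP => x; have [y _ []] := glue_incl_local x.
  + by move=> x y; exact: glue_inj.
  + move=> x; have [y Oy [xy _ ->]] := glue_incl_local x.
    have n : \forall z \near y, rho (glue_index x) (g (glue_index x) z) = z.
      have nO : nbhs y (O (glue_index x)) by apply: open_nbhs_nbhs.
      by apply: filterS nO => z /rg.
    have e := T_cancel (gs Oy) (rs Oy) n.
    by apply/row_freeP; exists (tangent_map (rho (glue_index x)) (g (glue_index x) y)).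
- apply/seteqP; split => [_ [x _ <-]|p [a [y [Oy yp]]]]; first exact: svalP.
  by exists (exist _ p (ex_intro _ a (ex_intro _ y (conj Oy yp)))).
- move=> x a y Oy xy; have [z Oz [xz _ ->]] := glue_incl_local x.
  have E : g a y = g (glue_index x) z by rewrite -xy -xz.
  by apply/eqmxP/andP; split; [exact: glue_tangent_sub Oy Oz E|exact: glue_tangent_sub Oz Oy (esym E)].
- by move=> A; exact: glue_openP.
Qed.

End Glue.

(** * Plaques and leaves *)

Section Topology.

(** Connectedness in the form used for continuation along a leaf or a t-line: a property that is
    locally stable along [A], and whose negation is too, spreads from one point to all of [A]. *)
Lemma clopen_propagation (T : topologicalType) (A : set T) (Q : T -> Prop) (x0 : T) :
  connected A -> A x0 -> Q x0 ->
  (forall x, A x -> Q x -> \forall y \near x, A y -> Q y) ->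
  (forall x, A x -> ~ Q x -> \forall y \near x, A y -> ~ Q y) ->
  forall x, A x -> Q x.
Proof.
move=> cA Ax0 Qx0 H1 H2.
have /(_ _ _ _) h := cA (A `&` [set x | Q x]).
have E : A `&` [set x | Q x] = A.
  apply: h.
  - by exists x0.
  - exists (interior [set x | A x -> Q x]); first exact: open_interior.
    apply/seteqP; split => x [Ax xQ]; split => //; first exact: H1.
    by have := nbhs_singleton xQ; exact.
  - exists (~` interior [set x | A x -> ~ Q x]); first by apply: open_closedC; exact: open_interior.
    apply/seteqP; split => x [Ax xQ]; split => //.
      by move=> h; have := nbhs_singleton h; apply.
    by apply: contrapT => nQ; apply: xQ; exact: H2.
by move=> x; rewrite -{1}E => -[].
Qed.

(** For each basic open set contained in some [V i] one such [i] is chosen; [f] numbers the basis,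
    and [i0] fills the remaining numbers. *)
Lemma lindelof (T : topologicalType) (I : Type) (V : I -> set T) (i0 : I) :
  @second_countable T -> (forall i, open (V i)) ->
  exists D : nat -> I, forall i x, V i x -> exists m, V (D m) x.
Proof.
move=> [BB cB [oB bB]] oV.
have /countable_injP[f finj] := cB.
have H m : exists i, (exists j b, [/\ BB b, f b = m & b `<=` V j]) -> exists b, [/\ BB b, f b = m & b `<=` V i].
  have [[j [b hb]]|n] := pselect (exists j b, [/\ BB b, f b = m & b `<=` V j]).
    by exists j => _; exists b.
  by exists i0.
pose D m := sval (cid (H m)).
exists D => i x Vx.
have [b [Bb bx] bV] := bB x _ (open_nbhs_nbhs (conj (oV i) Vx)).
exists (f b); rewrite /D; case: cid => i' /= []; first by exists i, b.
move=> b' [Bb' fb b'V]; apply: b'V.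
by rewrite (finj b' b) ?inE.
Qed.

Lemma countable_seq (T : Type) (A : set T) (a : T) : countable A -> A a ->
  exists s : nat -> T, (forall m, A (s m)) /\ forall x, A x -> exists m, s m = x.
Proof.
move=> /countable_injP[f finj] Aa.
have H m : exists x, A x /\ ((exists2 y, A y & f y = m) -> f x = m).
  have [[y Ay fy]|n] := pselect (exists2 y, A y & f y = m); first by exists y.
  by exists a.
exists (fun m => sval (cid (H m))); split=> [m|x Ax]; first by case: cid => x [].
exists (f x); case: cid => y /= [Ay h]; apply: finj; rewrite ?inE//.
by apply: h; exists x.
Qed.

End Topology.

Section SliceImage.
Context {R : realType} {M : manifold R} (L : dirac_structure M).
Local Opaque derive jacobian transition tangent_map.
Variables (X : manifold R) (i : X -> M) (x0 : X) (r : nat) (s : slice_chart L i x0 r).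
Local Notation e := (sc_codim s).
Local Notation w0 := (slice_center x0 r (sc_codim s)).

Definition slice_image : set M := sc_param s @` [set w : 'rV[R]_(r + (mdim X + e)) | `|w - w0| < sc_rad s].

Lemma slice_image_open : open slice_image.
Proof. by apply: sc_open => //; exact: norm_ball_open. Qed.

Lemma slice_imageP q : slice_image q ->
  `|(sc_coord s q : 'rV[R]_(r + (mdim X + e))) - w0| < sc_rad s /\ sc_param s (sc_coord s q) = q.
Proof. by move=> [w /= ww <-]; rewrite (sc_paramK s ww). Qed.

Lemma sc_jacK w : `|w - w0| < sc_rad s ->
  tangent_map (sc_param s) w *m tangent_map (sc_coord s) (sc_param s w) = 1%:M.
Proof.
move=> ww; apply: T_cancel; [exact: sc_param_sm|exact: sc_coord_sm|].
by apply: filterS (near_norm_ball ww) => w' /(sc_paramK s).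
Qed.

Lemma slice_coord_sm q : slice_image q -> sm (sc_coord s) q.
Proof. by move=> [w ww <-]; exact: sc_coord_sm. Qed.

(** A common form for integral submanifolds and for t-lines of slice charts. The tangent spaces may
    be smaller than pr_T L, but the rank of pr_T L has to be constant along the map. *)
Definition tangent_near (N : manifold R) (f : N -> M) (x : N) := \forall y \near x,
  [/\ sm f y, (tangent_map f y <= pr_T L (f y))%MS & \rank (pr_T L (f y)) = r].

(* Where [pr_T L] has the minimal rank [r], it is spanned by the first [r]
   coordinate fields of the chart. *)
Lemma slice_pr_T q : slice_image q -> \rank (pr_T L q) = r ->
  rsubmx (pr_T L q *m tangent_map (sc_coord s) q : 'M[R]_(_, r + (mdim X + e))) = 0.
Proof.
move=> [w ww <-] rq; have JT := sc_jacK ww.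
have t := sc_tangent s ww.
pose J : 'M[R]_(r + (mdim X + e), mdim M) := tangent_map (sc_param s) w.
have fJ : row_free J by apply/row_freeP; exists (tangent_map (sc_coord s) (sc_param s w)).
have fU : row_free (usubmx J).
  apply: inj_row_free => v vJ.
  have : row_mx v 0 *m J = 0 by rewrite -[J]vsubmxK mul_row_col vJ mul0mx addr0.
  by rewrite -[RHS](mul0mx _ J) => /(row_free_inj fJ)/(congr1 lsubmx); rewrite row_mxKl linear0.
have : (pr_T L (sc_param s w) <= usubmx J)%MS.
  by have := mxrank_leqif_sup t; rewrite /leqif rq (eqnP fU) eqxx => -[_ <-].
move=> /submxP[c ->]; rewrite -mulmxA.
have -> : usubmx J *m tangent_map (sc_coord s) (sc_param s w) = row_mx 1%:M 0.
  move: JT; rewrite -/J -{1}[J]vsubmxK mul_col_mx scalar_mx_block.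
  by move=> /eq_col_mx[].
by rewrite rsubmx_mul row_mxKr mulmx0.
Qed.

(** The last d + e coordinates of [f] have zero derivative by [slice_pr_T], and the mean value
    inequality with bound 0 makes them constant on a ball in a chart. *)
Lemma slice_constant (N : manifold R) (f : N -> M) (x : N) :
  slice_image (f x) -> tangent_near f x ->
  \forall y \near x, slice_image (f y) /\
    rsubmx (sc_coord s (f y) : 'rV[R]_(r + (mdim X + e))) = rsubmx (sc_coord s (f x) : 'rV[R]_(r + (mdim X + e))).
Proof.
move=> fx Hf; have [fs _ _] := nbhs_singleton Hf.
have n1 : \forall y \near x, slice_image (f y).
  by apply: (sm_cont fs); apply: open_nbhs_nbhs; split => //; exact: slice_image_open.
pose F (z : 'rV[R]_(mdim N)) : 'rV[R]_(r + (mdim X + e)) := sc_coord s (f (cinv (chart_at x) z)).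
have n2 : \forall z \near cmap (chart_at x) x, smooth_at F z /\ rsubmx ('J F z) = 0.
  apply: filterS (filterI (cimg_nbhs (chart_atP x)) (cinv_near (chart_atP x) (filterI n1 Hf))) => z [z1 [z2 [z3 z4 z5]]].
  have s1 := @sm_cinv _ N x z z1.
  have s2 := slice_coord_sm z2.
  have s3 := sm_comp z3 s2; have s4 := sm_comp s1 s3.
  split; first exact/sm_euc.
  have e1 := T_comp s1 s3; have e2 := T_comp z3 s2; rewrite T_euc in e1.
  rewrite (etrans e1 (congr1 (mulmx _) e2)) rsubmx_mul.
  have /submxP[c ->] := z4; rewrite -mulmxA rsubmx_mul (slice_pr_T z2 z5).
  by rewrite !mulmx0.
have [rho rho0 Hrho] := near_ballP n2.
have n3 : \forall y \near x, `|cmap (chart_at x) y - cmap (chart_at x) x| < rho.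
  have h : `|cmap (chart_at x) x - cmap (chart_at x) x| < rho by rewrite subrr normr0.
  exact: @cmap_continuous _ _ _ (chart_at x) x (chart_atP x) _ (near_norm_ball h).
apply: filterS (filterI n1 (filterI n3 (chart_nbhs (chart_atP x)))) => y [y1 [y2 y3]].
split => //; pose z0 := cmap (chart_at x) x; pose v := cmap (chart_at x) y - z0.
have FE q : cdom (chart_at x) q -> sc_coord s (f q) = F (cmap (chart_at x) q).
  by move=> cq; rewrite /F cmapK.
rewrite (FE y y3) (FE x (chart_atP x)); apply/eqP; rewrite -subr_eq0 -normr_le0.
have -> : cmap (chart_at x) y = z0 + v by rewrite /v addrC subrK.
apply: (@mvt_ineq R _ _ _ (fun z => rsubmx (F z)) z0 v 0) => t /andP[t0 t1].
have tz : `|z0 + t *: v - z0| < rho.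
  rewrite addrAC subrr add0r normrZ ger0_norm// (le_lt_trans _ y2)// -[leRHS]mul1r.
  exact: ler_wpM2r.
have [Fs F0] := Hrho _ tz; have rs := sa_rsubmx Fs.
split; first exact: sa_derivable.
have -> : 'D_v (fun z => rsubmx (F z)) (z0 + t *: v) = 0; last by rewrite normr0.
apply/matrixP => k l; rewrite -(derive_entry _ _ (sa_derivable rs)).
have -> : (fun y => rsubmx (F y) k l) = (fun y => F y k (rshift r l)) by apply/funext => q; rewrite mxE.
rewrite (derive_entry _ _ (sa_derivable Fs)) -(jacE _ Fs).
have := congr1 (fun A : 'M[R]_(mdim N, mdim X + e) => (v *m A) k l) F0; rewrite -rsubmx_mul mulmx0 mxE => ->.
by rewrite !mxE.
Qed.

End SliceImage.

Lemma norm_ball_connected (R : realType) k (c : 'rV[R]_k) (rho : R) : 0 < rho ->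
  connected [set t : 'rV[R]_k | `|t - c| < rho].
Proof.
move=> rho0; pose seg (t : 'rV[R]_k) := (fun s : R => c + s *: (t - c)) @` `[0, 1]%classic.
have -> : [set t : 'rV[R]_k | `|t - c| < rho] = \bigcup_(t in [set t : 'rV[R]_k | `|t - c| < rho]) seg t.
  apply/seteqP; split => [t tr|u [t /= tr [s /=]]].
    exists t => //; exists 1; first by rewrite /= in_itv/= ler01 lexx.
    by rewrite scale1r addrC subrK.
  rewrite in_itv/= => /andP[s0 s1] <-; rewrite addrAC subrr add0r normrZ ger0_norm//.
  by rewrite (le_lt_trans _ tr)// -[leRHS]mul1r ler_wpM2r.
apply: bigcup_connected.
  exists c => t _; exists 0; first by rewrite /= in_itv/= ler01 lexx.
  by rewrite scale0r addr0.
move=> t _; apply: connected_continuous_connected; first exact: segment_connected.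
apply: continuous_subspaceT => s.
apply: (@continuousD _ _ _ (fun=> c) (fun s : R => s *: (t - c))); first exact: cst_continuous.
apply/continuous_mxP => i j.
have -> : (fun y : R => (y *: (t - c)) i j) = (fun y => y * (t - c) i j) by apply/funext => y; rewrite mxE.
by apply: continuousM; [exact: cvg_id|exact: cst_continuous].
Qed.

Section Leaves.
Context {R : realType} {M : manifold R} (L : dirac_structure M).
Local Opaque derive jacobian transition tangent_map.

Section Slices.
Variables (X : manifold R) (i : X -> M) (x0 : X) (r : nat) (s : slice_chart L i x0 r).
Local Notation e := (sc_codim s).
Local Notation w0 := (slice_center x0 r (sc_codim s)).

Definition slice_dom (v : 'rV[R]_(mdim X + e)) : set 'rV[R]_r :=
  [set t | `|row_mx t v - w0| < sc_rad s].

Definition slice_map (v : 'rV[R]_(mdim X + e)) (t : @euc R r) : M := sc_param s (row_mx t v).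

Definition transverse (q : M) : 'rV[R]_(mdim X + e) :=
  rsubmx (sc_coord s q : 'rV[R]_(r + (mdim X + e))).

Definition slice_time (q : M) : @euc R r :=
  lsubmx (sc_coord s q : 'rV[R]_(r + (mdim X + e))).

Definition plaque (q : M) : set M := [set q' | slice_image s q' /\ transverse q' = transverse q].

Lemma slice_dom_open v : open (slice_dom v).
Proof.
have cn : continuous (fun t : 'rV[R]_r => `|row_mx t v - w0|).
  move=> t; apply: (@continuous_comp _ _ _ (fun t : 'rV[R]_r => row_mx t v - w0) (fun z : 'rV[R]_(r + (mdim X + e)) => `|z|) t).
    by apply: sa_cont; apply: sa_add; [apply: sa_row_mx; [exact: sa_id|exact: sa_cst]|exact: sa_cst].
  exact: norm_continuous.
exact: (open_comp (fun z _ => cn z) (@open_lt _ _)).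
Qed.

(** For the maximum norm the conditions on t and on the transverse coordinate separate, so a plaque
    is parametrised by a full ball and is connected. *)
Lemma slice_dom_ball q : slice_image s q -> slice_dom (transverse q) = [set t | `|t - 0| < sc_rad s].
Proof.
move=> /slice_imageP[qr _]; rewrite /slice_dom /transverse.
rewrite -[sc_coord s q](hsubmxK (sc_coord s q : 'rV[R]_(r + (mdim X + e)))) in qr.
move: qr; move: (lsubmx _) (rsubmx _) => u v.
rewrite /slice_center; move: (row_mx (cmap (chart_at x0) x0) 0) => cc.
rewrite opp_row_mx add_row_mx => uv.
have [_ h _] := row_mx_norm (u + - 0) (v - cc).
have vr := le_lt_trans h uv.
apply/seteqP; split => t /=; rewrite add_row_mx => tr.
  by have [h1 _ _] := row_mx_norm (t + - 0) (v - cc); exact: le_lt_trans h1 tr.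
by apply: row_mx_norm_lt => //; exact: (sc_rad0 s).
Qed.

Lemma slice_map_sm v t : slice_dom v t -> sm (slice_map v) t /\
  tangent_map (slice_map v) t = usubmx (tangent_map (sc_param s) (row_mx t v) : 'M[R]_(r + (mdim X + e), mdim M)).
Proof.
move=> tv; have sa1 : smooth_at (fun t : 'rV[R]_r => row_mx t v) t.
  by apply: sa_row_mx; [exact: sa_id|exact: sa_cst].
have s1 := (sm_euc (fun t : 'rV[R]_r => row_mx t v) t).2 sa1.
have s2 := sc_param_sm s tv.
split; first exact: (sm_comp s1 s2).
have e1 := T_comp s1 s2; apply: (etrans e1); rewrite T_euc.
have -> : 'J (fun t : 'rV[R]_r => row_mx t v) t = row_mx 1%:M 0.
  apply: mulmx_rV_inj => z; have e2 := jacE z sa1; apply: (etrans e2).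
  rewrite mul_mx_row mulmx1 mulmx0; apply: derive_affine => h.
  by rewrite scale_row_mx add_row_mx scaler0 addr0 addrC.
move: (tangent_map (sc_param s) _) => J; rewrite -[J in LHS](vsubmxK (J : 'M[R]_(r + (mdim X + e), mdim M))).
by rewrite mul_row_col mul1mx mul0mx addr0.
Qed.

Lemma slice_map_plaque q t : slice_image s q -> slice_dom (transverse q) t ->
  plaque q (slice_map (transverse q) t) /\ slice_time (slice_map (transverse q) t) = t.
Proof.
move=> _ tq; split; last by rewrite /slice_time /slice_map (sc_paramK s tq) row_mxKl.
split; first by exists (row_mx t (transverse q)).
by rewrite /transverse /slice_map (sc_paramK s tq) row_mxKr.
Qed.

Lemma plaque_param q q' : plaque q q' -> slice_dom (transverse q) (slice_time q') /\
  slice_map (transverse q) (slice_time q') = q'.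
Proof.
move=> [/slice_imageP[h1 h2] <-].
by rewrite /slice_dom /slice_map /transverse /slice_time /= hsubmxK.
Qed.

Lemma plaque_rank q q' : slice_image s q -> plaque q q' -> \rank (pr_T L q') = \rank (pr_T L q).
Proof.
move=> /slice_imageP[h1 h2] [/slice_imageP[h3 h4] h5].
rewrite -h2 -h4 (sc_rank s h1) (sc_rank s h3).
by move: h5; rewrite /transverse => ->.
Qed.

Lemma slice_tangent_near q t : slice_image s q -> \rank (pr_T L q) = r ->
  slice_dom (transverse q) t -> tangent_near L r (slice_map (transverse q)) t.
Proof.
move=> qs qr tq; have nt : nbhs t (slice_dom (transverse q)).
  by apply: open_nbhs_nbhs; split => //; exact: slice_dom_open.
apply: filterS nt => t' t'q; have [h1 h2] := slice_map_sm t'q; split => //.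
  by rewrite h2; exact: sc_tangent.
have [h3 _] := slice_map_plaque qs t'q.
by rewrite (plaque_rank qs h3).
Qed.

Lemma slice_map_rank q t : slice_image s q -> slice_dom (transverse q) t ->
  \rank (tangent_map (slice_map (transverse q)) t) = r.
Proof.
move=> qs tq; have [_ ->] := slice_map_sm tq; have JT := sc_jacK tq.
pose J : 'M[R]_(r + (mdim X + e), mdim M) := tangent_map (sc_param s) (row_mx t (transverse q)).
rewrite -/J in JT *; have fJ : row_free J by apply/row_freeP; exists (tangent_map (sc_coord s) (sc_param s (row_mx t (transverse q)))).
apply/eqP; apply: inj_row_free => v vJ.
have : row_mx v 0 *m J = 0 by rewrite -[J]vsubmxK mul_row_col vJ mul0mx addr0.
by rewrite -[RHS](mul0mx _ J) => /(row_free_inj fJ)/(congr1 lsubmx); rewrite row_mxKl linear0.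
Qed.

End Slices.

Lemma point_chart_exists (U : set M) (p : M) : open U -> U p ->
  exists s : slice_chart L (fun _ : @euc R 0 => p) (0 : 'rV[R]_0) (\rank (pr_T L p)),
    slice_image s `<=` U.
Proof.
move=> oU Up.
have [|s Hs] := @slice_chart_exists R M L (@euc R 0) (fun=> p) (0 : 'rV[R]_0) (\rank (pr_T L p)) U _ oU Up.
  apply: filterS filterT => x _; split; first exact: sm_cst.
    by apply: inj_row_free => v _; apply/rowP => -[].
  apply/eqP; rewrite -(eqn_add2r (\rank (tangent_map (fun _ : @euc R 0 => p) x))) -rank_adds_cokerE.
  have -> : tangent_map (fun _ : @euc R 0 => p) x = 0 by apply/matrixP => -[].
  by rewrite mxrank0 addn0 addsmx0.
by exists s => q [w ww <-]; exact: Hs.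
Qed.

End Leaves.
Arguments slice_dom {R M L X i x0 r} s v.
Arguments slice_map {R M L X i x0 r} s v t.
Arguments transverse {R M L X i x0 r} s q.
Arguments slice_time {R M L X i x0 r} s q.
Arguments plaque {R M L X i x0 r} s q.
Arguments slice_image {R M L X i x0 r} s.

(** * The leaf through a point *)

Section LeafThroughPoint.
Context {R : realType} {M : manifold R} (L : dirac_structure M).
Variables (U : set M) (p : M).
Hypotheses (oU : open U) (Up : U p).
Local Opaque derive jacobian transition tangent_map.
Local Notation r := (\rank (pr_T L p)).

(** The rank of pr_T L is constant along a leaf. At the points with the rank of [p], plaques have
    the dimension of pr_T L and are themselves integral submanifolds. *)
Definition same_rank : set M := [set q | U q /\ \rank (pr_T L q) = r].

Let I0 := {q | same_rank q}.
Let p0 : I0 := exist _ p (conj Up erefl).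

Let ch_ex (q : I0) : exists s : slice_chart L (fun _ : @euc R 0 => sval q) (0 : 'rV[R]_0) r,
  slice_image s `<=` U.
Proof.
case: q => q [Uq qr] /=; have [s Hs] := point_chart_exists L oU Uq.
by move: s Hs; rewrite qr => s Hs; exists s.
Qed.

Let ch (q : I0) := sval (cid (ch_ex q)).

Let chU q : slice_image (ch q) `<=` U.
Proof. by rewrite /ch; case: cid. Qed.

Let ch_self q : slice_image (ch q) (sval q).
Proof.
exists (slice_center (0 : @euc R 0) r (sc_codim (ch q))); first by rewrite /= subrr normr0 sc_rad0.
have [|x [_ _]] := @sc_base _ _ _ _ _ _ _ (ch q) (cmap (chart_at (0 : @euc R 0)) (0 : @euc R 0)).
  by rewrite subrr normr0 sc_rad0.
exact.
Qed.

Let D_ex : exists D : nat -> I0, forall q x, slice_image (ch q) x -> exists m, slice_image (ch (D m)) x.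
Proof.
apply: (@lindelof M I0 (fun q => slice_image (ch q)) p0); first exact: manifold_second_countable.
by move=> q; exact: slice_image_open.
Qed.

Let D := sval (cid D_ex).
Let V m := slice_image (ch (D m)).
Let vm m := transverse (ch (D m)).
Let Pl m := plaque (ch (D m)).

Let V_cover q : same_rank q -> exists m, V m q.
Proof.
move=> qM; rewrite /V /D; case: cid => D' /= HD'.
exact: (HD' (exist _ q qM) q (ch_self (exist _ q qM))).
Qed.

Let Pl_rank m q q' : same_rank q -> V m q -> Pl m q q' -> same_rank q'.
Proof.
move=> [Uq qr] Vq h; split; first by have [/chU] := h.
by rewrite (plaque_rank Vq h).
Qed.

(** One point for each plaque of the chart [m] met by the plaque of [q0]: the sets where the
    transverse coordinate of [m] is locally constant cover the parameters, and Lindelöf's theorem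
    extracts a sequence. *)
Let reps m0 q0 m : same_rank q0 -> V m0 q0 -> exists E : set M,
  [/\ countable E, forall q, E q -> Pl m0 q0 q /\ V m q &
      forall q, Pl m0 q0 q -> V m q -> exists2 q', E q' & vm m q' = vm m q].
Proof.
move=> [Uq0 qr0] Vq0.
have [[q1 [Pq1 Vq1]]|n] := pselect (exists q, Pl m0 q0 q /\ V m q); last first.
  exists set0; split => // q Pq Vq; exfalso; apply: n; by exists q.
pose s0 := ch (D m0); pose g := slice_map s0 (transverse s0 q0).
pose J := {t : 'rV[R]_r | slice_dom s0 (transverse s0 q0) t /\ V m (g t)}.
have gJ q : Pl m0 q0 q -> V m q -> exists t : J, g (sval t) = q.
  move=> Pq Vq; have [h1 h2] := plaque_param Pq.
  have h : slice_dom s0 (transverse s0 q0) (slice_time s0 q) /\ V m (g (slice_time s0 q)).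
    by split => //; rewrite /g h2.
  by exists (exist _ (slice_time s0 q) h).
have [t1 _] := gJ q1 Pq1 Vq1.
pose W (t : J) : set 'rV[R]_r := interior [set t' | vm m (g t') = vm m (g (sval t))].
have Wt (t : J) : W t (sval t).
  have [h1 h2] := svalP t.
  have tn := @slice_tangent_near _ _ _ _ _ _ _ s0 q0 (sval t) Vq0 qr0 h1.
  by apply: filterS (slice_constant h2 tn) => t' [].
have [D' HD'] := @lindelof 'rV[R]_r J W t1 (@rV_second_countable R r) (fun t => open_interior _).
exists (range (fun k => g (sval (D' k)))); split.
- exact: sub_countable (card_image_le _ _) (countableP _).
- move=> _ [k _ <-]; have [h1 h2] := svalP (D' k); split => //.
  by have [h _] := slice_map_plaque Vq0 h1.
- move=> q Pq Vq; have [t tq] := gJ q Pq Vq; have [k hk] := HD' t (sval t) (Wt t).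
  exists (g (sval (D' k))); first by exists k.
  by rewrite -tq; have /= := nbhs_singleton hk; move=> ->.
Qed.

Let E q0 m0 m : set M :=
  if pselect (same_rank q0 /\ V m0 q0) is left h then sval (cid (reps m h.1 h.2)) else set0.

Let E_countable q0 m0 m : countable (E q0 m0 m).
Proof. by rewrite /E; case: pselect => // h; case: cid => A /= []. Qed.

Let E_sub q0 m0 m q : E q0 m0 m q -> [/\ same_rank q0, V m0 q0, Pl m0 q0 q & V m q].
Proof. by rewrite /E; case: pselect => // -[h1 h2]; case: cid => A /= [_ H _] /H[]. Qed.

Let E_rep q0 m0 m q : same_rank q0 -> V m0 q0 -> Pl m0 q0 q -> V m q ->
  exists2 q', E q0 m0 m q' & vm m q' = vm m q.
Proof.
move=> h1 h2 h3 h4; rewrite /E; case: pselect => [h|n]; last by exfalso; exact: n.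
by case: cid => A /= [_ _]; exact.
Qed.

(* A countable set of points meeting every plaque that is reached from [p] through a
   chain of k successively intersecting plaques: the plaques of one chart meeting a
   given plaque are countably many since the transverse coordinate is locally
   constant on the latter. *)
Fixpoint leaf_points (k : nat) : set M :=
  if k is k'.+1 then \bigcup_(q in leaf_points k') \bigcup_m0 \bigcup_m E q m0 m else [set p].

Let DD := \bigcup_k leaf_points k.

Let leaf_points_rank k : leaf_points k `<=` same_rank.
Proof.
elim: k => [|k IH] q /=; first by move=> ->.
move=> [q0 /IH q0M [m0 _ [m _ /E_sub[_ Vq0 Pq _]]]].
exact: Pl_rank q0M Vq0 Pq.
Qed.

Let DD_countable : countable DD.
Proof.
apply: bigcup_countable => // k _; elim: k => [|k IH] /=; first exact: countable1.
by apply: bigcup_countable => // q _; apply: bigcup_countable => // m0 _; apply: bigcup_countable.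
Qed.

Let DDp : DD p. Proof. by exists 0%N. Qed.

Let DD_rank : DD `<=` same_rank.
Proof. by move=> q [k _ /leaf_points_rank]. Qed.

Definition leaf : set M := [set q | exists q0 m, [/\ DD q0, V m q0 & Pl m q0 q]].

Let leaf_rank : leaf `<=` same_rank.
Proof. by move=> q [q0 [m [/DD_rank h1 h2 h3]]]; exact: Pl_rank h1 h2 h3. Qed.

Lemma leaf_self : leaf p.
Proof.
have [m Vp] := V_cover (DD_rank DDp).
by exists p, m; split.
Qed.

(** The leaf contains every plaque it meets: such a plaque coincides with that of a representative
    in the next stage of [leaf_points]. *)
Let leaf_plaque m q q' : leaf q -> V m q -> Pl m q q' -> leaf q'.
Proof.
move=> [q0 [m0 [[k _ kq0] Vq0 Pq]]] Vq [Vq' q'q].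
have q0M := leaf_points_rank kq0.
have [q1 Eq1 q1q] := E_rep q0M Vq0 Pq Vq.
have [_ _ _ Vq1] := E_sub Eq1.
exists q1, m; split => //.
  by exists k.+1 => //; exists q0 => //; exists m0 => //; exists m.
by split => //; apply: etrans q'q _; exact/esym.
Qed.

(** Along [f] the image stays locally in one plaque. Within the points of the right rank, the leaf
    and its complement are both unions of plaques, so membership in the leaf neither begins nor
    ends. *)
Lemma leaf_propagation (N : manifold R) (f : N -> M) (A : set N) (x1 : N) :
  connected A -> A x1 -> leaf (f x1) ->
  (forall x, A x -> U (f x) /\ tangent_near L r f x) -> forall x, A x -> leaf (f x).
Proof.
move=> cA Ax1 fx1 H.
have loc x : A x -> exists m, V m (f x) /\ \forall y \near x, Pl m (f x) (f y).
  move=> Ax; have [Ux tx] := H x Ax; have [_ _ rx] := nbhs_singleton tx.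
  have [m Vm] := V_cover (conj Ux rx).
  by exists m; split => //; exact: slice_constant.
apply: (clopen_propagation cA Ax1 fx1) => x Ax Sx; have [m [Vm nm]] := loc x Ax.
  by apply: filterS nm => y Py _; exact: leaf_plaque Sx Vm Py.
apply: filterS nm => y [Vy Py] _ Sy; apply: Sx.
by apply: leaf_plaque Sy Vy _; split => //; exact/esym.
Qed.

(** The plaques of the leaf, indexed by a chart number and a point of the countable set [DD]; this
    countability becomes second countability of the leaf. *)
Let J := {mq : nat * M | DD mq.2 /\ V mq.1 mq.2}.
Let cq (a : J) := (sval a).2.
Let cc (a : J) := ch (D (sval a).1).
Let O (a : J) : set 'rV[R]_r := slice_dom (cc a) (transverse (cc a) (cq a)).
Let g (a : J) : @euc R r -> M := slice_map (cc a) (transverse (cc a) (cq a)).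
Let rho (a : J) : M -> @euc R r := slice_time (cc a).

Let cq_in a : slice_image (cc a) (cq a).
Proof. by have [] := svalP a. Qed.

Let cq_rank a : \rank (pr_T L (cq a)) = r.
Proof. by have [h _] := svalP a; have [] := DD_rank h. Qed.

Let g_plaque a y : O a y -> plaque (cc a) (cq a) (g a y) /\ rho a (g a y) = y.
Proof. by move=> Oy; have := slice_map_plaque (cq_in a) Oy. Qed.

Let g_sm a y : O a y -> sm (g a) y.
Proof. by move=> Oy; have [] := slice_map_sm Oy. Qed.

Let rho_sm a y : O a y -> sm (rho a) (g a y).
Proof.
move=> Oy; have [[h _] _] := g_plaque Oy.
have s1 := slice_coord_sm h.
pose w : 'rV[R]_(r + (0 + sc_codim (cc a))) := sc_coord (cc a) (g a y).
have ls : smooth_at (fun z : 'rV[R]_(r + (0 + sc_codim (cc a))) => lsubmx z) w.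
  by apply: sa_lsubmx; exact: sa_id.
have s2 := (sm_euc _ w).2 ls.
exact: (sm_comp s1 s2).
Qed.

Let g_overlap a b y : O b y -> (exists2 z, O a z & g a z = g b y) ->
  \forall y' \near y, exists2 z, O a z & g a z = g b y'.
Proof.
move=> Oy [z Oz zy]; have [[Vz vz] _] := g_plaque Oz.
have tn := slice_tangent_near (cq_in b) (cq_rank b) Oy.
rewrite zy in Vz vz.
apply: filterS (slice_constant Vz tn) => y' [h1 h2].
have h : plaque (cc a) (cq a) (g b y') by split => //; rewrite -vz.
by have [h3 h4] := plaque_param h; exists (rho a (g b y')).
Qed.

Let D2_ex : exists D2 : nat -> J, forall a y, O a y -> exists m, exists2 z, O (D2 m) z & g (D2 m) z = g a y.
Proof.
have [m Vp] := V_cover (DD_rank DDp).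
have c : countable [set mq : nat * M | DD mq.2 /\ V mq.1 mq.2].
  apply: (@sub_countable _ _ _ (setT `*` DD)); last by apply: countableX => //; exact: countableP.
  by apply: subset_card_le => mq /= [].
have [s [s1 s2]] := @countable_seq _ _ (m, p) c (conj DDp Vp).
exists (fun k => exist _ (s k) (s1 k)) => a y Oy.
have [k ka] := s2 (sval a) (svalP a).
exists k; have -> : exist _ (s k) (s1 k) = a; last by exists y.
by case: a Oy ka => a ha Oy /= ka; move: ha Oy; rewrite -ka => ha _; congr exist; exact: Prop_irrelevance.
Qed.

Let D2 := sval (cid D2_ex).
Let D2P : forall a y, O a y -> exists m, exists2 z, O (D2 m) z & g (D2 m) z = g a y.
Proof. by rewrite /D2; case: cid. Qed.

Lemma leaf_integral : integral_submanifold L U leaf.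
Proof.
have oO a : open (O a) by exact: slice_dom_open.
have [N [j [Nr jimm jr jT jo]]] := glue_family oO g_sm rho_sm (fun a y Oy => (g_plaque Oy).2) g_overlap D2P.
have jS : leaf = range j.
  rewrite jr; apply/seteqP; split => [q [q0 [m [Dq0 Vq0 Pq]]]|q [a [y [Oy <-]]]].
    pose a : J := exist _ (m, q0) (conj Dq0 Vq0).
    by have [h1 h2] := plaque_param Pq; exists a, (slice_time (ch (D m)) q).
  have [h _] := g_plaque Oy; have [h1 h2] := svalP a.
  by exists (cq a), (sval a).1.
have [_ jinj _] := jimm.
have ex (q : M) : leaf q -> exists x, j x = q by rewrite jS => -[x _ <-]; exists x.
(* Connectedness of the leaf: a clopen set meeting a plaque contains it, plaques being images of
   connected balls, and induction on the length of the chain of plaques reaches every point from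
   [p]. *)
have clop (B : set N) : open B -> open (~` B) -> (exists2 x, j x = p & B x) -> forall x, B x.
  move=> oB oC [x0 x0p Bx0].
  pose Q q := exists2 x, j x = q & B x.
  have Ql (A : set N) (a : J) y : open A -> O a y -> (exists2 x, j x = g a y & A x) ->
      \forall z \near y, O a z -> exists2 x, j x = g a z & A x.
    move=> /jo oA Oy [x xy Ax]; apply: filterS (oA a y x Oy xy Ax) => z hz Oz.
    have [x' x'z] : exists x', j x' = g a z.
      apply: ex; have [h _] := g_plaque Oz; have [h1 h2] := svalP a.
      by exists (cq a), (sval a).1.
    by exists x' => //; exact: hz.
  have plq (a : J) q q' : plaque (cc a) (cq a) q -> plaque (cc a) (cq a) q' -> Q q -> Q q'.
    move=> Pq Pq' Qq.
    have [h1 h2] := plaque_param Pq; have [h1' h2'] := plaque_param Pq'.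
    rewrite -h2'; have cO : connected (O a).
      by rewrite /O (slice_dom_ball (cq_in a)); apply: norm_ball_connected; exact: (sc_rad0 (cc a)).
    apply: (@clopen_propagation _ (O a) (fun t => Q (g a t)) _ cO h1 _ _ _ _ h1').
    - by rewrite /g h2.
    - by move=> y Oy Qy; exact: Ql.
    - move=> y Oy nQy.
      have [x xy] : exists x, j x = g a y.
        apply: ex; have [h _] := g_plaque Oy; have [k1 k2] := svalP a.
        by exists (cq a), (sval a).1.
      have nBx : (~` B) x by move=> Bx; apply: nQy; exists x.
      have h : exists2 x, j x = g a y & (~` B) x by exists x.
      apply: filterS (Ql (~` B) a y oC Oy h) => z hz Oz [x1 x1z Bx1].
      by have [x2 x2z nB] := hz Oz; apply: nB; have -> : x2 = x1 by apply: jinj; rewrite x2z.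
  have Qk k q : leaf_points k q -> Q q.
    elim: k q => [|k IH] q /=; first by move=> ->; exists x0.
    move=> [q0 kq0 [m0 _ [m _ /E_sub[q0M Vq0 Pq _]]]].
    have Dq0 : DD q0 by exists k.
    pose a : J := exist _ (m0, q0) (conj Dq0 Vq0).
    by apply: (plq a q0 q); [split|exact: Pq|exact: IH].
  move=> x; have : leaf (j x) by rewrite jS; exists x.
  move=> [q0 [m [Dq0 Vq0 Pq]]]; pose a : J := exist _ (m, q0) (conj Dq0 Vq0).
  have Qq0 : Q q0 by have [k _] := Dq0; exact: Qk.
  have [x' x'x Bx'] : Q (j x) by apply: (plq a q0 (j x)); [split|exact: Pq|exact: Qq0].
  by rewrite -(jinj _ _ x'x).
exists N, j; split => //.
- have [xp xpp] := ex p leaf_self.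
  move=> B [x1 Bx1] [C1 oC1 BE] [C2 cC2 BE2].
  rewrite setTI in BE; rewrite setTI in BE2; subst C1; subst C2.
  have oC : open (~` B) by exact: closed_openC.
  have [Bp|nBp] := pselect (B xp).
    by apply/seteqP; split => // x _; apply: (clop B) => //; exists xp.
  have h : forall x, (~` B) x.
    by apply: clop => //; [rewrite setCK|exists xp].
  by have := h x1 Bx1.
- by move=> q /leaf_rank[].
- move=> x; have : range j (j x) by exists x.
  rewrite jr => -[a [y [Oy yx]]].
  apply: (eqmx_trans (jT x a y Oy (esym yx))); rewrite -yx.
  have tn := nbhs_singleton (slice_tangent_near (cq_in a) (cq_rank a) Oy).
  have [_ t1 t2] := tn.
  apply/eqmxP; rewrite t1 /=.
  have := mxrank_leqif_sup t1; rewrite /leqif t2 (slice_map_rank (cq_in a) Oy) eqxx => -[_ <-].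
  by [].
Qed.

(** An integral submanifold through [p] has dimension equal to the rank of pr_T L at [p], and its
    domain is connected, so it propagates inside the leaf. *)
Lemma leaf_maximal : presymplectic_leaf L U leaf.
Proof.
split; first exact: leaf_integral.
move=> S [N [j [cN [/smooth_mapP js _ jf] SE SU jT]]] LS q; rewrite SE => -[x _ <-].
have [xp _ xpp] : range j p by rewrite -SE; apply: LS; exact: leaf_self.
have rj x' : \rank (pr_T L (j x')) = mdim N by rewrite -jT; apply/eqP; exact: jf.
have Np : mdim N = r by rewrite -xpp rj.
apply: (leaf_propagation cN (I : setT xp)) => //; first by rewrite xpp; exact: leaf_self.
move=> x' _; split; first by apply: SU; rewrite SE; exists x'.
by apply: filterS filterT => y _; split => //; [rewrite jT|rewrite rj].
Qed.

End LeafThroughPoint.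

(** * Pullback of a Dirac structure to an invariant submanifold *)

Section Retraction.
Context {R : realType}.
Local Opaque derive jacobian.

(** Adding a complement [N] of the tangent space turns [f] into the local diffeomorphism (u, v) |->
    f u + v N; the retraction is the first component of its inverse. *)
Lemma immersion_retraction k n (f : 'rV[R]_k -> 'rV[R]_n) (y0 : 'rV[R]_k) :
  smooth_at f y0 -> row_free ('J f y0) ->
  exists2 rho : 'rV[R]_n -> 'rV[R]_k, smooth_at rho (f y0) & \forall y \near y0, rho (f y) = y.
Proof.
move=> fs fJ; have [e [N [En fN]]] := complete_basis fJ.
pose P : 'M[R]_(k + e, k) := col_mx 1%:M 0; pose Q : 'M[R]_(k + e, n) := col_mx 0 N.
have PE (u : 'rV[R]_k) (v : 'rV[R]_e) : row_mx u v *m P = u by rewrite mul_row_col mulmx1 mulmx0 addr0.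
have QE (u : 'rV[R]_k) (v : 'rV[R]_e) : row_mx u v *m Q = v *m N by rewrite mul_row_col mulmx0 add0r.
pose h (w : 'rV[R]_(k + e)) : 'rV[R]_n := f (w *m P) + w *m Q.
pose w0 : 'rV[R]_(k + e) := row_mx y0 0.
have l1 : smooth_at (fun w : 'rV[R]_(k + e) => w *m P) w0 by apply: sa_mulmx; [exact: sa_id|exact: sa_cst].
have l2 : smooth_at (fun w : 'rV[R]_(k + e) => w *m Q) w0 by apply: sa_mulmx; [exact: sa_id|exact: sa_cst].
have fs0 : smooth_at f (w0 *m P) by rewrite PE.
have l3 := @sa_comp _ _ _ _ _ f (fun w => w *m P) w0 l1 fs0.
have hs : smooth_at h w0 by exact: sa_add l3 l2.
have hJ (v : 'rV[R]_(k + e)) : v *m 'J h w0 = v *m P *m 'J f y0 + v *m Q.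
  have e1 := jacE v hs; apply: (etrans e1).
  have e2 := @deriveD _ _ _ _ _ w0 v (@sa_derivable R _ _ _ _ v l3) (@sa_derivable R _ _ _ _ v l2).
  apply: (etrans e2); rewrite (@derive_comp _ _ _ _ (fun w => w *m P) f w0 v (sa_diff l1) (sa_diff fs0)).
  have -> : 'D_v (fun w : 'rV[R]_(k + e) => w *m P) w0 = v *m P.
    by apply: derive_affine => z; rewrite mulmxDl scalemxAl addrC.
  have -> : 'D_v (fun w : 'rV[R]_(k + e) => w *m Q) w0 = v *m Q.
    by apply: derive_affine => z; rewrite mulmxDl scalemxAl addrC.
  have e3 := jacE (v *m P) fs0; rewrite -e3 PE; reflexivity.
have fh : row_free ('J h w0).
  apply: inj_row_free => v; rewrite hJ -[v]hsubmxK PE QE -mul_row_col.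
  by rewrite -[RHS](mul0mx _ (col_mx ('J f y0) N)) => /(row_free_inj fN).
have [A [B [g [[oA Aw oB] [hA hB]]]]] := inverse_function_cast En hs fh.
have hE y : h (row_mx y 0) = f y by rewrite /h PE QE mul0mx addr0.
exists (fun x => lsubmx (g x)).
  apply: sa_lsubmx; rewrite -hE; have [Bw _ _] := hA _ Aw.
  by have [] := hB _ Bw.
have c : {for y0, continuous (fun y : 'rV[R]_k => row_mx y (0 : 'rV[R]_e))}.
  by apply: sa_cont; apply: sa_row_mx; [exact: sa_id|exact: sa_cst].
have nA : \forall y \near y0, A (row_mx y 0) by apply: c; apply: open_nbhs_nbhs.
by apply: filterS nA => y Ay; rewrite -hE; have [_ -> _] := hA _ Ay; rewrite row_mxKl.
Qed.

End Retraction.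

Lemma near_comp (T U : topologicalType) (f : T -> U) (x : T) (Q : U -> Prop) :
  {for x, continuous f} -> (\forall y \near f x, Q y) -> \forall x' \near x, Q (f x').
Proof. by move=> c; exact: c. Qed.

Lemma near_cmap (R : realType) (T : topologicalType) n (c : chart R T n) q (Q : 'rV[R]_n -> Prop) :
  cdom c q -> (\forall y \near cmap c q, Q y) -> \forall q' \near q, Q (cmap c q').
Proof. by move=> cq; apply: near_comp; exact: cmap_continuous. Qed.

Section Pullback.
Context {R : realType} {M P : manifold R} (L : dirac_structure M) (f : P -> M).
Hypothesis fs : forall p, sm f p.
Hypothesis ff : forall p, row_free (tangent_map f p).
Hypothesis finv : Defs.invariant L f.
Local Notation n := (mdim M).
Local Notation k := (mdim P).
Local Opaque derive jacobian transition tangent_map.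

(** On L the tangent component lies in the image of the differential by invariance, and there the
    pseudo-inverse gives its unique preimage. *)
Definition pull_block p : 'M[R]_(n + n, k + k) :=
  block_mx (pinvmx (tangent_map f p)) 0 0 (tangent_map f p)^T.

Definition pull_fiber p : 'M[R]_(k + k) := <<L (f p) *m pull_block p>>%MS.

Lemma pull_related p l : (l <= L (f p))%MS -> related_at (tangent_map f p) (l *m pull_block p) l.
Proof.
move=> lL; rewrite -[l in l *m _](hsubmxK l) /pull_block mul_row_block !mulmx0 addr0 add0r.
rewrite /related_at row_mxKl row_mxKr; split; last by [].
have : (lsubmx l <= tangent_map f p)%MS.
  by apply: submx_trans (finv p); rewrite /pr_T !lsubmxE; exact: submxMr.
exact: mulmxKpV.
Qed.

Lemma pull_relatedE p u l : related_at (tangent_map f p) u l -> u = l *m pull_block p.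
Proof.
move=> [h1 h2]; rewrite -[l]hsubmxK /pull_block mul_row_block !mulmx0 addr0 add0r -h1 -h2.
by rewrite mulmxKp ?hsubmxK.
Qed.

Lemma pull_fiberP p u : (u <= pull_fiber p)%MS <->
  exists2 l, (l <= L (f p))%MS & related_at (tangent_map f p) u l.
Proof.
rewrite /pull_fiber genmxE; split.
  move=> /submxP[c ->]; exists (c *m L (f p)); first exact: submxMl.
  by rewrite mulmxA; apply: pull_related; exact: submxMl.
by move=> [l lL /pull_relatedE ->]; exact: submxMr.
Qed.

Lemma pull_isotropic p u w : (u <= pull_fiber p)%MS -> (w <= pull_fiber p)%MS -> pairing u w = 0.
Proof.
move=> /pull_fiberP[l lL [h1 h2]] /pull_fiberP[l' lL' [h1' h2']].
rewrite -(dirac_isotropic lL lL') /pairing h2 h2' -h1 -h1' !trmx_mul !mulmxA; reflexivity.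
Qed.

(* At least k, since the kernel of the projection from [L] consists of conormal
   covectors; at most k, by isotropy. *)
Lemma pull_rank p : \rank (pull_fiber p) = k.
Proof.
apply/eqP; rewrite eqn_leq; apply/andP; split.
  set B := pull_fiber p.
  (* The matrix of the pairing. Isotropy reads B Jm B^T = 0 with [Jm] invertible, so twice the rank
     of B is at most 2 k. *)
  pose Jm : 'M[R]_(k + k) := block_mx 0 1%:M 1%:M 0.
  have pE (u w : 'rV[R]_(k + k)) : u *m Jm *m w^T = (pairing u w)%:M.
    rewrite -[u]hsubmxK -[w]hsubmxK /Jm mul_row_block tr_row_mx mul_row_col !mulmx0 !mulmx1 add0r addr0.
    rewrite /pairing !row_mxKl !row_mxKr.
    have -> : rsubmx w *m (lsubmx u)^T = lsubmx u *m (rsubmx w)^T by rewrite -[LHS]tr11 trmx_mul trmxK.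
    by apply/matrixP => a b; rewrite !mxE !ord1 mulr1n.
  have B0 : B *m (Jm *m B^T) = 0.
    apply/row_matrixP => i; rewrite row_mul row0 mulmxA; apply: trmx_inj; rewrite trmx0.
    apply/row_matrixP => j; rewrite row0 trmx_mul trmxK row_mul.
    apply: trmx_inj; rewrite trmx_mul trmxK trmx0 pE (@pull_isotropic p) ?row_sub//.
    exact: raddf0.
  have uJ : Jm \in unitmx.
    have : Jm *m Jm = 1%:M by rewrite /Jm mulmx_block !mulmx0 !mul0mx !mulmx1 !addr0 !add0r -scalar_mx_block.
    by move=> /mulmx1_unit[].
  have := mulmx0_rank_max B0.
  have -> : \rank (Jm *m B^T) = \rank B.
    by rewrite (eqmxMfull _ (_ : row_full Jm)) ?mxrank_tr// row_full_unit.
  by move: (\rank B) => rB; lia.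
rewrite /pull_fiber genmxE.
have e1 := mxrank_mul_ker (L (f p)) (pull_block p).
rewrite dirac_rank in e1.
have e2 : (\rank (L (f p) :&: kermx (pull_block p))%MS <= n - k)%N.
  have -> : (n - k)%N = \rank (kermx (tangent_map f p)^T) by rewrite mxrank_ker mxrank_tr (eqnP (ff p)).
  apply: leq_trans (mxrankM_maxl _ (row_mx 0 1%:M : 'M[R]_(n, n + n))).
  apply: mxrankS; apply/rV_subP => l; rewrite sub_capmx => /andP[lL]; rewrite sub_kermx => /eqP l0.
  have [h1 h2] := pull_related lL; rewrite l0 !linear0 mul0mx in h1 h2.
  rewrite -[l]hsubmxK -h1.
  have -> : row_mx 0 (rsubmx l) = rsubmx l *m row_mx (0 : 'M[R]_n) 1%:M.
    by rewrite mul_mx_row mulmx0 mulmx1.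
  by apply: submxMr; rewrite sub_kermx -h2.
have kn : (k <= n)%N by rewrite -(eqnP (ff p)) rank_leq_col.
move: e1 e2 kn; move: (\rank _) (\rank _) => r1 r2; lia.
Qed.

Lemma related_block a b r u l : cdom (chart_at a) r -> cdom (chart_at b) (f r) ->
  related_at ('J (chart_expr f a b) (cmap (chart_at a) r))
    (u *m chart_block a r) (l *m chart_block b (f r)) -> related_at (tangent_map f r) u l.
Proof.
move=> ar br; rewrite (chart_exprJ ar br (fs r)).
have [k1 k2] := transitionK ar; have [l1 l2] := transitionK br.
rewrite -{1 2}[u]hsubmxK -{1 2}[l]hsubmxK /chart_block !mul_row_block !mulmx0 !addr0 !add0r.
rewrite /related_at !row_mxKl !row_mxKr => -[h1 h2]; split.
  have := congr1 (mulmxr (transition b (f r) (f r))) h1.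
  by rewrite /= !mulmxA -[_ *m transition r a r *m _]mulmxA k1 mulmx1 -!mulmxA l1 !mulmx1.
have := congr1 (mulmxr (transition r a r)^T) h2.
rewrite /= -!mulmxA -!trmx_mul k1 trmx1 mulmx1 -!mulmxA l1 mulmx1.
by rewrite mulmxA k1 mul1mx.
Qed.

Section Local.
Variable p : P.
Local Notation b := (f p).
Local Notation y0 := (cmap (chart_at p) p).
Let ft := chart_expr f p b.
Variable F : 'rV[R]_n -> 'M[R]_(n, n + n).
Hypothesis nF : \forall x \near cmap (chart_at b) b, local_frame L b F x.

(** The right inverse J^T (J J^T)^-1 of the Jacobian takes the place of the pseudo-inverse, as its
    formula shows that it depends smoothly on y. *)
Let Kt y : 'M[R]_(n, k) := ('J ft y)^T *m invmx ('J ft y *m ('J ft y)^T).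
Definition pull_gen y : 'M[R]_(n, k + k) :=
  row_mx (lsubmx (F (ft y)) *m Kt y) (rsubmx (F (ft y)) *m ('J ft y)^T).

Let good (q : P) := [/\ cdom (chart_at p) q, cdom (chart_at b) (f q) & local_frame L b F (cmap (chart_at b) (f q))].

Let good_near : \forall q \near p, good q.
Proof.
have n1 : nbhs p (f @^-1` cdom (chart_at b)) by apply: (sm_cont (fs p)); exact: chart_nbhs (chart_atP b).
have n2 : \forall q \near p, local_frame L b F (cmap (chart_at b) (f q)).
  have nn := near_cmap (chart_atP b) nF.
  exact: (near_comp (sm_cont (fs p)) nn).
by apply: filterS (filterI (chart_nbhs (chart_atP p)) (filterI n1 n2)) => q [h1 [h2 h3]].
Qed.

Let ftE q : cdom (chart_at p) q -> ft (cmap (chart_at p) q) = cmap (chart_at b) (f q).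
Proof. exact: chart_exprE. Qed.

Let ft_sm q : good q -> smooth_at ft (cmap (chart_at p) q).
Proof. by move=> [h1 h2 _]; exact: chart_expr_smooth. Qed.

Let JE q : good q -> ('J ft (cmap (chart_at p) q) :=: tangent_map f q *m transition (f q) b (f q))%MS.
Proof.
move=> [h1 h2 _]; rewrite (chart_exprJ h1 h2 (fs q)) -mulmxA; apply: eqmxMfull.
by have [/mulmx1_unit[_ u] _] := transitionK h1; rewrite row_full_unit; exact: u.
Qed.

Let Jfree q : good q -> row_free ('J ft (cmap (chart_at p) q)).
Proof.
move=> gq; have [h1 h2 _] := gq; rewrite /row_free (JE gq) mxrankMfree.
  exact: ff.
by rewrite row_free_unit; exact: transition_unit.
Qed.

Let gen_related q m (c : 'M[R]_(m, n)) : good q ->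
  lsubmx (c *m pull_gen (cmap (chart_at p) q)) *m 'J ft (cmap (chart_at p) q) =
    lsubmx (c *m F (cmap (chart_at b) (f q))) /\
  rsubmx (c *m pull_gen (cmap (chart_at p) q)) =
    rsubmx (c *m F (cmap (chart_at b) (f q))) *m ('J ft (cmap (chart_at p) q))^T.
Proof.
move=> gq; have [h1 h2 h3] := gq.
have : (lsubmx (F (cmap (chart_at b) (f q))) <= 'J ft (cmap (chart_at p) q))%MS.
  have e := frame_pr_T h3; rewrite (cmapK h2) in e.
  by rewrite e (JE gq); apply: submxMr; exact: finv.
have u := gram_unit (Jfree gq).
rewrite /pull_gen /Kt (ftE h1); move: ('J ft _) u => J u /submxP[D DE].
rewrite mul_mx_row row_mxKl row_mxKr lsubmx_mul rsubmx_mul; split; last exact: mulmxA.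
by rewrite DE -!mulmxA; congr (_ *m (_ *m _)); rewrite mulmxA mulKVmx.
Qed.

Let gen_sm q : good q -> smooth_at pull_gen (cmap (chart_at p) q).
Proof.
move=> gq; have [h1 _ [_ Fs _]] := gq; have fts := ft_sm gq.
have Fs' : smooth_at F (ft (cmap (chart_at p) q)) by rewrite (ftE h1).
have Ff : smooth_at (fun y => F (ft y)) (cmap (chart_at p) q).
  exact: (@sa_comp _ _ _ _ _ F ft).
have Js := sa_jac fts; have Jts := sa_tr Js.
have us := sa_invmx (gram_unit (Jfree gq)) (sa_mulmx Js Jts).
exact: (sa_row_mx (sa_mulmx (sa_lsubmx Ff) (sa_mulmx Jts us)) (sa_mulmx (sa_rsubmx Ff) Jts)).
Qed.

Let gen_fiber q : good q -> (pull_gen (cmap (chart_at p) q) :=: pull_fiber q *m chart_block p q)%MS.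
Proof.
move=> gq; have [h1 h2 h3] := gq; have [_ _ FE] := h3; rewrite (cmapK h2) in FE.
have u1 := chart_block_unit h1; have u2 := chart_block_unit h2.
apply/eqmxP/andP; split; apply/rV_subP => v /submxP[c ->].
  have [r1 r2] := gen_related c gq.
  rewrite -[c *m _](mulmxKV u1); apply: submxMr; apply/pull_fiberP.
  exists (c *m F (cmap (chart_at b) (f q)) *m invmx (chart_block b (f q))).
    rewrite -(mulmxK u2 (L (f q))); apply: submxMr; rewrite -FE; exact: submxMl.
  apply: (@related_block p b q _ _ h1 h2); rewrite (mulmxKV u1) (mulmxKV u2); split; [exact: r1|exact: r2].
have /pull_fiberP[l lL rl] : (c *m pull_fiber q <= pull_fiber q)%MS by exact: submxMl.
have : (l *m chart_block b (f q) <= F (cmap (chart_at b) (f q)))%MS by rewrite FE; exact: submxMr.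
move=> /submxP[d dE].
have [r1 r2] := gen_related d gq.
suff -> : c *m (pull_fiber q *m chart_block p q) = d *m pull_gen (cmap (chart_at p) q) by exact: submxMl.
rewrite mulmxA -(mulmxKV u1 (d *m pull_gen _)); congr (_ *m _).
rewrite (pull_relatedE rl); apply/esym; apply: pull_relatedE.
apply: (@related_block p b q _ _ h1 h2).
by rewrite (mulmxKV u1) dE; split; [exact: r1|exact: r2].
Qed.

(** The n generators [pull_gen] span a space of constant dimension k, so k fixed combinations that
    are independent at p form a frame nearby. *)
Lemma pull_smooth : exists2 W : set P, open W /\ W p &
  exists G : 'I_k -> P -> 'rV[R]_(k + k),
    (forall j, smooth_section W (G j)) /\
    (forall q, W q -> (pull_fiber q :=: \matrix_j G j q)%MS).
Proof.
have gp := nbhs_singleton good_near.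
have rk : \rank (pull_gen y0) = k.
  rewrite (gen_fiber gp) mxrankMfree ?pull_rank// row_free_unit; exact: chart_block_unit (chart_atP p).
have [S fS] := rank_rows rk.
have SGs q : good q -> smooth_at (fun y => S *m pull_gen y) (cmap (chart_at p) q).
  by move=> gq; apply: sa_mulmx; [exact: sa_cst|exact: gen_sm].
have nfree := near_row_free (SGs p gp) fS.
have nf : \forall q \near p, row_free (S *m pull_gen (cmap (chart_at p) q)).
  exact: (near_cmap (chart_atP p) nfree).
have [W [oW Wp WG]] := near_open (filterI good_near nf).
pose G j q := row j (S *m pull_gen (cmap (chart_at p) q)) *m invmx (chart_block p q).
exists W; first by []; exists G; split.
  move=> j r; apply: sa_on => _ [q [rq Wq] <-].
  have [gq _] := WG q Wq; have [h1 _ _] := gq.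
  apply: (section_chart rq h1).
  apply: sa_near (sa_row j (SGs q gq)).
  have nW : nbhs q W by apply: open_nbhs_nbhs.
  apply: filterS (filterI (cimg_nbhs h1) (cinv_near h1 nW)) => y [y1 y2].
  have [y3 y4] := cinv_img y1.
  rewrite -y4 (local_rep_block _ y3) /G mulmxKV// chart_block_unit//.
move=> q Wq; have [gq fq] := WG q Wq; have [h1 _ _] := gq.
have u := chart_block_unit h1.
have -> : \matrix_j G j q = S *m pull_gen (cmap (chart_at p) q) *m invmx (chart_block p q).
  by apply/row_matrixP => j; rewrite rowK row_mul.
apply: eqmx_sym; apply/eqmxP.
have sub : (S *m pull_gen (cmap (chart_at p) q) *m invmx (chart_block p q) <= pull_fiber q)%MS.
  rewrite -[pull_fiber q](mulmxK u); apply: submxMr; rewrite -(gen_fiber gq); exact: submxMl.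
rewrite sub /=; have := mxrank_leqif_sup sub; rewrite /leqif pull_rank mxrankMfree; last first.
  by rewrite row_free_unit unitmx_inv.
by rewrite (eqnP fq) eqxx => -[_ <-].
Qed.

(** The coefficients of [s] in the generators are smooth by constant rank. Composed with a local
    retraction of M to P they become functions on M, and the same combination of the frame of L
    extends to a global section. *)
Lemma pull_extend (s : P -> 'rV[R]_(k + k)) : smooth_section setT s -> (forall q, (s q <= pull_fiber q)%MS) ->
  exists t, [/\ smooth_section setT t, forall q, (t q <= L q)%MS &
    \forall q \near p, related_at (tangent_map f q) (s q) (t (f q))].
Proof.
move=> ss sL; have gp := nbhs_singleton good_near.
have sr : smooth_at (local_rep p s) y0.
  by apply: smooth_section_at ss => //; [exact: openT|exact: chart_atP].
have gY : \forall y \near y0, exists2 q, y = cmap (chart_at p) q & good q.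
  apply: filterS (filterI (cimg_nbhs (chart_atP p)) (cinv_near (chart_atP p) good_near)) => y [y1 y2].
  by have [_ y4] := cinv_img y1; exists (cinv (chart_at p) y).
have rk q : good q -> \rank (pull_gen (cmap (chart_at p) q)) = k.
  move=> gq; rewrite (gen_fiber gq) mxrankMfree ?pull_rank// row_free_unit.
  by have [h1 _ _] := gq; exact: chart_block_unit.
have [|c cs cE] := @smooth_coef _ _ _ _ _ (local_rep p s) pull_gen y0 sr (gen_sm gp).
  apply: filterS gY => y [q -> gq]; have [h1 _ _] := gq; split; last exact: etrans (rk q gq) (esym (rk p gp)).
  rewrite (local_rep_block _ h1) (gen_fiber gq); apply: submxMr; exact: sL.
have [rho rhos rhoE] := immersion_retraction (ft_sm gp) (Jfree gp).
have [h1 _ _] := gp; rewrite (ftE h1) in rhos.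
have rho0 : rho (cmap (chart_at b) b) = y0 by rewrite -(ftE h1); exact: nbhs_singleton rhoE.
have cs' : smooth_at c (rho (cmap (chart_at b) b)) by rewrite rho0.
have crs := @sa_comp _ _ _ _ _ c rho _ rhos cs'.
have [t [t1 t2 t3]] := section_extend nF crs.
exists t; split => //.
have n1 : \forall q \near p, local_rep p s (cmap (chart_at p) q) = c (cmap (chart_at p) q) *m pull_gen (cmap (chart_at p) q) /\
    rho (ft (cmap (chart_at p) q)) = cmap (chart_at p) q.
  exact: (near_cmap (chart_atP p) (filterI cE rhoE)).
have n2 : \forall q \near p, local_rep b t (cmap (chart_at b) (f q)) =
    c (rho (cmap (chart_at b) (f q))) *m F (cmap (chart_at b) (f q)).
  have nn := near_cmap (chart_atP b) t3.
  exact: (near_comp (sm_cont (fs p)) nn).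
apply: filterS (filterI good_near (filterI n1 n2)) => q [gq [[e1 e2] e3]].
have [k1 k2 _] := gq.
apply: (@related_block p b q _ _ k1 k2).
rewrite -(local_rep_block _ k1) -(local_rep_block _ k2) e1 e3 -(ftE k1) e2 (ftE k1).
exact: gen_related.
Qed.

End Local.

Lemma pull_involutive (s t : P -> 'rV[R]_(k + k)) :
  smooth_section setT s -> smooth_section setT t ->
  (forall p, (s p <= pull_fiber p)%MS) -> (forall p, (t p <= pull_fiber p)%MS) ->
  forall p, (dorfman s t p <= pull_fiber p)%MS.
Proof.
move=> ss ts sL tL p; have [F nF] := local_frame_exists L (f p).
have [s' [s1 s2 s3]] := pull_extend nF ss sL.
have [t' [t1 t2 t3]] := pull_extend nF ts tL.
apply/pull_fiberP; exists (dorfman s' t' (f p)); first exact: dirac_involutive.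
exact: dorfman_related.
Qed.

Lemma pullback_dirac : exists LP : dirac_structure P, is_pullback L f LP.
Proof.
have sm_ p : exists2 W : set P, open W /\ W p &
    exists F : 'I_k -> P -> 'rV[R]_(k + k), (forall j, smooth_section W (F j)) /\
    (forall q, W q -> (pull_fiber q :=: \matrix_j F j q)%MS).
  by have [F nF] := local_frame_exists L (f p); exact: pull_smooth nF.
exists (@Dirac R P pull_fiber sm_ pull_rank pull_isotropic pull_involutive) => p u.
split.
  move=> /pull_fiberP[l lL [h1 h2]]; exists (lsubmx u), (rsubmx l).
  by rewrite -h2 hsubmxK h1 hsubmxK.
move=> [v [c [-> h]]]; apply/pull_fiberP; exists (row_mx (v *m tangent_map f p) c) => //.
by rewrite /related_at !row_mxKl !row_mxKr.
Qed.

End Pullback.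

(** * Slices are invariant *)

Section Invariance.
Context {R : realType} {M : manifold R} (L : dirac_structure M).
Local Opaque derive jacobian transition tangent_map.
Variables (X : manifold R) (i : X -> M) (x0 : X) (r : nat) (s : slice_chart L i x0 r).
Local Notation d := (mdim X).
Local Notation e := (sc_codim s).
Local Notation n := (mdim M).
Local Notation w0 := (slice_center x0 r (sc_codim s)).

Definition normal (u : 'rV[R]_(r + (d + e))) : 'rV[R]_e := rsubmx (rsubmx u).

Section Local.
Variable b : M.
Hypothesis bs : slice_image s b.
Hypothesis b0 : normal (sc_coord s b) = 0.
Local Notation cb := (chart_at b).
Let u0 : 'rV[R]_(r + (d + e)) := sc_coord s b.
Let Tt (x : 'rV[R]_n) : 'rV[R]_(r + (d + e)) := sc_coord s (cinv cb x).
Let psi (u : 'rV[R]_(r + (d + e))) : 'rV[R]_n := cmap cb (sc_param s u).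

Let u0_ball : `|u0 - w0| < sc_rad s.
Proof. by have [] := slice_imageP bs. Qed.

Let psi0 : psi u0 = cmap cb b.
Proof. by rewrite /psi; have [_ ->] := slice_imageP bs. Qed.

Let TtE q : cdom cb q -> slice_image s q ->
  smooth_at Tt (cmap cb q) /\ 'J Tt (cmap cb q) = transition b q q *m tangent_map (sc_coord s) q.
Proof.
move=> cq sq; have im : (cmap cb @` cdom cb) (cmap cb q) by exists q.
have s1 := @sm_cinv _ M b _ im.
have s2 : sm (sc_coord s) (cinv cb (cmap cb q)) by rewrite (cmapK cq); exact: slice_coord_sm.
split; first exact: (sm_euc _ _).1 (sm_comp s1 s2).
have e1 := T_comp s1 s2; rewrite T_euc in e1; apply: (etrans e1).
rewrite (T_cinv im) (cmapK cq); reflexivity.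
Qed.

Let near_u0 : \forall u \near u0, `|u - w0| < sc_rad s /\ cdom cb (sc_param s u).
Proof.
have n1 := near_norm_ball u0_ball.
have n2 : \forall u \near u0, cdom cb (sc_param s u).
  apply: (near_comp (sm_cont (sc_param_sm s u0_ball))).
  by have [_ ->] := slice_imageP bs; exact: chart_nbhs (chart_atP b).
exact: filterI n1 n2.
Qed.

Variables (Y : 'rV[R]_n -> 'M[R]_n).

Definition spans_pr_T (x : 'rV[R]_n) : Prop := smooth_at Y x /\
  (Y x :=: pr_T L (cinv cb x) *m transition (cinv cb x) b (cinv cb x))%MS.

Hypothesis HY : \forall x \near cmap cb b, spans_pr_T x.

(* The component of the vector fields [Y] normal to the slice: it vanishes on the
   slice, hence is bounded by the distance to the slice, and Gronwall's inequality
   applies to the normal coordinate along a curve tangent to [pr_T L]. *)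
Let beta (u : 'rV[R]_(r + (d + e))) : 'M[R]_(n, e) := rsubmx (rsubmx (Y (psi u) *m 'J Tt (psi u))).

Let beta_near : \forall u \near u0, smooth_at beta u /\ (normal u = 0 -> beta u = 0).
Proof.
have psis u : `|u - w0| < sc_rad s -> cdom cb (sc_param s u) -> smooth_at psi u.
  move=> h1 h2; have s1 := sc_param_sm s h1; have s2 := @sm_cmap _ M b _ h2.
  exact: (sm_euc _ _).1 (sm_comp s1 s2).
have ps0 : smooth_at psi u0.
  by apply: psis => //; have [_ ->] := slice_imageP bs; exact: chart_atP.
have nY : \forall u \near u0, spans_pr_T (psi u).
  by apply: (near_comp (sa_cont ps0)); rewrite psi0.
apply: filterS (filterI near_u0 nY) => u [[h1 h2] [Ys YE]].
have su : slice_image s (sc_param s u) by exists u.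
have [Ts TJ] := TtE h2 su.
split.
  have c1 := @sa_comp _ _ _ _ _ Y psi u (psis u h1 h2) Ys.
  have c2 := @sa_comp _ _ _ _ _ (fun x => 'J Tt x) psi u (psis u h1 h2) (sa_jac Ts).
  exact: (sa_rsubmx (sa_rsubmx (sa_mulmx c1 c2))).
move=> u2; have u3 := sc_inv s h1 u2.
rewrite {1 2}/psi (cmapK h2) -/(psi u) in YE.
have /submxP[c cE] : (Y (psi u) <= pr_T L (sc_param s u) *m transition (sc_param s u) b (sc_param s u))%MS.
  by rewrite YE.
have [k1 _] := transitionK h2.
have e1 : Y (psi u) *m 'J Tt (psi u) = c *m (pr_T L (sc_param s u) *m tangent_map (sc_coord s) (sc_param s u)).
  have e2 : 'J Tt (psi u) = transition b (sc_param s u) (sc_param s u) *m tangent_map (sc_coord s) (sc_param s u) by exact: TJ.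
  rewrite cE e2.
  rewrite -!mulmxA; congr (_ *m (_ *m _)); rewrite mulmxA k1 mul1mx; reflexivity.
by rewrite /beta e1 rsubmx_mul rsubmx_mul u3 mulmx0.
Qed.

Let beta_bound : exists2 K : R, 0 <= K & \forall u \near u0, `|beta u| <= K * `|normal u|.
Proof.
have [rho1 rho10 H1] := near_ballP beta_near.
have bs0 : smooth_at beta u0 by have [] := nbhs_singleton beta_near.
have [C [C0 nC]] : exists C : R, 0 <= C /\ \forall u \near u0, forall j, `|'D_(delta_mx 0 j) beta u| <= C.
  have B j := near_bounded (sa_cont (sa_derive (delta_mx 0 j : 'rV[R]_(r + (d + e))) bs0)).
  pose K j := sval (cid2 (B j)).
  have K0 j : 0 <= K j by rewrite /K; case: cid2.
  have KE j : \forall u \near u0, `|'D_(delta_mx 0 j) beta u| <= K j by rewrite /K; case: cid2.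
  exists (\sum_j K j); split; first exact: sumr_ge0.
  have KE' := filter_forall (nbhs_filter u0) KE.
  apply: filterS KE' => u hu j; apply: le_trans (hu j) _.
  by rewrite (bigD1 j)//= lerDl sumr_ge0.
have [rho2 rho20 H2] := near_ballP nC.
pose rho := Num.min rho1 rho2.
exists ((r + (d + e))%:R * C); first by rewrite mulr_ge0.
have rho0 : 0 < rho by rewrite lt_min rho10.
have nb : `|u0 - u0| < rho by rewrite subrr normr0.
apply: filterS (near_norm_ball nb) => u ub.
(* [u'] is the projection of [u] to the slice, where [beta] vanishes, and [v] is the difference. As
   [u0] lies in the slice, the segment from [u'] to [u] stays in the ball for the maximum norm. *)
pose v : 'rV[R]_(r + (d + e)) := row_mx 0 (row_mx 0 (normal u)).
pose u' : 'rV[R]_(r + (d + e)) := row_mx (lsubmx u) (row_mx (lsubmx (rsubmx u)) 0).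
have uE : u' + v = u by rewrite /u' /v !add_row_mx !addr0 add0r /normal !hsubmxK.
have tb (t : R) : 0 <= t <= 1 -> `|u' + t *: v - u0| < rho.
  move=> /andP[t0 t1]; apply: le_lt_trans ub.
  have u00 : u0 = row_mx (lsubmx u0) (row_mx (lsubmx (rsubmx u0)) 0).
    by rewrite -[LHS]hsubmxK -[rsubmx u0 in LHS]hsubmxK; move: b0; rewrite /normal -/u0 => ->.
  have -> : u - u0 = row_mx (lsubmx u - lsubmx u0) (row_mx (lsubmx (rsubmx u) - lsubmx (rsubmx u0)) (normal u)).
    by rewrite {1}u00 -{1}uE /u' /v !add_row_mx !opp_row_mx !add_row_mx !addr0 add0r subr0.
  have -> : u' + t *: v - u0 = row_mx (lsubmx u - lsubmx u0) (row_mx (lsubmx (rsubmx u) - lsubmx (rsubmx u0)) (t *: normal u)).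
    by rewrite {1}u00 /u' /v !scale_row_mx !add_row_mx !opp_row_mx !add_row_mx !scaler0 !addr0 add0r subr0.
  move: (lsubmx u - _) (lsubmx (rsubmx u) - _) (normal u) => a1 a2 a3.
  have [h1 h2 _] := row_mx_norm a1 (row_mx a2 a3); have [h3 h4 _] := row_mx_norm a2 a3.
  apply: mx_norm_leP => // k l; rewrite mxE; case: splitP => l' _.
    exact: le_trans (mx_norm_coord _ _ _) h1.
  rewrite mxE; case: splitP => l2 _; first exact: le_trans (mx_norm_coord _ _ _) (le_trans h3 h2).
  rewrite mxE normrM ger0_norm//; apply: le_trans (le_trans (mx_norm_coord a3 k l2) (le_trans h4 h2)).
  by rewrite -[leRHS]mul1r ler_wpM2r.
have bu' : beta u' = 0.
  have := tb 0; rewrite scale0r addr0 lexx ler01 => /(_ isT); rewrite lt_min => /andP[h _].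
  by have [_] := H1 u' h; apply; rewrite /normal /u' !row_mxKr.
rewrite -{1}uE -[beta _]subr0 -bu'.
apply: mvt_ineq => t t01; have := tb t t01; rewrite lt_min => /andP[h1 h2].
have [bsm _] := H1 _ h1; split; first exact: sa_derivable.
rewrite (derive_sumE v (sa_diff bsm)) (le_trans (ler_norm_sum _ _ _))//.
apply: (@le_trans _ _ (\sum_(j < r + (d + e)) C * `|normal u|)).
  apply: ler_sum => j _; rewrite normrZ mulrC ler_pM//; first exact: H2.
  apply: le_trans (mx_norm_coord v 0 j) _; rewrite /v.
  apply: mx_norm_leP => // k l; rewrite mxE; case: splitP => l' _; first by rewrite mxE normr0.
  by rewrite mxE; case: splitP => l2 _; [rewrite mxE normr0|exact: mx_norm_coord].
by rewrite sumr_const card_ord -[leLHS]mulr_natl mulrA.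
Qed.

Variables (N : manifold R) (f : N -> M) (x : N) (q : nat).
Hypothesis fx : f x = b.
Hypothesis Hf : \forall y \near x, [/\ sm f y, (tangent_map f y <= pr_T L (f y))%MS & \rank (pr_T L (f y)) = q].

Lemma normal_invariant_at : \forall y \near x, normal (sc_coord s (f y)) = 0.
Proof.
have fs := nbhs_singleton Hf; have [fsx _ _] := fs.
pose z0 := cmap (chart_at x) x.
pose ft := chart_expr f x b.
have bx : cdom cb (f x) by rewrite fx; exact: chart_atP.
have fts : smooth_at ft z0 := chart_expr_smooth (chart_atP x) bx fsx.
have ft0 : ft z0 = cmap cb b by rewrite /ft (chart_exprE f b (chart_atP x)) fx.
have ns : \forall y \near x, slice_image s (f y).
  by apply: (near_comp (sm_cont fsx)); rewrite fx; apply: open_nbhs_nbhs; split => //; exact: slice_image_open.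
have nY : \forall z \near z0, spans_pr_T (ft z).
  by apply: (near_comp (sa_cont fts)); rewrite ft0.
have nz : \forall z \near z0, exists y, [/\ z = cmap (chart_at x) y, cdom (chart_at x) y, cdom cb (f y), sm f y &
    slice_image s (f y) /\ [/\ sm f y, (tangent_map f y <= pr_T L (f y))%MS & \rank (pr_T L (f y)) = q]].
  exact: (@chart_expr_near _ N M f x b x _ (chart_atP x) bx fsx (filterI ns Hf)).
have Ys0 : smooth_at Y (ft z0) by have [] := nbhs_singleton nY.
have Yf := @sa_comp _ _ _ _ _ Y ft z0 fts Ys0.
have Jle : \forall z \near z0, [/\ ('J ft z <= Y (ft z))%MS & \rank (Y (ft z)) = q].
  apply: filterS (filterI nY nz) => z [[_ YE] [y [zE cy by_ sy [_ [_ ty ry]]]]].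
  have ftE : ft z = cmap cb (f y) by rewrite zE /ft (chart_exprE f b cy).
  rewrite ftE (cmapK by_) in YE; rewrite ftE.
  have u := transition_unit by_.
  split; last by rewrite YE mxrankMfree ?row_free_unit.
  rewrite zE (chart_exprJ cy by_ sy) YE -mulmxA; apply: submx_trans (submxMl _ _) _.
  exact: submxMr.
(* The rank of pr_T L is constant along [f], so the derivative of [f] is a smooth, hence locally
   bounded, combination of the fields [Y] along [f]. *)
have [|C Cs CE] := @smooth_coef _ _ _ _ _ (fun z => 'J ft z) (fun z => Y (ft z)) z0 (sa_jac fts) Yf.
  have [_ r0] := nbhs_singleton Jle.
  by apply: filterS Jle => z [h1 h2]; rewrite h2 r0.
have [KC KC0 HKC] := near_bounded (sa_cont Cs).
have [Kb Kb0 HKb] := beta_bound.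
pose F (z : 'rV[R]_(mdim N)) : 'rV[R]_(r + (d + e)) := Tt (ft z).
have F0 : F z0 = u0 by rewrite /F ft0 /Tt cmapK//; exact: chart_atP.
have [Ts0 _] := TtE (chart_atP b) bs.
have Fs0 : smooth_at F z0 by apply: (@sa_comp _ _ _ _ _ Tt ft z0 fts); rewrite ft0.
have nb : \forall z \near z0, `|beta (F z)| <= Kb * `|normal (F z)|.
  by apply: (near_comp (Q := fun u => `|beta u| <= Kb * `|normal u|) (sa_cont Fs0)); rewrite F0.
have nF : \forall z \near z0, [/\ smooth_at F z, rsubmx (rsubmx ('J F z)) = C z *m beta (F z),
    `|C z| <= KC & `|beta (F z)| <= Kb * `|normal (F z)|].
  have fts' := sa_nbhs fts.
  apply: filterS (filterI fts' (filterI nz (filterI CE (filterI HKC nb)))) => z [fz [[y [zE cy by_ sy [siy _]]] [Cz [KCz bz]]]].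
  have ftE : ft z = cmap cb (f y) by rewrite zE /ft (chart_exprE f b cy).
  have [Tsz _] := TtE by_ siy; rewrite -ftE in Tsz.
  have FE : F z = sc_coord s (f y) by rewrite /F ftE /Tt cmapK.
  have psiF : psi (F z) = ft z by rewrite /psi FE ftE; have [_ ->] := slice_imageP siy.
  split => //; first exact: (@sa_comp _ _ _ _ _ Tt ft z fz Tsz).
  have e1 := jac_comp fz Tsz.
  rewrite (congr1 (fun A => rsubmx (rsubmx A)) e1) Cz -mulmxA rsubmx_mul rsubmx_mul /beta psiF; reflexivity.
have [rho rho0 Hrho] := near_ballP nF.
have nc : \forall y \near x, `|cmap (chart_at x) y - z0| < rho.
  have h : `|z0 - z0| < rho by rewrite subrr normr0.
  exact: (near_cmap (chart_atP x) (near_norm_ball h)).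
have nd : \forall y \near x, cdom cb (f y).
  by apply: (near_comp (sm_cont fsx)); exact: chart_nbhs.
apply: filterS (filterI nc (filterI (chart_nbhs (chart_atP x)) nd)) => y [y1 [y2 y3]].
pose v := cmap (chart_at x) y - z0.
pose c (t : R) := normal (F (z0 + t *: v)).
have c0 : c 0 = 0 by rewrite /c scale0r addr0 F0.
have tz (t : R) : 0 <= t <= 1 -> `|z0 + t *: v - z0| < rho.
  move=> /andP[t0 t1]; rewrite addrAC subrr add0r normrZ ger0_norm// (le_lt_trans _ y1)// -[leRHS]mul1r.
  exact: ler_wpM2r.
have s1 : (0 <= (1 : R)) && ((1 : R) <= 1) by rewrite ler01 lexx.
suff : c 1 = 0.
  rewrite /c scale1r /v addrC subrK /F /Tt /ft (chart_exprE f b y2) cmapK//.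
apply: (@gronwall R _ _ c (n%:R * ((mdim N)%:R * `|v| * KC) * Kb)) s1 => // t t01.
have [Fs JF Ct bt] := Hrho _ (tz t t01).
have ns' : smooth_at (fun z => normal (F z)) (z0 + t *: v) := sa_rsubmx (sa_rsubmx Fs).
have [l1 l2] := derive_line (@sa_derivable R _ _ _ _ v ns').
split; first exact: l1.
have Dn : 'D_v (fun z => normal (F z)) (z0 + t *: v) = v *m C (z0 + t *: v) *m beta (F (z0 + t *: v)).
  rewrite -mulmxA -JF.
  apply/rowP => j; have e2 := jacE v Fs.
  rewrite -(derive_entry _ _ (sa_derivable ns')).
  have -> : (fun y => normal (F y) 0 j) = (fun y => F y 0 (rshift r (rshift d j))).
    by apply/funext => z; rewrite !mxE.
  rewrite (derive_entry _ _ (sa_derivable Fs)) -e2 !mxE; apply: eq_bigr => l _.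
  by rewrite !mxE.
have E : 'D_1 c t = v *m C (z0 + t *: v) *m beta (F (z0 + t *: v)) := etrans l2 Dn.
rewrite E -/(normal _) (_ : `|c t| = `|normal (F (z0 + t *: v))|); last reflexivity.
move: Ct bt; move: (C _) (beta _) (normal _) => C' B' Z Ct bt.
have h1 : `|v *m C'| <= (mdim N)%:R * `|v| * KC.
  by apply: le_trans (mulmx_norm _ _) _; rewrite ler_wpM2l// mulr_ge0.
apply: le_trans (mulmx_norm _ _) _; rewrite -[leRHS]mulrA; apply: ler_pM; [exact: mulr_ge0|exact: normr_ge0| |exact: bt].
by rewrite ler_wpM2l.
Qed.

End Local.

Lemma normal_invariant (N : manifold R) (f : N -> M) (x : N) (q : nat) :
  slice_image s (f x) -> normal (sc_coord s (f x)) = 0 -> tangent_near L q f x ->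
  \forall y \near x, normal (sc_coord s (f y)) = 0.
Proof.
move=> sx nx Hf; have [Y [K HY]] := vector_frame L (f x).
have HY' : \forall z \near cmap (chart_at (f x)) (f x), spans_pr_T (f x) Y z.
  by apply: filterS HY => z [].
exact: (normal_invariant_at sx nx HY' erefl Hf).
Qed.

End Invariance.
Arguments normal {R M L X i x0 r} s u.

(** * Construction of the invariant submanifold *)

Section Boxes.
Context {R : realType} {M : manifold R} (L : dirac_structure M).
Local Opaque derive jacobian transition tangent_map.
Variables (X : manifold R) (i : X -> M) (r : nat).
Hypothesis i_emb : embedding i.
Local Notation d := (mdim X).

Section OneChart.
Variables (x0 : X) (s : slice_chart L i x0 r).
Local Notation e := (sc_codim s).
Local Notation w0 := (slice_center x0 r (sc_codim s)).
Local Notation th q := (sc_coord s q : 'rV[R]_(r + (d + e))).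

Definition box (c : 'rV[R]_(r + (d + e))) (rho : R) : set M :=
  sc_param s @` [set w : 'rV[R]_(r + (d + e)) | `|w - c| < rho].

Definition sub_ball (c : 'rV[R]_(r + (d + e))) (rho : R) :=
  forall w : 'rV[R]_(r + (d + e)), `|w - c| < rho -> `|w - w0| < sc_rad s.

Lemma box_open c rho : sub_ball c rho -> open (box c rho).
Proof. by move=> h; apply: sc_open => //; exact: norm_ball_open. Qed.

Lemma boxP c rho q : sub_ball c rho -> box c rho q ->
  [/\ `|th q - c| < rho, sc_param s (th q) = q & slice_image s q].
Proof.
move=> h [w ww <-]; rewrite (sc_paramK s (h w ww)); split => //.
by exists w => //; exact: h.
Qed.

Lemma in_box c rho q : slice_image s q -> `|th q - c| < rho -> box c rho q.
Proof. by move=> /slice_imageP[_ qE] qr; exists (th q). Qed.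

Lemma slice_mapE v (t : 'rV[R]_r) : slice_map s v t = sc_param s (row_mx t v).
Proof. by []. Qed.

Lemma slice_map_tangent (v : 'rV[R]_(d + e)) t : slice_dom s v t ->
  tangent_near L (\rank (pr_T L (sc_param s (row_mx 0 v)))) (slice_map s v) t.
Proof.
move=> tv; have nt : nbhs t (slice_dom s v).
  by apply: open_nbhs_nbhs; split => //; exact: slice_dom_open.
apply: filterS nt => t' t'v; have [h1 h2] := slice_map_sm t'v; split => //.
  by rewrite h2; exact: sc_tangent.
by rewrite slice_mapE (sc_rank s t'v) row_mxKr.
Qed.

Lemma normal_near (N : manifold R) (f : N -> M) (x : N) :
  sm f x -> slice_image s (f x) -> normal s (sc_coord s (f x)) <> 0 ->
  \forall y \near x, normal s (sc_coord s (f y)) <> 0.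
Proof.
move=> fs fx nx; have c1 := sm_cont (slice_coord_sm fx).
have c2 := sa_cont (sa_rsubmx (sa_rsubmx (sa_id (th (f x))))).
have c3 : {for x, continuous (fun y => normal s (sc_coord s (f y)))}.
  apply: (@continuous_comp _ _ _ (fun y => sc_coord s (f y)) (fun u => normal s u)).
    exact: (continuous_comp (sm_cont fs) c1).
  exact: c2.
have n1 : normal s (sc_coord s (f x)) != 0 by apply/eqP.
have : \forall y \near x, normal s (sc_coord s (f y)) != 0 by exact: cvgr_neq0 c3 n1.
by apply: filterS => y /eqP.
Qed.

(* [rho] is so small that [i X] meets the box only along the middle axis. *)
Definition box_radius (rho : R) := [/\ 0 < rho, rho <= sc_rad s &
  forall x, box w0 rho (i x) -> lsubmx (th (i x)) = 0 /\ normal s (th (i x)) = 0].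

(** Here the topology induced by the embedding enters: a point of X whose image is close to the
    centre is itself close to [x0], and then [sc_base] gives its coordinates. *)
Lemma box_radius_exists : exists rho, box_radius rho.
Proof.
pose A : set X := [set x | cdom (chart_at x0) x /\ `|cmap (chart_at x0) x - cmap (chart_at x0) x0| < sc_rad s].
have oA : open A.
  rewrite openE => x [cx xr].
  have n1 := near_cmap cx (near_norm_ball xr).
  by apply: filterS (filterI (chart_nbhs cx) n1) => y [].
have [_ emb] := i_emb; have [B oB AB] := emb A oA.
have w0r : `|w0 - w0| < sc_rad s by rewrite subrr normr0 sc_rad0.
have [x [cx xE px]] : exists x, [/\ cdom (chart_at x0) x, cmap (chart_at x0) x = cmap (chart_at x0) x0 & sc_param s w0 = i x].
  by apply: sc_base; rewrite subrr normr0 sc_rad0.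
have xx0 : x = x0 by rewrite -(cmapK cx) xE cmapK//; exact: chart_atP.
have Bw0 : B (sc_param s w0).
  have : A x0 by split; [exact: chart_atP|rewrite subrr normr0 sc_rad0].
  by rewrite AB /= px xx0.
have nB : \forall w \near w0, B (sc_param s w).
  by apply: (near_comp (sm_cont (sc_param_sm s w0r))); apply: open_nbhs_nbhs.
have [rho rho0 H] := near_ballP nB.
exists (Num.min rho (sc_rad s)); split.
- by rewrite lt_min rho0 sc_rad0.
- by rewrite ge_min lexx orbT.
move=> x' [w /=]; rewrite lt_min => /andP[w1 w2] wE.
have : A x' by rewrite AB /= -wE; exact: H.
move=> [cx' x'r]; have [x2 [cx2 x2E px2]] := sc_base s x'r.
have xx : x2 = x' by rewrite -(cmapK cx2) x2E cmapK.
rewrite -xx -px2 sc_paramK; first by rewrite row_mxKl /normal !row_mxKr.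
rewrite /slice_center opp_row_mx add_row_mx opp_row_mx add_row_mx !subr0.
apply: row_mx_norm_lt; [exact: sc_rad0|by rewrite normr0 sc_rad0|].
by apply: row_mx_norm_lt; [exact: sc_rad0|exact: x'r|rewrite normr0 sc_rad0].
Qed.

End OneChart.
Arguments box {x0} s c rho.
Arguments sub_ball {x0} s c rho.
Arguments box_radius {x0} s rho.

Lemma axis_ball m k (c1 : 'rV[R]_k) (w : 'rV[R]_(m + k)) (u : 'rV[R]_m) (rho : R) : 0 < rho ->
  `|w - row_mx 0 c1| < rho -> `|u| < rho -> `|row_mx u (rsubmx w) - row_mx 0 c1| < rho.
Proof.
move=> rho0; rewrite -{1}[w]hsubmxK !opp_row_mx !add_row_mx !subr0 => h1 h2.
have [_ h3 _] := row_mx_norm (lsubmx w) (rsubmx w - c1).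
by apply: row_mx_norm_lt => //; exact: le_lt_trans h3 h1.
Qed.

(** A continuation principle: a point of the slice is the end of a t-line starting on X. The centre
    has zero t-coordinate, so the box contains this line. The property is tested on arbitrary
    connected families because the rank [m] varies with the line. *)
Lemma slice_ray (x0 : X) (s : slice_chart L i x0 r) (c1 : 'rV[R]_(d + sc_codim s)) (rho : R) (Q : M -> Prop)
    (q : M) : 0 < rho -> sub_ball s (row_mx 0 c1) rho -> box s (row_mx 0 c1) rho q ->
  normal s (sc_coord s q) = 0 ->
  (forall (A : set (@euc R r)) (f : @euc R r -> M) (m : nat) (x : X), connected A -> A 0 -> f 0 = i x ->
     (forall t, A t -> box s (row_mx 0 c1) rho (f t) /\ tangent_near L m f t) -> forall t, A t -> Q (f t)) ->
  Q q.
Proof.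
move=> rho0 sb bq nq Qp; have [h1 h2 h3] := boxP sb bq.
pose w : 'rV[R]_(r + (d + sc_codim s)) := sc_coord s q.
pose v := rsubmx w.
pose A : set (@euc R r) := [set t : 'rV[R]_r | `|t - 0| < rho].
have inA (t : @euc R r) : A t -> `|row_mx (t : 'rV[R]_r) v - row_mx 0 c1| < rho.
  by rewrite /A /= subr0 => tr; exact: axis_ball.
have wA : A (lsubmx w).
  rewrite /A /= subr0; apply: le_lt_trans h1; rewrite -/w.
  have -> : w - row_mx 0 c1 = row_mx (lsubmx w) (rsubmx w - c1).
    by rewrite -{1}[w]hsubmxK opp_row_mx add_row_mx subr0.
  by have [] := row_mx_norm (lsubmx w) (rsubmx w - c1).
have A0 : A 0 by rewrite /A /= subrr normr0.
have qE : q = slice_map s v (lsubmx w) by rewrite slice_mapE hsubmxK h2.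
have cA : connected A by exact: norm_ball_connected.
have [x [_ _ xE]] : exists x, [/\ cdom (chart_at x0) x, cmap (chart_at x0) x = lsubmx v &
    sc_param s (row_mx 0 (row_mx (lsubmx v) 0)) = i x].
  apply: sc_base; have := sb _ (inA 0 A0).
  rewrite /slice_center -{1}[v]hsubmxK !opp_row_mx !add_row_mx.
  have [_ h _] := row_mx_norm (0 - 0 : 'rV[R]_r) (row_mx (lsubmx v - cmap (chart_at x0) x0) (rsubmx v - 0)).
  have [h' _ _] := row_mx_norm (lsubmx v - cmap (chart_at x0) x0) (rsubmx v - 0).
  by apply: le_lt_trans; exact: le_trans h' h.
have vE : row_mx (lsubmx v) 0 = v.
  by rewrite -[RHS]hsubmxK; move: nq; rewrite /normal -/w -/v => ->.
rewrite vE in xE.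
rewrite qE; apply: (Qp A (slice_map s v) (\rank (pr_T L (sc_param s (row_mx 0 v)))) x cA A0 xE _ (lsubmx w) wA).
move=> t At; split; first by exists (row_mx t v) => //; exact: inA.
by apply: slice_map_tangent; apply: sb; exact: inA.
Qed.

Lemma slice_agree (x0 x1 : X) (s : slice_chart L i x0 r) (s' : slice_chart L i x1 r) (rho rho' : R) (z : X) :
  box_radius s rho -> box_radius s' rho' ->
  box s (slice_center x0 r (sc_codim s)) rho (i z) ->
  box s' (slice_center x1 r (sc_codim s')) rho' (i z) ->
  \forall q \near i z, normal s (sc_coord s q) = 0 -> normal s' (sc_coord s' q) = 0.
Proof.
move=> [rho0 rr H] [rho'0 rr' H'] bz bz'.
have sb : sub_ball s (slice_center x0 r (sc_codim s)) rho by move=> w h; exact: lt_le_trans h rr.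
have sb' : sub_ball s' (slice_center x1 r (sc_codim s')) rho' by move=> w h; exact: lt_le_trans h rr'.
have [z1 z2 z3] := boxP sb bz.
have [z4 _] := H z bz.
(* The box is recentred at [i z], which has t = 0 by [box_radius], so that a small box around it
   contains the t-lines of its points and lies inside the box of [s']. *)
pose c1 := rsubmx (sc_coord s (i z) : 'rV[R]_(r + (d + sc_codim s))).
have cE : (sc_coord s (i z) : 'rV[R]_(r + (d + sc_codim s))) = row_mx 0 c1.
  by rewrite -[LHS]hsubmxK z4.
have zr : `|row_mx 0 c1 - slice_center x0 r (sc_codim s)| < sc_rad s by rewrite -cE; exact: sb.
have n1 : \forall w \near row_mx 0 c1, box s' (slice_center x1 r (sc_codim s')) rho' (sc_param s w).
  apply: (near_comp (sm_cont (sc_param_sm s zr))); rewrite -cE z2.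
  by apply: open_nbhs_nbhs; split => //; exact: box_open.
have [dl dl0 Hd] := near_ballP (filterI n1 (near_norm_ball zr)).
have sbd : sub_ball s (row_mx 0 c1) dl by move=> w /Hd[].
have bzd : box s (row_mx 0 c1) dl (i z).
  by exists (row_mx 0 c1); [rewrite /= subrr normr0|rewrite -cE z2].
have sub : box s (row_mx 0 c1) dl `<=` box s' (slice_center x1 r (sc_codim s')) rho'.
  by move=> _ [w /Hd[h _] <-].
have nb : nbhs (i z) (box s (row_mx 0 c1) dl) by apply: open_nbhs_nbhs; split => //; exact: box_open.
apply: filterS nb => q bq nq.
apply: (slice_ray (Q := fun q => normal s' (sc_coord s' q) = 0) dl0 sbd bq nq).
move=> A f m x cA A0 fx Hf t At.
have Q0 : normal s' (sc_coord s' (f 0)) = 0.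
  by have [/sub + _] := Hf 0 A0; rewrite fx => /H'[].
apply: (clopen_propagation (Q := fun t => normal s' (sc_coord s' (f t)) = 0) cA A0 Q0 _ _ At) => t' At' Qt'.
  have [/sub bt' tn] := Hf t' At'; have [_ _ im] := boxP sb' bt'.
  by apply: filterS (normal_invariant im Qt' tn) => y hy _.
have [/sub bt' tn] := Hf t' At'; have [_ _ im] := boxP sb' bt'.
have [ft' _ _] := nbhs_singleton tn.
by apply: filterS (normal_near ft' im Qt') => y hy _.
Qed.

End Boxes.
Arguments box {R M L X i r x0} s c rho.
Arguments sub_ball {R M L X i r x0} s c rho.
Arguments box_radius {R M L X i r x0} s rho.

(** * The inclusion of a slice in linear coordinates *)

Section SliceMatrix.
Context {R : realType}.
Variables (r d e : nat).
Local Opaque derive jacobian.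

Definition slice_mx : 'M[R]_(r + d, r + (d + e)) :=
  col_mx (row_mx 1%:M 0) (row_mx 0 (row_mx 1%:M 0)).

Lemma mul_slice_mx m (u : 'M[R]_(m, r + d)) :
  u *m slice_mx = row_mx (lsubmx u) (row_mx (rsubmx u) 0).
Proof.
rewrite -{1}[u]hsubmxK /slice_mx mul_row_col !mul_mx_row !mulmx1 !mulmx0.
by rewrite add_row_mx addr0 add0r.
Qed.

Lemma mul_slice_mxT m (w : 'M[R]_(m, r + (d + e))) :
  w *m slice_mx^T = row_mx (lsubmx w) (lsubmx (rsubmx w)).
Proof.
apply: trmx_inj; rewrite trmx_mul trmxK tr_row_mx -{1}[w]hsubmxK -{1}[rsubmx w]hsubmxK.
rewrite /slice_mx !tr_row_mx !mul_col_mx !mul_row_col !mul1mx !mul0mx addr0 add0r.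
by rewrite addr0.
Qed.

Lemma slice_mxK : slice_mx *m slice_mx^T = 1%:M.
Proof.
apply: mulmx_rV_inj => u; rewrite mulmxA mul_slice_mx mul_slice_mxT row_mxKl row_mxKr row_mxKl.
by rewrite hsubmxK mulmx1.
Qed.

Lemma slice_mx_proj m (w : 'M[R]_(m, r + (d + e))) :
  rsubmx (rsubmx w) = 0 -> w *m slice_mx^T *m slice_mx = w.
Proof.
move=> w0; rewrite mul_slice_mxT mul_slice_mx row_mxKl row_mxKr -[RHS]hsubmxK -[rsubmx w in RHS]hsubmxK.
by rewrite w0.
Qed.

Lemma slice_mx_norm (w : 'rV[R]_(r + (d + e))) : `|w *m slice_mx^T *m slice_mx| <= `|w|.
Proof.
rewrite mul_slice_mxT mul_slice_mx row_mxKl row_mxKr.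
apply: mx_norm_leP => // k l; rewrite mxE; case: splitP => l' _.
  by rewrite mxE; exact: mx_norm_coord.
rewrite mxE; case: splitP => l2 _; last by rewrite mxE normr0.
by rewrite !mxE; exact: mx_norm_coord.
Qed.

Lemma mulmxr_sm m n (A : 'M[R]_(m, n)) (u : 'rV[R]_m) :
  @sm R (euc m) (euc n) (fun u => u *m A) u /\ @tangent_map R (euc m) (euc n) (fun u => u *m A) u = A.
Proof.
have s : smooth_at (fun u : 'rV[R]_m => u *m A) u by apply: sa_mulmx; [exact: sa_id|exact: sa_cst].
split; first exact/sm_euc.
apply: (etrans (T_euc _ _)); apply: mulmx_rV_inj => v; have e1 := jacE v s; apply: (etrans e1).
by apply: derive_affine => h; rewrite mulmxDl scalemxAl addrC.
Qed.

End SliceMatrix.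

(** * Coherent slices on a neighbourhood of X *)

Section Construction.
Context {R : realType} {M : manifold R} (L : dirac_structure M).
Local Opaque derive jacobian transition tangent_map.
Variables (X : manifold R) (i : X -> M) (r : nat) (xs : X).
Hypothesis i_emb : embedding i.
Hypothesis i_rank : forall x, \rank (pr_T L (i x) *m cokermx (tangent_map i x)) = r.
Local Notation d := (mdim X).

Let i_sm x : sm i x.
Proof. by have [[/smooth_mapP]] := i_emb. Qed.

Let s_ex (x : X) : exists s : slice_chart L i x r, True.
Proof.
have [|s _] := @slice_chart_exists R M L X i x r setT _ openT I; last by exists s.
apply: filterS filterT => y _; split; [exact: i_sm| |exact: i_rank].
by have [[_ _]] := i_emb; exact.
Qed.

Let s (x : X) : slice_chart L i x r := sval (cid (s_ex x)).
Let rho (x : X) : R := sval (cid (box_radius_exists i_emb (s x))).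
Let rhoP x : box_radius (s x) (rho x).
Proof. by rewrite /rho; case: cid. Qed.

Let bx (x : X) (t : R) : set M := box (s x) (slice_center x r (sc_codim (s x))) t.
Let cb (x : X) (t : R) : set M :=
  sc_param (s x) @` [set w | `|w - slice_center x r (sc_codim (s x))| <= t].

Let sub_bx x t : t <= rho x -> sub_ball (s x) (slice_center x r (sc_codim (s x))) t.
Proof. by move=> tr w wt; have [_ h _] := rhoP x; exact: lt_le_trans wt (le_trans tr h). Qed.

Let bx_open x t : t <= rho x -> open (bx x t).
Proof. by move=> /sub_bx; exact: box_open. Qed.

Let bx_self x t : 0 < t -> bx x t (i x).
Proof.
move=> t0; exists (slice_center x r (sc_codim (s x))); first by rewrite /= subrr normr0.
have [|x' [cx' xE]] := @sc_base _ _ _ _ _ _ _ (s x) (cmap (chart_at x) x).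
  by rewrite subrr normr0 sc_rad0.
by move=> ->; congr i; rewrite -(cmapK cx') xE cmapK//; exact: chart_atP.
Qed.

Let cb_closed x t : t < rho x -> closed (cb x t).
Proof.
move=> tr; apply: closed_ball_image; first exact: manifold_hausdorff.
move=> w wt; have [_ h _] := rhoP x.
exact: (sm_cont (sc_param_sm (s x) (le_lt_trans wt (lt_le_trans tr h)))).
Qed.

Let bx_cb x t : bx x t `<=` cb x t.
Proof. by move=> _ [w wt <-]; exists w => //; exact: ltW. Qed.

Let cb_bx x t t' : t < t' -> cb x t `<=` bx x t'.
Proof. by move=> tt _ [w wt <-]; exists w => //; exact: le_lt_trans wt tt. Qed.

(** Three nested boxes around each centre: the quarter boxes cover X, the half boxes carry the sets
    [W], and [slice_agree] is applied in the full boxes. *)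
Let rho_half x : [/\ 0 < rho x / 4, rho x / 4 < rho x / 2, rho x / 2 < rho x & 0 < rho x].
Proof. by have [h _ _] := rhoP x; split; lra. Qed.

Let D_ex : exists D : nat -> X, forall z x, bx z (rho z / 4) (i x) -> exists m, bx (D m) (rho (D m) / 4) (i x).
Proof.
apply: (@lindelof X X (fun z => i @^-1` bx z (rho z / 4)) xs); first exact: manifold_second_countable.
move=> z; apply: open_comp; first by move=> x _; exact: sm_cont.
by apply: bx_open; have [h1 h2 h3 h4] := rho_half z; rewrite ltW// (lt_trans h2).
Qed.

Let D := sval (cid D_ex).
Let DP x : exists m, bx (D m) (rho (D m) / 4) (i x).
Proof.
rewrite /D; case: cid => D' /= H; apply: (H x); apply: bx_self.
by have [] := rho_half x.
Qed.

(* The sets [W k] form an open cover of [i X], locally finite at the points of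
   [i X]: a point of the quarter box around [D l] has a neighbourhood that meets
   no [W k] with k > l. *)
Let W (k : nat) : set M := [set q | bx (D k) (rho (D k) / 2) q /\
  forall l : 'I_k, ~ cb (D l) (rho (D l) / 4) q].
Let Pn (k : nat) (q : M) := normal (s (D k)) (sc_coord (s (D k)) q) = 0.
(** At such a point every member of the cover containing it gives the same answer as [k] about
    membership in its slice. *)
Definition coherent (k : nat) (q : M) := W k q /\ forall l, W l q -> (Pn l q <-> Pn k q).

Let W_near k q : W k q -> \forall q' \near q, W k q'.
Proof.
move=> [h1 h2]; have [g1 g2 g3 g4] := rho_half (D k).
have n1 : nbhs q (bx (D k) (rho (D k) / 2)).
  by apply: open_nbhs_nbhs; split => //; apply: bx_open; exact: ltW.
have n2 : \forall q' \near q, forall l : 'I_k, ~ cb (D l) (rho (D l) / 4) q'.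
  apply: (filter_forall (nbhs_filter q)) => l.
  have [f1 f2 f3 f4] := rho_half (D l).
  apply: open_nbhs_nbhs; split; last exact: h2.
  by apply: closed_openC; apply: cb_closed; exact: lt_trans f3.
by apply: filterS (filterI n1 n2) => q' [].
Qed.

(** The least k whose half box contains [i z] has [i z] in [W k], since the earlier closed quarter
    boxes lie in half boxes. Near [i z] only finitely many [W m] occur; for each of them either
    [i z] lies in the closed half box, and [slice_agree] applies in both directions, or a
    neighbourhood of [i z] avoids it. *)
Let kappa_ex z : exists k, \forall q \near i z, coherent k q.
Proof.
have [l Bl] := DP z.
have ex : exists m, `[< bx (D m) (rho (D m) / 2) (i z) >].
  exists l; apply/asboolP; have [h1 h2 h3 h4] := rho_half (D l).
  by apply: cb_bx (bx_cb Bl).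
have [k /asboolP Bk kmin] := ex_minnP ex.
have Wk : W k (i z).
  split => // j cj; have [h1 h2 h3 h4] := rho_half (D j).
  have : (k <= j)%N by apply: kmin; apply/asboolP; exact: cb_bx cj.
  by rewrite leqNgt ltn_ord.
exists k; have [g1 g2 g3 g4] := rho_half (D l).
have nl : nbhs (i z) (bx (D l) (rho (D l) / 4)).
  by apply: open_nbhs_nbhs; split => //; apply: bx_open; rewrite ltW// (lt_trans g2).
have big k' : bx (D k') (rho (D k') / 2) `<=` bx (D k') (rho (D k')).
  by move=> q /bx_cb; apply: cb_bx; have [] := rho_half (D k').
have nk : \forall q \near i z, forall m : 'I_l.+1, W m q -> (Pn m q <-> Pn k q).
  apply: (filter_forall (nbhs_filter (i z))) => m.
  have [f1 f2 f3 f4] := rho_half (D m).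
  have [cm|ncm] := pselect (cb (D m) (rho (D m) / 2) (i z)).
    have bm : bx (D m) (rho (D m)) (i z) by exact: cb_bx cm.
    have a1 := slice_agree (rhoP (D m)) (rhoP (D k)) bm (big _ _ Bk).
    have a2 := slice_agree (rhoP (D k)) (rhoP (D m)) (big _ _ Bk) bm.
    by apply: filterS (filterI a1 a2) => q [].
  have : nbhs (i z) (~` cb (D m) (rho (D m) / 2)).
    by apply: open_nbhs_nbhs; split => //; apply: closed_openC; exact: cb_closed.
  by apply: filterS => q nq [/bx_cb].
apply: filterS (filterI (W_near Wk) (filterI nl nk)) => q [Wq [lq kq]]; split => // m Wm.
have ml : (m < l.+1)%N.
  rewrite ltnS leqNgt; apply/negP => lm; have [_ /(_ (Ordinal lm))] := Wm; apply.
  exact: bx_cb.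
exact: (kq (Ordinal ml)).
Qed.

Let kap z := sval (cid (kappa_ex z)).
Let kapP z : \forall q \near i z, coherent (kap z) q.
Proof. by rewrite /kap; case: cid. Qed.

Let c (z : X) := s (D (kap z)).
Local Notation E z := (sc_codim (c z)).
Let th (z : X) (q : M) : 'rV[R]_(r + (d + E z)) := sc_coord (c z) q.
Let tz (z : X) := th z (i z).

Let z_in z : [/\ slice_image (c z) (i z), lsubmx (tz z) = 0 & normal (c z) (tz z) = 0].
Proof.
have [[h _] _] := nbhs_singleton (kapP z).
have [g1 g2 g3 g4] := rho_half (D (kap z)).
have h' : bx (D (kap z)) (rho (D (kap z))) (i z) by apply: cb_bx (bx_cb h).
have [_ _ h3] := boxP (sub_bx (lexx _)) h'.
have [_ _ H] := rhoP (D (kap z)); have [h4 h5] := H z h'.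
by [].
Qed.

Let dl_ex z : exists2 dl : R, 0 < dl & forall w : 'rV[R]_(r + (d + E z)), `|w - tz z| < dl ->
  `|w - slice_center (D (kap z)) r (E z)| < sc_rad (c z) /\ coherent (kap z) (sc_param (c z) w).
Proof.
have [h1 h2 h3] := z_in z; have [h4 h5] := slice_imageP h1.
have n1 : \forall w \near tz z, coherent (kap z) (sc_param (c z) w).
  apply: (near_comp (sm_cont (sc_param_sm (c z) h4))).
  have -> : sc_param (c z) (tz z) = i z by exact: h5.
  exact: kapP.
exact: near_ballP (filterI (near_norm_ball h4) n1).
Qed.

Let dl z := sval (cid2 (dl_ex z)).
Let dl0 z : 0 < dl z. Proof. by rewrite /dl; case: cid2. Qed.
Let dlP z (w : 'rV[R]_(r + (d + E z))) : `|w - tz z| < dl z ->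
  `|w - slice_center (D (kap z)) r (E z)| < sc_rad (c z) /\ coherent (kap z) (sc_param (c z) w).
Proof. by rewrite /dl; case: cid2 => t /= _; exact. Qed.

Definition tube_box z : set M := box (c z) (tz z) (dl z).
Local Notation V := tube_box.

Let sbV z : sub_ball (c z) (tz z) (dl z).
Proof. by move=> w /dlP[]. Qed.

Let V_open z : open (V z).
Proof. exact: box_open. Qed.

Let V_self z : V z (i z).
Proof.
have [h1 _ _] := z_in z; apply: in_box => //.
by rewrite /tz /th subrr normr0.
Qed.

Let VP z q : V z q -> [/\ `|th z q - tz z| < dl z, sc_param (c z) (th z q) = q, slice_image (c z) q & coherent (kap z) q].
Proof.
move=> Vq; have [h1 h2 h3] := boxP (sbV (z := z)) Vq; split => //.
by have [_] := dlP h1; have -> : sc_param (c z) (th z q) = q by [].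
Qed.

Definition tube_slice : set M := [set q | exists2 z, V z q & normal (c z) (th z q) = 0].
Definition tube : set M := \bigcup_z V z.
Local Notation PP := tube_slice.

Lemma tube_open : open tube.
Proof. by apply: bigcup_open => z _; exact: V_open. Qed.

Lemma tube_sub : range i `<=` tube.
Proof. by move=> _ [z _ <-]; exists z. Qed.

(** Coherence lets membership in the glued slice be tested in any tube box containing the point, and
    not only in the one that witnesses it. *)
Let PP_local z q : V z q -> PP q -> normal (c z) (th z q) = 0.
Proof.
move=> Vz [z' Vz' n']; have [_ _ _ [W1 H1]] := VP Vz; have [_ _ _ [W2 H2]] := VP Vz'.
exact/(H2 _ W1).
Qed.

Lemma tube_slice_sub : range i `<=` PP.
Proof. by move=> _ [z _ <-]; exists z => //; have [] := z_in z. Qed.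

Let axis z : tz z = row_mx 0 (rsubmx (tz z)).
Proof. by have [_ h _] := z_in z; rewrite -[LHS]hsubmxK h. Qed.

(** The open set [U] is kept general: all of M serves the first part of the theorem and the tube
    itself the second. *)
Lemma tube_slice_saturation (U : set M) : open U -> tube `<=` U -> PP `<=` saturation L U (range i).
Proof.
move=> oU TU q [z Vq nq].
have sb := sbV (z := z); have Vq' := Vq; rewrite /tube_box in Vq'; rewrite axis in sb Vq'.
apply: (slice_ray (Q := saturation L U (range i)) (dl0 z) sb Vq' nq).
move=> A f m x cA A0 fx Hf t At.
have Uf t' : A t' -> U (f t').
  by move=> /Hf[h _]; apply: TU; exists z => //; rewrite /tube_box axis.
have Ux : U (i x) by rewrite -fx; exact: Uf.
have [_ tn0] := Hf 0 A0; have [_ _ m0] := nbhs_singleton tn0.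
exists (leaf L oU Ux).
  split; first exact: leaf_maximal.
  by exists (i x); split; [exact: leaf_self|exists x].
apply: (leaf_propagation cA A0 _ _ At); first by rewrite fx; exact: leaf_self.
move=> t' At'; split; first exact: Uf.
by rewrite -fx m0; have [] := Hf t' At'.
Qed.

(** Along a leaf of the tube both lying in the slice and lying outside it are locally stable: the
    first by invariance of slices, the second by continuity of the normal coordinate. *)
Lemma saturation_tube_slice : saturation L tube (range i) `<=` PP.
Proof.
move=> q [S [[[N [j [cN [/smooth_mapP js _ jf] SE SU jT]]] _] [p [Sp ip]]] Sq].
rewrite SE in Sp Sq; case: Sp ip => xp _ <- ip; case: Sq => x _ <-.
have tn y : tangent_near L (mdim N) j y.
  apply: filterS filterT => y' _; split => //; first by rewrite jT.
  by rewrite -jT; apply/eqP; exact: jf.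
apply: (clopen_propagation (Q := fun x => PP (j x)) cN (I : setT xp)) => //.
- exact: tube_slice_sub.
- move=> y _ Py; have [z _ Vz] : tube (j y) by apply: SU; rewrite SE; exists y.
  have [_ _ im _] := VP Vz; have n0 := PP_local Vz Py.
  have nV : \forall y' \near y, V z (j y').
    by apply: (near_comp (sm_cont (js y))); apply: open_nbhs_nbhs; split => //; exact: V_open.
  apply: filterS (filterI nV (normal_invariant im n0 (tn y))) => y' [h1 h2] _.
  by exists z.
- move=> y _ nPy; have [z _ Vz] : tube (j y) by apply: SU; rewrite SE; exists y.
  have [_ _ im _] := VP Vz.
  have n0 : normal (c z) (sc_coord (c z) (j y)) <> 0 by move=> h; apply: nPy; exists z.
  have nV : \forall y' \near y, V z (j y').
    by apply: (near_comp (sm_cont (js y))); apply: open_nbhs_nbhs; split => //; exact: V_open.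
  apply: filterS (filterI nV (normal_near (js y) im n0)) => y' [h1 h2] _ Py'.
  by apply: h2; exact: PP_local h1 Py'.
Qed.

Let O z : set 'rV[R]_(r + d) := [set u | `|u *m slice_mx r d (E z) - tz z| < dl z].
Let g z (u : @euc R (r + d)) : M := sc_param (c z) (u *m slice_mx r d (E z)).
Let ret z (q : M) : @euc R (r + d) := th z q *m (slice_mx r d (E z))^T.

Let g_in z u : O z u -> [/\ V z (g z u), th z (g z u) = u *m slice_mx r d (E z), PP (g z u) & ret z (g z u) = u].
Proof.
move=> Ou; have [h1 _] := dlP Ou.
have tE : th z (g z u) = u *m slice_mx r d (E z) by rewrite /th /g (sc_paramK (c z) h1).
have Vz : V z (g z u) by exists (u *m slice_mx r d (E z)).
split => //.
  by exists z => //; rewrite tE mul_slice_mx /normal !row_mxKr.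
by rewrite /ret tE -mulmxA slice_mxK mulmx1.
Qed.

Let PP_param z q : V z q -> PP q -> O z (ret z q) /\ g z (ret z q) = q.
Proof.
move=> Vz Pq; have n0 := PP_local Vz Pq; have [h1 h2 _ _] := VP Vz.
have e : ret z q *m slice_mx r d (E z) = th z q by exact: slice_mx_proj.
by rewrite /O /g /= e.
Qed.

Let O_ret z q : V z q -> O z (ret z q).
Proof.
move=> Vz; have [h1 _ _ _] := VP Vz; have [_ _ n0] := z_in z.
rewrite /O /ret /=; apply: le_lt_trans h1.
rewrite -{1}(slice_mx_proj n0) -!mulmxBl; exact: slice_mx_norm.
Qed.

Let O_open z : open (O z).
Proof.
have cn : continuous (fun u : 'rV[R]_(r + d) => `|u *m slice_mx r d (E z) - tz z|).
  move=> t; apply: (@continuous_comp _ _ _ (fun u : 'rV[R]_(r + d) => u *m slice_mx r d (E z) - tz z) (fun w : 'rV[R]_(r + (d + E z)) => `|w|) t).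
    by apply: sa_cont; apply: sa_add; [apply: sa_mulmx; [exact: sa_id|exact: sa_cst]|exact: sa_cst].
  exact: norm_continuous.
exact: (open_comp (fun z _ => cn z) (@open_lt _ _)).
Qed.

Let g_sm z u : O z u -> sm (g z) u /\
  tangent_map (g z) u = slice_mx r d (E z) *m tangent_map (sc_param (c z)) (u *m slice_mx r d (E z)).
Proof.
move=> Ou; have [h1 _] := dlP Ou; have [s1 T1] := mulmxr_sm (slice_mx r d (E z)) u.
have s2 := sc_param_sm (c z) h1.
split; first exact: (sm_comp s1 s2).
by have e1 := T_comp s1 s2; apply: (etrans e1); rewrite T1.
Qed.

Let ret_sm z q : V z q -> sm (ret z) q.
Proof.
move=> Vz; have [_ _ im _] := VP Vz; have s1 := slice_coord_sm im.
have [s2 _] := mulmxr_sm (slice_mx r d (E z))^T (th z q).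
exact: (sm_comp s1 s2).
Qed.

Let g_overlap a b y : O b y -> (exists2 z, O a z & g a z = g b y) ->
  \forall y' \near y, exists2 z, O a z & g a z = g b y'.
Proof.
move=> Oy [z Oz zy]; have [Vz _ _ _] := g_in Oz; rewrite zy in Vz.
have n1 : \forall y' \near y, V a (g b y').
  apply: (near_comp (sm_cont (g_sm Oy).1)); apply: open_nbhs_nbhs; split => //; exact: V_open.
have n2 : nbhs y (O b) by apply: open_nbhs_nbhs; split => //; exact: O_open.
apply: filterS (filterI n1 n2) => y' [h1 Oy']; have [_ _ Py' _] := g_in Oy'.
by have [h2 h3] := PP_param h1 Py'; exists (ret a (g b y')).
Qed.

Let D2_ex : exists D2 : nat -> X, forall a y, O a y -> exists m, exists2 z, O (D2 m) z & g (D2 m) z = g a y.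
Proof.
have [D2 H] := @lindelof M X V xs (@manifold_second_countable R M) V_open.
exists D2 => a y Oy; have [Vy _ Py _] := g_in Oy.
have [m Vm] := H a _ Vy; have [h1 h2] := PP_param Vm Py.
by exists m, (ret (D2 m) (g a y)).
Qed.

Let pr_T_slice z u : O z u -> (pr_T L (g z u) <= tangent_map (g z) u)%MS.
Proof.
move=> Ou; have [Vz tE _ _] := g_in Ou; have [h1 _] := dlP Ou.
have [_ ->] := g_sm Ou; have [_ qE im _] := VP Vz.
have y2 : rsubmx (rsubmx (u *m slice_mx r d (E z))) = 0 by rewrite mul_slice_mx !row_mxKr.
have inv0 := sc_inv (c z) h1 y2.
have s1 := slice_coord_sm im.
have s2 : sm (sc_param (c z)) (sc_coord (c z) (g z u)).
  have -> : sc_coord (c z) (g z u) = u *m slice_mx r d (E z) by exact: tE.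
  exact: sc_param_sm.
have nK : \forall q \near g z u, sc_param (c z) (sc_coord (c z) q) = q.
  have nV : nbhs (g z u) (V z) by apply: open_nbhs_nbhs; split => //; exact: V_open.
  by apply: filterS nV => q /VP[].
have TT := T_cancel s1 s2 nK.
have tE' : sc_coord (c z) (g z u) = u *m slice_mx r d (E z) by exact: tE.
rewrite tE' in TT.
(* In slice coordinates pr_T L has no normal component, so it factors through the inclusion of the
   slice. *)
rewrite -[X in (X <= _)%MS]mulmx1 -TT mulmxA.
rewrite -(slice_mx_proj inv0) -!mulmxA.
rewrite !mulmxA -[_ *m slice_mx _ _ _ *m _]mulmxA; exact: submxMl.
Qed.

Lemma tube_slice_manifold : exists (P : manifold R) (f : P -> M),
  [/\ embedding f, Defs.invariant L f & range f = PP].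
Proof.
have [D2 D2P] := D2_ex.
have ret_sm' a y : O a y -> sm (ret a) (g a y) by move=> Oy; apply: ret_sm; have [] := g_in Oy.
have ret_K a y : O a y -> ret a (g a y) = y by move=> Oy; have [] := g_in Oy.
have [P [f [_ fimm fr fT fo]]] := glue_family O_open (fun a y Oy => (g_sm Oy).1) ret_sm' ret_K g_overlap D2P.
have [/smooth_mapP fs finj ff] := fimm.
have rE : range f = PP.
  rewrite fr; apply/seteqP; split => [q [a [y [Oy <-]]]|q Pq]; first by have [] := g_in Oy.
  have [z Vz _] := Pq; have [h1 h2] := PP_param Vz Pq.
  by exists z, (ret z q).
exists P, f; split; last exact: rE.
- split; first exact: fimm.
  move=> A oA.
  (* The preimage of [A] under the local retractions of the tube boxes to the slice. It is open
     because [A] is open in the parameters, and it meets the slice exactly in [A]. *)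
  pose B : set M := [set q | exists2 a, V a q & exists2 x, A x & f x = g a (ret a q)].
  exists B.
    rewrite openE => q [a Vq [x Ax xE]].
    have Oy := O_ret Vq.
    have /fo oA' := oA; have nA := oA' a (ret a q) x Oy xE Ax.
    have nO : nbhs (ret a q) (O a) by apply: open_nbhs_nbhs; split => //; exact: O_open.
    have n1 : \forall q' \near q, O a (ret a q') /\
        (O a (ret a q') -> forall x', f x' = g a (ret a q') -> A x').
      exact: (near_comp (Q := fun z => O a z /\ (O a z -> forall x', f x' = g a z -> A x'))
        (sm_cont (ret_sm Vq)) (filterI nO nA)).
    have nV : nbhs q (V a) by apply: open_nbhs_nbhs; split => //; exact: V_open.
    apply: filterS (filterI n1 nV) => q' [[Oq' Aq'] Vq'].
    exists a => //; have [_ _ Pg _] := g_in Oq'.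
    have [x' _ x'E] : range f (g a (ret a q')) by rewrite rE.
    by exists x' => //; exact: Aq'.
  apply/seteqP; split => [x Ax|x [a Va [x' Ax' x'E]]].
    have Pfx : PP (f x) by rewrite -rE; exists x.
    have [z Vz _] := Pfx; have [h1 h2] := PP_param Vz Pfx.
    by exists z => //; exists x.
  have Pfx : PP (f x) by rewrite -rE; exists x.
  have [h1 h2] := PP_param Va Pfx.
  by have <- : x' = x by apply: finj; rewrite x'E h2.
- move=> x; have : range f (f x) by exists x.
  rewrite fr => -[a [y [Oy yE]]].
  rewrite (fT x a y Oy (esym yE)) -yE; exact: pr_T_slice.
Qed.

End Construction.

Section Embedding.
Context {R : realType} {M : manifold R} (L : dirac_structure M).

Lemma invariant_submanifold_exists (P : manifold R) (f : P -> M) :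
  embedding f -> Defs.invariant L f -> exists LP, invariant_submanifold L f LP.
Proof.
move=> fe fi; have [[/smooth_mapP fs _ ff] _] := fe.
by have [LP HLP] := pullback_dirac fs ff fi; exists LP.
Qed.

End Embedding.

Theorem theorem6p5 (R : realType) (M : manifold R) (L : dirac_structure M)
    (X : manifold R) (i : X -> M) (i_emb : embedding i)
    (i_coreg : coregular L i) :
  exists (P : manifold R) (LP : dirac_structure P) (f : P -> M),
    [/\ invariant_submanifold L f LP,
        range i `<=` range f &
        range f `<=` saturation L setT (range i)] /\
    exists (P' : manifold R) (LP' : dirac_structure P') (f' : P' -> M),
      [/\ invariant_submanifold L f' LP',
          range i `<=` range f',
          (exists2 W : set P, open W & range f' = f @` W) &
          exists U : set M,
            [/\ open U, range i `<=` U &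
                range f' = saturation L U (range i)]].
Proof.
have [r rE] := i_coreg.
(* A point of X is required to index the countable covers. If X is empty, X itself is the
   submanifold sought and every saturation of its image is empty. *)
have [[xs _]|nX] := pselect (exists x : X, True).
  have [P [f [fe fi fr]]] := tube_slice_manifold xs i_emb rE.
  have [LP HLP] := invariant_submanifold_exists fe fi.
  have iP : range i `<=` range f by rewrite fr; exact: tube_slice_sub.
  exists P, LP, f; split.
    split; [exact: HLP|exact: iP|rewrite fr].
    by apply: tube_slice_saturation => //; exact: openT.
  exists P, LP, f; split; [exact: HLP|exact: iP|by exists setT; [exact: openT|]|].
  exists (tube xs i_emb rE); split; [exact: tube_open|exact: tube_sub|].
  rewrite fr; apply/seteqP; split; last exact: saturation_tube_slice.
  by apply: tube_slice_saturation => //; exact: tube_open.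
have nr q : ~ range i q by move=> [x _ _]; apply: nX; exists x.
have fi : Defs.invariant L i by move=> x; case: nX; exists x.
have [LP HLP] := invariant_submanifold_exists i_emb fi.
exists X, LP, i; split; first by split => // q /nr.
exists X, LP, i; split => //; first by exists setT => //; exact: openT.
exists setT; split => //; first exact: openT.
apply/seteqP; split => q; first by move/nr.
by move=> [S [_ [p [_ /nr]]]].
Qed.
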